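(* Let $\Omega\subset\mathbb{C}$ be a simply connected domain with base point $z_0$. Let $\beta:\Omega\to\mathbb{R}$ be harmonic with $\beta(z_0)=0$ and let $a,b:\Omega\to\mathbb{C}$ be holomorphic. Let $\gamma$ be the harmonic conjugate of $\beta$ vanishing at $z_0$ (i.e. $\partial(\beta+i\gamma)/\partial\bar z=0$) and, for $\lambda\in S^1$, $\beta_\lambda=\frac12(\lambda^{-2}+\lambda^2)\beta+\frac i2(\lambda^{-2}-\lambda^2)\gamma$. Then the potential $$\mu_\lambda=\Big(\frac{\lambda^{-2}}{2}\frac{\partial\beta}{\partial z}L_i,\ \lambda^{-1}(a\epsilon+bL_i\bar\epsilon)\Big)dz$$ leads to the map $U_\lambda=(F_\lambda,X_\lambda):\Omega\to\Lambda\mathcal{G}_\tau$ given by $$F_\lambda(z)=e^{\frac12\beta_\lambda(z)L_i},\qquad X_\lambda(z)=e^{\frac12\beta_\lambda(z)L_i}\,P\Big(e^{-\frac12\beta_\lambda(z)L_i}\int_{z_0}^ze^{\frac{\lambda^{-2}}{4}(\beta(v)+i\gamma(v))L_i}\lambda^{-1}\big(a(v)\epsilon+b(v)L_i\bar\epsilon\big)dv\Big);$$ that is, if $H_\lambda:\Omega\to\Lambda\mathcal{G}^{\mathbb{C}}_\tau$ is the solution of $dH_\lambda=H_\lambda\mu_\lambda$, $H_\lambda(z_0)=\mathbf 1$, then $U_\lambda$ is the $\Lambda\mathcal{G}_\tau$ factor in the decomposition $H_\lambda=U_\lambda V_\lambda$, $V_\lambda\in\Lambda^+_{\mathcal{B}_0}\mathcal{G}^{\mathbb{C}}_\tau$.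 Moreover $U_\lambda$ is an extended lift of a Hamiltonian stationary conformal (Lagrangian) immersion if and only if $X_\lambda$ is an immersion.
   Context: $\mathbb{R}^4$ has its standard inner product and symplectic form $\omega=dx^1\wedge dx^2+dx^3\wedge dx^4$. Identify $\mathbb{R}^4$ with the quaternions by $(x^1,x^2,x^3,x^4)\mapsto x^1+ix^2+jx^3+kx^4$; $L_p$ (resp. $R_p$) is the matrix of left (resp. right) multiplication by $p$. $\mathcal{G}_0=\{q^1\mathbf 1-q^2R_i-q^3R_j-q^4R_k:q\in\mathbb{R}^4,|q|=1\}$, $\mathcal{G}_2=\{e^{\theta L_i}:\theta\in\mathbb{R}\}$, $\vec{\mathcal{G}}=\mathcal{G}_0\mathcal{G}_2\simeq U(2)$, $\mathcal{G}=\vec{\mathcal{G}}\ltimes\mathbb{R}^4$ with $(G,T)(G',T')=(GG',GT'+T)$, a group of $5\times5$ matrices; $\mathfrak{g}$ is its Lie algebra. Complexifications $\mathcal{G}_0^{\mathbb{C}},\mathcal{G}_2^{\mathbb{C}}$ are obtained by allowing $q\in\mathbb{C}^4$ with $\sum(q^m)^2=1$ and $\theta\in\mathbb{C}$; $\vec{\mathcal{G}}^{\mathbb{C}}=\mathcal{G}_0^{\mathbb{C}}\mathcal{G}_2^{\mathbb{C}}$, $\mathcal{G}^{\mathbb{C}}=\vec{\mathcal{G}}^{\mathbb{C}}\ltimes\mathbb{C}^4$. $\tau(G,T)=(-L_jGL_j,-L_jT)$. $\epsilon=\frac12(1,0,-i,0)^T$, $\bar\epsilon=\frac12(1,0,i,0)^T$.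 $\mathcal{B}_0=\{B\in\mathcal{G}_0^{\mathbb{C}}:B\epsilon\in\mathbb{R}_+^*\epsilon\}$. Loop groups (loops in $\lambda\in S^1$ of Sobolev class $H^s$, $s>1/2$): $\Lambda\mathcal{G}_\tau$ (resp. $\Lambda\mathcal{G}^{\mathbb{C}}_\tau$) is the group of loops in $\mathcal{G}$ (resp. $\mathcal{G}^{\mathbb{C}}$) with $G_{i\lambda}=\tau(G_\lambda)$; $\Lambda^+_{\mathcal{B}_0}\mathcal{G}^{\mathbb{C}}_\tau$ is the subgroup of loops in $\Lambda\mathcal{G}^{\mathbb{C}}_\tau$ extending holomorphically to the unit disk with value at $\lambda=0$ in $(\mathcal{B}_0,0)$. Every element of $\Lambda\mathcal{G}^{\mathbb{C}}_\tau$ factors uniquely as a product of an element of $\Lambda\mathcal{G}_\tau$ and one of $\Lambda^+_{\mathcal{B}_0}\mathcal{G}^{\mathbb{C}}_\tau$. $\Lambda\mathbb{C}^4_\tau$ is the space of loops $V:S^1\to\mathbb{C}^4$ with $-L_jV_\lambda=V_{i\lambda}$ (only odd powers of $\lambda$ occur), $\Lambda\mathbb{R}^4_\tau$ the subspace of $\mathbb{R}^4$-valued loops, and $P:\Lambda\mathbb{C}^4_\tau\to\Lambda\mathbb{R}^4_\tau$ is $$P\Big(\sum_{n\in\mathbb{Z}}\hat V_{2n+1}\lambda^{2n+1}\Big)=\sum_{n\le0}\hat V_{2n-1}\lambda^{2n-1}+\sum_{n\ge0}\overline{\hat V_{-2n-1}}\lambda^{2n+1}.$$ The eigenspaces of $\tau$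 on $\mathfrak{g}^{\mathbb{C}}$ for eigenvalues $i^k$, $k=-1,0,1,2$, are $\mathfrak{g}_{-1}^{\mathbb{C}}=\{0\}\times(\mathbb{C}\epsilon\oplus\mathbb{C}L_i\bar\epsilon)$, $\mathfrak{g}_0^{\mathbb{C}}=\mathrm{span}_{\mathbb{C}}\{(R_i,0),(R_j,0),(R_k,0)\}$, $\mathfrak{g}_1^{\mathbb{C}}=\{0\}\times(\mathbb{C}\bar\epsilon\oplus\mathbb{C}L_i\epsilon)$, $\mathfrak{g}_2^{\mathbb{C}}=\mathbb{C}(L_i,0)$; $\alpha_k$ is the $\mathfrak{g}_k^{\mathbb{C}}$-component of a 1-form $\alpha$, and $\alpha_k',\alpha_k''$ its $dz$ and $d\bar z$ parts. A lifted conformal Lagrangian immersion (LCLI) is a smooth $U=(F,X):\Omega\to\mathcal{G}$ with $U(z_0)=(\mathbf 1,0)$ and $F^{-1}dX=e^fK(\epsilon\,dz+\bar\epsilon\,d\bar z)$, $K\in C^\infty(\Omega,\mathcal{G}_0)$, $f\in C^\infty(\Omega,\mathbb{R})$; then $X$ is a conformal Lagrangian immersion, with Lagrangian angle map the function $\beta$ such that $F=e^{\beta L_i/2}M_0$, $M_0\in C^\infty(\Omega,\mathcal{G}_0)$, $\beta(z_0)=0$. It is Hamiltonian stationary iff $\Delta\beta=0$ (known to be equivalent to criticality of area under compactly supported Hamiltonian variations). The extended lift of a Hamiltonian stationary LCLI $U$, with $\alpha=U^{-1}dU$, is the unique $U_\lambda:\Omega\to\Lambda\mathcal{G}_\tau$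 with $U_\lambda(z_0)=\mathbf 1$ and $U_\lambda^{-1}dU_\lambda=\lambda^{-2}\alpha_2'+\lambda^{-1}\alpha_{-1}'+\alpha_0+\lambda\alpha_1''+\lambda^2\alpha_2''$. ''$X_\lambda$ is an immersion'' means that $z\mapsto X_\lambda(z)$ is an immersion for each $\lambda\in S^1$. *)

(* Defs.v *)
From HB Require Import structures.
From mathcomp Require Import all_boot all_order all_algebra.
From mathcomp Require Import all_classical all_reals all_analysis.
From mathcomp Require Import complex.
Set Implicit Arguments.
Unset Strict Implicit.
Unset Printing Implicit Defensive.
Import Order.TTheory GRing.Theory Num.Theory.
Import numFieldNormedType.Exports.

Local Open Scope classical_set_scope.
Local Open Scope complex_scope.
Local Open Scope ring_scope.

(* [R[i]] as a normed space over itself: [derivable f z 1] is complex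
   differentiability at [z].  Real differentiation goes through real and
   imaginary parts, along lines ([pd]). *)
HB.instance Definition _ (R : realType) := NormedModule.copy R[i] R[i]^o.

Section Defs.
Context {R : realType}.

Local Notation C := R[i].
Local Notation iC := (Complex 0 1 : C).
Local Notation "x %:C" := (real_complex_def (Phant R) x : C).
Local Notation toC := (fun x : R => x%:C).

Definition S1 : set C := [set l | `|l| = 1].

Definition pd (w : C) (f : C -> R) (z : C) : R :=
  (fun t : R => f (z + t%:C * w))^`()%classic 0.

Definition pderivable (w : C) (f : C -> R) (z : C) : Prop :=
  derivable (fun t : R => f (z + t%:C * w)) 0 1.

Fixpoint Ck (k : nat) (Om : set C) (f : C -> R) : Prop :=
  (forall z, Om z -> {for z, continuous f}) /\
  (if k is k'.+1 then
     [/\ forall z, Om z -> pderivable 1 f z /\ pderivable iC f z,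
         Ck k' Om (pd 1 f) & Ck k' Om (pd iC f)]
   else True).

Definition smooth (Om : set C) (f : C -> R) : Prop := forall k, Ck k Om f.

Definition mxsmooth m n (Om : set C) (f : C -> 'M[C]_(m, n)) : Prop :=
  forall i j, smooth Om (fun z => complex.Re (f z i j)) /\
              smooth Om (fun z => complex.Im (f z i j)).

Definition laplacian (f : C -> R) (z : C) : R :=
  pd 1 (pd 1 f) z + pd iC (pd iC f) z.

Definition harmonic_on (Om : set C) (f : C -> R) : Prop :=
  Ck 2 Om f /\ forall z, Om z -> laplacian f z = 0.

Definition holomorphic_on (Om : set C) (f : C -> C) : Prop :=
  forall z, Om z -> derivable f z 1.

Definition cpd (w : C) (f : C -> C) (z : C) : C :=
  Complex (pd w (fun v => complex.Re (f v)) z)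
          (pd w (fun v => complex.Im (f v)) z).

Definition dz (f : C -> C) (z : C) : C := 2^-1 * (cpd 1 f z - iC * cpd iC f z).
Definition dzb (f : C -> C) (z : C) : C := 2^-1 * (cpd 1 f z + iC * cpd iC f z).

Definition mxpd m n (w : C) (f : C -> 'M[C]_(m, n)) (z : C) : 'M[C]_(m, n) :=
  \matrix_(i, j) cpd w (fun v => f v i j) z.
Definition mxdz m n (f : C -> 'M[C]_(m, n)) (z : C) : 'M[C]_(m, n) :=
  \matrix_(i, j) dz (fun v => f v i j) z.
Definition mxdzb m n (f : C -> 'M[C]_(m, n)) (z : C) : 'M[C]_(m, n) :=
  \matrix_(i, j) dzb (fun v => f v i j) z.

(* [X] is R^4-valued, with R^4 seen in C^4; the differential of [X] sends the
   real vector (s,t) to s X_x + t X_y. *)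
Definition immersion (Om : set C) (X : C -> 'cV[C]_4) : Prop :=
  mxsmooth Om X /\
  forall z, Om z -> forall s t : R,
    s%:C *: mxpd 1 X z + t%:C *: mxpd iC X z = 0 -> s = 0 /\ t = 0.

Definition I01 : set R := [set t | 0 <= t <= 1].

Definition simply_connected (Om : set C) : Prop :=
  connected Om /\
  forall c : R -> C, {within I01, continuous c} ->
    (forall t, I01 t -> Om (c t)) -> c 0 = c 1 ->
    exists h : R * R -> C,
      [/\ {within I01 `*` I01, continuous h},
          forall u, (I01 `*` I01) u -> Om (h u),
          forall t, I01 t -> h (0, t) = c t /\ h (1, t) = c 0 &
          forall s, I01 s -> h (s, 0) = c 0 /\ h (s, 1) = c 0].

Definition cint (a b : R) (g : R -> C) : C :=
  Complex (\int[lebesgue_measure]_(t in `[a, b]) complex.Re (g t))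
          (\int[lebesgue_measure]_(t in `[a, b]) complex.Im (g t)).

(* A C^1 arc on [0,1] extends to a C^1 function on the real line, so nothing
   is lost by requiring the regularity on all of R. *)
Definition C1_curve (c : R -> C) : Prop :=
  [/\ forall t, derivable (fun u : R => complex.Re (c u)) t 1,
      continuous (fun u : R => complex.Re (c u))^`()%classic,
      forall t, derivable (fun u : R => complex.Im (c u)) t 1 &
      continuous (fun u : R => complex.Im (c u))^`()%classic].

Definition cderive (c : R -> C) (t : R) : C :=
  Complex ((fun u : R => complex.Re (c u))^`()%classic t)
          ((fun u : R => complex.Im (c u))^`()%classic t).

(* A piecewise C^1 path from x to y in Om is a list of C^1 arcs
   [0,1] -> Om, each starting at the end of the previous one. *)
Fixpoint pw_path (Om : set C) (x y : C) (p : seq (R -> C)) : Prop :=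
  if p is c :: p' then
    [/\ C1_curve c, forall t, I01 t -> Om (c t), c 0 = x &
        pw_path Om (c 1) y p']
  else x = y.

Definition line_int n (f : C -> 'cV[C]_n) (p : seq (R -> C)) : 'cV[C]_n :=
  \col_r \sum_(c <- p) cint 0 1 (fun t => f (c t) r 0 * cderive c t).

(* \int_x^y f(v) dv: the common value of the integrals of f along all paths
   from x to y in Om. *)
Definition int_from n (Om : set C) (x y : C) (f : C -> 'cV[C]_n) : 'cV[C]_n :=
  xget 0 [set w | forall p, pw_path Om x y p -> line_int f p = w].

Definition quat (a b c d : C) : 'cV[C]_4 := \col_r nth 0 [:: a; b; c; d] r.
Definition qcoord (p : 'cV[C]_4) (r : nat) : C := p (inord r) 0.

(* C-bilinear extension of the product of quaternions
   x^1 + i x^2 + j x^3 + k x^4 *)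
Definition qmul (p q : 'cV[C]_4) : 'cV[C]_4 :=
  let p0 := qcoord p 0 in let p1 := qcoord p 1 in
  let p2 := qcoord p 2 in let p3 := qcoord p 3 in
  let q0 := qcoord q 0 in let q1 := qcoord q 1 in
  let q2 := qcoord q 2 in let q3 := qcoord q 3 in
  quat (p0 * q0 - p1 * q1 - p2 * q2 - p3 * q3)
       (p0 * q1 + p1 * q0 + p2 * q3 - p3 * q2)
       (p0 * q2 - p1 * q3 + p2 * q0 + p3 * q1)
       (p0 * q3 + p1 * q2 - p2 * q1 + p3 * q0).

Definition qi := quat 0 1 0 0.
Definition qj := quat 0 0 1 0.
Definition qk := quat 0 0 0 1.

Definition Lq (p : 'cV[C]_4) : 'M[C]_4 :=
  \matrix_(r, c) qmul p (delta_mx c 0) r 0.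
Definition Rq (p : 'cV[C]_4) : 'M[C]_4 :=
  \matrix_(r, c) qmul (delta_mx c 0) p r 0.
Definition Li := Lq qi.
Definition Lj := Lq qj.

(* In these two vectors the imaginary entry is the complex unit, not the
   quaternion. *)
Definition eps : 'cV[C]_4 := 2^-1 *: quat 1 0 (- iC) 0.
Definition epsb : 'cV[C]_4 := 2^-1 *: quat 1 0 iC 0.

Definition expmx (A : 'M[C]_4) : 'M[C]_4 :=
  limn (series (fun n : nat => (n`!%:R : C)^-1 *: A ^+ n)).

Definition G0mx (q : 'cV[C]_4) : 'M[C]_4 :=
  qcoord q 0 *: 1%:M - qcoord q 1 *: Rq qi - qcoord q 2 *: Rq qj
  - qcoord q 3 *: Rq qk.

(* The real groups are seen inside the complex ones. *)
Definition G0C : set 'M[C]_4 :=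
  [set A | exists2 q : 'cV[C]_4, \sum_m q m 0 ^+ 2 = 1 & A = G0mx q].
Definition G0 : set 'M[C]_4 :=
  [set A | exists2 q : 'cV[R]_4, \sum_m q m 0 ^+ 2 = 1
         & A = G0mx (map_mx toC q)].
Definition G2C : set 'M[C]_4 :=
  [set A | exists theta : C, A = expmx (theta *: Li)].
Definition G2 : set 'M[C]_4 :=
  [set A | exists theta : R, A = expmx (theta%:C *: Li)].

Definition GvecC : set 'M[C]_4 :=
  [set A | exists B D, [/\ G0C B, G2C D & A = B *m D]].
Definition Gvec : set 'M[C]_4 :=
  [set A | exists B D, [/\ G0 B, G2 D & A = B *m D]].

(* (A,T) as a 5x5 matrix; (A,T)(A',T') = (AA', AT'+T) is the matrix product *)
Definition aff (A : 'M[C]_4) (T : 'cV[C]_4) : 'M[C]_(4 + 1) :=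
  block_mx A T 0 1%:M.
Definition lie (A : 'M[C]_4) (T : 'cV[C]_4) : 'M[C]_(4 + 1) :=
  block_mx A T 0 0.

Definition GC : set 'M[C]_(4 + 1) :=
  [set M | exists A T, GvecC A /\ M = aff A T].
Definition G : set 'M[C]_(4 + 1) :=
  [set M | exists A (T : 'cV[R]_4), Gvec A /\ M = aff A (map_mx toC T)].

Definition tau (M : 'M[C]_(4 + 1)) : 'M[C]_(4 + 1) :=
  aff (- (Lj *m ulsubmx M *m Lj)) (- (Lj *m ursubmx M)).

Definition B0 : set 'M[C]_4 :=
  [set B | G0C B /\ exists2 r : R, 0 < r & B *m eps = r%:C *: eps].

Definition expi (t : R) : C := Complex (cos t) (sin t).

Definition fourier (f : C -> C) (n : int) : C :=
  ((2 * pi)^-1)%:C *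
  cint 0 (2 * pi) (fun t => f (expi t) * expi (- (n%:~R * t))).

(* Loops of class H^s, for s > 1/2, are represented by functions on C of which
   only the continuous restriction to S1 matters. *)
Definition Hs (s : R) (f : C -> C) : Prop :=
  {within S1, continuous f} /\
  (\esum_(n in [set: int])
     ((1 + n%:~R ^+ 2) `^ s * complex.Re `|fourier f n| ^+ 2)%:E < +oo)%E.

Definition twisted_loops (s : R) (K : set 'M[C]_(4 + 1)) :
    set (C -> 'M[C]_(4 + 1)) :=
  [set g : C -> 'M[C]_(4 + 1) | [/\ forall i j, Hs s (fun l => g l i j),
               forall l, S1 l -> K (g l) &
               forall l, S1 l -> g (iC * l) = tau (g l)]].

Definition LambdaG (s : R) := twisted_loops s G.
Definition LambdaGC (s : R) := twisted_loops s GC.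

Definition LambdaPlus (s : R) : set (C -> 'M[C]_(4 + 1)) :=
  [set V : C -> 'M[C]_(4 + 1) | LambdaGC s V /\
     exists W : C -> 'M[C]_(4 + 1),
       [/\ {within [set l : C | `|l| <= 1], continuous W},
           forall l : C, `|l| < 1 -> derivable W l 1,
           forall l : C, `|l| <= 1 -> GC (W l),
           forall l, S1 l -> W l = V l &
           exists2 B, B0 B & W 0 = aff B 0]].

Definition iwasawa_factor (s : R) (H U : C -> 'M[C]_(4 + 1)) : Prop :=
  LambdaG s U /\
  exists2 V, LambdaPlus s V & forall l, S1 l -> H l = U l *m V l.

Definition vfourier (V : C -> 'cV[C]_4) (n : int) : 'cV[C]_4 :=
  \col_r fourier (fun l => V l r 0) n.

(* Both sums are indexed by n >= 0; in the first one the index runs over the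
   exponents -1, -3, -5, ... *)
Definition projP (V : C -> 'cV[C]_4) (l : C) : 'cV[C]_4 :=
  limn (series (fun n : nat =>
    l ^- n.*2.+1 *: vfourier V (- n.*2.+1%:Z))) +
  limn (series (fun n : nat =>
    l ^+ n.*2.+1 *: map_mx (@conjc R) (vfourier V (- n.*2.+1%:Z)))).

Definition LCLI (Om : set C) (z0 : C)
    (F : C -> 'M[C]_4) (X : C -> 'cV[C]_4) : Prop :=
  [/\ mxsmooth Om F, mxsmooth Om X,
      forall z, Om z -> G (aff (F z) (X z)),
      F z0 = 1%:M /\ X z0 = 0 &
      exists (K : C -> 'M[C]_4) (f : C -> R),
        [/\ mxsmooth Om K, forall z, Om z -> G0 (K z), smooth Om f &
            forall z, Om z ->
              invmx (F z) *m mxdz X z = (expR (f z))%:C *: (K z *m eps) /\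
              invmx (F z) *m mxdzb X z = (expR (f z))%:C *: (K z *m epsb)]].

Definition lagrangian_angle (Om : set C) (z0 : C)
    (F : C -> 'M[C]_4) (beta : C -> R) : Prop :=
  [/\ smooth Om beta, beta z0 = 0 &
      exists M0 : C -> 'M[C]_4,
        [/\ mxsmooth Om M0, forall z, Om z -> G0 (M0 z) &
            forall z, Om z -> F z = expmx ((beta z / 2)%:C *: Li) *m M0 z]].

Definition hamiltonian_stationary_LCLI (Om : set C) (z0 : C)
    (F : C -> 'M[C]_4) (X : C -> 'cV[C]_4) : Prop :=
  LCLI Om z0 F X /\
  exists2 beta : C -> R, lagrangian_angle Om z0 F beta &
    forall z, Om z -> laplacian beta z = 0.

(* [lie_k] is the eigenspace of tau for i^k on the complexified Lie algebra. *)
Definition lie_m1 : set 'M[C]_(4 + 1) :=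
  [set M | exists a b : C, M = lie 0 (a *: eps + b *: (Li *m epsb))].
Definition lie_0 : set 'M[C]_(4 + 1) :=
  [set M | exists a b c : C,
     M = lie (a *: Rq qi + b *: Rq qj + c *: Rq qk) 0].
Definition lie_1 : set 'M[C]_(4 + 1) :=
  [set M | exists a b : C, M = lie 0 (a *: epsb + b *: (Li *m eps))].
Definition lie_2 : set 'M[C]_(4 + 1) :=
  [set M | exists a : C, M = lie (a *: Li) 0].

Definition eigen_split (M Mm1 M0 M1 M2 : 'M[C]_(4 + 1)) : Prop :=
  [/\ lie_m1 Mm1, lie_0 M0, lie_1 M1, lie_2 M2 & M = Mm1 + M0 + M1 + M2].

(* The primed (doubly primed) components of alpha = U^-1 dU are its values
   on d/dz (on d/dzbar): [am], [a0], [a1], [a2] resp. [bm], [b0], [b1], [b2]. *)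
Definition extended_lift (s : R) (Om : set C) (z0 : C)
    (F : C -> 'M[C]_4) (X : C -> 'cV[C]_4)
    (Ul : C -> C -> 'M[C]_(4 + 1)) : Prop :=
  let U := fun z => aff (F z) (X z) in
  [/\ forall z, Om z -> LambdaG s (Ul z),
      forall l, S1 l -> Ul z0 l = 1%:M,
      forall l, S1 l -> mxsmooth Om (fun z => Ul z l) &
      forall z, Om z -> exists am a0 a1 a2 bm b0 b1 b2,
        [/\ eigen_split (invmx (U z) *m mxdz U z) am a0 a1 a2,
            eigen_split (invmx (U z) *m mxdzb U z) bm b0 b1 b2 &
            forall l, S1 l ->
              invmx (Ul z l) *m mxdz (fun w => Ul w l) z
                = l ^- 2 *: a2 + l^-1 *: am + a0 /\
              invmx (Ul z l) *m mxdzb (fun w => Ul w l) z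
                = b0 + l *: b1 + l ^+ 2 *: b2]].

Definition potential (beta : C -> R) (a b : C -> C) (l z : C) :
    'M[C]_(4 + 1) :=
  lie ((l ^- 2 / 2 * dz (fun w => (beta w)%:C) z) *: Li)
      (l^-1 *: (a z *: eps + b z *: (Li *m epsb))).

(* dH = H mu with mu = M dz: the complex derivative of H is H M. *)
Definition solves (s : R) (Om : set C) (z0 : C)
    (M : C -> C -> 'M[C]_(4 + 1)) (H : C -> C -> 'M[C]_(4 + 1)) : Prop :=
  [/\ forall z, Om z -> LambdaGC s (H z),
      forall l, S1 l -> H z0 l = 1%:M &
      forall l, S1 l -> forall z, Om z ->
        is_derive (z : C) (1 : C) (fun w => H w l) (H z l *m M l z)].

Definition beta_loop (beta gamma : C -> R) (l z : C) : C :=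
  2^-1 * (l ^- 2 + l ^+ 2) * (beta z)%:C
  + iC / 2 * (l ^- 2 - l ^+ 2) * (gamma z)%:C.

Definition F_loop (beta gamma : C -> R) (l z : C) : 'M[C]_4 :=
  expmx ((2^-1 * beta_loop beta gamma l z) *: Li).

Definition X_loop (Om : set C) (z0 : C) (beta gamma : C -> R) (a b : C -> C)
    (l z : C) : 'cV[C]_4 :=
  expmx ((2^-1 * beta_loop beta gamma l z) *: Li) *m
  projP (fun m =>
    expmx (- (2^-1 * beta_loop beta gamma m z) *: Li) *m
    int_from Om z0 z (fun v =>
      expmx ((m ^- 2 / 4 * ((beta v)%:C + iC * (gamma v)%:C)) *: Li) *m
      (m^-1 *: (a v *: eps + b v *: (Li *m epsb))))) l.

End Defs.

(* Main.v *)
Require Import Defs.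
From HB Require Import structures.
From mathcomp Require Import all_boot all_order all_algebra.
From mathcomp Require Import all_classical all_reals all_analysis.
From mathcomp Require Import complex.
From mathcomp Require Import ring lra.
Set Implicit Arguments.
Unset Strict Implicit.
Unset Printing Implicit Defensive.
Import Order.TTheory GRing.Theory Num.Theory.
Import numFieldNormedType.Exports.
Local Open Scope classical_set_scope.
Local Open Scope ring_scope.

(** The function [B] = beta + i gamma is holomorphic, and the linear part of dH = H mu involves only
    [Li], so that everything is explicit. [Li] has eigenvalues i and -i, with projectors [Pp] and
    [Pm]. In the basis [Pp] eps, [Pm] eps, [Pp] Li epsb, [Pm] Li epsb of C^4 ([vec4]) every exp(k
    Li) is diagonal, while [Lj] and complex conjugation only permute the coordinates up to factors i
    and -i. The 5x5 problem thus falls apart into four scalar ones, of one kind, with a constant th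
    = i/4 or -i/4 ([thq]) and g = a or b. The translation part of H has the coordinates l^-1 times
    the integral of exp(th l^-2 B) g ([transH]). Multiplied by exp(-beta_l Li / 2) they become w(l)
    = exp(-th (l^-2 B + l^2 conj B)) times that ([sloop]), an odd function holomorphic for l != 0.

    Factorisation. Split w = w_- + w_+ into negative and positive powers of l. Both parts are means
    against a kernel ([negp] on the circle of radius 1/2, [Tker] on the circle of radius 2;
    [sloop_split]). P keeps w_- and adds its complex conjugate, so X_l is real and U_l takes values
    in the real group. What remains for V = U^-1 H is the linear part exp(-l^2 conj B Li / 4) and a
    translation made of w_+ and of conjugates of w_-. On the unit circle the latter coincide with
    holomorphic functions of l on the disc of radius 2 that vanish at 0 ([negp_conj], [Tker_hol],
    [Tker0]), hence V extends to the disc with V(0) = (1, 0). This is [UV_factor], [Uloop_LambdaG]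
    and [Vloop_LambdaPlus]. The twisting condition comes from l^2 changing sign under l -> i l,
    which exchanges the two values of th ([sloop_iC]). The loops extend holomorphically to an
    annulus around the unit circle, so their Fourier coefficients decay geometrically and they are
    of class H^s ([Hs_hol]). Uniqueness of H follows since the product of any solution with the
    explicit inverse [Hinv] has derivative zero ([solves_unique]).

    Immersions. Differentiating the circle means in z and conj z gives U^-1 dU ([Uloop_wdiff]): the
    dz part is l^-2 alpha_2' + l^-1 (p eps + q Li epsb) and the d conj z part is the conjugate one,
    with p and q ([pz], [qz]) free of l. So the equation of an extended lift holds, and what is left
    is whether F^-1 dX has the form e^f K (eps dz + epsb d conj z). As K runs through G_0, K eps
    runs through the vectors p eps + q Li epsb with |p|^2 + |q|^2 = 1 ([G0mx_eps]); hence e^(2f) =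
    |p|^2 + |q|^2 solves the problem where (p, q) != (0, 0). The vector p eps + q Li epsb and its
    conjugate lie in complementary planes, so that a nonzero (p, q) is what makes dX_l injective
    ([conformal_injective]). The two directions are [lift_immersion] on the one hand,
    [immersion_hamiltonian] and [immersion_lift] on the other.

    The complex analysis behind this is developed from Goursat's theorem: local primitives, Cauchy's
    formula for derivatives, monodromy on simply connected domains, and contour shifts for means
    over circles. *)

Local Notation cabs := (@ComplexField.Normc.normc _).
Local Notation rc := (real_complex _).
Local Notation iC := (Complex 0 1).

(** * The real-valued modulus of a complex number, and neighbourhoods in terms of it *)

Section Modulus.
Context {R : realType}.
Local Notation C := R[i].
Implicit Types (x y z : C) (r : R).

Lemma normE z : `|z| = rc (cabs z). Proof. by []. Qed.

Lemma cabs_ge0 z : 0 <= cabs z.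
Proof. by case: z => a b; exact: sqrtr_ge0. Qed.

Lemma cabs0 : cabs (0 : C) = 0. Proof. exact: ComplexField.Normc.normc0. Qed.
Lemma cabs1 : cabs (1 : C) = 1. Proof. exact: ComplexField.Normc.normc1. Qed.

Lemma cabsM x y : cabs (x * y) = cabs x * cabs y.
Proof. exact: ComplexField.Normc.normcM. Qed.

Lemma cabsV x : cabs x^-1 = (cabs x)^-1.
Proof. exact: ComplexField.Normc.normcV. Qed.

Lemma cabsN x : cabs (- x) = cabs x. Proof. exact: normcN. Qed.

Lemma cabsX x n : cabs (x ^+ n) = cabs x ^+ n.
Proof. by elim: n => [|n IH]; rewrite ?expr0 ?cabs1 // !exprS cabsM IH. Qed.

Lemma cabsD x y : cabs (x + y) <= cabs x + cabs y.
Proof. exact: le_normcD. Qed.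

Lemma cabsB x y : cabs (x - y) <= cabs x + cabs y.
Proof. by rewrite -(cabsN y); exact: cabsD. Qed.

Lemma cabs_sub x y : cabs (x - y) = cabs (y - x).
Proof. by rewrite -cabsN opprB. Qed.

Lemma cabs_tri y x z : cabs (x - z) <= cabs (x - y) + cabs (y - z).
Proof. by apply: le_trans (cabsD _ _); rewrite subrKA. Qed.

Lemma cabs_subr_ge x y : cabs x - cabs y <= cabs (x - y).
Proof. by rewrite lerBlDr; apply: le_trans (cabsD _ _); rewrite subrK. Qed.

Lemma cabs_eq0 z : (cabs z == 0) = (z == 0).
Proof.
apply/eqP/eqP => [|->]; [exact: ComplexField.Normc.eq0_normc|exact: cabs0].
Qed.

Lemma cabs_gt0 z : (0 < cabs z) = (z != 0).
Proof. by rewrite lt_def cabs_ge0 andbT cabs_eq0. Qed.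

Lemma cabs_real r : cabs (rc r) = `|r|.
Proof. by rewrite /= expr0n addr0 sqrtr_sqr. Qed.

Lemma cabs_i : cabs (iC : C) = 1.
Proof. by rewrite /= expr0n expr1n add0r sqrtr1. Qed.

Lemma cabs_conj z : cabs z^*%C = cabs z.
Proof. by case: z => a b /=; rewrite sqrrN. Qed.

Lemma cabs_sqr z : cabs z ^+ 2 = complex.Re z ^+ 2 + complex.Im z ^+ 2.
Proof. by case: z => a b; rewrite sqr_sqrtr // addr_ge0 // sqr_ge0. Qed.

Lemma Re_le_cabs z : `|complex.Re z| <= cabs z.
Proof.
case: z => a b /=; rewrite -sqrtr_sqr ler_wsqrtr // lerDl; exact: sqr_ge0.
Qed.

Lemma Im_le_cabs z : `|complex.Im z| <= cabs z.
Proof.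
case: z => a b /=; rewrite -sqrtr_sqr ler_wsqrtr // lerDr; exact: sqr_ge0.
Qed.

Lemma cabs_le z : cabs z <= `|complex.Re z| + `|complex.Im z|.
Proof.
rewrite [z in cabs z]complexE; apply: le_trans (cabsD _ _) _.
by rewrite cabsM cabs_i mul1r !cabs_real.
Qed.

Lemma mul_conj z : z * z^*%C = rc (cabs z ^+ 2).
Proof.
by rewrite cabs_sqr; case: z => a b; rewrite /= -!complexr0; simpc;
  rewrite -!expr2 [b * a]mulrC addNr.
Qed.

Lemma iCiC : (iC : C) * iC = -1.
Proof. by simpc. Qed.

Lemma ReD x y : complex.Re (x + y) = complex.Re x + complex.Re y.
Proof. by case: x y => [? ?] []. Qed.
Lemma ImD x y : complex.Im (x + y) = complex.Im x + complex.Im y.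
Proof. by case: x y => [? ?] []. Qed.
Lemma ReB x y : complex.Re (x - y) = complex.Re x - complex.Re y.
Proof. by case: x y => [? ?] []. Qed.
Lemma ImB x y : complex.Im (x - y) = complex.Im x - complex.Im y.
Proof. by case: x y => [? ?] []. Qed.
Lemma ReM x y : complex.Re (x * y) =
  complex.Re x * complex.Re y - complex.Im x * complex.Im y.
Proof. by case: x y => [? ?] []. Qed.
Lemma ImM x y : complex.Im (x * y) =
  complex.Re x * complex.Im y + complex.Im x * complex.Re y.
Proof. by case: x y => [? ?] []. Qed.
Lemma ReZ r x : complex.Re (rc r * x) = r * complex.Re x.
Proof. by rewrite ReM /= mul0r subr0. Qed.
Lemma ImZ r x : complex.Im (rc r * x) = r * complex.Im x.
Proof. by rewrite ImM /= mul0r addr0. Qed.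
Lemma rc0 : rc (0 : R) = 0. Proof. by []. Qed.
Lemma rc1 : rc (1 : R) = 1. Proof. by []. Qed.
Lemma conj_rc r : (rc r)^*%C = rc r.
Proof. exact: conjc_real. Qed.
Lemma conj_rcM r x : (rc r * x)^*%C = rc r * x^*%C.
Proof. by case: x => a b; rewrite /= -!complexr0; simpc. Qed.
Lemma complex_eta z : Complex (complex.Re z) (complex.Im z) = z.
Proof. by case: z. Qed.
Lemma complex_ext x y : complex.Re x = complex.Re y ->
  complex.Im x = complex.Im y -> x = y.
Proof. by case: x y => [a b] [c d] /= -> ->. Qed.

Lemma nbhsCP z (P : set C) :
  nbhs z P <-> exists2 d : R, 0 < d & forall w, cabs (w - z) < d -> P w.
Proof.
split=> [/nbhs_ballP[e /= e0 H]|[d d0 H]].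
  have [k ke] : exists k, e = rc k by apply/complex_realP; exact: gtr0_real.
  subst e; exists k => [|w wz]; first by rewrite -ltcR.
  by apply: H; rewrite -ball_normE /= distrC normE ltcR.
apply/nbhs_ballP; exists (rc d); first by rewrite /= ltcR.
by move=> w; rewrite -ball_normE /= distrC normE ltcR => /H.
Qed.

Lemma nbhsRP (t : R) (P : set R) :
  nbhs t P <-> exists2 d : R, 0 < d & forall w : R, `|w - t| < d -> P w.
Proof.
split=> [/nbhs_ballP[e /= e0 H]|[d d0 H]].
  by exists e => // w wz; apply: H; rewrite -ball_normE /= distrC.
by apply/nbhs_ballP; exists d => // w; rewrite -ball_normE /= distrC => /H.
Qed.

Lemma nbhsS (P : set C) (z : C) : open P -> P z ->
  exists2 d : R, 0 < d & forall w, cabs (w - z) < d -> P w.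
Proof. by move=> oP Pz; apply/nbhsCP; exact: open_nbhs_nbhs. Qed.

Lemma continuousCRP (f : C -> R) z : {for z, continuous f} <->
  forall e, 0 < e -> exists2 d : R, 0 < d &
    forall w : C, cabs (w - z) < d -> `|f w - f z| < e.
Proof.
split=> [cf e e0|H A /nbhsRP[e e0 eA]].
  have /nbhsCP[d d0 H] : nbhs z (f @^-1` (fun y : R => `|y - f z| < e)).
    by apply: cf; apply/nbhsRP; exists e.
  by exists d.
by have [d d0 dH] := H e e0; apply/nbhsCP; exists d => // w /dH /eA.
Qed.

End Modulus.

#[global] Arguments ComplexField.Normc.normc : simpl never.
#[global] Arguments real_complex_def : simpl never.

(** * First-order expansions, uniform in a parameter *)

Section Differentials.
Context {R : realType}.
Local Notation C := R[i].
Variables (T : zmodType) (N : T -> R).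

(** Uniformity in the index is what differentiation under an integral sign consumes. The domain is
    any additive group with a size [N], so that real and complex variables share one calculus. *)
Definition udiff (I : Type) (D : set I) (f L : I -> T -> C) (x : T) : Prop :=
  forall e, 0 < e -> exists2 d, 0 < d & forall h, N h < d -> forall i, D i ->
    cabs (f i (x + h) - f i x - L i h) <= e * N h.

Definition gdiff (f L : T -> C) (x : T) : Prop :=
  udiff setT (fun _ : unit => f) (fun _ => L) x.

Lemma gdiffP f L x : gdiff f L x <->
  forall e, 0 < e -> exists2 d, 0 < d & forall h, N h < d ->
    cabs (f (x + h) - f x - L h) <= e * N h.
Proof.
by split=> H e e0; have [d d0 dH] := H e e0; exists d => // h /dH Hh;
  [exact: Hh tt I|move=> _ _].
Qed.

Lemma eq_udiff I D f g L M x : (forall i t, D i -> f i t = g i t) ->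
  (forall i h, D i -> L i h = M i h) -> @udiff I D f L x -> udiff D g M x.
Proof.
move=> fg LM H e e0; have [d d0 dH] := H e e0; exists d => // h hd i Di.
by rewrite -!fg// -LM//; exact: dH.
Qed.

Lemma eq_gdiff f g L M x : (forall t, f t = g t) ->
  (forall h, L h = M h) -> gdiff f L x -> gdiff g M x.
Proof. by move=> fg LM; apply: eq_udiff => _ h _; [exact: fg|exact: LM]. Qed.

Lemma near_gdiff f g L x d : 0 < d -> (forall h, N h < d -> f (x + h) = g (x + h)) ->
  f x = g x -> gdiff f L x -> gdiff g L x.
Proof.
move=> d0 fg fgx /gdiffP H; apply/gdiffP => e e0.
have [d' d'0 dH] := H e e0; exists (Num.min d d'); first by rewrite lt_min d0.
by move=> h; rewrite lt_min => /andP[h1 h2]; rewrite -fg// -fgx; exact: dH.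
Qed.

Hypothesis N0 : forall h, 0 <= N h.

Lemma udiff_cst I D (c : I -> C) x : udiff D (fun i _ => c i) (fun _ _ => 0) x.
Proof.
by move=> e e0; exists 1 => // h _ i _; rewrite subr0 subrr cabs0 mulr_ge0// ltW.
Qed.

Lemma udiffD I D f g Lf Lg x : @udiff I D f Lf x -> @udiff I D g Lg x ->
  udiff D (fun i t => f i t + g i t) (fun i h => Lf i h + Lg i h) x.
Proof.
move=> Hf Hg e e0.
have [d1 d10 H1] := Hf _ (divr_gt0 e0 (ltr0Sn _ 1)).
have [d2 d20 H2] := Hg _ (divr_gt0 e0 (ltr0Sn _ 1)).
exists (Num.min d1 d2); first by rewrite lt_min d10.
move=> h; rewrite lt_min => /andP[h1 h2] i Di.
have -> : f i (x + h) + g i (x + h) - (f i x + g i x) - (Lf i h + Lg i h) =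
  (f i (x + h) - f i x - Lf i h) + (g i (x + h) - g i x - Lg i h) by ring.
apply: le_trans (cabsD _ _) _; rewrite [e]splitr mulrDl.
by rewrite lerD ?H1 ?H2.
Qed.

(** The product rule stays uniform because a single [M] bounds the values and the linear parts of
    both families. *)
Lemma udiffM I D f g Lf Lg x M :
  (forall i, D i -> cabs (f i x) <= M) -> (forall i, D i -> cabs (g i x) <= M) ->
  (forall i h, D i -> cabs (Lf i h) <= M * N h) ->
  (forall i h, D i -> cabs (Lg i h) <= M * N h) ->
  @udiff I D f Lf x -> @udiff I D g Lg x ->
  udiff D (fun i t => f i t * g i t)
    (fun i h => Lf i h * g i x + f i x * Lg i h) x.
Proof.
move=> fM gM LfM LgM Hf Hg e e0.
pose K := `|M| + 1.
have MK : M <= K by rewrite /K; apply: le_trans (ler_norm _) _; rewrite lerDl.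
have K1 : 1 <= K by rewrite /K lerDr.
have K0 : 0 < K by exact: lt_le_trans K1.
(* The product of the two linear parts will cost e/2, through [d3]; the two terms that contain a
   remainder cost together 5 K e1, at most 5e/16. *)
pose e1 := Num.min 1 (e / (16 * K)).
have e10 : 0 < e1 by rewrite lt_min ltr01 divr_gt0// mulr_gt0.
have [d1 d10 H1] := Hf _ e10.
have [d2 d20 H2] := Hg _ e10.
pose d3 := Num.min 1 (e / (2 * K ^+ 2)).
have d30 : 0 < d3 by rewrite lt_min ltr01 divr_gt0// mulr_gt0// exprn_gt0.
exists (Num.min d3 (Num.min d1 d2)); first by rewrite lt_min d30 lt_min d10.
move=> h; rewrite lt_min => /andP[h3a]; rewrite lt_min => /andP[h1 h2] i Di.
move: h3a; rewrite lt_min => /andP[h3 h3'].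
set rf := f i (x + h) - f i x - Lf i h.
set rg := g i (x + h) - g i x - Lg i h.
have Hrf : cabs rf <= e1 * N h by exact: H1.
have Hrg : cabs rg <= e1 * N h by exact: H2.
have -> : f i (x + h) * g i (x + h) - f i x * g i x -
  (Lf i h * g i x + f i x * Lg i h) =
  Lf i h * Lg i h + rf * (g i x + Lg i h + rg) + (f i x + Lf i h) * rg.
  by rewrite /rf /rg; ring.
have nh := N0 h.
have e11 : e1 <= 1 by rewrite /e1 ge_min lexx.
have LfK : cabs (Lf i h) <= K * N h.
  by apply: le_trans (LfM i h Di) _; rewrite ler_wpM2r.
have LgK : cabs (Lg i h) <= K * N h.
  by apply: le_trans (LgM i h Di) _; rewrite ler_wpM2r.
have a1 : cabs (Lf i h * Lg i h) <= e / 2 * N h.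
  rewrite cabsM; apply: (@le_trans _ _ ((K * N h) * (K * N h))).
    by apply: ler_pM => //; exact: cabs_ge0.
  have -> : K * N h * (K * N h) = (K ^+ 2 * N h) * N h by ring.
  rewrite ler_wpM2r//; move: h3' => /ltW.
  rewrite ler_pdivlMr; last by rewrite mulr_gt0// exprn_gt0.
  by rewrite ler_pdivlMr// => ?; lra.
have KN : K * N h <= K by rewrite ler_piMr// ltW.
have gb : cabs (g i x + Lg i h + rg) <= 3 * K.
  have h4 : e1 * N h <= K.
    by apply: (le_trans _ K1); apply: mulr_ile1 => //; exact: ltW.
  apply: le_trans (cabsD _ _) _; have := cabsD (g i x) (Lg i h).
  have := gM i Di; lra.
have fb : cabs (f i x + Lf i h) <= 2 * K.
  have := cabsD (f i x) (Lf i h); have := fM i Di; lra.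
have e1e : e1 * (16 * K) <= e.
  by rewrite -ler_pdivlMr ?mulr_gt0// ge_min lexx orbT.
have a2 : cabs (rf * (g i x + Lg i h + rg)) <= (e1 * N h) * (3 * K).
  by rewrite cabsM; apply: ler_pM => //; exact: cabs_ge0.
have a3 : cabs ((f i x + Lf i h) * rg) <= (2 * K) * (e1 * N h).
  by rewrite cabsM; apply: ler_pM => //; exact: cabs_ge0.
have a4 : e1 * (16 * K) * N h <= e * N h by rewrite ler_wpM2r.
have a5 : 0 <= e1 * K * N h by rewrite !mulr_ge0// ltW.
apply: le_trans (cabsD _ _) _; apply: le_trans (lerD (cabsD _ _) (lexx _)) _.
lra.
Qed.

Lemma gdiff_cst c x : gdiff (fun=> c) (fun=> 0) x.
Proof. exact: (udiff_cst setT (fun _ : unit => c)). Qed.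

Lemma gdiffD f g Lf Lg x : gdiff f Lf x -> gdiff g Lg x ->
  gdiff (fun t => f t + g t) (fun h => Lf h + Lg h) x.
Proof. exact: udiffD. Qed.

Lemma gdiffM f g Lf Lg x Mf Mg :
  (forall h, cabs (Lf h) <= Mf * N h) -> (forall h, cabs (Lg h) <= Mg * N h) ->
  gdiff f Lf x -> gdiff g Lg x ->
  gdiff (fun t => f t * g t) (fun h => Lf h * g x + f x * Lg h) x.
Proof.
move=> HMf HMg; pose M := `|Mf| + `|Mg| + cabs (f x) + cabs (g x).
have f0 := cabs_ge0 (f x); have g0 := cabs_ge0 (g x).
have f1 := normr_ge0 Mf; have g1 := normr_ge0 Mg.
apply: (@udiffM unit _ _ _ _ _ _ M) => [_ _|_ _|_ h _|_ h _]; rewrite /M; try lra.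
  by apply: le_trans (HMf h) _; rewrite ler_wpM2r//; have := ler_norm Mf; lra.
by apply: le_trans (HMg h) _; rewrite ler_wpM2r//; have := ler_norm Mg; lra.
Qed.

Lemma gdiff_near f L x M : (forall h, cabs (L h) <= M * N h) ->
  gdiff f L x -> forall e, 0 < e -> exists2 d, 0 < d &
    forall h, N h < d -> cabs (f (x + h) - f x) <= e.
Proof.
move=> LM /gdiffP Hf e e0.
have [d d0 dH] := Hf _ ltr01.
pose K := `|M| + 1.
have K0 : 0 < K by rewrite ltr_wpDl.
exists (Num.min d (e / K)); first by rewrite lt_min d0 divr_gt0.
move=> h; rewrite lt_min => /andP[hd]; rewrite ltr_pdivlMr// => hK.
have := dH _ hd; rewrite mul1r => h1.
have := cabsD (f (x + h) - f x - L h) (L h); rewrite subrK => h2.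
have h3 : cabs (L h) <= `|M| * N h.
  by apply: le_trans (LM h) _; rewrite ler_wpM2r// ler_norm.
rewrite /K in hK; lra.
Qed.

End Differentials.

(** * Wirtinger derivatives, complex derivatives, derivatives of curves; mean value inequalities *)

Section Derivatives.
Context {R : realType}.
Local Notation C := R[i].
Implicit Types (z w d : C) (f g : C -> C) (c : R -> C) (t : R).

(** Real differentiability, with [A] and [A'] the Wirtinger derivatives in z and in conj z. *)
Definition wdiff f z (A A' : C) : Prop :=
  gdiff cabs f (fun h => A * h + A' * h^*%C) z.
Definition hasD f z d : Prop := gdiff cabs f (fun h => d * h) z.
Definition cdiff c t (v : C) : Prop :=
  gdiff (@Num.norm R R) c (fun h => rc h * v) t.

Lemma hasDP f z d : hasD f z d <-> forall e, 0 < e -> exists2 r : R, 0 < r &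
  forall h, cabs h < r -> cabs (f (z + h) - f z - d * h) <= e * cabs h.
Proof. exact: gdiffP. Qed.

Lemma cdiffP c t v : cdiff c t v <-> forall e, 0 < e -> exists2 r : R, 0 < r &
  forall h : R, `|h| < r -> cabs (c (t + h) - c t - rc h * v) <= e * `|h|.
Proof. exact: gdiffP. Qed.

Lemma hasD_wdiff f z d : hasD f z d <-> wdiff f z d 0.
Proof. by split; apply: eq_gdiff => // h; rewrite mul0r addr0. Qed.

Lemma wdiff_bound (A A' : C) h :
  cabs (A * h + A' * h^*%C) <= (cabs A + cabs A') * cabs h.
Proof. by apply: le_trans (cabsD _ _) _; rewrite !cabsM cabs_conj mulrDl. Qed.

Lemma hasD_bound d (h : C) : cabs (d * h) <= cabs d * cabs h.
Proof. by rewrite cabsM. Qed.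

Lemma cdiff_bound v (h : R) : cabs (rc h * v) <= cabs v * `|h|.
Proof. by rewrite cabsM cabs_real mulrC. Qed.

Lemma wdiff_comp (T : zmodType) (N : T -> R) f (g : T -> C) L x A A' M :
  (forall h, 0 <= N h) -> (forall h, cabs (L h) <= M * N h) ->
  wdiff f (g x) A A' -> gdiff N g L x ->
  gdiff N (fun y => f (g y)) (fun h => A * L h + A' * (L h)^*%C) x.
Proof.
move=> N0 LM /gdiffP Hf /gdiffP Hg; apply/gdiffP => e e0.
pose K := `|M| + 1; have K0 : 0 < K by rewrite ltr_wpDl.
pose a := cabs A + cabs A' + 1.
have a0 : 0 < a by rewrite ltr_wpDl// addr_ge0// cabs_ge0.
have [d1 d10 H1] := Hf _ (divr_gt0 (divr_gt0 e0 K0) (ltr0Sn _ 1)).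
have [d2 d20 H2] := Hg _ (divr_gt0 (divr_gt0 e0 a0) (ltr0Sn _ 1)).
have [d3 d30 H3] := Hg _ ltr01.
exists (Num.min (Num.min d2 d3) (d1 / K)).
  by rewrite !lt_min d20 d30 divr_gt0.
move=> h; rewrite !lt_min ltr_pdivlMr// => /andP[/andP[h2 h3] h1].
set k := g (x + h) - g x.
have kL : cabs k <= K * N h.
  have := H3 _ h3; rewrite -/k mul1r => h4.
  have := cabsD (k - L h) (L h); rewrite subrK => h5.
  have h6 : cabs (L h) <= `|M| * N h.
    by apply: le_trans (LM h) _; rewrite ler_wpM2r// ler_norm.
  rewrite /K; lra.
have := H1 k; rewrite [g x + k]addrC /k subrK -/k => H1k.
have {}H1k : cabs (f (g (x + h)) - f (g x) - (A * k + A' * k^*%C)) <= e / K / 2 * cabs k.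
  by apply: H1k; apply: le_lt_trans kL _; rewrite mulrC.
have H2h := H2 _ h2; rewrite -/k in H2h.
have -> : f (g (x + h)) - f (g x) - (A * L h + A' * (L h)^*%C) =
  (f (g (x + h)) - f (g x) - (A * k + A' * k^*%C)) +
  (A * (k - L h) + A' * (k - L h)^*%C) by move: (f (g (x + h))) (f (g x)) => u v; ring.
apply: le_trans (cabsD _ _) _.
have b1 : e / K / 2 * cabs k <= e / 2 * N h.
  have -> : e / 2 * N h = e / K / 2 * (K * N h) by field; rewrite gt_eqF.
  by rewrite ler_wpM2l// !divr_ge0// ltW.
have b2 := wdiff_bound A A' (k - L h).
have b3 : (cabs A + cabs A') * cabs (k - L h) <= e / 2 * N h.
  apply: (@le_trans _ _ (a * (e / a / 2 * N h))).
    by apply: ler_pM => //; rewrite ?addr_ge0 ?cabs_ge0// /a lerDl.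
  by rewrite le_eqVlt; apply/orP; left; apply/eqP; field; rewrite gt_eqF.
lra.
Qed.

Lemma hasD_gcomp (T : zmodType) (N : T -> R) f (g : T -> C) L x d M :
  (forall h, 0 <= N h) -> (forall h, cabs (L h) <= M * N h) ->
  hasD f (g x) d -> gdiff N g L x ->
  gdiff N (fun y => f (g y)) (fun h => d * L h) x.
Proof.
move=> N0 LM /hasD_wdiff Hf Hg; have := wdiff_comp N0 LM Hf Hg.
by apply: eq_gdiff => // h; rewrite mul0r addr0.
Qed.

Lemma cdiff_gcomp (T : zmodType) (N : T -> R) c (g : T -> R) (l : T -> R) x v M :
  (forall h, 0 <= N h) -> (forall h, `|l h| <= M * N h) ->
  cdiff c (g x) v -> gdiff N (fun y => rc (g y)) (fun h => rc (l h)) x ->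
  gdiff N (fun y => c (g y)) (fun h => rc (l h) * v) x.
Proof.
move=> N0 LM Hc Hg.
(* The curve is extended to the plane as a function of the real part, whose Wirtinger derivatives
   are both v/2; the complex chain rule then applies. *)
have Hf : wdiff (fun z => c (complex.Re z)) (rc (g x)) (v / 2) (v / 2).
  apply/gdiffP => e e0; have [d d0 dH] := (gdiffP _ _ _ _).1 Hc e e0.
  exists d => // h hd.
  have := dH _ (le_lt_trans (Re_le_cabs h) hd); rewrite ReD /=.
  have -> : v / 2 * h + v / 2 * h^*%C = rc (complex.Re h) * v.
    by rewrite ReJ_add; field.
  by move=> /le_trans; apply; rewrite ler_wpM2l ?Re_le_cabs ?ltW.
have := wdiff_comp (L := fun h => rc (l h)) N0 _ Hf Hg.
move=> /(_ M) H; apply: eq_gdiff (H _) => [//|h|h].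
  by rewrite conj_rc; field.
by rewrite cabs_real.
Qed.

Lemma wdiff_cst (a z : C) : wdiff (fun=> a) z 0 0.
Proof.
by apply: eq_gdiff (gdiff_cst cabs_ge0 a z) => // h; rewrite !mul0r addr0.
Qed.

Lemma wdiff_id z : wdiff id z 1 0.
Proof.
apply/gdiffP => e e0; exists 1 => // h _.
have -> : z + h - z - (1 * h + 0 * h^*%C) = 0 by ring.
by rewrite cabs0 mulr_ge0 ?cabs_ge0 ?ltW.
Qed.

Lemma wdiff_conj z : wdiff (fun w => w^*%C) z 0 1.
Proof.
apply/gdiffP => e e0; exists 1 => // h _.
have -> : (z + h)^*%C - z^*%C - (0 * h + 1 * h^*%C) = 0 by ring.
by rewrite cabs0 mulr_ge0 ?cabs_ge0 ?ltW.
Qed.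

Lemma wdiffD f g z A A' B B' : wdiff f z A A' -> wdiff g z B B' ->
  wdiff (fun w => f w + g w) z (A + B) (A' + B').
Proof.
move=> Hf Hg; apply: eq_gdiff (gdiffD Hf Hg) => // h; ring.
Qed.

Lemma wdiffM f g z A A' B B' : wdiff f z A A' -> wdiff g z B B' ->
  wdiff (fun w => f w * g w) z (A * g z + f z * B) (A' * g z + f z * B').
Proof.
move=> Hf Hg.
apply: eq_gdiff (gdiffM cabs_ge0 _ _ Hf Hg) => // h; last 2 first.
- exact: wdiff_bound.
- exact: wdiff_bound.
ring.
Qed.

Lemma wdiff_conjc f z A A' : wdiff f z A A' ->
  wdiff (fun w => (f w)^*%C) z A'^*%C A^*%C.
Proof.
move=> Hf; have := wdiff_comp cabs_ge0 (@wdiff_bound A A') (wdiff_conj (f z)) Hf.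
apply: eq_gdiff => // h; rewrite rmorphD !rmorphM /= conjcK; ring.
Qed.

Lemma eq_wdiff f g z A A' B B' : (forall w, f w = g w) -> A = B -> A' = B' ->
  wdiff f z A A' -> wdiff g z B B'.
Proof. by move=> fg -> ->; apply: eq_gdiff. Qed.

Lemma near_wdiff (U : set C) f g z A A' : open U -> U z ->
  (forall w, U w -> f w = g w) -> wdiff f z A A' -> wdiff g z A A'.
Proof.
move=> oU Uz fg; have [d d0 dU] := nbhsS oU Uz.
apply: (near_gdiff (d := d)) => //; last exact: fg.
by move=> h hd; apply: fg; apply: dU; rewrite addrC addKr.
Qed.

Lemma hasD_cst (a z : C) : hasD (fun=> a) z 0.
Proof. by apply/hasD_wdiff; exact: wdiff_cst. Qed.

Lemma hasD_id z : hasD id z 1.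
Proof. by apply/hasD_wdiff; exact: wdiff_id. Qed.

Lemma hasDD f g z d d' : hasD f z d -> hasD g z d' ->
  hasD (fun w => f w + g w) z (d + d').
Proof.
move=> /hasD_wdiff Hf /hasD_wdiff Hg; apply/hasD_wdiff.
by apply: eq_wdiff (wdiffD Hf Hg) => //; rewrite addr0.
Qed.

Lemma hasDM f g z d d' : hasD f z d -> hasD g z d' ->
  hasD (fun w => f w * g w) z (d * g z + f z * d').
Proof.
move=> /hasD_wdiff Hf /hasD_wdiff Hg; apply/hasD_wdiff.
by apply: eq_wdiff (wdiffM Hf Hg) => //; rewrite mul0r mulr0 addr0.
Qed.

Lemma hasDZ f z d a : hasD f z d -> hasD (fun w => a * f w) z (a * d).
Proof.
by move=> Hf; have := hasDM (hasD_cst a z) Hf; rewrite mul0r add0r.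
Qed.

Lemma hasDN f z d : hasD f z d -> hasD (fun w => - f w) z (- d).
Proof.
by move=> /(hasDZ (-1)); apply: eq_gdiff => // h; rewrite mulN1r.
Qed.

Lemma hasDB f g z d d' : hasD f z d -> hasD g z d' ->
  hasD (fun w => f w - g w) z (d - d').
Proof. by move=> Hf Hg; exact: hasDD Hf (hasDN Hg). Qed.

Lemma hasD_comp f g z d d' : hasD f (g z) d -> hasD g z d' ->
  hasD (fun w => f (g w)) z (d * d').
Proof.
move=> Hf Hg; apply: eq_gdiff (hasD_gcomp cabs_ge0 (hasD_bound d') Hf Hg) => // h.
by rewrite mulrA.
Qed.

Lemma eq_hasD f g z d d' : (forall w, f w = g w) -> d = d' ->
  hasD f z d -> hasD g z d'.
Proof. by move=> fg ->; apply: eq_gdiff. Qed.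

Lemma near_hasD (U : set C) f g z d : open U -> U z ->
  (forall w, U w -> f w = g w) -> hasD f z d -> hasD g z d.
Proof.
by move=> oU Uz fg /hasD_wdiff Hf; apply/hasD_wdiff; exact: (near_wdiff oU Uz fg Hf).
Qed.

Lemma hasD_near f z d : hasD f z d -> forall e : R, 0 < e ->
  exists2 r : R, 0 < r & forall w, cabs (w - z) < r -> cabs (f w - f z) <= e.
Proof.
move=> Hf e e0; have [r r0 rH] := gdiff_near cabs_ge0 (hasD_bound d) Hf e0.
by exists r => // w /rH; rewrite [z + _]addrC subrK.
Qed.

Lemma hasD_unique f z d d' : hasD f z d -> hasD f z d' -> d = d'.
Proof.
move=> /hasDP H1 /hasDP H2; apply/eqP; rewrite -subr_eq0 -cabs_eq0.
rewrite eq_le cabs_ge0 andbT; apply/ler_addgt0Pr => e e0; rewrite add0r.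
have [r1 r10 {}H1] := H1 _ (divr_gt0 e0 (ltr0Sn _ 1)).
have [r2 r20 {}H2] := H2 _ (divr_gt0 e0 (ltr0Sn _ 1)).
pose h := Num.min r1 r2 / 2.
have m0 : 0 < Num.min r1 r2 by rewrite lt_min r10.
have h0 : 0 < h by rewrite divr_gt0.
have hr : h < Num.min r1 r2.
  by rewrite /h; lra.
have ch : cabs (rc h) = h by rewrite cabs_real gtr0_norm.
move: hr; rewrite lt_min -ch => /andP[/H1 {}H1 /H2 {}H2].
rewrite -(ler_pM2r h0) -{1}ch -cabsM.
have -> : (d - d') * rc h = (f (z + rc h) - f z - d' * rc h)
    - (f (z + rc h) - f z - d * rc h) by ring.
apply: le_trans (cabsB _ _) _; move: H1 H2; rewrite !ch; lra.
Qed.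

Lemma scaleCE (x y : C) : x *: y = x * y. Proof. by []. Qed.
Lemma scaleRE (x y : R) : x *: y = x * y. Proof. by []. Qed.

Lemma is_derive_hasD f z d : is_derive z 1 f d <-> hasD f z d.
Proof.
split=> [[df <-]|/hasDP H].
  apply/hasDP => e e0; move: df => /cvg_ex[l Hl].
  have -> : 'D_1 f z = l by exact: cvg_lim Hl.
  have e0' : (0 : C) < rc e by rewrite ltcR.
  move/cvgrPdist_le : Hl => /(_ _ e0').
  move=> /nbhs_ballP[r /= r0 rH].
  have [k ke] : exists k, r = rc k by apply/complex_realP; exact: gtr0_real.
  subst r; exists k => [|h hk]; first by rewrite -ltcR.
  have [->|h0] := eqVneq h 0.
    by rewrite addr0 subrr mulr0 subrr !cabs0 mulr0.
  have := rH h; rewrite -ball_normE /= sub0r normrN normE ltcR => /(_ hk h0).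
  rewrite normE lecR => /(ler_wpM2r (cabs_ge0 h)); rewrite -cabsM.
  rewrite !scaleCE mulr1 [h + z]addrC -cabsN.
  by congr (_ <= _); congr (cabs _); field.
have Hl : h^-1 *: (f (h *: 1 + z) - f z) @[h --> 0^'] --> d.
  apply/cvgrPdist_le => e e0.
  have [k ke] : exists k, e = rc k by apply/complex_realP; exact: gtr0_real.
  subst e; rewrite ltcR in e0; have [r r0 rH] := H _ e0.
  apply/nbhs_ballP; exists (rc r); first by rewrite /= ltcR.
  move=> h; rewrite -ball_normE /= sub0r normrN normE ltcR => hr h0.
  rewrite normE lecR -(@ler_pM2r _ (cabs h)) ?cabs_gt0//.
  apply: le_trans (rH _ hr); rewrite -cabsM.
  rewrite !scaleCE mulr1 [h + z]addrC -cabsN.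
  by rewrite le_eqVlt; apply/orP; left; apply/eqP; congr (cabs _); field.
split; first by apply/cvg_ex; exists d.
exact: cvg_lim Hl.
Qed.

Lemma is_derive_cdiff (f : R -> R) t (v : R) :
  is_derive t 1 f v <-> cdiff (fun t => rc (f t)) t (rc v).
Proof.
split=> [[df <-]|/cdiffP H].
  apply/cdiffP => e e0; move: df => /cvg_ex[l Hl].
  have -> : 'D_1 f t = l by exact: cvg_lim Hl.
  move/cvgrPdist_le : Hl => /(_ _ e0).
  move=> /nbhs_ballP[r /= r0 rH].
  exists r => // h hk.
  have [->|h0] := eqVneq h 0.
    have -> : rc (f (t + 0)) - rc (f t) - rc 0 * rc l = 0 by rewrite addr0; ring.
    by rewrite cabs0 normr0 mulr0.
  have := rH h; rewrite -ball_normE /= sub0r normrN => /(_ hk h0).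
  move=> /(ler_wpM2r (normr_ge0 h)); rewrite -normrM.
  rewrite !scaleRE mulr1 [h + t]addrC -[`|_ * h|]normrN.
  rewrite -!rmorphB -rmorphM -rmorphB cabs_real.
by congr (_ <= _); congr (`|_|); field.
have Hl : h^-1 *: (f (h *: 1 + t) - f t) @[h --> 0^'] --> v.
  apply/cvgrPdist_le => e e0; have [r r0 rH] := H _ e0.
  apply/nbhs_ballP; exists r; first by [].
  move=> h; rewrite -ball_normE /= sub0r normrN => hr h0.
  rewrite -(@ler_pM2r _ `|h|) ?normr_gt0//.
  apply: le_trans (rH _ hr); rewrite -normrM.
  rewrite !scaleRE mulr1 [h + t]addrC -[`|_ * h|]normrN.
  rewrite -!rmorphB -rmorphM -rmorphB cabs_real.
  by rewrite le_eqVlt; apply/orP; left; apply/eqP; congr (`|_|); field.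
split; first by apply/cvg_ex; exists v.
exact: cvg_lim Hl.
Qed.

Lemma cdiff_parts c t v : cdiff c t v <->
  is_derive t 1 (fun t => complex.Re (c t)) (complex.Re v) /\
  is_derive t 1 (fun t => complex.Im (c t)) (complex.Im v).
Proof.
split.
  move=> /cdiffP H; split; apply/is_derive_cdiff/cdiffP => e e0;
    have [r r0 rH] := H e e0; exists r => // h /rH; apply: le_trans;
    rewrite -!rmorphB -rmorphM -rmorphB cabs_real.
    by rewrite -ReB -ReZ -ReB Re_le_cabs.
  by rewrite -ImB -ImZ -ImB Im_le_cabs.
move=> [/is_derive_cdiff/cdiffP H1 /is_derive_cdiff/cdiffP H2].
apply/cdiffP => e e0.
have [r1 r10 {}H1] := H1 _ (divr_gt0 e0 (ltr0Sn _ 1)).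
have [r2 r20 {}H2] := H2 _ (divr_gt0 e0 (ltr0Sn _ 1)).
exists (Num.min r1 r2); first by rewrite lt_min r10.
move=> h; rewrite lt_min => /andP[/H1 {}H1 /H2 {}H2].
move: H1 H2; rewrite -!rmorphB -!rmorphM -!rmorphB !cabs_real.
rewrite -!ReB -ReZ -ReB -!ImB -ImZ -ImB => H1 H2.
apply: le_trans (cabs_le _) _; lra.
Qed.

Lemma wdiff_curve f c t A A' v : wdiff f (c t) A A' -> cdiff c t v ->
  cdiff (fun s => f (c s)) t (A * v + A' * v^*%C).
Proof.
move=> Hf Hc; have := wdiff_comp (@normr_ge0 _ _) (cdiff_bound v) Hf Hc.
by apply: eq_gdiff => // h; rewrite conj_rcM; ring.
Qed.

Lemma hasD_curve f c t d v : hasD f (c t) d -> cdiff c t v ->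
  cdiff (fun s => f (c s)) t (d * v).
Proof.
move=> /hasD_wdiff Hf Hc; apply: eq_gdiff (wdiff_curve Hf Hc) => // h.
by rewrite mul0r addr0.
Qed.

Lemma eq_cdiff c c' t v v' : (forall s, c s = c' s) -> v = v' ->
  cdiff c t v -> cdiff c' t v'.
Proof. by move=> cc ->; apply: eq_gdiff. Qed.

Lemma cdiff_cst a t : cdiff (fun=> a) t 0.
Proof.
by apply: eq_gdiff (gdiff_cst (@normr_ge0 _ _) a t) => // h; rewrite mulr0.
Qed.

Lemma cdiff_line z w t : cdiff (fun s => z + rc s * w) t w.
Proof.
apply/cdiffP => e e0; exists 1 => // h _.
have -> : z + rc (t + h) * w - (z + rc t * w) - rc h * w = 0.
  by rewrite rmorphD; ring.
by rewrite cabs0 mulr_ge0 // ltW.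
Qed.

Lemma cdiffD c c' t v v' : cdiff c t v -> cdiff c' t v' ->
  cdiff (fun s => c s + c' s) t (v + v').
Proof.
by move=> H H'; apply: eq_gdiff (gdiffD H H') => // h; ring.
Qed.

Lemma cdiffM c c' t v v' : cdiff c t v -> cdiff c' t v' ->
  cdiff (fun s => c s * c' s) t (v * c' t + c t * v').
Proof.
move=> H H'.
apply: eq_gdiff (gdiffM (@normr_ge0 _ _) (cdiff_bound v) (cdiff_bound v') H H') => // h.
ring.
Qed.

Lemma cdiffZ a c t v : cdiff c t v -> cdiff (fun s => a * c s) t (a * v).
Proof. by move=> H; have := cdiffM (cdiff_cst a t) H; rewrite mul0r add0r. Qed.

Lemma cdiffB c c' t v v' : cdiff c t v -> cdiff c' t v' ->
  cdiff (fun s => c s - c' s) t (v - v').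
Proof.
move=> H /(cdiffZ (-1)) H'; apply: eq_cdiff (cdiffD H H') => [s|].
  by rewrite mulN1r.
by rewrite mulN1r.
Qed.

Lemma cdiff_affine c t v (a b : R) : cdiff c (a + b * t) v ->
  cdiff (fun s => c (a + b * s)) t (rc b * v).
Proof.
move=> Hc.
have Hg : gdiff (@Num.norm R R) (fun s => rc (a + b * s)) (fun h => rc (b * h)) t.
  apply/gdiffP => e e0; exists 1 => // h _; rewrite -!rmorphB.
  have -> : a + b * (t + h) - (a + b * t) - b * h = 0 by ring.
  by rewrite cabs_real normr0 mulr_ge0 // ltW.
have lb (h : R) : `|b * h| <= `|b| * `|h| by rewrite normrM.
have := cdiff_gcomp (g := fun s => a + b * s) (@normr_ge0 _ _) lb Hc Hg.
by apply: eq_gdiff => // h; rewrite rmorphM; ring.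
Qed.

Lemma cdiff_near c t v : cdiff c t v -> forall e : R, 0 < e ->
  exists2 r : R, 0 < r & forall s : R, `|s - t| < r -> cabs (c s - c t) <= e.
Proof.
move=> Hf e e0.
have [r r0 rH] := gdiff_near (@normr_ge0 _ _) (cdiff_bound v) Hf e0.
by exists r => // w /rH; rewrite [t + _]addrC subrK.
Qed.

(** The increment is paired with its own conjugate, and the real mean value theorem is applied to
    the real part of the result. *)
Lemma mean_value_le c (v : R -> C) (a b M : R) : a <= b ->
  (forall t, a <= t <= b -> cdiff c t (v t)) ->
  (forall t, a <= t <= b -> cabs (v t) <= M) ->
  cabs (c b - c a) <= M * (b - a).
Proof.
move=> ab Hc HM; pose u := (c b - c a)^*%C.
have D t : a <= t <= b -> is_derive t 1 (fun s => complex.Re (u * c s)) (complex.Re (u * v t)).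
  by move=> /Hc /(cdiffZ u) /cdiff_parts[].
have [||x xab] := @MVT_segment _ (fun s => complex.Re (u * c s))
  (fun t => complex.Re (u * v t)) a b ab.
- by move=> x; rewrite in_itv /= => /andP[x1 x2]; apply: D; rewrite !ltW.
- by apply: derivable_within_continuous => x; rewrite in_itv /= => /D [].
rewrite -ReB -mulrBr /u mulrC mul_conj /= => E.
move: xab; rewrite in_itv /= => xab.
have [->|n0] := eqVneq (cabs (c b - c a)) 0.
  rewrite mulr_ge0 ?subr_ge0//; exact: le_trans (cabs_ge0 _) (HM _ xab).
have n0' : 0 < cabs (c b - c a) by rewrite lt_def n0 cabs_ge0.
rewrite -(ler_pM2l n0') -expr2 E mulrA ler_wpM2r ?subr_ge0//.
apply: le_trans (ler_norm _) _; apply: le_trans (Re_le_cabs _) _.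
by rewrite cabsM cabs_conj ler_wpM2l ?cabs_ge0 ?HM.
Qed.

Lemma cdiff0_cst c (a b : R) : a <= b -> (forall t, a <= t <= b -> cdiff c t 0) ->
  c a = c b.
Proof.
move=> ab H; apply/eqP; rewrite eq_sym -subr_eq0 -cabs_eq0 eq_le cabs_ge0 andbT.
by have := @mean_value_le c (fun=> 0) a b 0 ab H; rewrite mul0r; apply => t _;
  rewrite cabs0.
Qed.

Lemma segment_le f (f' : C -> C) z w M :
  (forall t : R, 0 <= t <= 1 -> hasD f (z + rc t * (w - z)) (f' (z + rc t * (w - z)))) ->
  (forall t : R, 0 <= t <= 1 -> cabs (f' (z + rc t * (w - z))) <= M) ->
  cabs (f w - f z) <= M * cabs (w - z).
Proof.
move=> Hf HM.
have := @mean_value_le (fun t => f (z + rc t * (w - z)))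
  (fun t => f' (z + rc t * (w - z)) * (w - z)) 0 1 (M * cabs (w - z)) ler01.
rewrite subr0 mulr1 mul1r mul0r addr0 [z + (w - z)]addrC subrK; apply=> t t01.
  exact: hasD_curve (Hf t t01) (cdiff_line _ _ _).
by rewrite cabsM ler_wpM2r ?cabs_ge0 ?HM.
Qed.

Lemma wdiff_pd f z A A' w : wdiff f z A A' ->
  [/\ pderivable w (fun v => complex.Re (f v)) z,
      pderivable w (fun v => complex.Im (f v)) z &
      cpd w f z = A * w + A' * w^*%C].
Proof.
move=> Hf.
have Hc : wdiff f (z + rc 0 * w) A A' by rewrite mul0r addr0.
have /cdiff_parts [[d1 v1] [d2 v2]] := wdiff_curve Hc (cdiff_line z w 0).
split => //; rewrite /cpd /pd !derive1E.
by rewrite [X in Complex X]v1 [X in Complex _ X]v2 complex_eta.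
Qed.

Lemma wdiff_dz f z A A' : wdiff f z A A' -> dz f z = A.
Proof.
move=> Hf; rewrite /dz; have [_ _ ->] := wdiff_pd 1 Hf.
have [_ _ ->] := wdiff_pd iC Hf; rewrite rmorph1.
have -> : (iC : C)^*%C = - iC by simpc.
have := @iCiC R; set i := Complex 0 1 => Hi.
have -> : A * 1 + A' * 1 - i * (A * i + A' * - i) = A + A' - (i * i) * (A - A') by ring.
by rewrite Hi; field.
Qed.

Lemma wdiff_dzb f z A A' : wdiff f z A A' -> dzb f z = A'.
Proof.
move=> Hf; rewrite /dzb; have [_ _ ->] := wdiff_pd 1 Hf.
have [_ _ ->] := wdiff_pd iC Hf; rewrite rmorph1.
have -> : (iC : C)^*%C = - iC by simpc.
have := @iCiC R; set i := Complex 0 1 => Hi.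
have -> : A * 1 + A' * 1 + i * (A * i + A' * - i) = A + A' + (i * i) * (A - A') by ring.
by rewrite Hi; field.
Qed.

End Derivatives.

(** * Compactness of a square by repeated quartering *)

Section Bisection.
Context {R : realType}.
Variables (P : R -> R -> R -> Prop) (x0 y0 s0 : R).
Hypothesis s0_gt0 : 0 < s0.
Hypothesis Psplit : forall x y s, 0 < s ->
  x0 <= x -> x + s <= x0 + s0 -> y0 <= y -> y + s <= y0 + s0 ->
  P x y (s / 2) -> P (x + s / 2) y (s / 2) ->
  P x (y + s / 2) (s / 2) -> P (x + s / 2) (y + s / 2) (s / 2) -> P x y s.
Hypothesis Ploc : forall a b, x0 <= a <= x0 + s0 -> y0 <= b <= y0 + s0 ->
  exists2 d, 0 < d & forall x y s, 0 < s < d ->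
    x0 <= x -> x + s <= x0 + s0 -> y0 <= y -> y + s <= y0 + s0 ->
    x <= a <= x + s -> y <= b <= y + s -> P x y s.

(** If [P] failed, one could go on choosing a failing quarter; the nested squares shrink to a point,
    and near that point [Ploc] says that [P] holds. All compactness arguments on segments, squares
    and circles are reduced to this one. *)
Lemma bisection : P x0 y0 s0.
Proof.
apply: contrapT => nP.
pose good (q : R * R * R) := [/\ 0 < q.2, ~ P q.1.1 q.1.2 q.2, 
  x0 <= q.1.1 /\ q.1.1 + q.2 <= x0 + s0 & y0 <= q.1.2 /\ q.1.2 + q.2 <= y0 + s0].
pose next (q q' : R * R * R) := [/\ good q', q'.2 = q.2 / 2,
  q.1.1 <= q'.1.1 /\ q'.1.1 + q'.2 <= q.1.1 + q.2 &
  q.1.2 <= q'.1.2 /\ q'.1.2 + q'.2 <= q.1.2 + q.2].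
have step q : good q -> exists q', next q q'.
  case: q => [[x y] s] /= [/= s_gt0 nPq [xx1 xx2] [yy1 yy2]]; apply: contrapT => H.
  have s2 : 0 < s / 2 by rewrite divr_gt0.
  by apply: nPq; apply: Psplit => //; apply: contrapT => nQ; apply: H;
    [exists (x, y, s / 2)|exists (x + s / 2, y, s / 2)|
     exists (x, y + s / 2, s / 2)|exists (x + s / 2, y + s / 2, s / 2)];
    split => //=; do ?split => //=; lra.
pose nxt q := xget q [set q' | next q q'].
have nxtP q : good q -> next q (nxt q).
  by move=> /step [q' Hq']; rewrite /nxt; case: xgetP => [? _ //|/(_ q')].
pose S n := iter n nxt (x0, y0, s0).
have SG n : good (S n).
  elim: n => [|n IH]; last by have [] := nxtP _ IH.
  by split => //=; split; lra.
have SN n : next (S n) (S n.+1) by exact: nxtP.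
have Ss n : (S n).2 = s0 / 2 ^+ n.
  elim: n => [|n IH]; first by rewrite expr0 divr1.
  by have [_ -> _ _] := SN n; rewrite IH exprSr invfM mulrA.
have mono (f : R * R * R -> R) :
    (forall n, f (S n) <= f (S n.+1) /\ f (S n.+1) + (S n.+1).2 <= f (S n) + (S n).2) ->
    exists a, forall n, f (S n) <= a <= f (S n) + (S n).2.
  move=> Hf.
  have H1 n m : f (S n) <= f (S (n + m)%N).
    elim: m => [|m IH]; first by rewrite addn0.
    by rewrite addnS; apply: le_trans IH _; have [] := Hf (n + m)%N.
  have H2 n m : f (S (n + m)%N) + (S (n + m)%N).2 <= f (S n) + (S n).2.
    elim: m => [|m IH]; first by rewrite addn0.
    by rewrite addnS; apply: le_trans IH; have [] := Hf (n + m)%N.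
  have H n m : f (S m) <= f (S n) + (S n).2.
    apply: le_trans (H1 m n) _; rewrite addnC; apply: le_trans (H2 n m).
    by rewrite lerDl ltW //; have [] := SG (n + m)%N.
  (* The lower corners increase and stay below every upper corner, so their supremum lies in all the
     intervals. *)
  exists (sup (range (fun n => f (S n)))) => n; apply/andP; split.
    apply: ub_le_sup; last by exists n.
    by exists (f (S 0%N) + (S 0%N).2) => _ [m _ <-].
  by apply: ge_sup; [exists (f (S 0%N)); exists 0%N|move=> _ [m _ <-]].
have [a Ha] : exists a, forall n, (S n).1.1 <= a <= (S n).1.1 + (S n).2.
  by apply: (mono (fun q => q.1.1)) => n; have [] := SN n.
have [b Hb] : exists b, forall n, (S n).1.2 <= b <= (S n).1.2 + (S n).2.
  by apply: (mono (fun q => q.1.2)) => n; have [] := SN n.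
have [d d0 dH] := Ploc (Ha 0%N) (Hb 0%N).
have [n Hn] : exists n, s0 / 2 ^+ n < d.
  have := archi_boundP (ltW (divr_gt0 s0_gt0 d0)); set n := Num.bound _ => Hn.
  exists n; rewrite ltr_pdivrMr ?exprn_gt0// mulrC -ltr_pdivrMr//.
  apply: lt_le_trans Hn _; rewrite -natrX ler_nat; exact/ltnW/ltn_expl.
have [g1 g2 [g3 g4] [g5 g6]] := SG n; apply: g2; apply: dH => //.
by rewrite g1 Ss.
Qed.

End Bisection.

(** * Continuity by epsilon and delta *)

Section Continuity.
Context {R : realType}.
Local Notation C := R[i].

Definition gcont (T : zmodType) (N : T -> R) (f : T -> C) (x : T) : Prop :=
  forall e, 0 < e -> exists2 d : R, 0 < d &
    forall h, N h < d -> cabs (f (x + h) - f x) <= e.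

Definition ccont (g : R -> C) : Prop := forall t, gcont (@Num.norm R R) g t.
Definition zcont (f : C -> C) (z : C) : Prop := gcont cabs f z.

Lemma zcontP f z : zcont f z <-> forall e, 0 < e -> exists2 d : R, 0 < d &
    forall w, cabs (w - z) < d -> cabs (f w - f z) <= e.
Proof.
split=> H e e0; have [d d0 dH] := H e e0; exists d => // h hd.
  by have := dH _ hd; rewrite [z + _]addrC subrK.
by apply: dH; rewrite addrC addKr.
Qed.

Lemma ccontP g : ccont g <-> forall t e, 0 < e -> exists2 d : R, 0 < d &
    forall s : R, `|s - t| < d -> cabs (g s - g t) <= e.
Proof.
split=> H t e e0; have [d d0 dH] := H t e e0; exists d => // h hd.
  by have := dH _ hd; rewrite [t + _]addrC subrK.
by apply: dH; rewrite addrC addKr.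
Qed.

Section General.
Variables (T : zmodType) (N : T -> R).
Implicit Types (f g : T -> C) (x : T).

Lemma gcont_cst (a : C) x : gcont N (fun=> a) x.
Proof. by move=> e e0; exists 1 => // h _; rewrite subrr cabs0 ltW. Qed.

Lemma gcontD f g x : gcont N f x -> gcont N g x ->
  gcont N (fun t => f t + g t) x.
Proof.
move=> Hf Hg e e0.
have [d1 d10 {}Hf] := Hf _ (divr_gt0 e0 (ltr0Sn _ 1)).
have [d2 d20 {}Hg] := Hg _ (divr_gt0 e0 (ltr0Sn _ 1)).
exists (Num.min d1 d2); first by rewrite lt_min d10.
move=> h; rewrite lt_min => /andP[/Hf {}Hf /Hg {}Hg].
have -> : f (x + h) + g (x + h) - (f x + g x) =
  (f (x + h) - f x) + (g (x + h) - g x) by ring.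
apply: le_trans (cabsD _ _) _; lra.
Qed.

Lemma gcont_comp (F : C -> C) f x : zcont F (f x) -> gcont N f x ->
  gcont N (fun t => F (f t)) x.
Proof.
move=> /zcontP HF Hf e e0; have [d1 d10 {}HF] := HF _ e0.
have [d2 d20 {}Hf] := Hf _ (divr_gt0 d10 (ltr0Sn _ 1)).
exists d2 => // h /Hf Hh; apply: HF; apply: le_lt_trans Hh _.
lra.
Qed.

Lemma gcontM f g x : gcont N f x -> gcont N g x ->
  gcont N (fun t => f t * g t) x.
Proof.
move=> Hf Hg e e0.
pose K := cabs (f x) + cabs (g x) + 1.
have f0 := cabs_ge0 (f x); have g0 := cabs_ge0 (g x).
have K0 : 0 < K by rewrite /K; lra.
pose e1 := Num.min 1 (e / (2 * K)).
have e10 : 0 < e1 by rewrite lt_min ltr01 divr_gt0// mulr_gt0.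
have [d1 d10 {}Hf] := Hf _ e10.
have [d2 d20 {}Hg] := Hg _ e10.
exists (Num.min d1 d2); first by rewrite lt_min d10.
move=> h; rewrite lt_min => /andP[/Hf {}Hf /Hg {}Hg].
have -> : f (x + h) * g (x + h) - f x * g x =
  (f (x + h) - f x) * g (x + h) + f x * (g (x + h) - g x) by ring.
have e11 : e1 <= 1 by rewrite ge_min lexx.
have e1e : e1 * (2 * K) <= e by rewrite -ler_pdivlMr ?mulr_gt0// ge_min lexx orbT.
have gb : cabs (g (x + h)) <= K.
  by have := cabsD (g (x + h) - g x) (g x); rewrite subrK /K; lra.
apply: le_trans (cabsD _ _) _; rewrite !cabsM.
have a1 : cabs (f (x + h) - f x) * cabs (g (x + h)) <= e1 * K.
  by apply: ler_pM; rewrite ?cabs_ge0.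
have a2 : cabs (f x) * cabs (g (x + h) - g x) <= K * e1.
  by apply: ler_pM; rewrite ?cabs_ge0// /K; lra.
lra.
Qed.

Lemma gdiff_cont f L x M : (forall h, 0 <= N h) ->
  (forall h, cabs (L h) <= M * N h) -> gdiff N f L x -> gcont N f x.
Proof. by move=> N0 LM Hf e e0; exact: gdiff_near Hf _ e0. Qed.

Lemma eq_gcont f g x : (forall t, f t = g t) -> gcont N f x -> gcont N g x.
Proof.
by move=> fg H e e0; have [d d0 dH] := H e e0; exists d => // h; rewrite -!fg;
  exact: dH.
Qed.

End General.

Lemma hasD_zcont f z d : hasD f z d -> zcont f z.
Proof. by move=> Hf; exact: (gdiff_cont cabs_ge0 (hasD_bound d) Hf). Qed.

Lemma wdiff_zcont f z A A' : wdiff f z A A' -> zcont f z.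
Proof. by move=> Hf; exact: (gdiff_cont cabs_ge0 (@wdiff_bound _ A A') Hf). Qed.

Lemma cdiff_cont c t v : cdiff c t v -> gcont (@Num.norm R R) c t.
Proof. by move=> Hf; exact: (gdiff_cont (@normr_ge0 _ _) (cdiff_bound v) Hf). Qed.

Lemma ccont_cdiff (c v : R -> C) : (forall t, cdiff c t (v t)) -> ccont c.
Proof. by move=> H t; exact: cdiff_cont (H t). Qed.

Lemma ccont_cst a : ccont (fun=> a).
Proof. by move=> t; exact: gcont_cst. Qed.
Lemma ccontD f g : ccont f -> ccont g -> ccont (fun t => f t + g t).
Proof. by move=> Hf Hg t; exact: gcontD. Qed.
Lemma ccontM f g : ccont f -> ccont g -> ccont (fun t => f t * g t).
Proof. by move=> Hf Hg t; exact: gcontM. Qed.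
Lemma ccontZ a g : ccont g -> ccont (fun t => a * g t).
Proof. by move=> Hg; apply: ccontM => //; exact: ccont_cst. Qed.
Lemma ccontN g : ccont g -> ccont (fun t => - g t).
Proof.
by move=> /(ccontZ (-1)) Hg t; apply: eq_gcont (Hg t) => s; rewrite mulN1r.
Qed.
Lemma ccontB f g : ccont f -> ccont g -> ccont (fun t => f t - g t).
Proof. by move=> Hf Hg; apply: ccontD => //; exact: ccontN. Qed.
Lemma ccont_comp F g : (forall t, zcont F (g t)) -> ccont g ->
  ccont (fun t => F (g t)).
Proof. by move=> HF Hg t; apply: gcont_comp. Qed.
Lemma eq_ccont f g : (forall t, f t = g t) -> ccont f -> ccont g.
Proof. by move=> fg Hf t; exact: eq_gcont (Hf t). Qed.

Lemma ccont_parts g : ccont g <-> continuous (fun t => complex.Re (g t)) /\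
  continuous (fun t => complex.Im (g t)).
Proof.
split.
  move=> /ccontP H; split=> t A /nbhsRP[e e0 eA]; apply/nbhsRP;
    have [d d0 dH] := H t _ (divr_gt0 e0 (ltr0Sn _ 1));
    exists d => // s /dH sd; apply: eA; rewrite -?ReB -?ImB.
    by apply: le_lt_trans (Re_le_cabs _) _; lra.
  by apply: le_lt_trans (Im_le_cabs _) _; lra.
move=> [H1 H2]; apply/ccontP => t e e0.
have e20 := divr_gt0 e0 (ltr0Sn R 1).
have /nbhsRP[d1 d10 {}H1] : nbhs t ((fun t => complex.Re (g t)) @^-1`
    (fun y : R => `|y - complex.Re (g t)| < e / 2)).
  by apply: H1; apply/nbhsRP; exists (e / 2).
have /nbhsRP[d2 d20 {}H2] : nbhs t ((fun t => complex.Im (g t)) @^-1`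
    (fun y : R => `|y - complex.Im (g t)| < e / 2)).
  by apply: H2; apply/nbhsRP; exists (e / 2).
exists (Num.min d1 d2); first by rewrite lt_min d10.
move=> s; rewrite lt_min => /andP[/H1 /= {}H1 /H2 /= {}H2].
by apply: le_trans (cabs_le _) _; rewrite ReB ImB; lra.
Qed.

End Continuity.

(** * Primitives and oriented integrals of continuous functions of a real variable *)

Section Primitives.
Context {R : realType}.
Local Notation C := R[i].

Lemma real_primitive_itv (g : R -> R) (n : R) : 0 < n -> continuous g ->
  exists G : R -> R, forall t : R, `|t| < n -> is_derive t 1 G (g t).
Proof.
move=> n0 cg; exists (fun x => \int[lebesgue_measure]_(t in `[- n, x]) g t) => t.
rewrite ltr_norml => /andP[t1 t2].
have [||D1 D2] := @continuous_FTC1_closed _ g (- n) t n t2 _ t1.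
- apply: continuous_compact_integrable; first exact: segment_compact.
  exact: continuous_subspaceT.
- exact: cg.
by split => //; rewrite -derive1E.
Qed.

(** The primitives on the intervals (-n, n), normalised to vanish at 0, agree wherever two of them
    are defined, and so glue. *)
Lemma real_primitive (g : R -> R) : continuous g ->
  exists G : R -> R, forall t : R, is_derive t 1 G (g t).
Proof.
move=> cg.
pose Gn (n : nat) := xget (fun=> 0) [set G : R -> R |
  (forall t : R, `|t| < n%:R -> is_derive t 1 G (g t)) /\ G 0 = 0].
have GnP (n : nat) : (0 < n)%N ->
    (forall t : R, `|t| < n%:R -> is_derive t 1 (Gn n) (g t)) /\ Gn n 0 = 0.
  move=> n0; rewrite /Gn; case: xgetP => [? _ //|].
  have [|G HG] := @real_primitive_itv g n%:R _ cg; first by rewrite ltr0n.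
  move=> /(_ (fun t => G t - G 0)) []; split; last by rewrite subrr.
  move=> t /HG ?; rewrite -[g t]subr0.
  exact: is_deriveB.
pose G t := Gn (Num.bound `|t|) t.
have bd (t : R) : `|t| < (Num.bound `|t|)%:R by exact: archi_boundP.
have GE n t : `|t| < n%:R -> G t = Gn n t.
  move=> tn; rewrite /G; move: (Num.bound _) (bd t) => m tm.
  have m0 : (0 < m)%N by rewrite -(ltr_nat R); apply: le_lt_trans tm; exact: normr_ge0.
  have n0 : (0 < n)%N by rewrite -(ltr_nat R); apply: le_lt_trans tn; exact: normr_ge0.
  have [Hm m00] := GnP _ m0; have [Hn n00] := GnP _ n0.
  have D (s : R) : `|s| <= `|t| -> cdiff (fun s => rc (Gn m s) - rc (Gn n s)) s 0.
    move=> st; rewrite -[X in cdiff _ _ X](subrr (rc (g s))); apply: cdiffB.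
      by apply/is_derive_cdiff/Hm; exact: le_lt_trans tm.
    by apply/is_derive_cdiff/Hn; exact: le_lt_trans tn.
  have E : rc (Gn m 0) - rc (Gn n 0) = rc (Gn m t) - rc (Gn n t).
    have [t0|t0] := leP 0 t.
      apply: (@cdiff0_cst _ (fun s => rc (Gn m s) - rc (Gn n s))) => // s /andP[? ?].
      by apply: D; rewrite !ger0_norm.
    symmetry; apply: (@cdiff0_cst _ (fun s => rc (Gn m s) - rc (Gn n s))) => //.
      exact: ltW.
    by move=> s /andP[? ?]; apply: D; rewrite !ler0_norm ?lerN2// ltW.
  move: E; rewrite m00 n00 subrr => /esym /subr0_eq; exact: complexI.
exists G => t; apply/is_derive_cdiff.
have [n tn] : exists n : nat, `|t| + 1 < n%:R.
  by exists (Num.bound (`|t| + 1)); apply: archi_boundP; rewrite addr_ge0.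
have n0 : (0 < n)%N by rewrite -(ltr_nat R); apply: le_lt_trans tn; exact: addr_ge0.
have [Hn _] := GnP _ n0.
have tn' : `|t| < n%:R by apply: lt_trans tn; rewrite ltrDl.
apply: (near_gdiff (f := fun s => rc (Gn n s)) (d := 1)) => //.
- move=> h h1; rewrite -GE//; apply: le_lt_trans (ler_normD _ _) _.
  by apply: lt_trans tn; rewrite ltrD2l.
- by rewrite -GE.
- by apply/is_derive_cdiff; exact: Hn.
Qed.

Lemma primitive_exists (g : R -> C) : ccont g ->
  exists G : R -> C, forall t, cdiff G t (g t).
Proof.
move=> /ccont_parts[/real_primitive[G1 H1] /real_primitive[G2 H2]].
exists (fun t => Complex (G1 t) (G2 t)) => t; apply/cdiff_parts; split.
  exact: H1.
exact: H2.
Qed.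

Definition prim (g : R -> C) : R -> C :=
  xget (fun=> 0) [set G : R -> C | forall t, cdiff G t (g t)].

Lemma primP g : ccont g -> forall t, cdiff (prim g) t (g t).
Proof.
move=> /primitive_exists[G HG]; rewrite /prim; case: xgetP => [? _ //|/(_ G)].
by [].
Qed.

(** The oriented integral as a difference of values of one primitive: the bounds may come in any
    order, additivity in the bounds is algebra, and every other rule is the fundamental theorem. *)
Definition sint (a b : R) (g : R -> C) : C := prim g b - prim g a.

Lemma sint_rev a b g : sint b a g = - sint a b g.
Proof. by rewrite /sint opprB. Qed.

Lemma sint_ftc_itv a b (g G : R -> C) : a <= b -> ccont g ->
  (forall t, a <= t <= b -> cdiff G t (g t)) -> sint a b g = G b - G a.
Proof.
move=> ab cg HG; have := @cdiff0_cst _ (fun t => prim g t - G t) a b ab.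
rewrite /sint => H; have {}H := H _.
have E : prim g a - G a = prim g b - G b.
  apply: H => t t01; rewrite -(subrr (g t)).
  by apply: cdiffB; [exact: primP|exact: HG].
by rewrite -(subrK (G a) (prim g a)) E; ring.
Qed.

Lemma sint_ftc a b (g G : R -> C) : ccont g ->
  (forall t, cdiff G t (g t)) -> sint a b g = G b - G a.
Proof.
move=> cg HG; have [ab|ba] := leP a b; first exact: sint_ftc_itv.
by rewrite sint_rev (@sint_ftc_itv b a g G) ?opprB ?ltW.
Qed.

Lemma sintD a b f g : ccont f -> ccont g ->
  sint a b (fun t => f t + g t) = sint a b f + sint a b g.
Proof.
move=> cf cg; rewrite (@sint_ftc a b _ (fun t => prim f t + prim g t)).
- by rewrite /sint; ring.
- exact: ccontD.
- by move=> t; apply: cdiffD; exact: primP.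
Qed.

Lemma sintZ a b k g : ccont g -> sint a b (fun t => k * g t) = k * sint a b g.
Proof.
move=> cg; rewrite (@sint_ftc a b _ (fun t => k * prim g t)).
- by rewrite /sint; ring.
- exact: ccontZ.
- by move=> t; apply: cdiffZ; exact: primP.
Qed.

Lemma sintB a b f g : ccont f -> ccont g ->
  sint a b (fun t => f t - g t) = sint a b f - sint a b g.
Proof.
move=> cf cg; rewrite (@sint_ftc a b _ (fun t => prim f t - prim g t)).
- by rewrite /sint; ring.
- exact: ccontB.
- by move=> t; apply: cdiffB; exact: primP.
Qed.

Lemma sint_conj a b g : ccont g ->
  sint a b (fun t => (g t)^*%C) = (sint a b g)^*%C.
Proof.
move=> cg; rewrite (@sint_ftc a b _ (fun t => (prim g t)^*%C)).
- by rewrite /sint rmorphB.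
- by apply: ccont_comp => // t; exact: wdiff_zcont (wdiff_conj _).
- move=> t; have := wdiff_curve (wdiff_conj (prim g t)) (primP cg t).
  by rewrite mul0r add0r mul1r.
Qed.

Lemma sint_cst a b k : sint a b (fun=> k) = rc (b - a) * k.
Proof.
rewrite (@sint_ftc a b _ (fun t => 0 + rc t * k)).
- by rewrite rmorphB; ring.
- exact: ccont_cst.
- by move=> t; exact: cdiff_line.
Qed.

Lemma sint_id a b : sint a b rc = rc ((b ^+ 2 - a ^+ 2) / 2).
Proof.
have D (t : R) : cdiff rc t 1.
  by apply: eq_cdiff (cdiff_line 0 1 t) => // s; rewrite add0r mulr1.
rewrite (@sint_ftc a b _ (fun t => 2^-1 * (rc t * rc t))).
- by rewrite !(rmorphM, rmorphB, rmorphXn) fmorphV rmorphD rmorph1 /=; field.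
- by apply: (@ccont_cdiff _ _ (fun=> 1)) => t; exact: D.
- move=> t; have H := cdiffZ 2^-1 (cdiffM (D t) (D t)); apply: (eq_cdiff _ _ H) => //.
  by field.
Qed.

Lemma sint_le a b g M : a <= b -> ccont g ->
  (forall t, a <= t <= b -> cabs (g t) <= M) -> cabs (sint a b g) <= M * (b - a).
Proof. by move=> ab cg; apply: mean_value_le => // t _; exact: primP. Qed.

Lemma eq_sint a b f g : (forall t, f t = g t) -> sint a b f = sint a b g.
Proof. by move=> /funext ->. Qed.

Lemma sint_affine a b (x k : R) g : ccont g ->
  sint a b (fun t => rc k * g (x + k * t)) = sint (x + k * a) (x + k * b) g.
Proof.
move=> cg; rewrite (@sint_ftc a b _ (fun t => prim g (x + k * t))) //.
  apply: ccontZ => t.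
  have cl : ccont (fun s => rc (x + k * s)).
    apply: (@ccont_cdiff _ _ (fun=> rc k)) => s.
    apply: eq_cdiff (cdiff_line (rc x) (rc k) s) => // u.
    by rewrite rmorphD rmorphM; ring.
  have gr (z : R) : zcont (fun z => g (complex.Re z)) (rc z).
    apply/zcontP => e e0; have [d d0 dH] := (ccontP _).1 cg z e e0.
    exists d => // w wd; apply: dH.
    by rewrite -[z]/(complex.Re (rc z)) -ReB (le_lt_trans (Re_le_cabs _)).
  have H := gcont_comp (f := fun s => rc (x + k * s)) (gr (x + k * t)) (cl t); by apply: eq_gcont H.
by move=> t; apply: cdiff_affine; exact: primP.
Qed.

(** The fundamental theorem of calculus links the Lebesgue integrals in the statement to differences
    of primitives. *)
Lemma cint_sint a b g : a <= b -> ccont g -> cint a b g = sint a b g.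
Proof.
rewrite le_eqVlt => /predU1P[<- _|ab cg].
  by rewrite /cint /sint set_itv1 !Rintegral_set1 subrr.
have /ccont_parts [c1 c2] := cg.
have D (t : R) : is_derive t 1 (fun t => complex.Re (prim g t)) (complex.Re (g t)) /\
    is_derive t 1 (fun t => complex.Im (prim g t)) (complex.Im (g t)).
  exact/cdiff_parts/primP.
have FTC (f F : R -> R) : continuous f -> (forall t : R, is_derive t 1 F (f t)) ->
    \int[lebesgue_measure]_(t in `[a, b]) f t = F b - F a.
  move=> cf HF; rewrite /Rintegral (@continuous_FTC2 _ _ F a b ab) //.
  - exact: continuous_subspaceT.
  - have cF (t : R) : {for t, continuous F}.
      by apply: differentiable_continuous; apply/derivable1_diffP; have [] := HF t.
    split=> [t _||]; first by have [] := HF t.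
    + by apply: cvg_at_right_filter; exact: cF.
    + by apply: cvg_at_left_filter; exact: cF.
  - by move=> t _; rewrite derive1E; have [_ ->] := HF t.
rewrite /cint /sint; apply: complex_ext; rewrite ?ReB ?ImB /=.
  by apply: (FTC _ (fun t => complex.Re (prim g t)) c1) => t; have [] := D t.
by apply: (FTC _ (fun t => complex.Im (prim g t)) c2) => t; have [] := D t.
Qed.

Lemma eq_cint (a b : R) (f g : R -> C) : (forall t, a <= t <= b -> f t = g t) ->
  cint a b f = cint a b g.
Proof.
by move=> fg; rewrite /cint; congr Complex; apply: eq_Rintegral => t;
  rewrite inE /= in_itv /= => /fg ->.
Qed.

(** Differentiation under the integral sign: a remainder that is uniform in t is integrated, at the
    cost of a factor b - a. *)
Lemma udiff_sint (T : zmodType) (N : T -> R) (f L : R -> T -> C) (x : T) a b r :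
  a <= b -> (forall h, 0 <= N h) -> N 0 = 0 -> 0 < r ->
  (forall h, N h < r -> ccont (fun t => f t (x + h))) ->
  (forall h, ccont (fun t => L t h)) ->
  udiff N [set t | a <= t <= b] f L x ->
  gdiff N (fun y => sint a b (fun t => f t y)) (fun h => sint a b (fun t => L t h)) x.
Proof.
move=> ab N0 N00 r0 cf cL H; apply/gdiffP => e e0.
pose K := b - a + 1; have K0 : 0 < K by rewrite /K; lra.
have [d d0 dH] := H _ (divr_gt0 e0 K0).
exists (Num.min d r) => [|h]; first by rewrite lt_min d0.
rewrite lt_min => /andP[hd hr].
have c0 : ccont (fun t => f t x) by have := cf 0; rewrite addr0 N00; exact.
have c1 := cf _ hr.
rewrite -sintB// -sintB//; last exact: ccontB.
apply: le_trans (sint_le (M := e / K * N h) ab _ _) _.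
- by apply: ccontB => //; exact: ccontB.
- by move=> t tab; exact: dH.
have -> : e * N h = e / K * N h * K by field; rewrite gt_eqF.
apply: ler_wpM2l; last by rewrite /K; lra.
by rewrite mulr_ge0 ?N0 ?divr_ge0 // ltW.
Qed.

Lemma udiff_sint_hasD (f : R -> C -> C) (A : R -> C) (x : C) a b r :
  a <= b -> 0 < r ->
  (forall h, cabs h < r -> ccont (fun t => f t (x + h))) -> ccont A ->
  udiff cabs [set t | a <= t <= b] f (fun t h => A t * h) x ->
  hasD (fun y => sint a b (fun t => f t y)) x (sint a b A).
Proof.
move=> ab r0 cf cA H.
have := udiff_sint ab cabs_ge0 (cabs0 (R := R)) r0 cf _ H.
have cl h : ccont (fun t => A t * h) by apply: ccontM => //; exact: ccont_cst.
move=> /(_ cl); apply: eq_gdiff => // h.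
by under eq_sint do rewrite mulrC; rewrite sintZ// mulrC.
Qed.

Lemma udiff_sint_wdiff (f : R -> C -> C) (A A' : R -> C) (x : C) a b r :
  a <= b -> 0 < r ->
  (forall h, cabs h < r -> ccont (fun t => f t (x + h))) -> ccont A -> ccont A' ->
  udiff cabs [set t | a <= t <= b] f (fun t h => A t * h + A' t * h^*%C) x ->
  wdiff (fun y => sint a b (fun t => f t y)) x (sint a b A) (sint a b A').
Proof.
move=> ab r0 cf cA cA' H.
have cl (h : C) (B : R -> C) : ccont B -> ccont (fun t => B t * h).
  by move=> ?; apply: ccontM => //; exact: ccont_cst.
have := udiff_sint ab cabs_ge0 (cabs0 (R := R)) r0 cf _ H.
move=> /(_ (fun h => ccontD (cl h A cA) (cl h^*%C A' cA'))); apply: eq_gdiff => // h.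
rewrite sintD; [|exact: cl|exact: cl].
by congr (_ + _); under eq_sint do rewrite mulrC; rewrite sintZ// mulrC.
Qed.

Lemma udiff_sint_cdiff (f : R -> R -> C) (A : R -> C) (x : R) a b r :
  a <= b -> 0 < r ->
  (forall h : R, `|h| < r -> ccont (fun t => f t (x + h))) -> ccont A ->
  udiff (@Num.norm R R) [set t | a <= t <= b] f (fun t h => rc h * A t) x ->
  cdiff (fun y => sint a b (fun t => f t y)) x (sint a b A).
Proof.
move=> ab r0 cf cA H.
have := udiff_sint ab (@normr_ge0 _ _) (normr0 R) r0 cf _ H.
have cl (h : R) : ccont (fun t => rc h * A t) by exact: ccontZ.
move=> /(_ cl); apply: eq_gdiff => // h.
by rewrite sintZ.
Qed.

End Primitives.

(** * The unit circle parametrised by the angle *)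

Section Circle.
Context {R : realType}.
Local Notation C := R[i].

Lemma expi0 : expi (0 : R) = 1.
Proof. by rewrite /expi cos0 sin0. Qed.

Lemma expiD (s t : R) : expi (s + t) = expi s * expi t.
Proof. by rewrite /expi cosD sinD; simpc; congr Complex; rewrite addrC. Qed.

Lemma expiN (t : R) : expi (- t) = (expi t)^*%C.
Proof. by rewrite /expi cosN sinN. Qed.

Lemma expi2pi : expi (2 * pi) = 1 :> C.
Proof.
have -> : 2 * pi = pi + pi :> R by ring.
by rewrite expiD /expi cospi sinpi; simpc; rewrite complexr0.
Qed.

Lemma expipi2 : expi (pi / 2) = iC :> C.
Proof. by rewrite /expi cos_pihalf sin_pihalf. Qed.

Lemma cabs_expi (t : R) : cabs (expi t) = 1.
Proof. by rewrite /= /ComplexField.Normc.normc /expi cos2Dsin2 sqrtr1. Qed.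

Lemma expiVN (t : R) : expi t * expi (- t) = 1 :> C.
Proof. by rewrite -expiD subrr expi0. Qed.

Lemma cdiff_expi (t : R) : cdiff expi t (iC * expi t).
Proof.
apply/cdiff_parts; rewrite /expi; simpc; rewrite /=.
by split; [exact: is_derive_cos|exact: is_derive_sin].
Qed.

Lemma cdiff_expiN (t : R) : cdiff (fun s => expi (- s)) t (- iC * expi (- t)).
Proof.
have H := wdiff_curve (wdiff_conj (expi t)) (cdiff_expi t).
apply: eq_cdiff H => [s|]; first by rewrite expiN.
by rewrite expiN mul0r add0r mul1r rmorphM; congr (_ * _); simpc.
Qed.

Lemma ccont_expi : ccont (@expi R).
Proof. exact: ccont_cdiff cdiff_expi. Qed.

Lemma ccont_expiN : ccont (fun t : R => expi (- t)).
Proof. exact: ccont_cdiff cdiff_expiN. Qed.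

Lemma pi2_ge0 : 0 <= 2 * pi :> R.
Proof. by rewrite mulr_ge0// pi_ge0. Qed.

Lemma pi2_gt0 : 0 < 2 * pi :> R.
Proof. by rewrite mulr_gt0// pi_gt0. Qed.

Lemma ccont_circle (z : C) (u : C) : ccont (fun t => z + u * expi t).
Proof. by apply: ccontD; [exact: ccont_cst|apply: ccontZ; exact: ccont_expi]. Qed.

End Circle.

(** * Uniform estimates along compact arcs *)

Section UniformAlongCurves.
Context {R : realType}.
Local Notation C := R[i].

(** A Lebesgue number for the segment: one radius serves all its points. The second coordinate of
    the squares in [bisection] is idle here. *)
Lemma compact_seg (Q : R -> R -> Prop) (a b : R) : a <= b ->
  (forall t d d', 0 < d' <= d -> Q t d -> Q t d') ->
  (forall t, a <= t <= b -> exists2 d, 0 < d &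
     forall s, `|s - t| < d -> Q s d) ->
  exists2 d, 0 < d & forall t, a <= t <= b -> Q t d.
Proof.
move=> ab Qm Ql.
(* Since a = b is allowed, the segment is prolonged by 1 to have positive length; what happens
   beyond b is made vacuous by the condition s <= b. *)
have ab1 : 0 < b - a + 1 by lra.
have Ql' t : a <= t <= b + 1 -> exists2 d, 0 < d &
     forall s, `|s - t| < d -> s <= b -> Q s d.
  move=> /andP[at1 tb1]; have [tb|tb] := leP t b.
    by have [|d d0 dH] := Ql t; [lra|exists d => // s /dH].
  exists (t - b); first by lra.
  by move=> s; rewrite ltr_norml => /andP[s1 s2] sb; lra.
have [||d d0 dH] := @bisection _ (fun x _ s => exists2 d, 0 < d &
  forall t, x <= t <= x + s -> t <= b -> Q t d) a 0 (b - a + 1) ab1.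
- move=> x y s s0 _ _ _ _ [d1 d10 H1] [d2 d20 H2] _ _.
  exists (Num.min d1 d2); first by rewrite lt_min d10.
  move=> t /andP[t1 t2] tb; have [ts|ts] := leP t (x + s / 2).
    by apply: (Qm t d1); [rewrite lt_min d10 d20 ge_min lexx|apply: H1 => //; lra].
  by apply: (Qm t d2); [rewrite lt_min d10 d20 ge_min lexx orbT|apply: H2 => //; lra].
- move=> t y tab _; have [|d d0 dH] := Ql' t; first by lra.
  exists d => // x _ s /andP[s0 sd] _ _ _ _ /andP[t1 t2] _; exists d => // u u1.
  by apply: dH; rewrite ltr_norml; lra.
by exists d => // t tab; apply: dH; lra.
Qed.

(** The mean value inequality for v -> f v - f' w v, whose derivative is small near z because f' is
    continuous there. The base point w may then vary with the increment. *)
Lemma strict_diff (U : set C) (f f' : C -> C) z : open U -> U z ->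
  (forall w, U w -> hasD f w (f' w)) -> zcont f' z ->
  forall e, 0 < e -> exists2 d : R, 0 < d & forall w, cabs (w - z) < d ->
    forall h, cabs h < d -> cabs (f (w + h) - f w - f' w * h) <= e * cabs h.
Proof.
move=> oU Uz Hf /zcontP cf' e e0; have [r r0 rU] := nbhsS oU Uz.
have [d d0 dH] := cf' _ (divr_gt0 e0 (ltr0Sn _ 1)).
have m0 : 0 < Num.min r d by rewrite lt_min r0.
exists (Num.min r d / 2) => [|w wz h hd]; first by rewrite divr_gt0.
have near (t : R) : 0 <= t <= 1 -> cabs (w + rc t * (w + h - w) - z) < Num.min r d.
  move=> /andP[t0 t1].
  have -> : w + rc t * (w + h - w) - z = (w - z) + rc t * h by ring.
  apply: le_lt_trans (cabsD _ _) _; rewrite cabsM cabs_real ger0_norm//.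
  have : t * cabs h <= cabs h by rewrite ler_piMl ?cabs_ge0.
  lra.
have := @segment_le _ (fun v => f v - f' w * v) (fun v => f' v - f' w) w (w + h) e.
have -> : f (w + h) - f' w * (w + h) - (f w - f' w * w) = f (w + h) - f w - f' w * h by ring.
have -> : w + h - w = h by ring.
apply=> t t01; have := near t t01.
all: rewrite (_ : w + h - w = h); last by ring.
all: rewrite lt_min => /andP[n1 n2].
  apply: hasDB; first exact/Hf/rU.
  by have := hasDZ (f' w) (hasD_id (w + rc t * h)); rewrite mulr1.
have E : f' (w + rc t * h) - f' w = (f' (w + rc t * h) - f' z) - (f' w - f' z) by ring.
rewrite E; apply: le_trans (cabsB _ _) _.
have := dH _ n2; have /dH : cabs (w - z) < d.
  by apply: lt_trans wz _; have : Num.min r d <= d by [rewrite ge_min lexx orbT]; lra.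
lra.
Qed.

Lemma curve_strict (U : set C) (f f' : C -> C) (c : R -> C) (a b : R) :
  a <= b -> open U -> ccont c -> (forall t, a <= t <= b -> U (c t)) ->
  (forall w, U w -> hasD f w (f' w) /\ zcont f' w) ->
  forall e, 0 < e -> exists2 d : R, 0 < d & forall t, a <= t <= b ->
    forall k, cabs k < d -> cabs (f (c t + k) - f (c t) - f' (c t) * k) <= e * cabs k.
Proof.
move=> ab oU /ccontP cc cU Hf e e0.
apply: (@compact_seg (fun t d => forall k, cabs k < d ->
  cabs (f (c t + k) - f (c t) - f' (c t) * k) <= e * cabs k)) => //.
  by move=> t d d' /andP[_ d'd] H k kd; apply: H; exact: lt_le_trans d'd.
move=> t /cU Ut; have [||d d0 dH] := strict_diff oU Ut (f := f) (f' := f') _ _ e0.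
- by move=> w /Hf[].
- by have [] := Hf _ Ut.
have [r r0 rH] := cc t _ (divr_gt0 d0 (ltr0Sn _ 1)).
exists (Num.min d r); first by rewrite lt_min d0.
move=> s; rewrite lt_min => /andP[_ /rH sr] k; rewrite lt_min => /andP[kd _].
by apply: dH => //; lra.
Qed.

Lemma curve_unif_cont (f : C -> C) (c : R -> C) (a b : R) :
  a <= b -> ccont c -> (forall t, a <= t <= b -> zcont f (c t)) ->
  forall e, 0 < e -> exists2 d : R, 0 < d & forall t, a <= t <= b ->
    forall k, cabs k < d -> cabs (f (c t + k) - f (c t)) <= e.
Proof.
move=> ab /ccontP cc cf e e0.
apply: (@compact_seg (fun t d => forall k, cabs k < d ->
  cabs (f (c t + k) - f (c t)) <= e)) => //.
  by move=> t d d' /andP[_ d'd] H k kd; apply: H; exact: lt_le_trans d'd.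
move=> t /cf /zcontP /(_ _ (divr_gt0 e0 (ltr0Sn _ 1)))[d d0 dH].
have d20 : 0 < d / 4 by rewrite divr_gt0.
have [r r0 rH] := cc t _ d20.
exists (Num.min (d / 4) r); first by rewrite lt_min d20.
move=> s; rewrite lt_min => /andP[_ /rH sr] k; rewrite lt_min => /andP[kd _].
have h1 := dH (c s + k); have h2 := dH (c s).
have {}h1 : cabs (f (c s + k) - f (c t)) <= e / 2.
  by apply: h1; rewrite addrAC; apply: le_lt_trans (cabsD _ _) _; lra.
have {}h2 : cabs (f (c s) - f (c t)) <= e / 2 by apply: h2; lra.
apply: le_trans (cabs_tri (f (c t)) _ _) _.
by rewrite [X in _ + X]cabs_sub; lra.
Qed.

End UniformAlongCurves.

(** * Goursat's theorem for rectangles *)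

Section Goursat.
Context {R : realType}.
Local Notation C := R[i].
Variables (F : C -> C) (S : set C).
Hypothesis cF : forall z, zcont F z.
Hypothesis dF : forall z, S z -> exists d, forall e, 0 < e ->
  exists2 r : R, 0 < r & forall w, S w -> cabs (w - z) < r ->
    cabs (F w - F z - d * (w - z)) <= e * cabs (w - z).

Definition hI (G : C -> C) (y a b : R) := sint a b (fun u => G (Complex u y)).
Definition vI (G : C -> C) (x a b : R) := sint a b (fun v => G (Complex x v)).
(** The integral of G dz along the boundary, counterclockwise if x1 < x2 and y1 < y2; the signs
    adapt to any order of the bounds. *)
Definition rect (G : C -> C) (x1 x2 y1 y2 : R) : C :=
  hI G y1 x1 x2 + iC * vI G x2 y1 y2 - hI G y2 x1 x2 - iC * vI G x1 y1 y2.

Lemma ccont_h (y : R) : ccont (fun u : R => Complex u y : C).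
Proof.
apply: (@ccont_cdiff _ _ (fun=> 1)) => t.
apply: eq_cdiff (cdiff_line (Complex 0 y) 1 t) => // s.
by rewrite mulr1; simpc.
Qed.

Lemma ccont_v (x : R) : ccont (fun v : R => Complex x v : C).
Proof.
apply: (@ccont_cdiff _ _ (fun=> iC)) => t.
apply: eq_cdiff (cdiff_line (rc x) iC t) => // s.
by rewrite -!complexr0; simpc.
Qed.

Lemma rect_split G x1 x2 x3 y1 y2 y3 : rect G x1 x3 y1 y3 =
  rect G x1 x2 y1 y2 + rect G x2 x3 y1 y2 + rect G x1 x2 y2 y3 + rect G x2 x3 y2 y3.
Proof. by rewrite /rect /hI /vI /sint; ring. Qed.

Lemma rectD G H x1 x2 y1 y2 : (forall z, zcont G z) -> (forall z, zcont H z) ->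
  rect (fun z => G z + H z) x1 x2 y1 y2 = rect G x1 x2 y1 y2 + rect H x1 x2 y1 y2.
Proof.
move=> cG cH; rewrite /rect /hI /vI.
have hc (G0 : C -> C) y : (forall z, zcont G0 z) -> ccont (fun u => G0 (Complex u y)).
  by move=> cG0; apply: ccont_comp => //; exact: ccont_h.
have vc (G0 : C -> C) x : (forall z, zcont G0 z) -> ccont (fun u => G0 (Complex x u)).
  by move=> cG0; apply: ccont_comp => //; exact: ccont_v.
rewrite !sintD; try exact: hc; try exact: vc; ring.
Qed.

Lemma rect_affine (p q : C) x1 x2 y1 y2 : rect (fun z => p + q * z) x1 x2 y1 y2 = 0.
Proof.
have hE y a b : hI (fun z => p + q * z) y a b =
    (p + q * iC * rc y) * rc (b - a) + q * rc ((b ^+ 2 - a ^+ 2) / 2).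
  rewrite /hI (@eq_sint _ a b _ (fun u => (p + q * iC * rc y) + q * rc u)); last first.
    move=> t; rewrite -addrA -mulrA -mulrDr; congr (_ + q * _).
    by rewrite -!complexr0; simpc.
  have cr : ccont (@real_complex_def R (Phant R)).
    apply: eq_ccont (ccont_h 0) => t; exact: complexr0.
  rewrite sintD; [|exact: ccont_cst|exact: ccontZ].
  by rewrite sint_cst sintZ// sint_id mulrC.
have vE x a b : vI (fun z => p + q * z) x a b =
    (p + q * rc x) * rc (b - a) + q * iC * rc ((b ^+ 2 - a ^+ 2) / 2).
  rewrite /vI (@eq_sint _ a b _ (fun u => (p + q * rc x) + q * iC * rc u)); last first.
    move=> t; rewrite -addrA -mulrA -mulrDr; congr (_ + q * _).
    by rewrite -!complexr0; simpc.
  have cr : ccont (@real_complex_def R (Phant R)).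
    apply: eq_ccont (ccont_h 0) => t; exact: complexr0.
  rewrite sintD; [|exact: ccont_cst|exact: ccontZ].
  by rewrite sint_cst sintZ// sint_id mulrC.
rewrite /rect !hE !vE.
have := @iCiC R; set i := Complex 0 1 => Hi.
have r2 (a : R) : rc (a / 2) = rc a / 2.
  by rewrite rmorphM fmorphV rmorphD rmorph1.
rewrite !r2 !rmorphB !rmorphXn /=.
transitivity (i * i * (- q * (rc y2 ^+ 2 - rc y1 ^+ 2) / 2 + q * (rc y2 ^+ 2 - rc y1 ^+ 2) / 2)
  + 0 : C).
  by field.
by ring.
Qed.

Lemma sint_le_gen (a b : R) (g : R -> C) M : ccont g ->
  (forall t, 0 <= t <= 1 -> cabs (g (a + (b - a) * t)) <= M) ->
  cabs (sint a b g) <= M * `|b - a|.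
Proof.
move=> cg HM; have := sint_affine 0 1 a (b - a) cg.
have -> : a + (b - a) * 0 = a by ring.
have -> : a + (b - a) * 1 = b by ring.
move=> <-.
have cg' : ccont (fun t => g (a + (b - a) * t)).
  apply/ccontP => t e e0.
  have [d d0 dH] := (ccontP _).1 cg (a + (b - a) * t) e e0.
  have K0 : 0 < `|b - a| + 1 by rewrite ltr_wpDl.
  exists (d / (`|b - a| + 1)) => [|s]; first by rewrite divr_gt0.
  rewrite ltr_pdivlMr// => sd; apply: dH.
  have -> : a + (b - a) * s - (a + (b - a) * t) = (b - a) * (s - t) by ring.
  rewrite normrM; apply: le_lt_trans sd; rewrite mulrC ler_wpM2l// lerDl.
  exact: ler01.
rewrite sintZ// cabsM cabs_real mulrC ler_wpM2r//.
by have := sint_le ler01 cg' HM; rewrite subr0 mulr1.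
Qed.

Hypothesis Sconv : forall p1 p2 x1 x2 y1 y2 : R,
  S (Complex x1 y1) -> S (Complex x2 y2) -> 0 <= p1 <= 1 -> 0 <= p2 <= 1 ->
  S (Complex (x1 + (x2 - x1) * p1) (y1 + (y2 - y1) * p2)).

(** Bisection of the unit square of parameters, with the bound e s^2 on the boundary integral. The
    bound is inherited from the quarters, as 4 e (s/2)^2 = e s^2; it holds on small squares because
    [F] is affine up to a small remainder and affine functions integrate to zero. *)
Lemma goursat (x1 x2 y1 y2 : R) : S (Complex x1 y1) -> S (Complex x2 y2) ->
  rect F x1 x2 y1 y2 = 0.
Proof.
move=> S1 S2; apply/eqP; rewrite -cabs_eq0 eq_le cabs_ge0 andbT.
apply/ler_addgt0Pr => e e0; rewrite add0r.
pose A := x2 - x1; pose B := y2 - y1.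
pose K := `|A| + `|B| + 1.
have K0 : 0 < K by rewrite ltr_wpDl// addr_ge0.
(* On a rectangle of scale s the remainder is at most e/(2 K^2) times K s, and the boundary has
   length at most 2 K s; the product is e s^2. *)
have e10 : 0 < e / (2 * K ^+ 2) by rewrite divr_gt0// mulr_gt0// exprn_gt0.
have := @bisection _ (fun x y s => cabs (rect F (x1 + A * x) (x1 + A * (x + s))
  (y1 + B * y) (y1 + B * (y + s))) <= e * s ^+ 2) 0 0 1 ltr01.
rewrite /= !add0r !mulr0 !addr0 !mulr1 expr1n mulr1 /A /B [x1 + _]addrC.
rewrite [y1 + _]addrC !subrK -/A -/B; apply.
- move=> x y s s0 _ _ _ _ H1 H2 H3 H4.
  rewrite (rect_split F _ (x1 + A * (x + s / 2)) _ _ (y1 + B * (y + s / 2))).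
  have E z : z + s = z + s / 2 + s / 2 by field.
  rewrite (E x) (E y).
  apply: le_trans (cabsD _ _) _; apply: le_trans (lerD (cabsD _ _) (lexx _)) _.
  apply: le_trans (lerD (lerD (cabsD _ _) (lexx _)) (lexx _)) _.
  move: H1 H2 H3 H4; have -> : e * s ^+ 2 = 4 * (e * (s / 2) ^+ 2) by field.
  lra.
move=> a b a01 b01; pose q : C := Complex (x1 + A * a) (y1 + B * b).
have Sq : S q by apply: Sconv => //; rewrite ?a01 ?b01 //; lra.
have [d Hd] := dF Sq; have [r r0 rH] := Hd _ e10.
exists (r / K) => [|x y s /andP[s0]]; first by rewrite divr_gt0.
rewrite ltr_pdivlMr// => sr x0 xs y0 ys xa yb.
pose r0F z := F z - F q - d * (z - q).
have cr z : zcont r0F z.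
  apply: (gcontD (f := fun z => F z - F q)).
    by apply: gcontD; [exact: cF|exact: gcont_cst].
  exact: hasD_zcont (hasDN (hasDZ d (hasDB (hasD_id z) (hasD_cst q z)))).
have -> : rect F = rect (fun z => r0F z + ((F q - d * q) + d * z)).
  by congr rect; apply/funext => z; rewrite /r0F; ring.
rewrite rectD//; last first.
  by move=> z; apply: hasD_zcont (hasDD (hasD_cst _ z) (hasDZ d (hasD_id z))).
rewrite rect_affine addr0.
have main x' y' : x <= x' <= x + s -> y <= y' <= y + s ->
    cabs (r0F (Complex (x1 + A * x') (y1 + B * y'))) <= e / (2 * K ^+ 2) * (K * s).
  move=> xx' yy'; set w := Complex _ _.
  have wq : cabs (w - q) <= K * s.
    apply: le_trans (cabs_le _) _; rewrite ReB ImB /=.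
    have -> : x1 + A * x' - (x1 + A * a) = A * (x' - a) by ring.
    have -> : y1 + B * y' - (y1 + B * b) = B * (y' - b) by ring.
    rewrite !normrM.
    have l1 : `|A| * `|x' - a| <= `|A| * s.
      by rewrite ler_wpM2l// ler_norml; lra.
    have l2 : `|B| * `|y' - b| <= `|B| * s.
      by rewrite ler_wpM2l// ler_norml; lra.
    rewrite /K; lra.
  have Sw : S w by apply: Sconv => //; rewrite ?a01 ?b01 //; lra.
  have := rH w Sw; rewrite mulrC in sr; move=> /(_ (le_lt_trans wq sr)) H.
  by apply: le_trans H _; rewrite ler_wpM2l// ltW.
have bh y' : y' = y \/ y' = y + s -> cabs (hI r0F (y1 + B * y') (x1 + A * x) (x1 + A * (x + s)))
    <= e / (2 * K ^+ 2) * (K * s) * (`|A| * s).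
  move=> Hy'; rewrite /hI.
  have -> : `|A| * s = `|x1 + A * (x + s) - (x1 + A * x)|.
    have -> : x1 + A * (x + s) - (x1 + A * x) = A * s by ring.
    by rewrite normrM (gtr0_norm s0).
  apply: sint_le_gen.
    by apply: ccont_comp => //; exact: ccont_h.
  move=> t t01.
  have -> : x1 + A * x + (x1 + A * (x + s) - (x1 + A * x)) * t = x1 + A * (x + s * t) by ring.
  have st : 0 <= s * t <= s.
    have /andP[t0 t1] := t01.
    by apply/andP; split; [apply: mulr_ge0 => //; lra|rewrite ler_piMr//; lra].
  by apply: main; [lra|case: Hy' => ->; lra].
have bv x' : x' = x \/ x' = x + s -> cabs (vI r0F (x1 + A * x') (y1 + B * y) (y1 + B * (y + s)))
    <= e / (2 * K ^+ 2) * (K * s) * (`|B| * s).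
  move=> Hx'; rewrite /vI.
  have -> : `|B| * s = `|y1 + B * (y + s) - (y1 + B * y)|.
    have -> : y1 + B * (y + s) - (y1 + B * y) = B * s by ring.
    by rewrite normrM (gtr0_norm s0).
  apply: sint_le_gen.
    by apply: ccont_comp => //; exact: ccont_v.
  move=> t t01.
  have -> : y1 + B * y + (y1 + B * (y + s) - (y1 + B * y)) * t = y1 + B * (y + s * t) by ring.
  have st : 0 <= s * t <= s.
    have /andP[t0 t1] := t01.
    by apply/andP; split; [apply: mulr_ge0 => //; lra|rewrite ler_piMr//; lra].
  by apply: main; [case: Hx' => ->; lra|lra].
have h1 := bh y (or_introl erefl); have h2 := bh (y + s) (or_intror erefl).
have v1 := bv x (or_introl erefl); have v2 := bv (x + s) (or_intror erefl).
rewrite /rect.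
apply: le_trans (cabsB _ _) _; apply: le_trans (lerD (cabsB _ _) (lexx _)) _.
apply: le_trans (lerD (lerD (cabsD _ _) (lexx _)) (lexx _)) _.
rewrite !(cabsM iC) cabs_i !mul1r.
have E : e * s ^+ 2 = 2 * (e / (2 * K ^+ 2) * (K * s) * (K * s)) by field; rewrite gt_eqF.
have E2 : e / (2 * K ^+ 2) * (K * s) * (K * s) = 
  e / (2 * K ^+ 2) * (K * s) * (`|A| * s) + e / (2 * K ^+ 2) * (K * s) * (`|B| * s)
  + e / (2 * K ^+ 2) * (K * s) * s by rewrite /K; ring.
have E3 : 0 <= e / (2 * K ^+ 2) * (K * s) * s.
  by apply: mulr_ge0; [apply: mulr_ge0; [exact: ltW|apply: mulr_ge0; exact: ltW]|exact: ltW].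
rewrite E E2; lra.
Qed.

End Goursat.

(** * Primitives on small discs *)

Section LocalPrimitive.
Context {R : realType}.
Local Notation C := R[i].

Definition disc (c : C) (r : R) : set C := [set w | cabs (w - c) < r].

Lemma disc_center c r : 0 < r -> disc c r c.
Proof. by move=> r0; rewrite /disc /= subrr cabs0. Qed.

Lemma disc_open c r : open (disc c r).
Proof.
rewrite openE => z zr; apply/nbhsCP; exists (r - cabs (z - c)).
  by rewrite subr_gt0.
by move=> w wz; rewrite /disc /=; have := cabs_tri z w c; lra.
Qed.

(** Truncation to [-p, p]. It is 1-Lipschitz, so composition with it extends functions that are
    continuous on a segment or a square to the line or the plane. *)
Definition clip (p u : R) : R := Num.max (- p) (Num.min u p).

Lemma clip_id p u : `|u| <= p -> clip p u = u.
Proof.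
by rewrite ler_norml => /andP[h1 h2]; rewrite /clip min_l// max_r.
Qed.

Lemma clip_bound p u : 0 <= p -> `|clip p u| <= p.
Proof.
move=> p0; rewrite /clip ler_norml le_max lexx ge_max ge_min lexx orbT andbT /=.
lra.
Qed.

Lemma clip_lip p u v : `|clip p u - clip p v| <= `|u - v|.
Proof.
have M (a b c : R) : `|Num.max a b - Num.max a c| <= `|b - c|.
  have l1 := ler_norm (b - c); have := ler_norm (- (b - c)); rewrite normrN => l2.
  by case: (leP a b) => ab; case: (leP a c) => ac; rewrite ?subrr ?normr0//;
    rewrite ler_norml; lra.
apply: le_trans (M _ _ _) _.
have l1 := ler_norm (u - v); have := ler_norm (- (u - v)); rewrite normrN => l2.
by case: (leP u p) => up; case: (leP v p) => vp; rewrite ?subrr ?normr0//;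
  rewrite ler_norml; lra.
Qed.

(** The primitive is the integral along a horizontal and then a vertical segment. The function is
    first clipped to the square of half side r/3, whose corners stay within the disc, so that
    [goursat] has a function continuous on the whole plane. *)
Lemma local_primitive (f : C -> C) (z0 : C) (r : R) : 0 < r ->
  (forall z, disc z0 r z -> exists d, hasD f z d) ->
  exists g, forall z, disc z0 (r / 3) z -> hasD g z (f z).
Proof.
move=> r0 Hf; pose p := r / 3; have p0 : 0 < p by rewrite divr_gt0.
pose K (w : C) : C := Complex (clip p (complex.Re w)) (clip p (complex.Im w)).
pose F w := f (z0 + K w).
pose S := [set w : C | `|complex.Re w| <= p /\ `|complex.Im w| <= p].
have KS w : S (K w) by split; rewrite clip_bound// ltW.
have SK w : S w -> K w = w by case: w => x y [/= h1 h2]; rewrite /K !clip_id.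
have Sdisc w : S w -> disc z0 r (z0 + w).
  move=> [h1 h2]; rewrite /disc /= [z0 + w]addrC addrK.
  apply: le_lt_trans (cabs_le _) _; rewrite /p in h1 h2; lra.
have Klip w v : cabs (K w - K v) <= 2 * cabs (w - v).
  apply: le_trans (cabs_le _) _; rewrite ReB ImB /=.
  have := clip_lip p (complex.Re w) (complex.Re v).
  have := clip_lip p (complex.Im w) (complex.Im v).
  rewrite -ReB -ImB; have := Re_le_cabs (w - v); have := Im_le_cabs (w - v); lra.
have cF z : zcont F z.
  have [d Hd] := Hf _ (Sdisc _ (KS z)).
  apply/zcontP => e e0; have [q q0 qH] := hasD_near Hd e0.
  exists (q / 2) => [|w wz]; first by rewrite divr_gt0.
  apply: qH; have -> : z0 + K w - (z0 + K z) = K w - K z by ring.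
  by apply: le_lt_trans (Klip _ _) _; lra.
have dF z : S z -> exists d, forall e, 0 < e ->
  exists2 r : R, 0 < r & forall w, S w -> cabs (w - z) < r ->
    cabs (F w - F z - d * (w - z)) <= e * cabs (w - z).
  move=> Sz; have [d /hasDP Hd] := Hf _ (Sdisc _ Sz); exists d => e e0.
  have [q q0 qH] := Hd e e0; exists q => // w Sw wz.
  have := qH _ wz; rewrite /F !SK//.
  by have -> : z0 + z + (w - z) = z0 + w by ring.
have Sconv (p1 p2 x1 x2 y1 y2 : R) :
  S (Complex x1 y1) -> S (Complex x2 y2) -> 0 <= p1 <= 1 -> 0 <= p2 <= 1 ->
  S (Complex (x1 + (x2 - x1) * p1) (y1 + (y2 - y1) * p2)).
  have H (t u v : R) : `|u| <= p -> `|v| <= p -> 0 <= t <= 1 -> `|u + (v - u) * t| <= p.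
    rewrite !ler_norml => /andP[u1 u2] /andP[v1 v2] /andP[t1 t2].
    have : 0 <= t * (p - v) by apply: mulr_ge0 => //; lra.
    have : 0 <= t * (v + p) by apply: mulr_ge0 => //; lra.
    have : 0 <= (1 - t) * (p - u) by apply: mulr_ge0; lra.
    have : 0 <= (1 - t) * (p + u) by apply: mulr_ge0; lra.
    by move=> ? ? ? ?; apply/andP; split; lra.
  by move=> [/= a1 a2] [/= b1 b2] t1 t2; split => /=; apply: H.
pose G (w : C) := hI F 0 0 (complex.Re w) + iC * vI F (complex.Re w) 0 (complex.Im w).
have HG w : `|complex.Re w| < p -> `|complex.Im w| < p -> hasD G w (F w).
  case: w => x y /= hx hy; set w := Complex x y.
  apply/hasDP => e e0.
  have [q q0 qH] := (zcontP _ _).1 (cF w) _ (divr_gt0 e0 (ltr0Sn _ 1)).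
  pose q' := Num.min (q / 2) (Num.min (p - `|x|) (p - `|y|)).
  have q'0 : 0 < q' by rewrite !lt_min divr_gt0//= !subr_gt0 hx.
  exists q' => // -[a b] hq.
  have := Re_le_cabs (Complex a b); have := Im_le_cabs (Complex a b) => /= lb la.
  move: hq; rewrite !lt_min => /and3P[hq hq1 hq2].
  (* By [goursat] the difference of two hook-shaped paths from 0 is a short hook starting at w. *)
  have E : G (w + Complex a b) - G w = hI F y x (x + a) + iC * vI F (x + a) y (y + b).
    rewrite /G /w ReD ImD /=.
    have := @goursat _ F S cF dF Sconv x (x + a) 0 y.
    rewrite /rect => /(_ _ _).
    have S1 : S (Complex x 0) by split => /=; rewrite ?normr0 ltW.
    have S2 : S (Complex (x + a) y).
      split => /=; last exact: ltW.
      by apply: le_trans (ler_normD _ _) _; lra.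
    move=> /(_ S1 S2) Z; apply/eqP; rewrite -subr_eq0 -[X in _ == X]Z; apply/eqP.
    by rewrite /hI /vI /sint; ring.
  rewrite E.
  have B1 : cabs (hI F y x (x + a) - rc a * F w) <= e / 2 * cabs (Complex a b).
    have -> : rc a = rc (x + a - x) by congr rc; ring.
    rewrite -sint_cst /hI -sintB; last 2 first.
    - by apply: ccont_comp => //; exact: ccont_h.
    - exact: ccont_cst.
    apply: le_trans (sint_le_gen (M := e / 2) _ _) _.
    - apply: ccontB; last exact: ccont_cst.
      by apply: ccont_comp => //; exact: ccont_h.
    - move=> t /andP[t0 t1]; apply: qH; rewrite /w.
      apply: le_lt_trans (cabs_le _) _; rewrite ReB ImB /= subrr normr0 addr0.
      have -> : x + (x + a - x) * t - x = a * t by ring.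
      rewrite normrM (ger0_norm t0).
      have : `|a| * t <= `|a| by rewrite ler_piMr.
      lra.
    - have -> : x + a - x = a by ring.
      by rewrite ler_wpM2l// divr_ge0// ltW.
  have B2 : cabs (vI F (x + a) y (y + b) - rc b * F w) <= e / 2 * cabs (Complex a b).
    have -> : rc b = rc (y + b - y) by congr rc; ring.
    rewrite -sint_cst /vI -sintB; last 2 first.
    - by apply: ccont_comp => //; exact: ccont_v.
    - exact: ccont_cst.
    apply: le_trans (sint_le_gen (M := e / 2) _ _) _.
    - apply: ccontB; last exact: ccont_cst.
      by apply: ccont_comp => //; exact: ccont_v.
    - move=> t /andP[t0 t1]; apply: qH; rewrite /w.
      apply: le_lt_trans (cabs_le _) _; rewrite ReB ImB /=.
      have -> : y + (y + b - y) * t - y = b * t by ring.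
      have -> : x + a - x = a by ring.
      rewrite normrM (ger0_norm t0).
      have : `|b| * t <= `|b| by rewrite ler_piMr.
      lra.
    - have -> : y + b - y = b by ring.
      by rewrite ler_wpM2l// divr_ge0// ltW.
  have -> : hI F y x (x + a) + iC * vI F (x + a) y (y + b) - F w * Complex a b =
    (hI F y x (x + a) - rc a * F w) + iC * (vI F (x + a) y (y + b) - rc b * F w).
    have -> : Complex a b = rc a + iC * rc b by exact: (complexE (Complex a b)).
    by ring.
  apply: le_trans (cabsD _ _) _; rewrite cabsM cabs_i mul1r; lra.
exists (fun z => G (z - z0)) => z zz0.
have h1 : `|complex.Re (z - z0)| < p by apply: le_lt_trans (Re_le_cabs _) _.
have h2 : `|complex.Im (z - z0)| < p by apply: le_lt_trans (Im_le_cabs _) _.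
have H := hasD_comp (f := G) (g := fun z => z - z0) (HG _ h1 h2) (hasDB (hasD_id z) (hasD_cst z0 z)).
apply: eq_hasD H => //; rewrite subr0 mulr1 /F SK; first by congr f; ring.
by split; exact: ltW.
Qed.

Lemma hasD_inv (z : C) : z != 0 -> hasD (fun w => w^-1) z (- (z ^+ 2)^-1).
Proof.
move=> z0; apply/hasDP => e e0.
have a0 : 0 < cabs z by rewrite cabs_gt0.
pose q := Num.min (cabs z / 2) (e * cabs z ^+ 3 / 2).
exists q => [|h]; first by rewrite lt_min !divr_gt0// mulr_gt0// exprn_gt0.
rewrite lt_min => /andP[h1 h2].
have zh : cabs z / 2 <= cabs (z + h).
  by have := cabs_subr_ge z (- h); rewrite opprK cabsN; lra.
have zh0 : z + h != 0 by rewrite -cabs_gt0; lra.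
have -> : (z + h)^-1 - z^-1 - - (z ^+ 2)^-1 * h = h * h / (z ^+ 2 * (z + h)).
  by field; rewrite ?z0 ?zh0.
rewrite !cabsM cabsV cabsM cabsX mulrAC; apply: ler_wpM2r; first exact: cabs_ge0.
rewrite ler_pdivrMr; last by rewrite mulr_gt0// ?exprn_gt0//; lra.
apply: le_trans (ltW h2) _.
have -> : e * cabs z ^+ 3 / 2 = e * (cabs z ^+ 2 * (cabs z / 2)) by ring.
by apply: (ler_wpM2l (ltW e0)); apply: ler_wpM2l => //; rewrite exprn_ge0 ?cabs_ge0.
Qed.

End LocalPrimitive.

(** * Cauchy's formula, regularity of holomorphic functions, Cauchy estimates *)

Section Cauchy.
Context {R : realType}.
Local Notation C := R[i].
Local Notation twopi := (2 * pi : R).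

Section C1.
Variables (c : C) (r : R) (g f : C -> C).
Hypothesis gf : forall w, disc c r w -> hasD g w (f w) /\ zcont f w.

Let circ (w : C) (s : R) t := w + rc s * expi t.

Let circ_disc w s t : cabs (w - c) + `|s| < r -> disc c r (circ w s t).
Proof.
move=> ws; rewrite /disc /circ /=.
have -> : w + rc s * expi t - c = (w - c) + rc s * expi t by ring.
apply: le_lt_trans (cabsD _ _) _.
by rewrite cabsM cabs_real cabs_expi mulr1.
Qed.

Let cg w s : cabs (w - c) + `|s| < r -> ccont (fun t => g (circ w s t)).
Proof.
move=> ws; apply: ccont_comp; last exact: ccont_circle.
by move=> t; have [H _] := gf (circ_disc t ws); exact: hasD_zcont H.
Qed.

Let cf w s : cabs (w - c) + `|s| < r -> ccont (fun t => f (circ w s t)).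
Proof.
move=> ws; apply: ccont_comp; last exact: ccont_circle.
by move=> t; have [_] := gf (circ_disc t ws).
Qed.

Let J w s := sint 0 twopi (fun t => g (circ w s t) * expi (- t)).
Let M w s := sint 0 twopi (fun t => f (circ w s t)).

Let strict w s : cabs (w - c) + `|s| < r -> forall e, 0 < e ->
  exists2 d : R, 0 < d & forall t, 0 <= t <= twopi -> forall k, cabs k < d ->
    cabs (g (circ w s t + k) - g (circ w s t) - f (circ w s t) * k) <= e * cabs k.
Proof.
move=> ws; apply: (@curve_strict _ (disc c r)) => //; first exact: pi2_ge0.
- exact: disc_open.
- exact: ccont_circle.
- by move=> t _; exact: circ_disc.
Qed.

(** Differentiation in the radius produces f e^{it}, which the factor e^{-it} of [J] cancels. *)
Let J_diff w s : cabs (w - c) + `|s| < r -> cdiff (J w) s (M w s).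
Proof.
move=> ws; pose q := r - (cabs (w - c) + `|s|); have q0 : 0 < q by rewrite subr_gt0.
apply: (udiff_sint_cdiff (f := fun t s => g (circ w s t) * expi (- t)) (r := q)) => //.
- exact: pi2_ge0.
- move=> h hq; apply: ccontM; last exact: ccont_expiN.
  apply: cg; have := ler_normD s h; rewrite /q in hq; lra.
- exact: cf.
move=> e e0; have [d d0 dH] := strict ws e0; exists d => // h hd t t01.
have := dH t t01 (rc h * expi t).
rewrite cabsM cabs_expi mulr1 cabs_real => /(_ hd); apply: le_trans.
have -> : circ w s t + rc h * expi t = circ w (s + h) t.
  by rewrite /circ rmorphD; ring.
rewrite -[leRHS]mulr1 -[X in _ <= _ * X](cabs_expi (- t)) -cabsM.
have := expiVN t; set x := expi t; set y := expi (- t) => xy.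
have -> : (g (circ w (s + h) t) - g (circ w s t) - f (circ w s t) * (rc h * x)) * y
  = g (circ w (s + h) t) * y - g (circ w s t) * y - rc h * f (circ w s t) * (x * y).
  by ring.
by rewrite xy mulr1.
Qed.

(** Integration by parts over a full turn: the derivative in t of g e^{-it} is i (s f - g
    e^{-it}). *)
Let sM_J w s : cabs (w - c) + `|s| < r -> rc s * M w s = J w s.
Proof.
move=> ws; apply/eqP; rewrite -subr_eq0; apply/eqP.
rewrite -sintZ; last exact: cf.
rewrite -sintB; last 2 first.
- by apply: ccontZ; exact: cf.
- by apply: ccontM; [exact: cg|exact: ccont_expiN].
set u := (X in sint _ _ X).
have cu : ccont u.
  apply: ccontB; first by apply: ccontZ; exact: cf.
  by apply: ccontM; [exact: cg|exact: ccont_expiN].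
have iu : iC * sint 0 twopi u = 0.
  rewrite -sintZ// (@sint_ftc _ _ _ _ (fun t => g (circ w s t) * expi (- t))).
  - by rewrite /circ expiN expi2pi oppr0 expi0 rmorph1 mulr1 subrr.
  - exact: ccontZ.
  move=> t; have [Hg _] := gf (circ_disc t ws).
  have Hc : cdiff (circ w s) t (rc s * (iC * expi t)).
    have := cdiffD (cdiff_cst w t) (cdiffZ (rc s) (cdiff_expi t)).
    by rewrite add0r.
  have := cdiffM (hasD_curve Hg Hc) (cdiff_expiN t).
  apply: eq_cdiff => //; rewrite /u.
  have := expiVN t; set x := expi t; set y := expi (- t) => xy.
  have -> : f (circ w s t) * (rc s * (iC * x)) * y = f (circ w s t) * rc s * iC * (x * y) by ring.
  by rewrite xy; ring.
move/eqP: iu; rewrite mulf_eq0 => /orP[|/eqP//].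
by rewrite -cabs_eq0 cabs_i oner_eq0.
Qed.

(** By [J_diff] and [sM_J] the quotient J/s has derivative zero in s. It is the integral [M] of f
    over the circle, which is therefore independent of the radius and equal to its limit at radius
    0. *)
Lemma mean_value_C1 w s : 0 < s -> cabs (w - c) + s < r ->
  sint 0 twopi (fun t => f (w + rc s * expi t)) = rc twopi * f w.
Proof.
move=> s0 ws; rewrite -/(M w s).
have fw : disc c r w by rewrite /disc /=; lra.
have [_ /zcontP cfw] := gf fw.
apply/eqP; rewrite -subr_eq0 -cabs_eq0 eq_le cabs_ge0 andbT.
apply/ler_addgt0Pr => e e0; rewrite add0r.
have K0 := @pi2_gt0 R.
have [d d0 dH] := cfw _ (divr_gt0 e0 K0).
pose x := Num.min s d / 2.
have m0 : 0 < Num.min s d by rewrite lt_min s0.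
have [m1 m2] : Num.min s d <= s /\ Num.min s d <= d by rewrite !ge_min !lexx orbT.
have x0 : 0 < x by rewrite divr_gt0.
have xs : x < s by rewrite /x; lra.
have xd : x < d by rewrite /x; lra.
have dr t : x <= t <= s -> cabs (w - c) + `|t| < r.
  by move=> /andP[xt ts]; rewrite ger0_norm; lra.
have E : rc x^-1 * J w x = rc s^-1 * J w s.
  apply: (@cdiff0_cst _ (fun t => rc t^-1 * J w t)); first exact: ltW.
  move=> t tx; have t0 : 0 < t by lra.
  have tn0 : rc t != 0 by rewrite -cabs_gt0 cabs_real normr_gt0 gt_eqF.
  have Hr : cdiff (fun u => rc u) t 1.
    by apply: eq_cdiff (cdiff_line 0 1 t) => // u; rewrite add0r mulr1.
  have Hi := hasD_curve (hasD_inv tn0) Hr.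
  have := cdiffM Hi (J_diff (dr t tx)); apply: eq_cdiff.
    by move=> u; rewrite fmorphV.
  rewrite -(sM_J (dr t tx)); field; exact: tn0.
have sE t : 0 < t -> cabs (w - c) + `|t| < r -> rc t^-1 * J w t = M w t.
  move=> t0 /sM_J <-; rewrite mulrA -rmorphM mulVf ?gt_eqF// rmorph1.
  by rewrite mul1r.
rewrite !sE// in E; [|by apply: dr; lra|by apply: dr; lra].
rewrite -E /M.
have -> : rc twopi * f w = sint 0 twopi (fun=> f w) by rewrite sint_cst subr0.
rewrite -sintB; [|by apply: cf; apply: dr; lra|exact: ccont_cst].
have -> : e = e / twopi * (twopi - 0) by rewrite subr0 divfK ?gt_eqF ?pi2_gt0.
apply: sint_le; first exact: ltW.
  by apply: ccontB; [apply: cf; apply: dr; lra|exact: ccont_cst].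
move=> t _; apply: dH; rewrite /circ addrAC subrr add0r cabsM cabs_expi.
by rewrite cabs_real mulr1 gtr0_norm.
Qed.

Lemma cauchy_C1 w s : 0 < s -> cabs (w - c) + s < r ->
  sint 0 twopi (fun t => g (w + rc s * expi t) * expi (- t)) = rc (twopi * s) * f w.
Proof.
move=> s0 ws; have := @sM_J w s; rewrite /M mean_value_C1// gtr0_norm// => /(_ ws).
by rewrite -/(J w s) => <-; rewrite rmorphM /=; ring.
Qed.

End C1.

(** Cauchy's formula writes f = g' as an integral of values of g, and differentiation under that
    integral gains one derivative. *)
Lemma C1_step (c : C) r (g f : C -> C) : 0 < r ->
  (forall w, disc c r w -> hasD g w (f w) /\ zcont f w) ->
  exists f', forall w, disc c (r / 2) w -> hasD f w (f' w) /\ zcont f' w.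
Proof.
move=> r0 gf; pose s := r / 2; have s0 : 0 < s by rewrite divr_gt0.
pose K := rc (twopi * s)^-1.
exists (fun w => K * sint 0 twopi (fun t => f (w + rc s * expi t) * expi (- t))).
have dd w t : disc c (r / 2) w -> disc c r (w + rc s * expi t).
  rewrite /disc /= => wr.
  have -> : w + rc s * expi t - c = (w - c) + rc s * expi t by ring.
  apply: le_lt_trans (cabsD _ _) _.
  by rewrite cabsM cabs_real cabs_expi mulr1 (gtr0_norm s0) /s; lra.
have cfw w : disc c (r / 2) w -> ccont (fun t => f (w + rc s * expi t)).
  move=> wr; apply: ccont_comp; last exact: ccont_circle.
  by move=> t; have [] := gf _ (dd w t wr).
have cgw w : disc c (r / 2) w -> ccont (fun t => g (w + rc s * expi t)).
  move=> wr; apply: ccont_comp; last exact: ccont_circle.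
  by move=> t; have [/hasD_zcont] := gf _ (dd w t wr).
have K1 : K * rc (twopi * s) = 1.
  by rewrite /K -rmorphM mulVf ?rmorph1// mulf_neq0 ?gt_eqF ?pi2_gt0.
move=> w wr; pose q := r / 2 - cabs (w - c).
have q0 : 0 < q by rewrite subr_gt0.
have wq h : cabs h < q -> disc c (r / 2) (w + h).
  rewrite /disc /q /= => hq; have -> : w + h - c = (w - c) + h by ring.
  by apply: le_lt_trans (cabsD _ _) _; lra.
split.
  have H : hasD (fun v => sint 0 twopi (fun t => g (v + rc s * expi t) * expi (- t))) w
      (sint 0 twopi (fun t => f (w + rc s * expi t) * expi (- t))).
    apply: (udiff_sint_hasD (f := fun t v => g (v + rc s * expi t) * expi (- t)) (r := q)) => //.
    - exact: pi2_ge0.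
    - by move=> h hq; apply: ccontM; [apply: cgw; exact: wq|exact: ccont_expiN].
    - by apply: ccontM; [exact: cfw|exact: ccont_expiN].
    move=> e e0.
    have [|||||d d0 dH] := @curve_strict _ (disc c r) g f (fun t => w + rc s * expi t) 0 twopi _ _ _ _ _ e e0 => //.
    - exact: pi2_ge0.
    - exact: disc_open.
    - exact: ccont_circle.
    - by move=> t _; exact: dd.
    exists d => // h hd t t01; have := dH t t01 h hd; apply: le_trans.
    rewrite -[leRHS]mulr1 -[X in _ <= _ * X](cabs_expi (- t)) -cabsM.
    have -> : w + h + rc s * expi t = w + rc s * expi t + h by ring.
    by rewrite le_eqVlt; apply/orP; left; apply/eqP; congr cabs; ring.
  have := hasDZ K H.
  apply: (near_hasD (@disc_open _ c (r / 2)) wr) => v vr.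
  rewrite (cauchy_C1 gf s0); last by rewrite /disc /= in vr; rewrite /s; lra.
  by rewrite mulrA K1 mul1r.
apply: (gcontM (f := fun=> K)); first exact: gcont_cst.
move=> e e0; have K0 := @pi2_gt0 R.
have [||d d0 dH] := @curve_unif_cont _ f (fun t => w + rc s * expi t) 0 twopi (@pi2_ge0 R) _ _ _ (divr_gt0 e0 K0).
- exact: ccont_circle.
- by move=> t _; have [] := gf _ (dd w t wr).
exists (Num.min d q); first by rewrite lt_min d0.
move=> h; rewrite lt_min => /andP[hd hq].
have c1 : ccont (fun t => f (w + h + rc s * expi t) * expi (- t)).
  by apply: ccontM; [apply: cfw; exact: wq|exact: ccont_expiN].
have c2 : ccont (fun t => f (w + rc s * expi t) * expi (- t)).
  by apply: ccontM; [apply: cfw|exact: ccont_expiN].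
rewrite -sintB//.
have -> : e = e / twopi * (twopi - 0) by rewrite subr0 divfK ?gt_eqF ?pi2_gt0.
apply: sint_le; [exact: ltW|exact: ccontB|move=> t t01].
rewrite -mulrBl cabsM cabs_expi mulr1.
have -> : w + h + rc s * expi t = w + rc s * expi t + h by ring.
exact: dH.
Qed.

Definition der (f : C -> C) (z : C) : C := xget 0 [set d | hasD f z d].
Definition hol (U : set C) (f : C -> C) : Prop := forall z, U z -> hasD f z (der f z).

Lemma der_hasD f z d : hasD f z d -> der f z = d.
Proof.
move=> Hf; rewrite /der; case: xgetP => [y _ Hy|/(_ d)]; last by [].
exact: hasD_unique Hy Hf.
Qed.

Lemma hasD_der f z d : hasD f z d -> hasD f z (der f z).
Proof. by move=> Hf; rewrite (der_hasD Hf). Qed.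

(** A local primitive of f starts the process: one application of [C1_step] makes f continuously
    differentiable, a second one does so for its derivative. *)
Lemma hol_der (U : set C) f : open U -> hol U f -> hol U (der f).
Proof.
move=> oU Hf z Uz; have [r r0 rU] := nbhsS oU Uz.
have [|g Hg] := @local_primitive _ f z r r0.
  by move=> w wr; exists (der f w); apply/Hf/rU.
have r3 : 0 < r / 3 by rewrite divr_gt0.
have [|f1 Hf1] := @C1_step z (r / 3) g f r3.
  move=> w wr; split; first exact: Hg.
  apply: hasD_zcont (Hf _ _); apply: rU; move: wr; rewrite /disc /=; lra.
have r32 : 0 < r / 3 / 2 by rewrite divr_gt0.
have [f2 Hf2] := C1_step r32 Hf1.
have H2 : hasD f1 z (f2 z).
  by have [] := Hf2 z (disc_center _ (divr_gt0 r32 (ltr0Sn _ 1))).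
apply: (@hasD_der _ _ (f2 z)).
apply: (near_hasD (@disc_open _ z (r / 3 / 2)) (disc_center _ r32)) H2.
by move=> w /Hf1 [/der_hasD].
Qed.

Lemma holP (U : set C) f : (forall z, U z -> exists d, hasD f z d) -> hol U f.
Proof. by move=> H z /H[d /hasD_der]. Qed.

Lemma hol_zcont U f z : hol U f -> U z -> zcont f z.
Proof. by move=> Hf /Hf/hasD_zcont. Qed.

(** Cauchy's formula for the derivative, applied to f(w) (w - c), whose derivative at c is f(c). *)
Lemma hol_mean (c : C) r f s : hol (disc c r) f -> 0 < s < r ->
  sint 0 twopi (fun t => f (c + rc s * expi t)) = rc twopi * f c.
Proof.
move=> Hf /andP[s0 sr].
have Hd := hol_der (@disc_open _ c r) Hf.
pose h w := f w * (w - c).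
have Dh w : disc c r w -> hasD h w (der f w * (w - c) + f w).
  move=> /Hf Hw; have := hasDM Hw (hasDB (hasD_id w) (hasD_cst c w)).
  by apply: eq_hasD => //; rewrite subr0 mulr1.
have [h' Hh'] : exists h', forall w, disc c r w -> hasD h w (h' w) /\ zcont h' w.
  exists (fun w => der f w * (w - c) + f w) => w wr; split; first exact: Dh.
  apply: gcontD; last exact: hol_zcont Hf wr.
  apply: gcontM; first exact: hol_zcont Hd wr.
  apply: gcontD; [exact: hasD_zcont (hasD_id w)|exact: gcont_cst].
have H := @cauchy_C1 c r h h' Hh' c s s0; rewrite subrr cabs0 add0r in H.
have h'c : h' c = f c.
  have cc : disc c r c by apply: disc_center; lra.
  have [H1 _] := Hh' _ cc.
  by rewrite (hasD_unique H1 (Dh _ cc)) subrr mulr0 add0r.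
have {H} := H sr; rewrite h'c rmorphM => H.
have s0' : rc s != 0 by rewrite -cabs_gt0 cabs_real normr_gt0 gt_eqF.
apply: (mulfI s0'); rewrite -sintZ; last first.
  apply: ccont_comp; last exact: ccont_circle.
  move=> t; apply: hol_zcont Hf _; rewrite /disc /= addrAC subrr add0r.
  by rewrite cabsM cabs_expi mulr1 cabs_real gtr0_norm.
rewrite (_ : rc s * (rc twopi * f c) = rc twopi * rc s * f c); last by ring.
rewrite -H; apply: eq_sint => t; rewrite /h.
have -> : c + rc s * expi t - c = rc s * expi t by ring.
by rewrite -[RHS]mulrA -[X in _ = _ * X]mulrA expiVN mulr1 mulrC.
Qed.

Lemma hol_cauchy (c : C) r f s : hol (disc c r) f -> 0 < s < r ->
  sint 0 twopi (fun t => f (c + rc s * expi t) * expi (- t)) = rc (twopi * s) * der f c.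
Proof.
move=> Hf /andP[s0 sr].
have Hd := hol_der (@disc_open _ c r) Hf.
apply: (@cauchy_C1 c r) => //; last by rewrite subrr cabs0 add0r.
by move=> w wr; split; [exact: Hf|exact: hol_zcont Hd wr].
Qed.

Lemma cauchy_estimate (c : C) r f B : 0 < r -> hol (disc c r) f ->
  (forall w, disc c r w -> cabs (f w) <= B) -> cabs (der f c) <= 2 * B / r.
Proof.
move=> r0 Hf HB; pose s := r / 2.
have sr : 0 < s < r by rewrite /s; lra.
have [s0 _] := andP sr.
have din t : disc c r (c + rc s * expi t).
  rewrite /disc /= addrAC subrr add0r cabsM cabs_expi mulr1 cabs_real gtr0_norm//.
  by case/andP: sr.
have cft : ccont (fun t => f (c + rc s * expi t) * expi (- t)).
  apply: ccontM; last exact: ccont_expiN.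
  apply: ccont_comp; last exact: ccont_circle.
  by move=> t; apply: hol_zcont Hf _.
have := @sint_le _ 0 twopi _ B (@pi2_ge0 R) cft.
rewrite (hol_cauchy Hf sr) cabsM cabs_real subr0 gtr0_norm ?mulr_gt0 ?pi_gt0//.
move=> H; have {}H := H _.
have {}H : twopi * s * cabs (der f c) <= B * twopi.
  by apply: H => t _; rewrite cabsM cabs_expi mulr1 HB.
have -> : 2 * B / r = B / s by rewrite /s; field; rewrite gt_eqF.
rewrite ler_pdivlMr// -(ler_pM2l (@pi2_gt0 R)).
by move: H; congr (_ <= _); ring.
Qed.

(** Cauchy estimates on discs of radius r/2 and then r/4 bound f' by 4B/r and f'' by 32 B/r^2 near
    c; two mean value inequalities turn the latter into a quadratic remainder. *)
Lemma hol_remainder (c : C) r f B : 0 < r -> hol (disc c r) f ->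
  (forall w, disc c r w -> cabs (f w) <= B) ->
  forall h, cabs h <= r / 4 ->
    cabs (f (c + h) - f c - der f c * h) <= 32 * B / r ^+ 2 * cabs h ^+ 2.
Proof.
move=> r0 Hf HB h hr.
have Hd := hol_der (@disc_open _ c r) Hf.
have sub (U V : set C) g : V `<=` U -> hol U g -> hol V g.
  by move=> VU Hg z /VU /Hg.
have r2 : 0 < r / 2 by rewrite divr_gt0.
have r4 : 0 < r / 4 by rewrite divr_gt0.
have D1 w : disc c (r / 2) w -> cabs (der f w) <= 4 * B / r.
  move=> wr; have wsub : disc w (r / 2) `<=` disc c r.
    move=> v vr; rewrite /disc /= in wr vr *.
    by apply: le_lt_trans (cabs_tri w _ _) _; lra.
  have := @cauchy_estimate w (r / 2) f B r2 (sub _ _ _ wsub Hf) (fun v vr => HB v (wsub v vr)).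
  by move=> /le_trans; apply; rewrite le_eqVlt; apply/orP; left; apply/eqP; field; rewrite gt_eqF.
have D2 w : cabs (w - c) <= r / 4 -> cabs (der (der f) w) <= 32 * B / r ^+ 2.
  move=> wr; have wsub : disc w (r / 4) `<=` disc c (r / 2).
    move=> v vr; rewrite /disc /= in vr *.
    by apply: le_lt_trans (cabs_tri w _ _) _; lra.
  have wsub' : disc w (r / 4) `<=` disc c r.
    by move=> v /wsub; rewrite /disc /=; lra.
  have := @cauchy_estimate w (r / 4) (der f) _ r4 (sub _ _ _ wsub' Hd) (fun v vr => D1 v (wsub v vr)).
  by move=> /le_trans; apply; rewrite le_eqVlt; apply/orP; left; apply/eqP; field; rewrite gt_eqF.
have Hdd w : cabs (w - c) <= r / 4 -> disc c r w by rewrite /disc /=; lra.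
have L1 k : cabs k <= r / 4 -> cabs (der f (c + k) - der f c) <= 32 * B / r ^+ 2 * cabs k.
  move=> kr.
  have tk (t : R) : 0 <= t <= 1 -> cabs (c + rc t * (c + k - c) - c) <= r / 4.
    move=> /andP[t0 t1].
    have -> : c + rc t * (c + k - c) - c = rc t * k by ring.
    rewrite cabsM cabs_real ger0_norm//.
    by have : t * cabs k <= cabs k by [rewrite ler_piMl ?cabs_ge0]; lra.
  have := @segment_le _ (der f) (der (der f)) c (c + k) (32 * B / r ^+ 2).
  have -> : c + k - c = k by ring.
  have ck : c + k - c = k by ring.
  rewrite ck in tk; apply => t /tk tr; last exact: D2.
  by apply: Hd; exact: Hdd.
have := @segment_le _ (fun v => f v - der f c * v) (fun v => der f v - der f c) c (c + h)
  (32 * B / r ^+ 2 * cabs h).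
have -> : f (c + h) - der f c * (c + h) - (f c - der f c * c) = f (c + h) - f c - der f c * h by ring.
have -> : c + h - c = h by ring.
rewrite expr2 mulrA; apply => t /andP[t0 t1].
  apply: hasDB; last first.
    by have := hasDZ (der f c) (hasD_id (c + rc t * h)); rewrite mulr1.
  apply: Hf; apply: Hdd; rewrite addrAC subrr add0r cabsM cabs_real ger0_norm//.
  by have : t * cabs h <= cabs h by [rewrite ler_piMl ?cabs_ge0]; lra.
have th : cabs (rc t * h) <= cabs h.
  by rewrite cabsM cabs_real ger0_norm// ler_piMl ?cabs_ge0.
apply: le_trans (L1 _ (le_trans th hr)) _; rewrite ler_wpM2l//.
have B0 : 0 <= B by apply: le_trans (cabs_ge0 _) (HB c (disc_center _ r0)).
by apply: divr_ge0; [exact: mulr_ge0|apply: exprn_ge0; exact: ltW].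
Qed.

End Cauchy.

(** * Continuation along paths, primitives on simply connected domains, path integrals *)

Section Monodromy.
Context {R : realType}.
Local Notation C := R[i].

(** The points of [Om] where [P] holds and those where it fails both form open sets. *)
Lemma connected_ind (Om : set C) (z0 : C) (P : C -> Prop) :
  open Om -> connected Om -> Om z0 -> P z0 ->
  (forall z, Om z -> exists2 r : R, 0 < r & disc z r `<=` Om /\
     forall x y, disc z r x -> disc z r y -> P x -> P y) ->
  forall z, Om z -> P z.
Proof.
move=> oO cO Oz0 Pz0 H z Oz.
have op (Q : C -> Prop) : (forall z, Om z -> exists2 r : R, 0 < r & disc z r `<=` Om /\
     forall x y, disc z r x -> disc z r y -> Q x -> Q y) -> open [set w | Om w /\ Q w].
  move=> HQ; rewrite openE => w [/HQ [r r0 [rO rQ]] Qw]; apply/nbhsCP; exists r => // v vr.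
  by split; [exact: rO|apply: rQ Qw => //; exact: disc_center].
suff : [set w | Om w /\ P w] = Om by move=> /seteqP[_ /(_ z Oz)][].
apply: cO; first by exists z0.
  exists [set w | Om w /\ P w]; first exact: op.
  by rewrite setIA setIid.
exists (~` [set w | Om w /\ ~ P w]).
  rewrite closedC; apply: op => w /H [r r0 [rO rP]]; exists r => //; split => //.
  by move=> x y xr yr nPx Py; apply: nPx; exact: rP Py.
apply/seteqP; split => w; first by move=> [Ow Pw]; split => // -[].
by move=> [Ow nP]; split => //; apply: contrapT => nPw; apply: nP.
Qed.

Definition unit_itv (t : R) : Prop := 0 <= t <= 1.

Definition loc (Q : R -> R -> Prop) : Prop := forall t, unit_itv t ->
  exists2 d, 0 < d & forall s, unit_itv s -> `|s - t| < d -> Q t s.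

Lemma loc_concat (Q1 Q2 Q : R -> R -> Prop) : loc Q1 -> loc Q2 ->
  (forall t s, 0 <= t <= 1 / 2 -> 0 <= s <= 1 / 2 -> Q1 (2 * t) (2 * s) -> Q t s) ->
  (forall t s, 1 / 2 <= t <= 1 -> 1 / 2 <= s <= 1 ->
    Q2 (2 * t - 1) (2 * s - 1) -> Q t s) -> loc Q.
Proof.
move=> L1 L2 H1 H2 t /andP[t0 t1].
have A1 : t <= 1 / 2 -> exists2 d, 0 < d & forall s, 0 <= s <= 1 / 2 -> `|s - t| < d -> Q t s.
  move=> t2; have [|d d0 dH] := L1 (2 * t); first by apply/andP; split; lra.
  exists (d / 2) => [|s s01]; first by rewrite divr_gt0.
  rewrite ltr_norml => st; apply: H1 => //; first by rewrite t0.
  apply: dH; [by rewrite /unit_itv; lra|rewrite ltr_norml; lra].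
have A2 : 1 / 2 <= t -> exists2 d, 0 < d & forall s, 1 / 2 <= s <= 1 -> `|s - t| < d -> Q t s.
  move=> t2; have [|d d0 dH] := L2 (2 * t - 1); first by apply/andP; split; lra.
  exists (d / 2) => [|s s01]; first by rewrite divr_gt0.
  rewrite ltr_norml => st; apply: H2 => //; first by rewrite t1 andbT.
  apply: dH; [by rewrite /unit_itv; lra|rewrite ltr_norml; lra].
have [t2|t2|t2] := ltrgtP t (1 / 2).
- have [d d0 dH] := A1 (ltW t2).
  exists (Num.min d (1 / 2 - t)); first by rewrite lt_min d0 subr_gt0.
  move=> s /andP[s0 s1]; rewrite lt_min => /andP[sd].
  by rewrite ltr_norml => s2; apply: dH => //; lra.
- have [d d0 dH] := A2 (ltW t2).
  exists (Num.min d (t - 1 / 2)); first by rewrite lt_min d0 subr_gt0.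
  move=> s /andP[s0 s1]; rewrite lt_min => /andP[sd].
  by rewrite ltr_norml => s2; apply: dH => //; lra.
have [|d1 d10 H3] := A1; first by rewrite t2.
have [|d2 d20 H4] := A2; first by rewrite t2.
exists (Num.min d1 d2); first by rewrite lt_min d10.
move=> s /andP[s0 s1]; rewrite lt_min => /andP[sd1 sd2].
by have [s2|s2] := leP s (1 / 2); [apply: H3|apply: H4] => //; lra.
Qed.

Lemma loc_const (phi : R -> C) (a b : R) : a <= b ->
  (forall t, a <= t <= b -> exists2 d, 0 < d & forall s, a <= s <= b ->
     `|s - t| < d -> phi s = phi t) -> phi a = phi b.
Proof.
rewrite le_eqVlt => /predU1P[-> //|ab] H.
have ba : 0 < b - a by rewrite subr_gt0.
have := @bisection _ (fun x _ s => phi x = phi (x + s)) a 0 (b - a) ba.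
rewrite addrC subrK; apply.
  move=> x y s _ _ _ _ _ -> -> _ _; congr phi; lra.
move=> t y tab _; have [d d0 dH] := H t tab; exists d => //.
move=> x _ s /andP[s0 sd] xa xs _ _ /andP[x1 x2] _.
by rewrite (dH x) ?(dH (x + s)) // ?ltr_norml; lra.
Qed.

Section Lifts.
Variables (Om : set C) (f : C -> C) (g : C -> C -> C) (rad : C -> R).
Hypothesis rad_gt0 : forall z, Om z -> 0 < rad z.
Hypothesis gP : forall z w, Om z -> disc z (rad z) w -> Om w /\ hasD (g z) w (f w).

Definition inc (z w : C) : C := g z w - g z z.

Lemma disc_convex (p x y : C) r (t : R) : disc p r x -> disc p r y ->
  0 <= t <= 1 -> disc p r (x + rc t * (y - x)).
Proof.
rewrite /disc /= => xr yr /andP[t0 t1].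
have -> : x + rc t * (y - x) - p = rc (1 - t) * (x - p) + rc t * (y - p).
  by rewrite rmorphB rmorph1; ring.
have := cabsD (rc (1 - t) * (x - p)) (rc t * (y - p)).
rewrite !cabsM !cabs_real !ger0_norm ?subr_ge0//.
have [->|t'] := eqVneq t 0; first by rewrite subr0 mul1r mul0r; lra.
have tgt0 : 0 < t by rewrite lt_def t'.
have : t * cabs (y - p) < t * r by rewrite ltr_pM2l.
have : (1 - t) * cabs (x - p) <= (1 - t) * r by rewrite ler_wpM2l ?subr_ge0// ltW.
lra.
Qed.

(** The segment from x to y lies in both discs, and along it the two local primitives have the same
    derivative. *)
Lemma inc_eq p q x y : Om p -> Om q -> disc p (rad p) x -> disc p (rad p) y ->
  disc q (rad q) x -> disc q (rad q) y -> g p y - g p x = g q y - g q x.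
Proof.
move=> Op Oq px py qx qy; apply/eqP; rewrite -subr_eq0 -cabs_eq0 eq_le cabs_ge0 andbT.
have := @segment_le _ (fun w => g p w - g q w) (fun w => f w - f w) x y 0.
have -> : g p y - g q y - (g p x - g q x) = g p y - g p x - (g q y - g q x) by ring.
rewrite mul0r; apply=> t t01; last by rewrite subrr cabs0.
have [_ h1] := gP Op (disc_convex px py t01).
have [_ h2] := gP Oq (disc_convex qx qy t01).
exact: hasDB.
Qed.

Definition pcont (c : R -> C) : Prop :=
  forall e, 0 < e -> loc (fun t s => cabs (c s - c t) < e).

(** Analytic continuation of a primitive of [f] along the curve [c]; [lift2] is the same over a
    two-parameter family of points. *)
Definition lift1 (c phi : R -> C) : Prop :=
  loc (fun t s => phi s - phi t = inc (c t) (c s)).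

Definition lift2 (h phi : R -> R -> C) (x1 x2 y1 y2 : R) : Prop :=
  forall x y, x1 <= x <= x2 -> y1 <= y <= y2 -> exists2 d, 0 < d &
    forall x' y', x1 <= x' <= x2 -> y1 <= y' <= y2 -> `|x' - x| < d ->
      `|y' - y| < d -> phi x' y' - phi x y = inc (h x y) (h x' y').

Lemma lift2_swap h phi x1 x2 y1 y2 : lift2 h phi x1 x2 y1 y2 ->
  lift2 (fun x y => h y x) (fun x y => phi y x) y1 y2 x1 x2.
Proof.
move=> H x y hx hy; have [d d0 dH] := H y x hy hx; exists d => // x' y' *.
exact: dH.
Qed.

(** Along the common edge the two lifts differ by a locally constant, hence constant, amount, by
    which the second one is shifted. *)
Lemma lift2_glue h phi1 phi2 x1 m x2 y1 y2 : x1 <= m <= x2 -> y1 <= y2 ->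
  lift2 h phi1 x1 m y1 y2 -> lift2 h phi2 m x2 y1 y2 ->
  exists phi, lift2 h phi x1 x2 y1 y2.
Proof.
move=> /andP[x1m mx2] y12 H1 H2.
pose K := phi1 m y1 - phi2 m y1.
have HK y : y1 <= y <= y2 -> phi1 m y - phi2 m y = K.
  move=> /andP[yy1 yy2]; symmetry; apply: (@loc_const (fun y => phi1 m y - phi2 m y)) => //.
  move=> t t12.
  have [||d1 d10 {}H1] := H1 m t; [lra|lra|].
  have [||d2 d20 {}H2] := H2 m t; [lra|lra|].
  exists (Num.min d1 d2); first by rewrite lt_min d10.
  move=> s s12; rewrite lt_min => /andP[sd1 sd2].
  have := H1 m s; have := H2 m s; rewrite subrr normr0 => E2 E1.
  have {}E1 : phi1 m s - phi1 m t = inc (h m t) (h m s) by apply: E1 => //; lra.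
  have {}E2 : phi2 m s - phi2 m t = inc (h m t) (h m s) by apply: E2 => //; lra.
  apply/eqP; rewrite -subr_eq0; apply/eqP; transitivity
    ((phi1 m s - phi1 m t) - (phi2 m s - phi2 m t)); first by ring.
  by rewrite E1 E2 subrr.
exists (fun x y => if x <= m then phi1 x y else phi2 x y + K) => x y /andP[hx1 hx2] hy.
have [xm|xm|xm] := ltrgtP x m.
- have [||d d0 dH] := H1 x y => //; first by lra.
  exists (Num.min d (m - x)); first by rewrite lt_min d0 subr_gt0.
  move=> x' y' hx' hy'; rewrite !lt_min => /andP[xd xd'] /andP[yd _].
  move: (xd'); rewrite ltr_norml => xd''.
  have xm' : x' <= m by lra.
  by rewrite xm'; apply: dH => //; lra.
- have [||d d0 dH] := H2 x y => //; first by lra.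
  exists (Num.min d (x - m)); first by rewrite lt_min d0 subr_gt0.
  move=> x' y' hx' hy'; rewrite !lt_min => /andP[xd xd'] /andP[yd _].
  move: (xd'); rewrite ltr_norml => xd''.
  have xm' : (x' <= m) = false by apply/negbTE; rewrite -ltNge; lra.
  by rewrite xm' opprD addrACA subrr addr0; apply: dH => //; lra.
subst x.
have [||d1 d10 {}H1] := H1 m y => //; first by lra.
have [||d2 d20 {}H2] := H2 m y => //; first by lra.
exists (Num.min d1 d2); first by rewrite lt_min d10.
move=> x' y' hx' hy'; rewrite !lt_min => /andP[xd1 xd2] /andP[yd1 yd2].
have [xm'|xm'] := leP x' m; first by apply: H1 => //; lra.
rewrite -(HK y hy) -(H2 x' y')//; last by lra.
by ring.
Qed.

Lemma lift_local (h : R -> R -> C) (p : C) (x1 x2 y1 y2 : R) : Om p ->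
  (forall x y, x1 <= x <= x2 -> y1 <= y <= y2 -> disc p (rad p) (h x y)) ->
  (forall x y, x1 <= x <= x2 -> y1 <= y <= y2 -> forall e, 0 < e ->
    exists2 d, 0 < d & forall x' y', x1 <= x' <= x2 -> y1 <= y' <= y2 ->
      `|x' - x| < d -> `|y' - y| < d -> cabs (h x' y' - h x y) < e) ->
  lift2 h (fun x y => g p (h x y)) x1 x2 y1 y2.
Proof.
move=> Op hp hc x y hx hy; have [Oh _] := gP Op (hp _ _ hx hy).
have [d d0 dH] := hc x y hx hy _ (rad_gt0 Oh).
exists d => // x' y' hx' hy' xd yd; apply: inc_eq => //.
- exact: hp.
- exact: hp.
- by apply: disc_center; exact: rad_gt0.
- exact: dH.
Qed.

(** By bisection: the four quarters are glued in rows and then, with the coordinates exchanged, in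
    columns. *)
Lemma square_lift (h : R -> R -> C) :
  (forall x y, unit_itv x -> unit_itv y -> Om (h x y)) ->
  (forall x y, unit_itv x -> unit_itv y -> forall e, 0 < e ->
    exists2 d, 0 < d & forall x' y', unit_itv x' -> unit_itv y' ->
      `|x' - x| < d -> `|y' - y| < d -> cabs (h x' y' - h x y) < e) ->
  exists phi, lift2 h phi 0 1 0 1.
Proof.
move=> hO hc.
have := @bisection _ (fun x y s => exists phi, lift2 h phi x (x + s) y (y + s)) 0 0 1 ltr01.
rewrite !add0r; apply.
  move=> x y s s0 x0 xs y0 ys [p1 H1] [p2 H2] [p3 H3] [p4 H4].
  have E z : z + s / 2 + s / 2 = z + s by field.
  rewrite E in H2; rewrite E in H3; rewrite !E in H4.
  have [||q1 Q1] := lift2_glue _ _ H1 H2; [lra|lra|].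
  have [||q2 Q2] := lift2_glue _ _ H3 H4; [lra|lra|].
  have [||q Q] := lift2_glue _ _ (lift2_swap Q1) (lift2_swap Q2); [lra|lra|].
  by exists (fun x y => q y x); exact: (lift2_swap Q).
move=> a b ab bb; have Op := hO _ _ ab bb.
have [d d0 dH] := hc a b ab bb _ (rad_gt0 Op).
exists d => // x y s /andP[s0 sd] x0 xs y0 ys xa yb.
exists (fun x y => g (h a b) (h x y)); apply: lift_local => //.
  move=> x' y' hx' hy'; apply: dH; rewrite ?/unit_itv ?ltr_norml; lra.
move=> x' y' hx' hy' e e0.
have [||d' d'0 d'H] := hc x' y' _ _ e e0; rewrite ?/unit_itv; [lra|lra|].
exists d' => // u v hu hv; apply: d'H; rewrite /unit_itv; lra.
Qed.

(** The null-homotopy of the loop is lifted over the square. The lift is constant on the three sides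
    where the homotopy is constant, and on the fourth it differs from [phi] by a constant. *)
Lemma loop_lift (h : R -> R -> C) (c phi : R -> C) :
  (forall x y, unit_itv x -> unit_itv y -> Om (h x y)) ->
  (forall x y, unit_itv x -> unit_itv y -> forall e, 0 < e ->
    exists2 d, 0 < d & forall x' y', unit_itv x' -> unit_itv y' ->
      `|x' - x| < d -> `|y' - y| < d -> cabs (h x' y' - h x y) < e) ->
  (forall t, unit_itv t -> h 0 t = c t /\ h 1 t = c 0) ->
  (forall s, unit_itv s -> h s 0 = c 0 /\ h s 1 = c 0) ->
  lift1 c phi -> phi 0 = phi 1.
Proof.
move=> hO hc h01 h10 cphi; have [psi Hpsi] := square_lift hO hc.
have u0 : unit_itv 0 by rewrite /unit_itv lexx ler01.
have u1 : unit_itv 1 by rewrite /unit_itv lexx ler01.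
have inc0 z : inc z z = 0 by rewrite /inc subrr.
have e1 : psi 0 0 = psi 1 0.
  apply: (@loc_const (fun s => psi s 0)) => // t t01.
  have [d d0 dH] := Hpsi t 0 t01 u0; exists d => // s s01 sd.
  have := dH s 0 s01 u0 sd; rewrite subrr normr0 => /(_ d0).
  by have [-> _] := h10 t t01; have [-> _] := h10 s s01; rewrite inc0 => /subr0_eq.
have e2 : psi 0 1 = psi 1 1.
  apply: (@loc_const (fun s => psi s 1)) => // t t01.
  have [d d0 dH] := Hpsi t 1 t01 u1; exists d => // s s01 sd.
  have := dH s 1 s01 u1 sd; rewrite subrr normr0 => /(_ d0).
  by have [_ ->] := h10 t t01; have [_ ->] := h10 s s01; rewrite inc0 => /subr0_eq.
have e3 : psi 1 0 = psi 1 1.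
  apply: (@loc_const (fun s => psi 1 s)) => // t t01.
  have [d d0 dH] := Hpsi 1 t u1 t01; exists d => // s s01 sd.
  have := dH 1 s u1 s01; rewrite subrr normr0 => /(_ d0 sd).
  by have [_ ->] := h01 t t01; have [_ ->] := h01 s s01; rewrite inc0 => /subr0_eq.
have e4 : phi 0 - psi 0 0 = phi 1 - psi 0 1.
  apply: (@loc_const (fun s => phi s - psi 0 s)) => // t t01.
  have [d1 d10 H1] := Hpsi 0 t u0 t01; have [d2 d20 H2] := cphi t t01.
  exists (Num.min d1 d2); first by rewrite lt_min d10.
  move=> s s01; rewrite lt_min => /andP[sd1 sd2].
  have := H1 0 s u0 s01; rewrite subrr normr0 => /(_ d10 sd1).
  have [-> _] := h01 t t01; have [-> _] := h01 s s01.
  rewrite -(H2 s s01 sd2) => E; apply/eqP; rewrite -subr_eq0; apply/eqP.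
  transitivity ((phi s - phi t) - (psi 0 s - psi 0 t)); first by ring.
  by rewrite E subrr.
by apply: (addIr (- psi 0 0)); rewrite e4 e1 e3 -e2.
Qed.

Lemma within_pcont (c : R -> C) : {within I01, continuous c} <-> pcont c.
Proof.
split=> [/subspace_continuousP H e e0 t t01|H].
  have : nbhs (c t) [set w | cabs (w - c t) < e] by apply/nbhsCP; exists e.
  by move=> /(H t t01) /nbhsRP[d d0 dH]; exists d => // s s01 sd; exact: (dH s sd).
apply/subspace_continuousP => t t01 A /nbhsCP[e e0 eA].
have [d d0 dH] := H e e0 t t01.
apply/nbhsRP; exists d => // s sd s01; apply: eA; exact: dH.
Qed.

Definition lpath (c phi : R -> C) : Prop :=
  [/\ pcont c, forall t, unit_itv t -> Om (c t) & lift1 c phi].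

Definition concat (c c' : R -> C) (t : R) : C :=
  if t <= 1 / 2 then c (2 * t) else c' (2 * t - 1).

Lemma concat_ge c c' t : c 1 = c' 0 -> 1 / 2 <= t -> concat c c' t = c' (2 * t - 1).
Proof.
rewrite /concat => E t2; case: ifP => // t2'.
have -> : t = 1 / 2 by apply/eqP; rewrite eq_le t2 t2'.
have -> : 2 * (1 / 2) - 1 = 0 :> R by field.
by have -> : 2 * (1 / 2) = 1 :> R by field.
Qed.

Lemma concat0 c c' : concat c c' 0 = c 0.
Proof. by rewrite /concat mulr0 divr_ge0. Qed.

Lemma concat1 c c' : concat c c' 1 = c' 1.
Proof.
rewrite /concat ifF; first by congr c'; ring.
by apply/negbTE; rewrite -ltNge; lra.
Qed.

Lemma lpath_concat c phi c' phi' : lpath c phi -> lpath c' phi' ->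
  c 1 = c' 0 -> phi 1 = phi' 0 -> lpath (concat c c') (concat phi phi').
Proof.
move=> [cc cO cl] [cc' cO' cl'] E1 E2; split.
- move=> e e0; apply: (loc_concat (cc e e0) (cc' e e0)).
    by move=> t s /andP[_ t2] /andP[_ s2]; rewrite /concat t2 s2.
  by move=> t s /andP[t2 _] /andP[s2 _]; rewrite !concat_ge.
- move=> t /andP[t0 t1]; have [t2|t2] := leP t (1 / 2).
    by rewrite /concat t2; apply: cO; rewrite /unit_itv; lra.
  by rewrite concat_ge// ?ltW//; apply: cO'; rewrite /unit_itv; lra.
- apply: (loc_concat cl cl').
    by move=> t s /andP[_ t2] /andP[_ s2]; rewrite /concat t2 s2.
  by move=> t s /andP[t2 _] /andP[s2 _]; rewrite !concat_ge.
Qed.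

Lemma loc_rev (Q : R -> R -> Prop) : loc Q -> loc (fun t s => Q (1 - t) (1 - s)).
Proof.
move=> H t t01; have [|d d0 dH] := H (1 - t); first by move: t01; rewrite /unit_itv; lra.
exists d => // s s01 sd; apply: dH; first by move: s01; rewrite /unit_itv; lra.
by rewrite opprB addrC addrA subrK distrC.
Qed.

Lemma lpath_rev c phi : lpath c phi -> lpath (fun t => c (1 - t)) (fun t => phi (1 - t)).
Proof.
move=> [cc cO cl]; split.
- by move=> e e0; exact: (loc_rev (cc e e0)).
- by move=> t t01; apply: cO; move: t01; rewrite /unit_itv; lra.
- exact: (loc_rev cl).
Qed.

Lemma lpath_shift c phi K : lpath c phi -> lpath c (fun t => phi t + K).
Proof.
move=> [cc cO cl]; split => // t t01; have [d d0 dH] := cl t t01; exists d => // s s01 sd.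
by rewrite -(dH s s01 sd); ring.
Qed.

Lemma lpath_segment p x y : Om p -> disc p (rad p) x -> disc p (rad p) y ->
  lpath (fun t => x + rc t * (y - x)) (fun t => g p (x + rc t * (y - x))).
Proof.
move=> Op px py; have c0 : pcont (fun t => x + rc t * (y - x)).
  move=> e e0 t t01; have e20 : 0 < e / 2 by rewrite divr_gt0.
  have [r r0 rH] := cdiff_near (cdiff_line x (y - x) t) e20.
  by exists r => // s _ /rH; lra.
split => //.
  by move=> t t01; have [] := gP Op (disc_convex px py t01).
have H : lift2 (fun t _ => x + rc t * (y - x)) (fun t _ => g p (x + rc t * (y - x))) 0 1 0 0.
  apply: (@lift_local (fun t _ => x + rc t * (y - x)) p) => // [t u t01 _|t u t01 _ e e0].
    exact: disc_convex.
  have [d d0 dH] := c0 e e0 t t01; exists d => // s _ s01 _ sd _; exact: dH.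
move=> t t01; have [|d d0 dH] := H t 0 t01; first by rewrite lexx.
exists d => // s s01 sd; apply: (dH s 0 s01) => //; first by rewrite lexx.
by rewrite subrr normr0.
Qed.

Hypothesis null_loop : forall c phi, lpath c phi -> c 0 = c 1 -> phi 0 = phi 1.
Variable z0 : C.
Hypothesis Oz0 : Om z0.
Hypothesis oO : open Om.
Hypothesis cO : connected Om.

Definition reach (z v : C) : Prop := exists c phi,
  [/\ lpath c phi, c 0 = z0, c 1 = z, phi 0 = 0 & phi 1 = v].

(** One path followed by the reverse of the other is a loop, and the lift along a loop closes up. *)
Lemma reach_unique z v v' : reach z v -> reach z v' -> v = v'.
Proof.
move=> [c [phi [H c0 c1 p0 p1]]] [c' [phi' [H' c'0 c'1 p'0 p'1]]].
have H2 := lpath_shift (v - v') (lpath_rev H').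
have := null_loop (lpath_concat H H2 _ _).
rewrite !concat0 !concat1 /= subr0 subrr c1 c'1 p1 p'1 c0 c'0 p0 p'0.
have E : v = v' + (v - v') by ring.
by move=> /(_ erefl E erefl); rewrite add0r => /esym /subr0_eq.
Qed.

Lemma reach_ext p x y v : Om p -> disc p (rad p) x -> disc p (rad p) y ->
  reach x v -> reach y (v + (g p y - g p x)).
Proof.
move=> Op px py [c [phi [H c0 c1 p0 p1]]].
have H2 := lpath_shift (v - g p x) (lpath_segment Op px py).
have E (x' y' : C) : x' + rc 0 * (y' - x') = x' by rewrite rc0 mul0r addr0.
have E' (x' y' : C) : x' + rc 1 * (y' - x') = y' by rewrite rc1 mul1r addrC subrK.
have := lpath_concat H H2; rewrite E c1 p1 => /(_ erefl).
have -> : g p x + (v - g p x) = v by ring.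
move=> /(_ erefl) H3; do 2 eexists; split; first exact: H3.
all: rewrite ?concat0 ?concat1 // E'; ring.
Qed.

(** The primitive at z is the value reached by continuation along any path from [z0]; near z it
    differs from the local primitive by a constant. *)
Lemma primitive_of_lifts : exists G : C -> C, G z0 = 0 /\
  forall z, Om z -> hasD G z (f z).
Proof.
have R0 : reach z0 0.
  have H := lpath_segment Oz0 (disc_center _ (rad_gt0 Oz0)) (disc_center _ (rad_gt0 Oz0)).
  do 2 eexists; split; first exact: (lpath_shift (- g z0 z0) H).
  all: rewrite ?rc0 ?subrr ?mulr0 ?addr0 ?subrr //.
have Rz z : Om z -> exists v, reach z v.
  apply: (connected_ind oO cO Oz0 (P := fun z => exists v, reach z v)).
    by exists 0.
  move=> p Op; exists (rad p); first exact: rad_gt0.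
  split; first by move=> w /(gP Op)[].
  by move=> x y px py [v Hv]; exists (v + (g p y - g p x)); exact: reach_ext Hv.
pose G z := xget 0 [set v | reach z v].
have GE z v : reach z v -> G z = v.
  move=> Hv; rewrite /G; case: xgetP => [w _ Hw|/(_ v)]; last by [].
  exact: reach_unique Hw Hv.
exists G; split; first exact: GE.
move=> z Oz; have [v Hv] := Rz z Oz.
have zz := disc_center z (rad_gt0 Oz).
have [_ Hg] := gP Oz zz.
have := hasDD Hg (hasD_cst (v - g z z) z); rewrite addr0.
apply: (near_hasD (@disc_open _ z (rad z)) zz) => w zw.
rewrite (GE _ _ (reach_ext Oz zz zw Hv)); ring.
Qed.

End Lifts.

Lemma within_square (h : R * R -> C) : {within I01 `*` I01, continuous h} ->
  forall x y, unit_itv x -> unit_itv y -> forall e, 0 < e ->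
    exists2 d, 0 < d & forall x' y', unit_itv x' -> unit_itv y' ->
      `|x' - x| < d -> `|y' - y| < d -> cabs (h (x', y') - h (x, y)) < e.
Proof.
move=> /subspace_continuousP H x y x01 y01 e e0.
have : nbhs (h (x, y)) [set w | cabs (w - h (x, y)) < e] by apply/nbhsCP; exists e.
move=> /(H (x, y) (conj x01 y01)) /nbhs_ballP[d /= d0 dH]; exists d => // x' y' x'01 y'01 xd yd.
by apply: (dH (x', y')) => //; split; rewrite -ball_normE /= distrC.
Qed.

Lemma global_primitive (Om : set C) (z0 : C) (f : C -> C) :
  open Om -> simply_connected Om -> Om z0 -> hol Om f ->
  exists G : C -> C, G z0 = 0 /\ forall z, Om z -> hasD G z (f z).
Proof.
move=> oO [cO sO] Oz0 Hf.
have /choice[lp lpP] : forall z, exists p : R * (C -> C), Om z -> 0 < p.1 /\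
    forall w, disc z p.1 w -> Om w /\ hasD p.2 w (f w).
  move=> z; have [Oz|nOz] := pselect (Om z); last by exists (0, f).
  have [r r0 rO] := nbhsS oO Oz.
  have [|g Hg] := @local_primitive _ f z r r0.
    by move=> w wr; exists (der f w); apply/Hf/rO.
  exists (r / 3, g) => _; split; first by rewrite divr_gt0.
  by move=> w wr; split; [apply: rO; move: wr; rewrite /disc /=; lra|exact: Hg].
have rad0 z : Om z -> 0 < (lp z).1 by move=> /lpP[].
have gP z w : Om z -> disc z (lp z).1 w -> Om w /\ hasD (lp z).2 w (f w).
  by move=> /lpP[_ H] /H.
apply: (primitive_of_lifts rad0 gP _ Oz0 oO cO).
move=> c phi [cc cO' cl] c01.
have [|h [hc hO h1 h2]] := sO c ((within_pcont c).2 cc) cO'; first exact: c01.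
apply: (loop_lift rad0 gP (h := fun x y => h (x, y)) _ _ h1 h2 cl).
- by move=> x y x01 y01; apply: hO.
- exact: within_square.
Qed.

Section PathIntegral.
Variable Om : set C.

Lemma pw_path_cat x y z p q : pw_path Om x y p -> pw_path Om y z q ->
  pw_path Om x z (p ++ q).
Proof.
elim: p x => [|c p IH] x /=; first by move=> ->.
by move=> [c1 c2 c3 Hp] Hq; split => //; exact: IH.
Qed.

Lemma pw_path_segment p r x y : disc p r `<=` Om -> disc p r x -> disc p r y ->
  pw_path Om x y [:: (fun t => x + rc t * (y - x))].
Proof.
move=> pO px py; split; last by rewrite /= rc1 mul1r addrC subrK.
- have /all_and2[D1 D2] t := (cdiff_parts _ _ _).1 (cdiff_line x (y - x) t).
  split.
  + by move=> t; have [] := D1 t.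
  + have -> : (fun u => complex.Re (x + rc u * (y - x)))^`()%classic = fun=> complex.Re (y - x).
      by apply/funext => t; rewrite derive1E; have [_ ->] := D1 t.
    exact: cst_continuous.
  + by move=> t; have [] := D2 t.
  + have -> : (fun u => complex.Im (x + rc u * (y - x)))^`()%classic = fun=> complex.Im (y - x).
      by apply/funext => t; rewrite derive1E; have [_ ->] := D2 t.
    exact: cst_continuous.
- by move=> t t01; apply: pO; exact: disc_convex.
- by rewrite rc0 mul0r addr0.
Qed.

Lemma pw_path_exists z0 z : open Om -> connected Om -> Om z0 -> Om z ->
  exists p, pw_path Om z0 z p.
Proof.
move=> oO cO Oz0; apply: (connected_ind oO cO Oz0 (P := fun z => exists p, pw_path Om z0 z p)).
  by exists [::].
move=> p Op; have [r r0 rO] := nbhsS oO Op; exists r => //; split; first exact: rO.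
move=> x y px py [q Hq]; exists (q ++ [:: (fun t => x + rc t * (y - x))]).
by apply: pw_path_cat Hq _; exact: pw_path_segment rO px py.
Qed.

Lemma C1_curve_cdiff (c : R -> C) t : C1_curve c -> cdiff c t (cderive c t).
Proof.
move=> [d1 _ d2 _]; apply/cdiff_parts; rewrite /cderive !derive1E.
by split; split.
Qed.

Lemma arc_ftc (f G : C -> C) (c : R -> C) : C1_curve c ->
  (forall t, I01 t -> Om (c t)) ->
  (forall z, Om z -> hasD G z (f z) /\ zcont f z) ->
  cint 0 1 (fun t => f (c t) * cderive c t) = G (c 1) - G (c 0).
Proof.
(* The curve is known to stay in [Om] only for parameters in [0,1]; [k] clamps the parameter there,
   which makes the integrand continuous on the whole line. *)
move=> Cc cO HG; pose k (t : R) := 1 / 2 + clip (1 / 2) (t - 1 / 2).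
have p2 : 0 <= 1 / 2 :> R by rewrite divr_ge0.
have k01 t : I01 (k t).
  by rewrite /I01 /= /k; have := clip_bound (t - 1 / 2) p2; rewrite ler_norml; lra.
have kid t : 0 <= t <= 1 -> k t = t.
  move=> t01; rewrite /k clip_id; first by ring.
  by rewrite ler_norml; lra.
have ck (u : R -> C) : ccont u -> ccont (fun t => u (k t)).
  move=> /ccontP cu; apply/ccontP => t e e0; have [d d0 dH] := cu (k t) e e0.
  exists d => // s sd; apply: dH; apply: le_lt_trans sd.
  have -> : s - t = (s - 1 / 2) - (t - 1 / 2) by ring.
  by rewrite /k opprD addrACA subrr add0r clip_lip.
have cc : ccont c by apply: ccont_cdiff => t; exact: C1_curve_cdiff.
have cdc : ccont (cderive c) by apply/ccont_parts; have [] := Cc.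
have cF : ccont (fun t => f (c (k t)) * cderive c (k t)).
  apply: ccontM; last exact: ck.
  apply: ccont_comp; last exact: ck.
  by move=> t; have [] := HG _ (cO _ (k01 t)).
rewrite (@eq_cint _ 0 1 _ (fun t => f (c (k t)) * cderive c (k t))); last first.
  by move=> t t01; rewrite kid.
rewrite cint_sint// (@sint_ftc_itv _ 0 1 _ (fun t => G (c t)))// => t t01.
rewrite kid//; apply: hasD_curve; first by have [] := HG _ (cO t t01).
exact: C1_curve_cdiff.
Qed.

Lemma line_int_ftc n (f : C -> 'cV[C]_n) (G : C -> 'cV[C]_n) x y p :
  (forall z, Om z -> forall r, hasD (fun v => G v r 0) z (f z r 0) /\
     zcont (fun v => f v r 0) z) ->
  pw_path Om x y p -> line_int f p = G y - G x.
Proof.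
move=> HG Hp; apply/colP => r; rewrite !mxE.
elim: p x Hp => [|c p IH] x /=; first by move=> ->; rewrite big_nil subrr.
move=> [c1 c2 c3 Hp]; rewrite big_cons (IH _ Hp).
rewrite (arc_ftc (f := fun v => f v r 0) (G := fun v => G v r 0) c1 c2) ?c3; first by ring.
by move=> z Oz; exact: HG.
Qed.

(** All admissible paths give the same value and one exists, so the [xget] in [int_from] returns
    that value and not its default 0. *)
Lemma int_from_ftc n (f : C -> 'cV[C]_n) (G : C -> 'cV[C]_n) x y :
  open Om -> connected Om -> Om x -> Om y ->
  (forall z, Om z -> forall r, hasD (fun v => G v r 0) z (f z r 0) /\
     zcont (fun v => f v r 0) z) ->
  int_from Om x y f = G y - G x.
Proof.
move=> oO cO Ox Oy HG; have [p Hp] := pw_path_exists oO cO Ox Oy.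
rewrite /int_from; case: xgetP => [w _ Hw|/(_ (G y - G x)) []].
  by rewrite -(Hw _ Hp); exact: line_int_ftc.
by move=> q Hq; exact: line_int_ftc.
Qed.

End PathIntegral.

End Monodromy.

(** * The complex exponential and its power series *)

Section ComplexExponential.
Context {R : realType}.
Local Notation C := R[i].

Definition cexp (z : C) : C := rc (expR (complex.Re z)) * expi (complex.Im z).

Lemma cexp0 : cexp 0 = 1.
Proof. by rewrite /cexp /= expR0 expi0 mulr1. Qed.

Lemma cexpD x y : cexp (x + y) = cexp x * cexp y.
Proof. by rewrite /cexp ReD ImD expRD expiD rmorphM /=; ring. Qed.

Lemma cexpN x : cexp x * cexp (- x) = 1.
Proof. by rewrite -cexpD subrr cexp0. Qed.

Lemma cexp_neq0 x : cexp x != 0.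
Proof.
by apply/eqP => E; have := cexpN x; rewrite E mul0r => /esym/eqP; rewrite oner_eq0.
Qed.

Lemma cexp_conj x : cexp x^*%C = (cexp x)^*%C.
Proof.
rewrite /cexp conj_rcM -expiN; case: x => a b /=.
by [].
Qed.

Lemma cabs_cexp x : cabs (cexp x) = expR (complex.Re x).
Proof. by rewrite /cexp cabsM cabs_expi mulr1 cabs_real ger0_norm ?expR_ge0. Qed.

Lemma gdiff_Re (z : C) : gdiff cabs (fun w => rc (complex.Re w)) (fun h => rc (complex.Re h)) z.
Proof.
apply/gdiffP => e e0; exists 1 => // h _; rewrite -!rmorphB ReD.
have -> : complex.Re z + complex.Re h - complex.Re z - complex.Re h = 0 by ring.
by rewrite cabs_real normr0 mulr_ge0 ?cabs_ge0 // ltW.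
Qed.

Lemma gdiff_Im (z : C) : gdiff cabs (fun w => rc (complex.Im w)) (fun h => rc (complex.Im h)) z.
Proof.
apply/gdiffP => e e0; exists 1 => // h _; rewrite -!rmorphB ImD.
have -> : complex.Im z + complex.Im h - complex.Im z - complex.Im h = 0 by ring.
by rewrite cabs_real normr0 mulr_ge0 ?cabs_ge0 // ltW.
Qed.

Lemma hasD_cexp z : hasD cexp z (cexp z).
Proof.
have He : cdiff (fun t => rc (expR t)) (complex.Re z) (rc (expR (complex.Re z))).
  by apply/is_derive_cdiff; exact: is_derive_expR.
have b1 (h : C) : `|complex.Re h| <= 1 * cabs h by rewrite mul1r Re_le_cabs.
have b2 (h : C) : `|complex.Im h| <= 1 * cabs h by rewrite mul1r Im_le_cabs.
have H1 := cdiff_gcomp cabs_ge0 b1 He (gdiff_Re z).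
have H2 := cdiff_gcomp cabs_ge0 b2 (cdiff_expi (complex.Im z)) (gdiff_Im z).
have c1 (h : C) : cabs (rc (complex.Re h) * rc (expR (complex.Re z))) <=
    `|expR (complex.Re z)| * cabs h.
  by rewrite cabsM !cabs_real mulrC ler_wpM2l ?Re_le_cabs.
have c2 (h : C) : cabs (rc (complex.Im h) * (iC * expi (complex.Im z))) <= 1 * cabs h.
  by rewrite !cabsM cabs_i cabs_expi !mulr1 mul1r cabs_real Im_le_cabs.
have := gdiffM cabs_ge0 c1 c2 H1 H2.
apply: eq_gdiff => // h.
rewrite [X in _ = _ * X]complexE /cexp.
ring.
Qed.

(** As [mean_value_le], but the speed is compared with the derivative of a real function [H], as the
    induction on Taylor remainders requires. *)
Lemma mean_value_le2 (c v : R -> C) (H m : R -> R) (a b : R) : a <= b ->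
  (forall t, a <= t <= b -> cdiff c t (v t)) ->
  (forall t, a <= t <= b -> is_derive t 1 H (m t)) ->
  (forall t, a <= t <= b -> cabs (v t) <= m t) ->
  cabs (c b - c a) <= H b - H a.
Proof.
move=> ab Hc HH Hm; pose u := (c b - c a)^*%C.
pose k t := complex.Re (u * c t) - cabs u * H t.
have D (t : R) : a <= t <= b ->
    is_derive t 1 k (complex.Re (u * v t) - cabs u * m t).
  move=> tab; have /cdiff_parts[d1 _] := cdiffZ u (Hc t tab).
  have d2 := HH t tab; rewrite /k -[cabs u * m t]/(cabs u *: m t : R).
  apply: is_deriveB.
have [||x xab E] := @MVT_segment _ k (fun t => complex.Re (u * v t) - cabs u * m t) a b ab.
- by move=> x; rewrite in_itv /= => /andP[x1 x2]; apply: D; rewrite !ltW.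
- by apply: derivable_within_continuous => x; rewrite in_itv /= => /D [].
move: xab; rewrite in_itv /= => xab.
have le0 : k b - k a <= 0.
  rewrite E mulr_le0_ge0 ?subr_ge0// subr_le0.
  apply: le_trans (ler_norm _) _; apply: le_trans (Re_le_cabs _) _.
  by rewrite cabsM ler_wpM2l ?cabs_ge0 ?Hm.
have Hab : 0 <= H b - H a.
  have [||y yab ->] := @MVT_segment _ H m a b ab.
  - by move=> x'; rewrite in_itv /= => /andP[x1 x2]; apply: HH; rewrite !ltW.
  - by apply: derivable_within_continuous => x'; rewrite in_itv /= => /HH [].
  move: yab; rewrite in_itv /= => yab.
  by rewrite mulr_ge0 ?subr_ge0// (le_trans (cabs_ge0 _) (Hm _ yab)).
have [->//|n0] := eqVneq (cabs (c b - c a)) 0.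
have n0' : 0 < cabs (c b - c a) by rewrite lt_def n0 cabs_ge0.
rewrite -(ler_pM2l n0').
move: le0; rewrite /k; have -> : complex.Re (u * c b) - cabs u * H b - (complex.Re (u * c a) - cabs u * H a)
  = complex.Re (u * c b) - complex.Re (u * c a) - cabs u * (H b - H a) by ring.
by rewrite -ReB -mulrBr /u mulrC mul_conj /= cabs_conj subr_le0 expr2.
Qed.

Lemma cdiff_scale (x : C) (s : R) : cdiff (fun s => rc s * x) s x.
Proof. by apply: eq_cdiff (cdiff_line 0 x s) => // u; rewrite add0r. Qed.

Lemma cdiff_monomial (x : C) (s : R) k :
  cdiff (fun s => (rc s * x) ^+ k) s (k%:R * (rc s * x) ^+ k.-1 * x).
Proof.
elim: k => [|k IHk].
  by rewrite mul0r mul0r; apply: eq_cdiff (cdiff_cst 1 s) => // u; rewrite expr0.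
have := cdiffM (cdiff_scale x s) IHk; apply: eq_cdiff => [u|]; first by rewrite exprS.
case: k {IHk} => [|k]; first by rewrite !expr0; ring.
by rewrite /= !exprS -[k.+2%:R]natr1; ring.
Qed.

(** Induction on n along the segment from 0 to x: the derivative of a Taylor remainder is x times
    the preceding remainder. *)
Lemma cexp_taylor (x : C) n : 
  cabs (cexp x - \sum_(0 <= k < n) (k`!%:R)^-1 * x ^+ k) <=
  expR (cabs x) * (cabs x ^+ n / n`!%:R).
Proof.
suff H (t : R) : 0 <= t <= 1 ->
    cabs (cexp (rc t * x) - \sum_(0 <= k < n) (k`!%:R)^-1 * (rc t * x) ^+ k) <=
    expR (cabs x) * ((cabs x * t) ^+ n / n`!%:R).
  by have := H 1; rewrite rc1 mul1r mulr1; apply; rewrite ler01 lexx.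
elim: n t => [|n IH] t /andP[t0 t1].
  rewrite big_nil subr0 expr0 fact0 divr1 mulr1 cabs_cexp ler_expR.
  apply: le_trans (ler_norm _) _; apply: le_trans (Re_le_cabs _) _.
  by rewrite cabsM cabs_real ger0_norm// ler_piMl ?cabs_ge0.
pose c s := cexp (rc s * x) - \sum_(0 <= k < n.+1) (k`!%:R)^-1 * (rc s * x) ^+ k.
pose v s := x * (cexp (rc s * x) - \sum_(0 <= k < n) (k`!%:R)^-1 * (rc s * x) ^+ k).
pose m s := cabs x * (expR (cabs x) * ((cabs x * s) ^+ n / n`!%:R)).
pose H s := expR (cabs x) * ((cabs x * s) ^+ n.+1 / n.+1`!%:R).
have Hl := cdiff_scale x; have Dx := cdiff_monomial x.
have Dsum (s : R) j : cdiff (fun s => \sum_(0 <= k < j.+1) (k`!%:R)^-1 * (rc s * x) ^+ k) s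
    (x * \sum_(0 <= k < j) (k`!%:R)^-1 * (rc s * x) ^+ k).
  elim: j => [|j IHj].
    rewrite big_nil mulr0; apply: eq_cdiff (cdiff_cst 1 s) => // u.
    by rewrite big_nat1 fact0 expr0 invr1 mulr1.
  have := cdiffD IHj (cdiffZ ((j.+1)`!%:R)^-1 (Dx s j.+1)).
  apply: eq_cdiff => [u|]; first by rewrite [RHS]big_nat_recr.
  rewrite [in RHS]big_nat_recr //= mulrDr; congr (_ + _).
  rewrite factS natrM invfM.
  have j0 : (j.+1%:R : C) != 0 by rewrite pnatr_eq0.
  have j1 : (j`!%:R : C) != 0 by rewrite pnatr_eq0 -lt0n fact_gt0.
  move: (j.+1%:R : C) j0 (j`!%:R : C) j1 => p p0 q q0.
  by field; rewrite ?p0 ?q0.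
have := @mean_value_le2 c v H m 0 t t0.
have c0 : c 0 = 0.
  rewrite /c rc0 mul0r cexp0 big_nat_recl // fact0 expr0 invr1 mulr1 big1 ?addr0 ?subrr//.
  by move=> k _; rewrite exprS mul0r mulr0.
have H0 : H 0 = 0 by rewrite /H mulr0 exprS mul0r mul0r mulr0.
rewrite c0 H0 !subr0; apply.
- move=> s _; rewrite /c /v mulrBr; apply: cdiffB; last exact: Dsum.
  by rewrite mulrC; apply: hasD_curve; [exact: hasD_cexp|exact: Hl].
- move=> s _.
  have E : m s = expR (cabs x) * (cabs x ^+ n.+1 / n.+1`!%:R) * (n.+1%:R * s ^+ n).
    rewrite /m factS natrM exprMn.
    have j0 : (n.+1%:R : R) != 0 by rewrite pnatr_eq0.
    have j1 : (n`!%:R : R) != 0 by rewrite pnatr_eq0 -lt0n fact_gt0.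
    rewrite exprS; move: (n.+1%:R : R) j0 (n`!%:R : R) j1 => p p0 q q0.
    by field; rewrite ?p0 ?q0.
  rewrite E; apply/is_derive_cdiff.
  have := cdiffZ (rc (expR (cabs x) * (cabs x ^+ n.+1 / n.+1`!%:R))) (cdiff_monomial 1 s n.+1).
  apply: eq_cdiff => [u|]; rewrite ?mulr1.
    by rewrite -rmorphXn -rmorphM /H exprMn; congr rc; ring.
  by rewrite -rmorphXn -[n.+1%:R](rmorph_nat (real_complex R)) -!rmorphM.
- move=> s /andP[s0 st]; rewrite /v cabsM ler_wpM2l ?cabs_ge0//.
  by apply: IH; rewrite s0 (le_trans st).
Qed.

Lemma cexp_cvg (x : C) :
  series (fun n : nat => (n`!%:R)^-1 * x ^+ n) @ \oo --> cexp x.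
Proof.
apply/cvgrPdist_le => e e0.
have [k ke] : exists k, e = rc k by apply/complex_realP; exact: gtr0_real.
subst e; rewrite ltcR in e0.
have E0 : 0 < expR (cabs x) by exact: expR_gt0.
have := cvg_series_cvg_0 (is_cvg_series_exp_coeff (cabs x)).
move=> /cvgrPdist_le /(_ _ (divr_gt0 e0 E0)).
apply: filterS => n; rewrite sub0r normrN => h.
rewrite normE lecR /series /=; apply: le_trans (cexp_taylor x n) _.
rewrite mulrC -ler_pdivlMr//; apply: le_trans h.
exact: ler_norm.
Qed.

End ComplexExponential.

(** * Quaternionic multiplication matrices and the diagonalisation of [Li] *)

Section Quaternions.
Context {R : realType}.
Local Notation C := R[i].
Implicit Types (a b c d : C) (v w : 'cV[C]_4) (A B : 'M[C]_4).

Lemma quat_ext v a b c d : v (inord 0) 0 = a -> v (inord 1) 0 = b ->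
  v (inord 2) 0 = c -> v (inord 3) 0 = d -> v = quat a b c d.
Proof.
move=> <- <- <- <-; apply/colP => i; rewrite mxE.
case: i => [[|[|[|[|//]]]] Hi] /=; congr (v _ _); apply/val_inj;
  by rewrite /= inordK.
Qed.

Lemma quat_eta v : v = quat (v (inord 0) 0) (v (inord 1) 0) (v (inord 2) 0) (v (inord 3) 0).
Proof. exact: quat_ext. Qed.

Lemma qcoord_quat a b c d : [/\ qcoord (quat a b c d) 0 = a,
  qcoord (quat a b c d) 1 = b, qcoord (quat a b c d) 2 = c &
  qcoord (quat a b c d) 3 = d].
Proof. by rewrite /qcoord !mxE !inordK. Qed.

Lemma qcoord_delta (i : 'I_4) k : (k < 4)%N ->
  qcoord (delta_mx i 0 : 'cV[C]_4) k = (k == i)%:R.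
Proof. by move=> k4; rewrite /qcoord mxE eqxx andbT -val_eqE /= inordK. Qed.

Lemma quatD a b c d a' b' c' d' :
  quat a b c d + quat a' b' c' d' = quat (a + a') (b + b') (c + c') (d + d').
Proof. by apply: quat_ext; rewrite !mxE inordK. Qed.

Lemma quatZ k a b c d : k *: quat a b c d = quat (k * a) (k * b) (k * c) (k * d).
Proof. by apply: quat_ext; rewrite !mxE inordK. Qed.

Lemma quatN a b c d : - quat a b c d = quat (- a) (- b) (- c) (- d).
Proof. by apply: quat_ext; rewrite !mxE inordK. Qed.

Lemma quat_inj a b c d a' b' c' d' : quat a b c d = quat a' b' c' d' ->
  [/\ a = a', b = b', c = c' & d = d'].
Proof.
move=> E.
have [x0 x1 x2 x3] := qcoord_quat a b c d.
have [y0 y1 y2 y3] := qcoord_quat a' b' c' d'.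
by rewrite E in x0 x1 x2 x3; rewrite -x0 -x1 -x2 -x3; split.
Qed.

Lemma LqE p v : Lq p *m v = qmul p v.
Proof.
rewrite [p]quat_eta [v]quat_eta; move: (p _ _) (p _ _) (p _ _) (p _ _) => p0 p1 p2 p3.
move: (v _ _) (v _ _) (v _ _) (v _ _) => v0 v1 v2 v3.
apply/colP => r; rewrite mxE !big_ord_recl big_ord0 !mxE /qmul.
rewrite !qcoord_delta//.
have [-> -> -> ->] := qcoord_quat p3 p2 p1 p0.
have [e0 e1 e2 e3] := qcoord_quat v3 v2 v1 v0.
by case: r => [[|[|[|[|//]]]] Hr] /=; rewrite ?mxE /= ?e0 ?e1 ?e2 ?e3; ring.
Qed.

Lemma RqE p v : Rq p *m v = qmul v p.
Proof.
rewrite [p]quat_eta [v]quat_eta; move: (p _ _) (p _ _) (p _ _) (p _ _) => p0 p1 p2 p3.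
move: (v _ _) (v _ _) (v _ _) (v _ _) => v0 v1 v2 v3.
apply/colP => r; rewrite mxE !big_ord_recl big_ord0 !mxE /qmul.
rewrite !qcoord_delta//.
have [-> -> -> ->] := qcoord_quat p3 p2 p1 p0.
have [-> -> -> ->] := qcoord_quat v3 v2 v1 v0.
have [e0 e1 e2 e3] := qcoord_quat v3 v2 v1 v0.
by case: r => [[|[|[|[|//]]]] Hr] /=; rewrite ?mxE /= ?e0 ?e1 ?e2 ?e3; ring.
Qed.

Lemma Li_quat a b c d : Li *m quat a b c d = quat (- b) a (- d) c.
Proof.
rewrite LqE /qmul.
have [-> -> -> ->] := qcoord_quat (0 : C) 1 0 0.
have [-> -> -> ->] := qcoord_quat a b c d; congr quat; ring.
Qed.

Lemma Lj_quat a b c d : Lj *m quat a b c d = quat (- c) d a (- b).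
Proof.
rewrite LqE /qmul.
have [-> -> -> ->] := qcoord_quat (0 : C) 0 1 0.
have [-> -> -> ->] := qcoord_quat a b c d; congr quat; ring.
Qed.

Lemma Ri_quat a b c d : Rq qi *m quat a b c d = quat (- b) a d (- c).
Proof.
rewrite RqE /qmul.
have [-> -> -> ->] := qcoord_quat (0 : C) 1 0 0.
have [-> -> -> ->] := qcoord_quat a b c d; congr quat; ring.
Qed.

Lemma Rj_quat a b c d : Rq qj *m quat a b c d = quat (- c) (- d) a b.
Proof.
rewrite RqE /qmul.
have [-> -> -> ->] := qcoord_quat (0 : C) 0 1 0.
have [-> -> -> ->] := qcoord_quat a b c d; congr quat; ring.
Qed.

Lemma Rk_quat a b c d : Rq qk *m quat a b c d = quat (- d) c (- b) a.
Proof.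
rewrite RqE /qmul.
have [-> -> -> ->] := qcoord_quat (0 : C) 0 0 1.
have [-> -> -> ->] := qcoord_quat a b c d; congr quat; ring.
Qed.

Definition quatE := (Li_quat, Lj_quat, Ri_quat, Rj_quat, Rk_quat, quatD, quatZ, quatN).

Lemma mx_quat_ext A B : (forall a b c d, A *m quat a b c d = B *m quat a b c d) ->
  A = B.
Proof.
move=> H; apply/matrixP => i j.
have /colP/(_ i) : A *m delta_mx j 0 = B *m delta_mx j 0 :> 'cV[C]_4.
  by rewrite [delta_mx j 0]quat_eta H.
rewrite !mxE (bigD1 j)//= [X in _ + X]big1 ?addr0; last first.
  by move=> k kj; rewrite mxE (negbTE kj) mulr0.
rewrite mxE !eqxx mulr1 (bigD1 j)//= [X in _ + X]big1 ?addr0; last first.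
  by move=> k kj; rewrite mxE (negbTE kj) mulr0.
by rewrite mxE !eqxx mulr1.
Qed.

Lemma LjLj : Lj *m Lj = - 1%:M :> 'M[C]_4.
Proof.
by apply: mx_quat_ext => a b c d; rewrite -mulmxA mulNmx mul1mx !quatE; congr quat; ring.
Qed.

(** The projectors [Pp] and [Pm] have as images the eigenspaces of [Li] for i and for -i. *)
Definition Pp : 'M[C]_4 := 2^-1 *: (1%:M - iC *: Li).
Definition Pm : 'M[C]_4 := 2^-1 *: (1%:M + iC *: Li).

Lemma Pp_quat a b c d : Pp *m quat a b c d = 2^-1 *:
  quat (a + iC * b) (b - iC * a) (c + iC * d) (d - iC * c).
Proof.
rewrite /Pp -scalemxAl mulmxBl -scalemxAl mul1mx !quatE.
by congr quat; ring.
Qed.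

Lemma Pm_quat a b c d : Pm *m quat a b c d = 2^-1 *:
  quat (a - iC * b) (b + iC * a) (c - iC * d) (d + iC * c).
Proof.
rewrite /Pm -scalemxAl mulmxDl -scalemxAl mul1mx !quatE.
by congr quat; ring.
Qed.

(** The elements of the algebra generated by [Li], given by their two eigenvalues. *)
Definition Emx (x y : C) : 'M[C]_4 := x *: Pp + y *: Pm.

Lemma Emx_quat (x y : C) a b c d : Emx x y *m quat a b c d = 2^-1 *: quat
  ((x + y) * a + iC * (x - y) * b) ((x + y) * b - iC * (x - y) * a)
  ((x + y) * c + iC * (x - y) * d) ((x + y) * d - iC * (x - y) * c).
Proof.
rewrite /Emx mulmxDl -[(x *: Pp) *m _]scalemxAl -[(y *: Pm) *m _]scalemxAl Pp_quat Pm_quat !quatE.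
by congr quat; ring.
Qed.

Lemma Emx1 : Emx 1 1 = 1%:M.
Proof.
apply: mx_quat_ext => a b c d; rewrite Emx_quat mul1mx quatE.
by congr quat; field.
Qed.

Lemma EmxM (x y x' y' : C) : Emx x y *m Emx x' y' = Emx (x * x') (y * y').
Proof.
apply: mx_quat_ext => a b c d; rewrite -mulmxA !Emx_quat !quatE Emx_quat !quatE.
have H := iCiC (R := R); move: (Complex 0 1 : C) H => i H.
by congr quat; field: H.
Qed.

Lemma EmxZ (k x y : C) : k *: Emx x y = Emx (k * x) (k * y).
Proof. by rewrite /Emx scalerDr !scalerA. Qed.

Lemma EmxD (x y x' y' : C) : Emx x y + Emx x' y' = Emx (x + x') (y + y').
Proof. by rewrite /Emx addrACA -!scalerDl. Qed.

Lemma EmxN (x y : C) : - Emx x y = Emx (- x) (- y).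
Proof. by rewrite -scaleN1r EmxZ !mulN1r. Qed.

Lemma Emx0 : Emx 0 0 = 0.
Proof. by rewrite /Emx !scale0r addr0. Qed.

Lemma Li_Emx : Li = Emx iC (- iC) :> 'M[C]_4.
Proof.
apply: mx_quat_ext => a b c d; rewrite Emx_quat !quatE.
have H := iCiC (R := R); move: (Complex 0 1 : C) H => i H.
by congr quat; field: H.
Qed.

(** [Lj] anticommutes with [Li] and so exchanges its eigenspaces; this is how tau acts on linear
    parts. *)
Lemma Lj_Emx (x y : C) : Lj *m Emx x y = Emx y x *m Lj.
Proof.
apply: mx_quat_ext => a b c d; rewrite -!mulmxA Emx_quat !quatE Emx_quat !quatE.
congr quat; ring.
Qed.

Lemma Emx_tau (x y : C) : - (Lj *m Emx x y *m Lj) = Emx y x.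
Proof. by rewrite Lj_Emx -mulmxA LjLj mulmxN mulmx1 opprK. Qed.

Lemma EmxX (x y : C) n : Emx x y ^+ n = Emx (x ^+ n) (y ^+ n).
Proof.
elim: n => [|n IH]; first by rewrite !expr0 Emx1.
by rewrite !exprS IH; exact: EmxM.
Qed.

Lemma Emx_unit (x y : C) : x != 0 -> y != 0 ->
  Emx x y \in unitmx /\ invmx (Emx x y) = Emx x^-1 y^-1.
Proof.
move=> x0 y0; have H : Emx x^-1 y^-1 *m Emx x y = 1%:M.
  by rewrite EmxM !mulVf // Emx1.
have [_ U] := mulmx1_unit H; split => //.
by rewrite -[LHS]mul1mx -H -mulmxA mulmxV// mulmx1.
Qed.

Lemma expmx_Li (z : C) : expmx (z *: Li) = Emx (cexp (iC * z)) (cexp (- iC * z)).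
Proof.
rewrite /expmx; apply: cvg_lim => //.
have -> : series (fun n : nat => (n`!%:R : C)^-1 *: (z *: Li : 'M[C]_4) ^+ n) =
  fun n => series (fun n : nat => (n`!%:R)^-1 * (iC * z) ^+ n) n *: Pp +
           series (fun n : nat => (n`!%:R)^-1 * (- iC * z) ^+ n) n *: Pm.
  apply/funext => n; rewrite /series /= !scaler_suml -big_split /=.
  apply: eq_bigr => k _.
  by rewrite Li_Emx EmxZ EmxX EmxZ ![z * _]mulrC.
apply: cvgD; apply: cvgZl; exact: cexp_cvg.
Qed.

End Quaternions.

(** * Real functions of class C^1, and boundedness on compact sets *)

Section RealC1.
Context {R : realType}.
Local Notation C := R[i].

Lemma pd_line (f : C -> R) (p w : C) (s : R) : pderivable w f (p + rc s * w) ->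
  cdiff (fun u => rc (f (p + rc u * w))) s (rc (pd w f (p + rc s * w))).
Proof.
move=> Hf; have : cdiff (fun u => rc (f ((p + rc s * w) + rc u * w))) 0
    (rc (pd w f (p + rc s * w))).
  by apply/is_derive_cdiff; rewrite /pd derive1E; split.
move=> /cdiffP H; apply/cdiffP => e e0; have [r r0 rH] := H e e0.
exists r => // h hr; have := rH h hr; rewrite add0r rc0 mul0r addr0.
by have -> : p + rc s * w + rc h * w = p + rc (s + h) * w by rewrite rmorphD; ring.
Qed.

Lemma Ck_cont k (Om : set C) f : Ck k Om f -> forall z, Om z -> {for z, continuous f}.
Proof. by case: k => [|k] []. Qed.

Lemma pd_increment (f : C -> R) (p w : C) (b e D : R) :
  (forall t : R, 0 <= t <= 1 -> pderivable w f (p + rc (b * t) * w) /\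
    `|pd w f (p + rc (b * t) * w) - D| <= e) ->
  `|f (p + rc b * w) - f p - b * D| <= e * `|b|.
Proof.
move=> H.
pose c t := rc (f (p + rc (0 + b * t) * w)) - rc t * rc (b * D).
have := @mean_value_le _ c
  (fun t => rc b * rc (pd w f (p + rc (0 + b * t) * w)) - rc (b * D)) 0 1 (e * `|b|) ler01.
rewrite /c subr0 mulr1 mulr0 mulr1 !add0r rc0 !mul0r subr0 addr0 rc1 mul1r => M.
have -> : `|f (p + rc b * w) - f p - b * D| =
    cabs (rc (f (p + rc b * w)) - rc (b * D) - rc (f p)).
  by rewrite -!rmorphB cabs_real; congr (`|_|); ring.
apply: M => t t01.
  apply: cdiffB; last first.
    by apply: eq_cdiff (cdiff_line 0 (rc (b * D)) t) => // u; rewrite add0r.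
  apply: (cdiff_affine (c := fun u => rc (f (p + rc u * w)))).
  by apply: pd_line; rewrite add0r; have [] := H t t01.
have [_ Ht] := H t t01; rewrite add0r -rmorphM -rmorphB cabs_real -mulrBr normrM.
by rewrite [leRHS]mulrC ler_wpM2l.
Qed.

(** The increment is made of a horizontal and a vertical step, each controlled by the continuity of
    one partial derivative. *)
Lemma C1_wdiff k (Om : set C) f z : open Om -> Ck k.+1 Om f -> Om z ->
  wdiff (fun w => rc (f w)) z (2^-1 * (rc (pd 1 f z) - iC * rc (pd iC f z)))
    (2^-1 * (rc (pd 1 f z) + iC * rc (pd iC f z))).
Proof.
move=> oO [_ [Hd /Ck_cont c1 /Ck_cont c2]] Oz; apply/gdiffP => e e0.
have e20 : 0 < e / 2 by rewrite divr_gt0.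
have [r r0 rO] := nbhsS oO Oz.
have [d1 d10 H1] := (continuousCRP _ _).1 (c1 z Oz) _ e20.
have [d2 d20 H2] := (continuousCRP _ _).1 (c2 z Oz) _ e20.
(* Half of the radius, since the points along the two steps are at distance at most |a| + |b| <= 2
   |h| from z. *)
pose d := Num.min r (Num.min d1 d2) / 2.
have m0 : 0 < Num.min r (Num.min d1 d2) by rewrite !lt_min r0 d10.
have d0 : 0 < d by rewrite divr_gt0.
have near w : cabs (w - z) < 2 * d -> [/\ Om w, `|pd 1 f w - pd 1 f z| <= e / 2 &
    `|pd iC f w - pd iC f z| <= e / 2].
  rewrite /d mulrC divfK ?pnatr_eq0// !lt_min => /and3P[a1 a2 a3].
  by split; [exact: rO|apply/ltW/H1|apply/ltW/H2].
exists d => // -[a b] hd; set h := Complex a b.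
have ha := Re_le_cabs h; have hb := Im_le_cabs h; rewrite /= in ha hb.
have t_le (x t : R) : 0 <= t <= 1 -> `|x * t| <= `|x|.
  by move=> /andP[t0 t1]; rewrite normrM (ger0_norm t0) ler_piMr.
have A1 : `|f (z + rc a * 1) - f z - a * pd 1 f z| <= e / 2 * `|a|.
  apply: pd_increment => t t01.
  have [|n1 n2 n3] := near (z + rc (a * t) * 1).
    rewrite addrAC subrr add0r mulr1 cabs_real.
    by apply: le_lt_trans (t_le _ _ t01) _; rewrite -/h in hd; lra.
  by split => //; have [] := Hd _ n1.
have A2 : `|f (z + rc a * 1 + rc b * iC) - f (z + rc a * 1) - b * pd iC f z| <= e / 2 * `|b|.
  apply: pd_increment => t t01.
  have [|n1 n2 n3] := near (z + rc a * 1 + rc (b * t) * iC).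
    have -> : z + rc a * 1 + rc (b * t) * iC - z = rc a + rc (b * t) * iC by ring.
    apply: le_lt_trans (cabsD _ _) _; rewrite cabsM cabs_i mulr1 !cabs_real.
    have := t_le b t t01; rewrite -/h in hd; lra.
  by split => //; have [] := Hd _ n1.
have hE : h = rc a + iC * rc b by exact: (complexE h).
have hE' : h^*%C = rc a - iC * rc b.
  by rewrite /h -!complexr0; simpc.
have zh : z + h = z + rc a * 1 + rc b * iC by rewrite hE; ring.
rewrite zh hE' hE.
have i2 := iCiC (R := R).
have -> : rc (f (z + rc a * 1 + rc b * iC)) - rc (f z) -
   (2^-1 * (rc (pd 1 f z) - iC * rc (pd iC f z)) * (rc a + iC * rc b) +
    2^-1 * (rc (pd 1 f z) + iC * rc (pd iC f z)) * (rc a - iC * rc b)) =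
  rc ((f (z + rc a * 1 + rc b * iC) - f (z + rc a * 1) - b * pd iC f z) +
      (f (z + rc a * 1) - f z - a * pd 1 f z)).
  move: (f (z + rc a * 1 + rc b * iC)) (f (z + rc a * 1)) (f z) (pd 1 f z) (pd iC f z) => u1 u2 u3 u4 u5.
  rewrite !(rmorphD, rmorphB, rmorphM) /=; move: (Complex 0 1 : C) i2 => i i2; by field: i2.
rewrite cabs_real -hE; apply: le_trans (ler_normD _ _) _; rewrite -/h in hd.
have l1 : e / 2 * `|a| <= e / 2 * cabs h by rewrite ler_wpM2l// ltW.
have l2 : e / 2 * `|b| <= e / 2 * cabs h by rewrite ler_wpM2l// ltW.
lra.
Qed.

(** Class C^1 gives real differentiability; when the conj z derivative vanishes, the other Wirtinger
    derivative is a complex derivative. *)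
Lemma hol_of_conjugates (Om : set C) (beta gamma : C -> R) : open Om ->
  Ck 2 Om beta -> Ck 2 Om gamma ->
  (forall z, Om z -> dzb (fun w => Complex (beta w) (gamma w)) z = 0) ->
  hol Om (fun w => Complex (beta w) (gamma w)).
Proof.
move=> oO Cb Cg Hc; apply: holP => z Oz.
have H1 := C1_wdiff oO Cb Oz; have H2 := C1_wdiff oO Cg Oz.
have H := wdiffD H1 (wdiffM (wdiff_cst iC z) H2).
have {}H := eq_wdiff (g := fun w => Complex (beta w) (gamma w)) _ erefl erefl H.
have {}H := H (fun w => esym (complexE (Complex (beta w) (gamma w)))).
move: (H) => /wdiff_dzb; rewrite (Hc z Oz) => E.
eexists; apply/hasD_wdiff; rewrite E; exact: H.
Qed.

(** Bisection of a large square. The second hypothesis says that [S] is closed: small squares around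
    a point outside [S] miss it, and around a point of [S] continuity gives a bound. *)
Lemma closed_bounded (S : set C) (f : C -> C) (L : R) :
  (forall z, S z -> zcont f z) ->
  (forall z, ~ S z -> exists2 d : R, 0 < d & forall w, cabs (w - z) < d -> ~ S w) ->
  exists2 M, 0 < M & forall z, S z -> cabs z <= L -> cabs (f z) <= M.
Proof.
move=> cf Scl; pose K := `|L| + 1; have K0 : 0 < K by rewrite ltr_wpDl.
have K20 : 0 < 2 * K by rewrite mulr_gt0.
have [||M M0 H] := @bisection _ (fun x y s => exists2 M, 0 < M &
  forall u v, x <= u <= x + s -> y <= v <= y + s -> S (Complex u v) ->
  cabs (f (Complex u v)) <= M) (- K) (- K) (2 * K) K20.
- move=> x y s s0 _ _ _ _ [M1 m1 H1] [M2 m2 H2] [M3 m3 H3] [M4 m4 H4].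
  exists (M1 + M2 + M3 + M4) => [|u v /andP[u1 u2] /andP[v1 v2] Suv]; first lra.
  have [us|us] := leP u (x + s / 2); have [vs|vs] := leP v (y + s / 2).
  + have : cabs (f (Complex u v)) <= M1 by apply: H1 => //; lra.
    lra.
  + have : cabs (f (Complex u v)) <= M3 by apply: H3 => //; lra.
    lra.
  + have : cabs (f (Complex u v)) <= M2 by apply: H2 => //; lra.
    lra.
  + have : cabs (f (Complex u v)) <= M4 by apply: H4 => //; lra.
    lra.
- move=> a b _ _.
  have near (d x y s u v : R) : 0 < d -> 0 < s < d / 2 -> x <= a <= x + s ->
      y <= b <= y + s -> x <= u <= x + s -> y <= v <= y + s ->
      cabs (Complex u v - Complex a b) < d.
    move=> d0 /andP[s0 sd] xa yb hu hv; apply: le_lt_trans (cabs_le _) _; rewrite ReB ImB /=.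
    have : `|u - a| <= s by rewrite ler_norml; lra.
    have : `|v - b| <= s by rewrite ler_norml; lra.
    lra.
  have [Sab|nSab] := pselect (S (Complex a b)).
    have [d d0 dH] := (zcontP _ _).1 (cf _ Sab) _ ltr01.
    exists (d / 2) => [|x y s sd _ _ _ _ xa yb]; first by rewrite divr_gt0.
    exists (cabs (f (Complex a b)) + 1); first by rewrite ltr_wpDl// cabs_ge0.
    move=> u v hu hv _; have /dH := near d x y s u v d0 sd xa yb hu hv.
    have := cabs_subr_ge (f (Complex u v)) (f (Complex a b)); lra.
  have [d d0 dH] := Scl _ nSab.
  exists (d / 2) => [|x y s sd _ _ _ _ xa yb]; first by rewrite divr_gt0.
  exists 1 => // u v hu hv Suv.
  by have /dH := near d x y s u v d0 sd xa yb hu hv.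
exists M => // -[u v] Suv hz.
have := le_trans (Re_le_cabs (Complex u v)) hz; have := le_trans (Im_le_cabs (Complex u v)) hz.
rewrite /= !ler_norml => hv hu; have := ler_norm L => hL.
by apply: H => //; rewrite /K; lra.
Qed.

Lemma zcont_bounded (f : C -> C) (L : R) : (forall z, zcont f z) ->
  exists2 M, 0 < M & forall z, cabs z <= L -> cabs (f z) <= M.
Proof.
move=> cf; have [z _|z /(_ I) []|M M0 HM] := @closed_bounded setT f L; first exact: cf.
by exists M => // z; exact: HM.
Qed.

Lemma circle_bounded (f : C -> C) (s : R) : (forall z, cabs z = s -> zcont f z) ->
  exists2 M, 0 < M & forall z, cabs z = s -> cabs (f z) <= M.
Proof.
move=> cf; have [z /= zs|M M0 HM] := @closed_bounded [set z | cabs z = s] f s cf.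
  exists `|cabs z - s|; first by rewrite normr_gt0 subr_eq0; apply/eqP.
  move=> w wz ws; have h1 := cabs_subr_ge w z; have h2 := cabs_subr_ge z w.
  rewrite (cabs_sub z w) ws in h2; rewrite ws in h1.
  by move: wz; rewrite ltNge => /negP; apply; rewrite ler_norml; lra.
by exists M => // z zs; apply: HM => //; rewrite zs.
Qed.

End RealC1.

(** * Primitives of exp(k B) g *)

Section WeightedPrimitive.
Context {R : realType}.
Local Notation C := R[i].
Variables (Om : set C) (z0 : C).
Hypothesis oO : open Om.
Hypothesis sO : simply_connected Om.
Hypothesis Oz0 : Om z0.
Variables (B : C -> C) (g : C -> C).
Hypothesis HB : hol Om B.
Hypothesis Hg : hol Om g.

(** In use, [B] is beta + i gamma and k = th u^-2: this is the scalar form of the integral in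
    [X_loop], up to the factor u^-1. *)
Definition wprim (k : C) : C -> C := xget (fun=> 0) [set G : C -> C |
  G z0 = 0 /\ forall z, Om z -> hasD G z (cexp (k * B z) * g z)].

Lemma hol_weight k : hol Om (fun z => cexp (k * B z) * g z).
Proof.
apply: holP => z Oz; eexists; apply: hasDM (Hg Oz).
apply: hasD_comp; first exact: hasD_cexp.
apply: hasDZ; exact: HB.
Qed.

Lemma wprimP k : wprim k z0 = 0 /\
  forall z, Om z -> hasD (wprim k) z (cexp (k * B z) * g z).
Proof.
have [G HG] := global_primitive oO sO Oz0 (hol_weight k).
by rewrite /wprim; case: xgetP => [G' _ //|/(_ G)].
Qed.

End WeightedPrimitive.

(** * Holomorphic dependence of these primitives on the weight *)

Section WeightedPrimitiveParameter.
Context {R : realType}.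
Local Notation C := R[i].
Variables (Om : set C) (z0 : C).
Hypothesis oO : open Om.
Hypothesis sO : simply_connected Om.
Hypothesis Oz0 : Om z0.
Variables (B : C -> C) (g : C -> C).
Hypothesis HB : hol Om B.
Hypothesis Hg : hol Om g.

Let y k z := wprim Om z0 B g k z.
Let y1 k z := wprim Om z0 B (fun z => B z * g z) k z.

Let HBg : hol Om (fun z => B z * g z).
Proof. by apply: holP => z Oz; eexists; apply: hasDM (HB Oz) (Hg Oz). Qed.

(** This is [hol_remainder] for u -> exp(u b) on the unit disc around k, where |u| is at most |k| +
    1. *)
Lemma cexp_remainder (k b h : C) (b0 : R) : cabs b <= b0 -> cabs h <= 4^-1 ->
  cabs (cexp ((k + h) * b) - cexp (k * b) - b * cexp (k * b) * h) <=
  32 * expR ((cabs k + 1) * b0) * cabs h ^+ 2.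
Proof.
move=> bb hh.
have Hd (u : C) : hasD (fun u => cexp (u * b)) u (b * cexp (u * b)).
  have := hasD_comp (g := fun u => u * b) (hasD_cexp (u * b)) (hasDM (hasD_id u) (hasD_cst b u)).
  by apply: eq_hasD => //; rewrite mul1r mulr0 addr0 mulrC.
have b00 : 0 <= b0 by exact: le_trans (cabs_ge0 _) bb.
have Hb w : disc k 1 w -> cabs (cexp (w * b)) <= expR ((cabs k + 1) * b0).
  rewrite /disc /= => wk; rewrite cabs_cexp ler_expR.
  apply: le_trans (ler_norm _) _; apply: le_trans (Re_le_cabs _) _; rewrite cabsM.
  apply: ler_pM; rewrite ?cabs_ge0//; have := cabs_subr_ge w k; lra.
have Hh : hol (disc k 1) (fun u => cexp (u * b)) by apply: holP => u _; eexists; exact: Hd.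
have := hol_remainder ltr01 Hh Hb (h := h).
by rewrite (der_hasD (Hd k)) expr1n divr1 mul1r; apply.
Qed.

Lemma hol_bounded_near (f : C -> C) z : hol Om f -> Om z -> exists2 r : R, 0 < r &
  disc z r `<=` Om /\ exists M, 0 <= M /\ forall w, disc z r w -> cabs (f w) <= M.
Proof.
move=> Hf Oz; have [r r0 rO] := nbhsS oO Oz.
have [d d0 dH] := hasD_near (Hf z Oz) ltr01.
exists (Num.min r d); first by rewrite lt_min r0.
split=> [w|]; first by rewrite /disc /= lt_min => /andP[/rO].
exists (cabs (f z) + 1); split; first by rewrite addr_ge0// cabs_ge0.
move=> w; rewrite /disc /= lt_min => /andP[_ /dH].
have := cabs_subr_ge (f w) (f z); lra.
Qed.

Lemma wprim_increment z : Om z -> exists2 r : R, 0 < r & disc z r `<=` Om /\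
  exists b0 g0, [/\ 0 <= b0, 0 <= g0 &
   forall w, disc z r w -> cabs (B w) <= b0 /\ cabs (g w) <= g0].
Proof.
move=> Oz; have [r1 r10 [r1O [b0 [b00 Hb]]]] := hol_bounded_near HB Oz.
have [r2 r20 [r2O [g0 [g00 Hg']]]] := hol_bounded_near Hg Oz.
exists (Num.min r1 r2); first by rewrite lt_min r10.
split=> [w|]; first by rewrite /disc /= lt_min => /andP[/r1O].
exists b0, g0; split => // w; rewrite /disc /= lt_min => /andP[w1 w2].
by split; [exact: Hb|exact: Hg'].
Qed.

(** Differentiation in k brings down a factor [B]. The property is carried over [Om] from [z0] by
    [connected_ind]: between nearby points the remainder in k changes by an amount of second order
    in the increment of k. *)
Lemma wprim_hasD k z : Om z -> hasD (fun k => y k z) k (y1 k z).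
Proof.
have [cO _] := sO; move=> Oz.
apply: (connected_ind oO cO Oz0 (P := fun z => hasD (fun k => y k z) k (y1 k z))) => //.
  rewrite /y1 (wprimP oO sO Oz0 HB HBg k).1.
  apply: eq_hasD (hasD_cst 0 k) => // u.
  by rewrite /y (wprimP oO sO Oz0 HB Hg u).1.
move=> {Oz}z Oz; have [r r0 [rO [b0 [g0 [b00 g00 bg]]]]] := wprim_increment Oz.
exists r => //; split => // x w zx zw /hasDP Hx; apply/hasDP => e e0.
(* The change of the remainder between x and w is at most (K - 1) |h|^2, and [d'] is chosen so that
   K |h| stays below e/2. *)
pose K := 32 * expR ((cabs k + 1) * b0) * g0 * cabs (w - x) + 1.
have K0 : 0 < K.
  rewrite ltr_wpDl// mulr_ge0 ?cabs_ge0// mulr_ge0// mulr_ge0// expR_ge0//.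
have [d d0 {}Hx] := Hx _ (divr_gt0 e0 (ltr0Sn _ 1)).
pose d' := Num.min d (Num.min 4^-1 (e / 2 / K)).
exists d' => [|h].
  by rewrite /d' !lt_min d0 /=; apply/andP; split; [rewrite invr_gt0|rewrite !divr_gt0].
rewrite !lt_min => /and3P[hd h4 hK].
pose rho v := y (k + h) v - y k v - h * y1 k v.
pose rho' v := (cexp ((k + h) * B v) - cexp (k * B v) - B v * cexp (k * B v) * h) * g v.
have Dr v : Om v -> hasD rho v (rho' v).
  move=> Ov; have h1 := (wprimP oO sO Oz0 HB Hg (k + h)).2 v Ov.
  have h2 := (wprimP oO sO Oz0 HB Hg k).2 v Ov.
  have h3 := (wprimP oO sO Oz0 HB HBg k).2 v Ov.
  apply: eq_hasD (hasDB (hasDB h1 h2) (hasDZ h h3)) => //.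
  rewrite /rho'; ring.
have := @segment_le _ rho rho' x w (32 * expR ((cabs k + 1) * b0) * g0 * cabs h ^+ 2).
move=> H; have {}H : cabs (rho w - rho x) <=
    32 * expR ((cabs k + 1) * b0) * g0 * cabs h ^+ 2 * cabs (w - x).
  apply: H => t t01; have zt := disc_convex zx zw t01; first exact/Dr/rO.
  have [bt gt] := bg _ zt; rewrite /rho' cabsM.
  have := cexp_remainder k bt (ltW h4).
  rewrite (_ : 32 * expR ((cabs k + 1) * b0) * g0 * cabs h ^+ 2 =
    32 * expR ((cabs k + 1) * b0) * cabs h ^+ 2 * g0); last by ring.
  move=> Hc.
  by apply: ler_pM; rewrite ?cabs_ge0.
have Hx' := Hx h hd.
have -> : y (k + h) w - y k w - y1 k w * h = (rho w - rho x) +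
   (y (k + h) x - y k x - y1 k x * h) by rewrite /rho; ring.
apply: le_trans (cabsD _ _) _.
suff : cabs (rho w - rho x) <= e / 2 * cabs h by lra.
apply: le_trans H _; rewrite ltr_pdivlMr// in hK.
have -> : 32 * expR ((cabs k + 1) * b0) * g0 * cabs h ^+ 2 * cabs (w - x) =
  (cabs h * (K - 1)) * cabs h by rewrite /K; ring.
apply: ler_wpM2r; first exact: cabs_ge0.
have := cabs_ge0 h; lra.
Qed.

Lemma wprim_bounded (L : R) z : Om z -> exists2 r : R, 0 < r & disc z r `<=` Om /\
  exists2 M, 0 < M & forall k w, cabs k <= L -> disc z r w -> cabs (y k w) <= M.
Proof.
move=> Oz; have [r r0 [rO [b0 [g0 [b00 g00 bg]]]]] := wprim_increment Oz.
have [M M0 HM] := @zcont_bounded _ (fun k => y k z) L (fun k => hasD_zcont (wprim_hasD k Oz)).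
exists r => //; split => //; have zz := disc_center z r0.
have L0 : 0 <= `|L| by [].
exists (M + expR (`|L| * b0) * g0 * r).
  by rewrite ltr_wpDr// !mulr_ge0 ?expR_ge0// ltW.
move=> k w kL zw.
have H := @segment_le _ (y k) (fun v => cexp (k * B v) * g v) z w (expR (`|L| * b0) * g0).
have {}H : cabs (y k w - y k z) <= expR (`|L| * b0) * g0 * cabs (w - z).
  apply: H => t t01; have zt := disc_convex zz zw t01.
    by have [_ H] := wprimP oO sO Oz0 HB Hg k; apply/H/rO.
  have [bt gt] := bg _ zt; rewrite cabsM; apply: ler_pM; rewrite ?cabs_ge0//.
  rewrite cabs_cexp ler_expR; apply: le_trans (ler_norm _) _.
  apply: le_trans (Re_le_cabs _) _; rewrite cabsM.
  by apply: ler_pM; rewrite ?cabs_ge0//; apply: le_trans kL (ler_norm _).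
have := HM k kL; have := cabs_subr_ge (y k w) (y k z).
have : expR (`|L| * b0) * g0 * cabs (w - z) <= expR (`|L| * b0) * g0 * r.
  by apply: ler_wpM2l (ltW zw); rewrite mulr_ge0 ?expR_ge0.
lra.
Qed.

End WeightedPrimitiveParameter.

(** * Means over circles: contour shifts and the Laurent splitting *)

Section CircleMeans.
Context {R : realType}.
Local Notation C := R[i].
Local Notation twopi := (2 * pi : R).
Implicit Types (f g : C -> C).

(** The contour integral of f(z) dz / (2 pi i z) over the circle of radius s. *)
Definition cm f (s : R) : C := rc twopi^-1 * sint 0 twopi (fun t => f (rc s * expi t)).

Definition circ_cont f (s : R) : Prop := ccont (fun t => f (rc s * expi t)).

Lemma ccont_ray (s : R) : ccont (fun t => rc s * expi t).
Proof. exact: ccontZ ccont_expi. Qed.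

Lemma cabs_ray (s t : R) : 0 <= s -> cabs (rc s * expi t) = s.
Proof. by move=> s0; rewrite cabsM cabs_real cabs_expi mulr1 ger0_norm. Qed.

Lemma circ_contP f s : 0 <= s -> (forall z, cabs z = s -> zcont f z) -> circ_cont f s.
Proof.
move=> s0 H; apply: ccont_comp; last exact: ccont_ray.
by move=> t; apply: H; exact: cabs_ray.
Qed.

Lemma rc2piV : rc twopi^-1 * rc twopi = 1 :> C.
Proof. by rewrite -rmorphM mulVf ?gt_eqF ?pi2_gt0. Qed.

Lemma eq_cm f g s : 0 <= s -> (forall z, cabs z = s -> f z = g z) -> cm f s = cm g s.
Proof.
move=> s0 fg; rewrite /cm; congr (_ * _); apply: eq_sint => t.
by apply: fg; exact: cabs_ray.
Qed.

Lemma cmD f g s : circ_cont f s -> circ_cont g s ->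
  cm (fun z => f z + g z) s = cm f s + cm g s.
Proof. by move=> cf cg; rewrite /cm sintD// mulrDr. Qed.

Lemma cmB f g s : circ_cont f s -> circ_cont g s ->
  cm (fun z => f z - g z) s = cm f s - cm g s.
Proof. by move=> cf cg; rewrite /cm sintB// mulrBr. Qed.

Lemma cmZ f k s : circ_cont f s -> cm (fun z => k * f z) s = k * cm f s.
Proof. by move=> cf; rewrite /cm sintZ// mulrCA. Qed.

Lemma cm_cst k s : cm (fun=> k) s = k.
Proof. by rewrite /cm sint_cst subr0 mulrA rc2piV mul1r. Qed.

Lemma cm_conj f s : circ_cont f s -> cm (fun z => (f z)^*%C) s = (cm f s)^*%C.
Proof. by move=> cf; rewrite /cm sint_conj// conj_rcM. Qed.

Lemma sint_periodic (x : R) (k : R -> C) : ccont k -> (forall t, k (t + twopi) = k t) ->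
  sint 0 twopi (fun t => k (x + t)) = sint 0 twopi k.
Proof.
move=> ck kp; have := sint_affine 0 twopi x 1 ck.
rewrite mulr0 addr0 mul1r (@eq_sint _ 0 twopi _ (fun t => k (x + t))); last first.
  by move=> t; rewrite rc1 !mul1r.
move=> ->; rewrite /sint.
have [c Hc] : exists c, forall x, prim k (x + twopi) - prim k x = c.
  exists (prim k (0 + twopi) - prim k 0) => {x} x.
  have D (t : R) : cdiff (fun t => prim k (t + twopi) - prim k t) t 0.
    rewrite -(subrr (k t)); apply: cdiffB; last exact: primP.
    have := @cdiff_affine _ (prim k) t (k t) twopi 1.
    rewrite mul1r rc1 mul1r [twopi + t]addrC -kp => H.
    apply: eq_cdiff (H (primP ck _)) => // s.
    by rewrite mul1r addrC.
  have [x0|x0] := leP 0 x.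
    by symmetry; apply: (@cdiff0_cst _ (fun t => prim k (t + twopi) - prim k t) 0 x x0) => t _; exact: D.
  by apply: (@cdiff0_cst _ (fun t => prim k (t + twopi) - prim k t) x 0 (ltW x0)) => t _; exact: D.
have := Hc x; have := Hc 0; rewrite add0r => -> ->.
by [].
Qed.

Lemma cm_rot f s : circ_cont f s -> cm (fun z => f (iC * z)) s = cm f s.
Proof.
move=> cf; rewrite /cm; congr (_ * _).
rewrite -(@sint_periodic (pi / 2) (fun t => f (rc s * expi t)))//.
  by apply: eq_sint => t; rewrite expiD expipi2 mulrCA.
by move=> t; rewrite expiD expi2pi mulr1.
Qed.

Lemma cm_center f r s : hol (disc 0 r) f -> 0 < s < r -> cm f s = f 0.
Proof.
move=> Hf sr; have := hol_mean Hf sr; rewrite /cm.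
under eq_sint do rewrite add0r.
by move=> ->; rewrite mulrA rc2piV mul1r.
Qed.

Definition annulus (r1 r2 : R) : set C := [set z | r1 < cabs z < r2].

Lemma annulus_open r1 r2 : open (annulus r1 r2).
Proof.
rewrite openE => z /andP[z1 z2]; apply/nbhsCP.
exists (Num.min (cabs z - r1) (r2 - cabs z)); first by rewrite lt_min !subr_gt0 z1.
move=> w; rewrite lt_min => /andP[w1 w2]; rewrite /annulus /=.
have := cabs_subr_ge w z; have := cabs_subr_ge z w; rewrite (cabs_sub z w).
move=> h1 h2; apply/andP; split; lra.
Qed.

(** The derivative in the radius is the mean of f'(z) e^{it}, and this integrand, multiplied by i
    times the radius, is a derivative in t of a periodic function. *)
Lemma cm_radius f r1 r2 s s' : 0 <= r1 -> hol (annulus r1 r2) f ->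
  r1 < s -> s <= s' -> s' < r2 -> cm f s = cm f s'.
Proof.
move=> r10 Hf rs ss' sr; rewrite /cm; congr (_ * _).
have Hd := hol_der (@annulus_open r1 r2) Hf.
have ann u (t : R) : r1 < u < r2 -> annulus r1 r2 (rc u * expi t).
  by move=> ur; rewrite /annulus /= cabs_ray//; lra.
have cfu u : r1 < u < r2 -> circ_cont f u.
  move=> ur; apply: circ_contP => [|z zu]; first by lra.
  by apply: hol_zcont Hf _; rewrite /annulus /= zu.
apply: (@cdiff0_cst _ (fun s => sint 0 twopi (fun t => f (rc s * expi t)))) => // u us.
have ur : r1 < u < r2 by lra.
pose A (t : R) := der f (rc u * expi t) * expi t.
have cA : ccont A.
  apply: ccontM; last exact: ccont_expi.
  apply: circ_contP => [|z zu]; first by lra.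
  by apply: hol_zcont Hd _; rewrite /annulus /= zu.
have A0 : sint 0 twopi A = 0.
  have u0 : rc u * iC != 0.
    by rewrite -cabs_eq0 cabsM cabs_i mulr1 cabs_real normr_eq0 gt_eqF//; lra.
  apply: (mulfI u0); rewrite mulr0 -sintZ//.
  rewrite (@sint_ftc _ _ _ _ (fun t => f (rc u * expi t))).
  - by rewrite expi2pi expi0 subrr.
  - exact: ccontZ.
  move=> t; have := hasD_curve (Hf _ (ann u t ur)) (cdiffZ (rc u) (cdiff_expi t)).
  by apply: eq_cdiff => //; rewrite /A; ring.
rewrite -A0; pose q := Num.min (u - r1) (r2 - u).
have q0 : 0 < q by rewrite lt_min !subr_gt0.
apply: (udiff_sint_cdiff (f := fun t u => f (rc u * expi t)) (r := q)) => //.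
- exact: pi2_ge0.
- move=> h; rewrite lt_min => /andP[h1 h2]; apply: cfu.
  by move: h1 h2; rewrite !ltr_norml => h1 h2; lra.
move=> e e0.
have [|||||d d0 dH] := @curve_strict _ (annulus r1 r2) f (der f) (fun t => rc u * expi t) 0 twopi _ _ _ _ _ e e0.
- exact: pi2_ge0.
- exact: annulus_open.
- exact: ccont_ray.
- by move=> t _; exact: ann.
- by move=> w Hw; split; [exact: Hf|exact: hol_zcont Hd Hw].
exists d => // h hd t t01; have := dH t t01 (rc h * expi t).
rewrite cabsM cabs_real cabs_expi mulr1 => /(_ hd).
have -> : rc u * expi t + rc h * expi t = rc (u + h) * expi t by rewrite rmorphD; ring.
by have -> : rc h * A t = der f (rc u * expi t) * (rc h * expi t) by rewrite /A; ring.
Qed.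

Lemma open_neqC (l : C) : open [set z : C | z != l].
Proof.
rewrite openE => z zl; apply/nbhsCP; exists (cabs (z - l)).
  by rewrite cabs_gt0 subr_eq0.
by move=> w; apply: contraTneq => ->; rewrite -cabs_sub ltxx.
Qed.

(* The difference quotient of [w] at [l] is holomorphic off [l] and merely
   continuous at [l]; its circle means are thus constant on both sides of the
   unit circle and continuous across it. *)
Lemma laurent_split (w : C -> C) (l : C) : hol (fun z => z != 0) w -> cabs l = 1 ->
  w l = cm (fun z => w z * (z / (z - l))) 2 - cm (fun z => w z * (z / (z - l))) (1 / 2).
Proof.
move=> Hw l1.
pose k z := if z == l then der w l else (w z - w l) / (z - l).
have z_neq (z : C) (a : R) : cabs z = a -> a != 1 -> z - l != 0.
  by move=> <- z1; rewrite subr_eq0; apply: contraNneq z1 => ->; rewrite l1.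
have kl z : z != l -> k z = (w z - w l) / (z - l) by move=> zl; rewrite /k (negbTE zl).
have Hk z : z != 0 -> z != l -> exists d, hasD k z d.
  move=> z0 zl.
  have zl0 : z - l != 0 by rewrite subr_eq0.
  have H1 := hasDB (Hw z z0) (hasD_cst (w l) z).
  have H2 := hasD_comp (g := fun z => z - l) (hasD_inv zl0) (hasDB (hasD_id z) (hasD_cst l z)).
  have H3 := hasDM H1 H2; eexists; apply: (near_hasD (@open_neqC l) _ _ H3) => //.
  by move=> v vl; rewrite kl.
have l0 : l != 0 by rewrite -cabs_gt0 l1.
have kc : zcont k l.
  apply/zcontP => e e0; have [d d0 dH] := (hasDP _ _ _).1 (Hw l l0) e e0.
  exists d => // v vd; have [->|vl] := eqVneq v l.
    by rewrite subrr cabs0 ltW.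
  rewrite (kl v vl) /k eqxx; have v0 : v - l != 0 by rewrite subr_eq0.
  have := dH _ vd; rewrite [l + _]addrC subrK => H.
  rewrite -(ler_pM2r (x := cabs (v - l))) ?cabs_gt0// -cabsM.
  by have -> : ((w v - w l) / (v - l) - der w l) * (v - l) = w v - w l - der w l * (v - l) by field.
pose h z := k z * z.
have Hh r1 r2 : 0 <= r1 -> (r2 <= 1) || (1 <= r1) -> hol (annulus r1 r2) h.
  move=> r10 r12; apply: holP => z /andP[z1 z2].
  have z0 : z != 0 by rewrite -cabs_gt0; lra.
  have zl : z != l.
    by apply/eqP => E; rewrite E l1 in z1 z2; case/orP: r12 => ?; lra.
  have [d Hd] := Hk z z0 zl; eexists; exact: hasDM Hd (hasD_id z).
have hc z : z != 0 -> zcont h z.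
  move=> z0; apply: gcontM; last exact: hasD_zcont (hasD_id z).
  have [->//|zl] := eqVneq z l; have [d Hd] := Hk z z0 zl; exact: hasD_zcont Hd.
have cc s : 0 < s -> circ_cont h s.
  by move=> s0; apply: circ_contP => [|z zs]; [exact: ltW|apply: hc; rewrite -cabs_gt0 zs].
have J1 s : 1 / 2 <= s <= 2 -> cm h s = cm h 1.
  move=> s12; apply/eqP; rewrite -subr_eq0 -cabs_eq0 eq_le cabs_ge0 andbT.
  apply/ler_addgt0Pr => e e0; rewrite add0r.
  have [||d d0 dH] := @curve_unif_cont _ h (fun t => rc 1 * expi t) 0 twopi (@pi2_ge0 R) _ _ e e0.
  - exact: ccont_ray.
  - by move=> t _; apply: hc; rewrite -cabs_gt0 cabs_ray.
  pose dd := Num.min d 2^-1 / 2.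
  have m0 : 0 < Num.min d 2^-1 by rewrite lt_min d0 invr_gt0 ltr0n.
  have [m1 m2] : Num.min d 2^-1 <= d /\ Num.min d 2^-1 <= 2^-1 by rewrite !ge_min !lexx orbT.
  have dd0 : 0 < dd by rewrite divr_gt0.
  have near u : `|u - 1| <= dd -> cabs (cm h u - cm h 1) <= e.
    rewrite ler_norml => /andP[u1 u2]; have u0 : 0 < u by rewrite /dd in u1; lra.
    rewrite /cm -mulrBr -sintB; [|exact: cc|exact: cc].
    rewrite cabsM cabs_real gtr0_norm ?invr_gt0 ?pi2_gt0//.
    rewrite mulrC ler_pdivrMr ?pi2_gt0//.
    rewrite -[X in _ <= _ * X]subr0; apply: sint_le; first exact: pi2_ge0.
      by apply: ccontB; exact: cc.
    move=> t t01; have := dH t t01 (rc (u - 1) * expi t).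
    have -> : rc 1 * expi t + rc (u - 1) * expi t = rc u * expi t.
      by rewrite rmorphB; ring.
    apply; rewrite cabsM cabs_real cabs_expi mulr1 ltr_norml /dd in u1 u2 *; lra.
  (* Inside or outside the unit circle the radius can be moved, by [cm_radius], to within [dd] of 1;
     the last bit is continuity. *)
  have [s1|s1|->] := ltrgtP s 1; last by rewrite subrr cabs0 ltW.
    have -> : cm h s = cm h (Num.max s (1 - dd)).
      apply: (@cm_radius h 0 1) => //; [by apply: Hh; rewrite ?lexx|lra| |].
        by rewrite le_max lexx.
      by rewrite gt_max s1; lra.
    apply: near; rewrite ler_norml; apply/andP; split.
      by have : 1 - dd <= Num.max s (1 - dd) by [rewrite le_max lexx orbT]; lra.
    by have : Num.max s (1 - dd) < 1 by [rewrite gt_max s1; lra]; lra.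
  have -> : cm h s = cm h (Num.min s (1 + dd)).
    symmetry; apply: (@cm_radius h 1 3) => //; [by apply: Hh; rewrite ?lexx ?orbT| | |lra].
      by rewrite lt_min s1; lra.
    by rewrite ge_min lexx.
  apply: near; rewrite ler_norml; apply/andP; split.
    by have : 1 < Num.min s (1 + dd) by [rewrite lt_min s1; lra]; lra.
  by have : Num.min s (1 + dd) <= 1 + dd by [rewrite ge_min lexx orbT]; lra.
have Kc s : 0 < s -> s != 1 -> circ_cont (fun z => z / (z - l)) s.
  move=> s0 s1; apply: circ_contP => [|z zs]; first exact: ltW.
  have z0 := z_neq _ _ zs s1.
  apply: gcontM; first exact: hasD_zcont (hasD_id z).
  exact: hasD_zcont (hasD_comp (g := fun z => z - l) (hasD_inv z0) (hasDB (hasD_id z) (hasD_cst l z))).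
have Wc s : 0 < s -> circ_cont w s.
  move=> s0; apply: circ_contP => [|z zs]; first exact: ltW.
  by apply: hol_zcont Hw _; rewrite -cabs_gt0 zs.
have E s : 0 < s -> s != 1 -> cm h s = cm (fun z => w z * (z / (z - l))) s - w l * cm (fun z => z / (z - l)) s.
  move=> s0 s1; rewrite -cmZ; last exact: Kc.
  rewrite -cmB; last 2 first.
  - by apply: ccontM; [exact: Wc|exact: Kc].
  - by apply: ccontZ; exact: Kc.
  apply: eq_cm => [|z zs]; first exact: ltW.
  have z0 := z_neq _ _ zs s1.
  rewrite /h (kl z); last by rewrite -subr_eq0.
  by rewrite -mulrBl [X in _ = _ * X]mulrC mulrA.
have K1 : cm (fun z => z / (z - l)) (1 / 2) = 0.
  have H : hol (disc 0 1) (fun z => z / (z - l)).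
    apply: holP => z; rewrite /disc /= subr0 => z1.
    have z0 : z - l != 0 by apply: (z_neq z (cabs z)); rewrite // lt_eqF.
    eexists; exact: hasDM (hasD_id z) (hasD_comp (g := fun z => z - l) (hasD_inv z0) (hasDB (hasD_id z) (hasD_cst l z))).
  by rewrite (cm_center H) ?mul0r//; lra.
(* With z = 2x, the conjugate of z/(z - l) is 1/(1 - conj l z') at z' = x/2. The pole is then
   outside the unit disc, and the mean over |z'| = 1/2 is the value 1 at the centre. *)
have K2 : cm (fun z => z / (z - l)) 2 = 1.
  have H : hol (disc 0 1) (fun z => (1 - l^*%C * z)^-1).
    apply: holP => z; rewrite /disc /= subr0 => z1.
    have z0 : 1 - l^*%C * z != 0.
      rewrite subr_eq0; apply/eqP => /(congr1 cabs); rewrite cabs1 cabsM cabs_conj l1 mul1r; lra.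
    eexists; exact: (hasD_comp (g := fun z => 1 - l^*%C * z) (hasD_inv z0) (hasDB (hasD_cst 1 z) (hasDZ l^*%C (hasD_id z)))).
  have HH : 0 < (1 / 2 : R) < 1 by lra.
  have := @cm_center _ _ _ H HH; rewrite mulr0 subr0 invr1 => H1.
  rewrite -(conjcK (cm _ 2)) -cm_conj; last by apply: Kc; rewrite ?gt_eqF//; lra.
  rewrite -[RHS]conjc1 -H1; congr conjc; rewrite /cm; congr (_ * _); apply: eq_sint => t.
  have ee := expiVN t; set x := expi t in ee *; set y := expi (- t) in ee.
  have xc : x^*%C = y by rewrite /y expiN.
  have x0 : x != 0 by rewrite -cabs_gt0 cabs_expi.
  have yE : y = x^-1 by apply: (mulfI x0); rewrite ee mulfV.
  have d0 : rc 2 * x - l != 0.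
    apply: (z_neq _ 2); last by rewrite gt_eqF//; lra.
    by rewrite cabs_ray.
  have r12 : rc (1 / 2) = 2^-1 :> C by rewrite rmorphM fmorphV rmorphD !rmorph1 mul1r.
  have r2 : rc 2 = 2 :> C by rewrite rmorphD rmorph1.
  rewrite r2 in d0 *; rewrite r12.
  have cB : (2 * x - l)^*%C = 2 * y - l^*%C by rewrite -xc; ring.
  have d0' : 2 * y - l^*%C != 0 by rewrite -cB conjc_eq0.
  have -> : (2 * x / (2 * x - l))^*%C = 2 * y / (2 * y - l^*%C).
    rewrite [LHS]rmorphM [X in _ * X]conjc_inv cB; congr (_ / _); rewrite -xc; ring.
  rewrite yE in d0' *.
  have d1 : 2 - l^*%C * x != 0.
    have -> : 2 - l^*%C * x = x * (2 * x^-1 - l^*%C) by field.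
    by rewrite mulf_neq0.
  by field; rewrite x0 d1.
have := E 2; rewrite J1 ?K2 ?mulr1; last by apply/andP; split; lra.
have := E (1 / 2); rewrite J1 ?K1 ?mulr0 ?subr0; last by apply/andP; split; lra.
have n1 : (1 / 2 : R) != 1 by rewrite lt_eqF//; lra.
have n2 : (2 : R) != 1 by rewrite gt_eqF//; lra.
move=> /(_ _ n1) ->; last by lra.
move=> /(_ _ n2) ->; last by lra.
by ring.
Qed.

End CircleMeans.

(** * Differentiation of circle means with respect to a parameter *)

Section ParametricMeans.
Context {R : realType}.
Local Notation C := R[i].
Local Notation twopi := (2 * pi : R).

(** One bound for the whole family makes the quadratic remainder of [hol_remainder] uniform in the
    index. *)
Lemma hol_family (I : Type) (D : set I) (F : I -> C -> C) (c : C) (r M : R) : 0 < r ->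
  (forall i, D i -> hol (disc c r) (F i)) ->
  (forall i w, D i -> disc c r w -> cabs (F i w) <= M) ->
  udiff cabs D F (fun i h => der (F i) c * h) c.
Proof.
move=> r0 HF HM e e0.
pose K := 32 * `|M| / r ^+ 2 + 1.
have K0 : 0 < K.
  by rewrite ltr_wpDl//; apply: divr_ge0; [exact: mulr_ge0|apply: exprn_ge0; exact: ltW].
exists (Num.min (r / 4) (e / K)); first by rewrite lt_min !divr_gt0.
move=> h; rewrite lt_min => /andP[h1]; rewrite ltr_pdivlMr// => h2 i Di.
have HM' w : disc c r w -> cabs (F i w) <= `|M|.
  by move=> wr; apply: le_trans (HM i w Di wr) (ler_norm _).
have H := hol_remainder r0 (HF i Di) HM' (ltW h1). apply: le_trans H _.
have -> : 32 * `|M| / r ^+ 2 * cabs h ^+ 2 = cabs h * (K - 1) * cabs h by rewrite /K; ring.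
by apply: ler_wpM2r; rewrite ?cabs_ge0//; have := cabs_ge0 h; lra.
Qed.

(** The derivatives are uniform limits of difference quotients, which are continuous in t. *)
Lemma udiff_ccont (F : R -> C -> C) (A : R -> C) (c : C) (r : R) : 0 < r ->
  (forall h, cabs h < r -> ccont (fun t => F t (c + h))) ->
  udiff cabs setT F (fun t h => A t * h) c -> ccont A.
Proof.
move=> r0 cF H; apply/ccontP => t e e0.
have [d d0 dH] := H _ (divr_gt0 e0 (ltr0Sn _ 3)).
pose x := Num.min d r / 2.
have m0 : 0 < Num.min d r by rewrite lt_min d0.
have [m1 m2] : Num.min d r <= d /\ Num.min d r <= r by rewrite !ge_min !lexx orbT.
have x0 : 0 < x by rewrite divr_gt0.
have cx : cabs (rc x : C) = x by rewrite cabs_real gtr0_norm.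
have e1 : 0 < e / 4 * x by rewrite mulr_gt0// divr_gt0.
have [d1 d10 H1] := (ccontP _).1 (cF (rc x) ltac:(rewrite cx /x; lra)) t _ e1.
have [d2 d20 H2] := (ccontP _).1 (cF 0 ltac:(by rewrite cabs0)) t _ e1.
exists (Num.min d1 d2); first by rewrite lt_min d10.
move=> s; rewrite lt_min => /andP[/H1 {}H1 /H2 {}H2].
rewrite addr0 in H2.
have xd : cabs (rc x : C) < d by rewrite cx /x; lra.
have Ht := dH _ xd t I; have Hs := dH _ xd s I; rewrite cx in Ht Hs.
rewrite -(ler_pM2r x0) -{1}cx -cabsM.
have -> : (A s - A t) * rc x = (F s (c + rc x) - F t (c + rc x)) - (F s c - F t c)
   - (F s (c + rc x) - F s c - A s * rc x) + (F t (c + rc x) - F t c - A t * rc x) by ring.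
apply: le_trans (cabsD _ _) _; apply: le_trans (lerD (cabsB _ _) (lexx _)) _.
apply: le_trans (lerD (lerD (cabsB _ _) (lexx _)) (lexx _)) _.
lra.
Qed.

Lemma hol_family_ccont (F : R -> C -> C) (c : C) (r M : R) : 0 < r ->
  (forall t, hol (disc c r) (F t)) ->
  (forall t w, disc c r w -> cabs (F t w) <= M) ->
  (forall w, disc c r w -> ccont (fun t => F t w)) ->
  ccont (fun t => der (F t) c).
Proof.
move=> r0 HF HM cF; apply: (@udiff_ccont F _ c r r0).
  by move=> h hr; apply: cF; rewrite /disc /= addrAC subrr add0r.
by apply: (hol_family (M := M) r0) => [t _|t w _]; [exact: HF|exact: HM].
Qed.

Lemma cm_hasD (F : C -> C -> C) (s : R) (c : C) (r M : R) : 0 <= s -> 0 < r ->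
  (forall u, cabs u = s -> hol (disc c r) (F u)) ->
  (forall u w, cabs u = s -> disc c r w -> cabs (F u w) <= M) ->
  (forall w, disc c r w -> circ_cont (fun u => F u w) s) ->
  hasD (fun w => cm (fun u => F u w) s) c (cm (fun u => der (F u) c) s).
Proof.
move=> s0 r0 HF HM cF; rewrite /cm; apply: hasDZ.
have us t : cabs (rc s * expi t : C) = s by exact: cabs_ray.
apply: (udiff_sint_hasD (f := fun t w => F (rc s * expi t) w) (r := r)) => //.
- exact: pi2_ge0.
- by move=> h hr; apply: cF; rewrite /disc /= addrAC subrr add0r.
- apply: (@hol_family_ccont _ c r M) => //.
  + by move=> t; exact: HF.
  + by move=> t w; exact: HM.
- by apply: (@hol_family _ _ (fun t w => F (rc s * expi t) w) c r M) => //
    [t _|t w _]; [exact: HF|exact: HM].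
Qed.

Lemma udiff_conj (T : zmodType) (N : T -> R) (I : Type) (D : set I) (f L : I -> T -> C) x :
  udiff N D f L x -> udiff N D (fun i y => (f i y)^*%C) (fun i h => (L i h)^*%C) x.
Proof.
move=> H e e0; have [d d0 dH] := H e e0; exists d => // h hd i Di.
by rewrite -!rmorphB cabs_conj; exact: dH.
Qed.

(** The integrand is the conjugate of one holomorphic family times another, the form in which the
    loops depend on z; so each Wirtinger derivative falls on one factor. *)
Lemma cm_wdiff (m : C -> C) (E K : C -> C -> C) (s : R) (z : C) (r M : R) :
  0 <= s -> 0 < r -> 0 <= M -> circ_cont m s ->
  (forall u, cabs u = s -> cabs (m u) <= M) ->
  (forall u, cabs u = s -> hol (disc z r) (E u)) ->
  (forall u, cabs u = s -> hol (disc z r) (K u)) ->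
  (forall u w, cabs u = s -> disc z r w -> cabs (E u w) <= M) ->
  (forall u w, cabs u = s -> disc z r w -> cabs (K u w) <= M) ->
  (forall w, disc z r w -> circ_cont (fun u => E u w) s) ->
  (forall w, disc z r w -> circ_cont (fun u => K u w) s) ->
  wdiff (fun v => cm (fun u => m u * ((E u v)^*%C * K u v)) s) z
    (cm (fun u => m u * ((E u z)^*%C * der (K u) z)) s)
    (cm (fun u => m u * ((der (E u) z)^*%C * K u z)) s).
Proof.
move=> s0 r0 M0 cm0 mM HE HK EM KM cE cK.
have us t : cabs (rc s * expi t : C) = s by exact: cabs_ray.
have zz := disc_center z r0.
have cconj (f : R -> C) : ccont f -> ccont (fun t => (f t)^*%C).
  by move=> cf; apply: ccont_comp cf => t; exact: wdiff_zcont (wdiff_conj _).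
have cdE : ccont (fun t => der (E (rc s * expi t)) z).
  apply: (@hol_family_ccont (fun t => E (rc s * expi t)) z r M) => //.
  + by move=> t; exact: HE.
  + by move=> t w; exact: EM.
have cdK : ccont (fun t => der (K (rc s * expi t)) z).
  apply: (@hol_family_ccont (fun t => K (rc s * expi t)) z r M) => //.
  + by move=> t; exact: HK.
  + by move=> t w; exact: KM.
pose D := [set t : R | 0 <= t <= twopi].
have dE := hol_family (D := D) (F := fun t => E (rc s * expi t)) r0
  (fun t _ => HE _ (us t)) (fun t w _ => EM _ w (us t)).
have dK := hol_family (D := D) (F := fun t => K (rc s * expi t)) r0
  (fun t _ => HK _ (us t)) (fun t w _ => KM _ w (us t)).
have bE t : cabs (der (E (rc s * expi t)) z) <= 2 * M / r.
  by apply: (cauchy_estimate r0 (HE _ (us t))) => w; exact: EM.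
have bK t : cabs (der (K (rc s * expi t)) z) <= 2 * M / r.
  by apply: (cauchy_estimate r0 (HK _ (us t))) => w; exact: KM.
pose M1 := M + 2 * M / r.
have Mr0 : 0 <= 2 * M / r by rewrite divr_ge0 ?mulr_ge0// ltW.
have dEK : udiff cabs D (fun t v => (E (rc s * expi t) v)^*%C * K (rc s * expi t) v)
   (fun t h => (der (E (rc s * expi t)) z * h)^*%C * K (rc s * expi t) z +
     (E (rc s * expi t) z)^*%C * (der (K (rc s * expi t)) z * h)) z.
  apply: (udiffM cabs_ge0 (M := M1)).
  - by move=> t _; rewrite cabs_conj; have := EM _ z (us t) zz; rewrite /M1; lra.
  - by move=> t _; have := KM _ z (us t) zz; rewrite /M1; lra.
  - move=> t h _; rewrite cabs_conj cabsM ler_wpM2r ?cabs_ge0//.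
    by have := bE t; rewrite /M1; lra.
  - move=> t h _; rewrite cabsM ler_wpM2r ?cabs_ge0//.
    by have := bK t; rewrite /M1; lra.
  - exact: udiff_conj dE.
  - exact: dK.
have dm : udiff cabs D (fun t v => m (rc s * expi t) *
     ((E (rc s * expi t) v)^*%C * K (rc s * expi t) v))
   (fun t h => m (rc s * expi t) * ((E (rc s * expi t) z)^*%C * der (K (rc s * expi t)) z) * h +
    m (rc s * expi t) * ((der (E (rc s * expi t)) z)^*%C * K (rc s * expi t) z) * h^*%C) z.
  move=> e e0; have M10 : 0 < M + 1 by lra.
  have [d d0 dH] := dEK _ (divr_gt0 e0 M10); exists d => // h hd t Dt.
  have Hd := dH h hd t Dt; rewrite rmorphM /= in Hd.
  set X := (X in cabs X <= _) in Hd.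
  have -> : e * cabs h = (M + 1) * (e / (M + 1) * cabs h) by field; rewrite gt_eqF.
  apply: (@le_trans _ _ (cabs (m (rc s * expi t)) * cabs X)).
    by rewrite -cabsM /X le_eqVlt; apply/orP; left; apply/eqP; congr cabs; ring.
  by apply: ler_pM; rewrite ?cabs_ge0//; have := mM _ (us t); lra.
have H := @udiff_sint_wdiff _ _ _ _ z 0 twopi r (@pi2_ge0 R) r0 _ _ _ dm.
rewrite /cm; have {}H := wdiffM (wdiff_cst (rc twopi^-1) z) (H _ _ _).
apply: eq_wdiff (H _ _ _) => //; rewrite ?mul0r ?add0r//.
- move=> h hr; have hz : disc z r (z + h) by rewrite /disc /= addrAC subrr add0r.
  apply: ccontM; first exact: cm0.
  by apply: ccontM; [apply: cconj; exact: cE|exact: cK].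
- apply: ccontM; first exact: cm0.
  by apply: ccontM; [apply: cconj; exact: cE|exact: cdK].
- apply: ccontM; first exact: cm0.
  by apply: ccontM; [exact: cconj|exact: cK].
Qed.

End ParametricMeans.

(** * Fourier coefficients: decay, Sobolev class, summation of the negative part *)

Section FourierSeries.
Context {R : realType}.
Local Notation C := R[i].
Local Notation twopi := (2 * pi : R).

Lemma ccont_bounded (g : R -> C) (a b : R) : a <= b -> ccont g ->
  exists2 M, 0 < M & forall t, a <= t <= b -> cabs (g t) <= M.
Proof.
(* The bound is encoded as the inverse of the radius d, in order to fit [compact_seg]. *)
move=> ab /ccontP cg; pose Q (t d : R) := cabs (g t) * d <= 1.
have [||d d0 dH] := @compact_seg _ Q a b ab.
- move=> t d d' /andP[_ d'd] H; apply: le_trans H.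
  by rewrite ler_wpM2l ?cabs_ge0.
- move=> t _; have [d d0 dH] := cg t _ ltr01.
  pose K := cabs (g t) + 1; have K0 : 0 < K by rewrite ltr_wpDl// cabs_ge0.
  exists (Num.min d K^-1); first by rewrite lt_min d0 invr_gt0.
  move=> u; rewrite lt_min => /andP[/dH u1 _].
  have gK : cabs (g u) <= K.
    by have := cabs_subr_ge (g u) (g t); rewrite /K; lra.
  rewrite /Q; apply: (@le_trans _ _ (K * K^-1)); last by rewrite mulfV// gt_eqF.
  apply: ler_pM => //; first exact: cabs_ge0.
    by rewrite le_min ltW//= invr_ge0 ltW.
  by rewrite ge_min lexx orbT.
exists d^-1 => [|t tab]; first by rewrite invr_gt0.
by rewrite -[d^-1]mul1r ler_pdivlMr//; exact: dH.
Qed.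

Lemma expi_exp (t : R) n : expi (n%:R * t) = expi t ^+ n :> C.
Proof.
elim: n => [|n IH]; first by rewrite mul0r expi0.
by rewrite exprS -IH -natr1 mulrDl mul1r addrC expiD.
Qed.

Lemma fourier_cm (f : C -> C) (n : int) : circ_cont f 1 ->
  fourier f n = cm (fun z => f z * (z^-1) ^ n) 1.
Proof.
move=> cf; rewrite /fourier /cm; congr (_ * _).
have E t : expi (- (n%:~R * t)) = (rc 1 * expi t)^-1 ^ n :> C.
  have V s : expi (- s) = (expi s)^-1 :> C.
    have s0 : expi s != 0 :> C by rewrite -cabs_gt0 cabs_expi.
    by apply: (mulfI s0); rewrite expiVN mulfV.
  rewrite rc1 mul1r; case: n => n.
    by rewrite V -[X in X * t]/(n%:R) expi_exp -exprVn.
  rewrite NegzE mulrNz mulNr opprK -[X in X * t]/(n.+1%:R) expi_exp.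
  by rewrite -exprz_inv invrK.
under [RHS]eq_sint do rewrite -E.
have cf1 : ccont (fun t => f (rc 1 * expi t)) by exact: cf.
have ce : ccont (fun t => expi (- (n%:~R * t)) : C).
  apply: (@ccont_cdiff _ _ (fun t => rc (- n%:~R) * (iC * expi (- (n%:~R * t))))) => t.
  have H := @cdiff_affine _ (@expi R) t (iC * expi (- (n%:~R * t))) 0 (- n%:~R).
  rewrite add0r mulNr in H.
  by apply: eq_cdiff (H (cdiff_expi _)) => // s; rewrite add0r mulNr.
rewrite -cint_sint; [|exact: pi2_ge0|exact: ccontM].
by apply: eq_cint => t _; rewrite rc1 mul1r.
Qed.

Lemma hasD_exp n (z : C) : exists d, hasD (fun z => z ^+ n) z d.
Proof.
elim: n => [|n [d Hd]]; first by exists 0; apply: eq_hasD (hasD_cst 1 z).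
eexists; apply: eq_hasD (hasDM (hasD_id z) Hd) => //= w.
by rewrite exprS.
Qed.

Lemma hasD_expz (n : int) (z : C) : z != 0 -> exists d, hasD (fun z => z^-1 ^ n) z d.
Proof.
move=> z0; case: n => n.
  have [d Hd] := hasD_exp n z^-1.
  by eexists; exact: (hasD_comp (g := fun z => z^-1) Hd (hasD_inv z0)).
have [d Hd] := hasD_exp n.+1 z; exists d; apply: eq_hasD Hd => // w.
by rewrite NegzE -exprz_inv invrK.
Qed.

(** The circle of integration is moved to radius 1/q for n >= 0 and to radius q for n < 0. *)
Lemma fourier_decay (f : C -> C) (r : R) : 1 < r -> hol (annulus r^-1 r) f ->
  forall q, r^-1 < q < 1 -> exists2 M, 0 < M &
    forall n : int, cabs (fourier f n) <= M * q ^+ `|n|%N.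
Proof.
move=> r1 Hf q /andP[rq q1].
have r0 : 0 < r by lra.
have rV0 : 0 < r^-1 by rewrite invr_gt0.
have q0 : 0 < q by lra.
have qV : q^-1 < r by rewrite -(invrK r) ltf_pV2 ?posrE.
have q1' : 1 < q^-1 by rewrite invf_gt1.
have cf s : r^-1 < s < r -> circ_cont f s.
  move=> sr; apply: circ_contP => [|z zs]; first lra.
  by apply: hol_zcont Hf _; rewrite /annulus /= zs.
have [M1 M10 HM1] := ccont_bounded (@pi2_ge0 R) (cf q^-1 ltac:(lra)).
have [M2 M20 HM2] := ccont_bounded (@pi2_ge0 R) (cf q ltac:(lra)).
have Hn (n : int) : hol (annulus r^-1 r) (fun z => f z * z^-1 ^ n).
  apply: holP => z zr; have z0 : z != 0 by rewrite -cabs_gt0; case/andP: zr => ? _; lra.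
  have [d Hd] := hasD_expz n z0; eexists; exact: hasDM (Hf z zr) Hd.
have main (n : int) (s M : R) : r^-1 < s < r -> 0 < M ->
    (forall t, 0 <= t <= twopi -> cabs (f (rc s * expi t)) <= M) ->
    cabs (fourier f n) <= M * s^-1 ^ n.
  move=> sr M0 HM; have s0 : 0 < s by lra.
  rewrite fourier_cm; last by apply: cf; lra.
  have -> : cm (fun z => f z * z^-1 ^ n) 1 = cm (fun z => f z * z^-1 ^ n) s.
    have [s1|s1] := leP 1 s.
      by apply: (cm_radius (ltW rV0) (Hn n)); lra.
    by symmetry; apply: (cm_radius (ltW rV0) (Hn n)); lra.
  rewrite /cm cabsM cabs_real gtr0_norm ?invr_gt0 ?pi2_gt0//.
  rewrite mulrC ler_pdivrMr ?pi2_gt0//.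
  rewrite -[X in _ <= _ * X]subr0; apply: sint_le; first exact: pi2_ge0.
    apply: (@circ_contP _ (fun z => f z * z^-1 ^ n) s) => [|z zs]; first exact: ltW.
    by apply: hol_zcont (Hn n) _; rewrite /annulus /= zs.
  move=> t t02; rewrite cabsM; have -> : cabs ((rc s * expi t)^-1 ^ n) = s^-1 ^ n.
    have E : cabs (rc s * expi t : C)^-1 = s^-1 by rewrite cabsV cabs_ray// ltW.
    case: n => n; first by rewrite -!exprnP cabsX E.
    by rewrite NegzE -!exprnN cabsV cabsX E.
  by rewrite ler_wpM2r ?HM// exprz_ge0// invr_ge0 ltW.
exists (M1 + M2) => [|[n|n]]; first by rewrite addr_gt0.
  apply: le_trans (main n _ _ _ M10 HM1) _; first by lra.
  rewrite invrK absz_nat -exprnP ler_wpM2r ?exprn_ge0 ?ltW//; lra.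
apply: le_trans (main (Negz n) _ _ _ M20 HM2) _; first by lra.
rewrite NegzE -exprnN -exprVn invrK abszN absz_nat ler_wpM2r ?exprn_ge0 ?ltW//; lra.
Qed.

Lemma esum_geometric (K q : R) : 0 <= K -> 0 < q < 1 ->
  (\esum_(n in [set: int]) (K * q ^+ `|n|%N)%:E < +oo)%E.
Proof.
move=> K0 /andP[q0 q1].
have pos (n : int) : (0%:E <= (K * q ^+ `|n|%N)%:E)%E.
  by rewrite lee_fin mulr_ge0// exprn_ge0// ltW.
have fin k : (\esum_(n in [set: nat]) (K * q ^+ (n + k))%:E < +oo)%E.
  have posn n : (0%:E <= (K * q ^+ (n + k))%:E)%E.
    by rewrite lee_fin mulr_ge0// exprn_ge0// ltW.
  rewrite -nneseries_esumT//.
  apply: (@le_lt_trans _ _ (K * q ^+ k * (1 - q)^-1)%:E); last exact: ltry.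
  apply: lime_le; first exact: is_cvg_nneseries.
  apply: nearW => n; rewrite sumEFin lee_fin.
  have := @geometric_le_lim R n (K * q ^+ k) q; rewrite mulr_ge0 ?exprn_ge0 ?(ltW q0)//.
  rewrite q0 ger0_norm ?(ltW q0)// q1 => /(_ isT isT isT); apply: le_trans.
  rewrite /series /= le_eqVlt; apply/orP; left; apply/eqP; apply: eq_bigr => i _.
  by rewrite exprD; ring.
rewrite (esumID (range Posz)) => [|n _]; last exact: pos.
rewrite !setTI; apply: lte_add_pinfty.
  rewrite esum_image//; last by move=> x y _ _ [].
  by have := fin 0%N; congr (_ < _)%E; apply: eq_esum => n _; rewrite addn0.
have -> : ~` range Posz = range Negz.
  apply/seteqP; split => -[n|n] //=.
  - by move=> H; case: H; exists n.
  - by move=> _; exists n.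
  - by move=> [m _].
  - by move=> _ [m _].
rewrite esum_image//; last by move=> x y _ _ [].
by have := fin 1%N; congr (_ < _)%E; apply: eq_esum => n _; rewrite addn1.
Qed.

(** The squared coefficients decay like q^(2|n|), while (1 + n^2)^s is at most a constant times
    q^(-|n|); a geometric series is left. *)
Lemma Hs_hol (s r : R) (f F : C -> C) : 1 < r -> hol (annulus r^-1 r) F ->
  (forall l, S1 l -> f l = F l) -> 0 < s -> Hs s f.
Proof.
move=> r1 HF fF s0.
have r0 : 0 < r by lra.
have rV0 : 0 < r^-1 by rewrite invr_gt0.
have rV1 : r^-1 < 1 by rewrite invf_lt1.
have S1c (l : C) : S1 l <-> cabs l = 1.
  by rewrite /S1 /= normE; split=> [/complexI//|->].
split.
  apply/subspace_continuousP => l Sl A /nbhsCP[e e0 eA].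
  have la : annulus r^-1 r l by rewrite /annulus /= ((S1c l).1 Sl) rV1 r1.
  have [d d0 dH] := (zcontP _ _).1 (hol_zcont HF la) _ (divr_gt0 e0 (ltr0Sn _ 1)).
  apply/nbhsCP; exists d => // w wd Sw.
  have fwl : cabs (f w - f l) < e by rewrite (fF w Sw) (fF l Sl); have := dH w wd; lra.
  exact: (eA (f w) fwl).
pose q := (1 + r^-1) / 2.
have [q0 [rq q1]] : 0 < q /\ r^-1 < q /\ q < 1 by rewrite /q; split; [|split]; lra.
have [M M0 HM] := fourier_decay r1 HF (q := q) ltac:(lra).
have fE n : fourier f n = fourier F n.
  rewrite /fourier; congr (_ * _); apply: eq_cint => t _; rewrite fF//.
  by apply/S1c; exact: cabs_expi.
(* Chosen so that exp(c n)^s = q^-n. The constant [K] then gives 1 + n^2 <= K exp(c n), from exp x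
   >= 1 + x^2/2. *)
pose c := - ln q / s.
have lnq : ln q < 0 by rewrite ln_lt0// q0.
have c0 : 0 < c by rewrite divr_gt0// oppr_gt0.
pose K := 1 + 2 / c ^+ 2.
have K0 : 0 < K.
  by rewrite ltr_wpDr//; apply: divr_ge0 => //; apply: exprn_ge0; exact: ltW.
have Kb (n : nat) : 1 + n%:R ^+ 2 <= K * expR (c * n%:R).
  have cn : 0 <= c * n%:R by rewrite mulr_ge0// ltW.
  have := expR_ge1Dxn 1 cn; rewrite -[2`!]/2%N => H.
  apply: (@le_trans _ _ (K * (1 + (c * n%:R) ^+ 2 / 2))); last by rewrite ler_wpM2l// ltW.
  have -> : K * (1 + (c * n%:R) ^+ 2 / 2) = 1 + n%:R ^+ 2 + (2 / c ^+ 2 + (c * n%:R) ^+ 2 / 2).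
    by rewrite /K; field; rewrite gt_eqF.
  rewrite lerDl addr_ge0// divr_ge0// exprn_ge0//; exact: ltW.
have powb (n : nat) : (1 + n%:R ^+ 2) `^ s <= K `^ s * (q ^+ n)^-1.
  have n0 : 0 <= 1 + n%:R ^+ 2 :> R by rewrite addr_ge0// exprn_ge0.
  apply: le_trans (ge0_ler_powR (ltW s0) _ _ (Kb n)) _; rewrite ?nnegrE ?mulr_ge0 ?expR_ge0 ?(ltW K0)//.
  rewrite powRM ?expR_ge0 ?(ltW K0)// ler_wpM2l ?powR_ge0//.
  rewrite -expRM /c.
  have -> : - ln q / s * n%:R * s = n%:R * - ln q by field; rewrite gt_eqF.
  by rewrite expRM_natl expRN lnK ?posrE// exprVn.
apply: le_lt_trans (esum_geometric (K := K `^ s * M ^+ 2) _ (q := q) ltac:(lra)); last first.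
  by rewrite mulr_ge0 ?powR_ge0 ?exprn_ge0 ?(ltW M0).
apply: le_esum => n _; rewrite lee_fin fE.
have -> : n%:~R ^+ 2 = (`|n|%N)%:R ^+ 2 :> R.
  by case: n => n; rewrite // NegzE mulrNz sqrrN abszN.
have -> : complex.Re `|fourier F n| = cabs (fourier F n) by [].
have h1 := powb `|n|%N; have h2 := HM n.
have qn : 0 < q ^+ `|n|%N by rewrite exprn_gt0.
have h3 : cabs (fourier F n) ^+ 2 <= (M * q ^+ `|n|%N) ^+ 2.
  by apply: lerXn2r; rewrite ?nnegrE ?cabs_ge0 ?mulr_ge0 ?(ltW M0) ?(ltW qn) ?h2.
apply: (@le_trans _ _ (K `^ s * (q ^+ `|n|%N)^-1 * (M * q ^+ `|n|%N) ^+ 2)).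
  by apply: ler_pM; rewrite ?powR_ge0 ?exprn_ge0 ?cabs_ge0.
rewrite le_eqVlt; apply/orP; left; apply/eqP; field; by rewrite gt_eqF.
Qed.

(* On [|z| = 1/2] the partial sums of the series are geometric sums of [(z/l)^2]. *)
Lemma neg_series (f : C -> C) (l : C) : hol (fun z => z != 0) f -> cabs l = 1 ->
  series (fun n : nat => l ^- n.*2.+1 * fourier f (- n.*2.+1%:Z)) @ \oo -->
  cm (fun z => f z * (l * z / (l ^+ 2 - z ^+ 2))) (1 / 2).
Proof.
move=> Hf l1.
have h0 : 0 <= 1 / 2 :> R by lra.
have l0 : l != 0 by rewrite -cabs_gt0 l1.
have zn (z : C) : cabs z = 1 / 2 -> z != 0 by move=> zh; rewrite -cabs_gt0 zh; lra.
have dn (z : C) : cabs z = 1 / 2 -> l ^+ 2 - z ^+ 2 != 0.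
  move=> zh; rewrite subr_eq0; apply/eqP => /(congr1 cabs); rewrite !cabsX l1 zh.
  by rewrite expr1n; lra.
have cf : circ_cont f (1 / 2).
  by apply: circ_contP => // z /zn z0; exact: hol_zcont Hf z0.
have zX n (z : C) : zcont (fun z => z ^+ n) z.
  by have [d Hd] := hasD_exp n z; exact: hasD_zcont Hd.
have zX' n (z : C) : z != 0 -> zcont (fun z => z^-1 ^ n) z.
  by move=> z0; have [d Hd] := hasD_expz n z0; exact: hasD_zcont Hd.
have cX n : circ_cont (fun z => z ^+ n) (1 / 2 : R).
  by apply: circ_contP => // z _; exact: zX.
have fE n : fourier f (- n.*2.+1%:Z) = cm (fun z => f z * z ^+ n.*2.+1) (1 / 2).
  rewrite fourier_cm; last first.
    by apply: circ_contP => // z z1; apply: hol_zcont Hf _; rewrite -cabs_gt0 z1.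
  have H : hol (annulus 0 2) (fun z => f z * z^-1 ^ (- n.*2.+1%:Z)).
    apply: holP => z /andP[z0 _]; rewrite cabs_gt0 in z0.
    have [d Hd] := hasD_expz (- n.*2.+1%:Z) z0; eexists; exact: hasDM (Hf z z0) Hd.
  rewrite -(@cm_radius _ _ 0 2 (1 / 2) 1 (lexx 0) H); [|lra|lra|lra].
  by apply: eq_cm => // z _; rewrite -exprz_inv invrK.
pose k z := l * z / (l ^+ 2 - z ^+ 2).
have ck : circ_cont k (1 / 2).
  apply: circ_contP => // z zh; apply: gcontM.
    by apply: gcontM; [exact: gcont_cst|exact: hasD_zcont (hasD_id z)].
  have [d Hd] := hasD_exp 2 z.
  exact: hasD_zcont (hasD_comp (g := fun z => l ^+ 2 - z ^+ 2) (hasD_inv (dn z zh)) (hasDB (hasD_cst (l ^+ 2) z) Hd)).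
pose S N z := \sum_(0 <= n < N) l ^- n.*2.+1 * z ^+ n.*2.+1.
have cS N : circ_cont (S N) (1 / 2).
  elim: N => [|N IH].
    by apply: eq_ccont (ccont_cst 0) => t; rewrite /S big_geq.
  apply: eq_ccont (ccontD IH (ccontZ (l ^- N.*2.+1) (cX N.*2.+1))) => t.
  by rewrite /S big_nat_recr.
have partial N : series (fun n : nat => l ^- n.*2.+1 * fourier f (- n.*2.+1%:Z)) N =
    cm (fun z => f z * S N z) (1 / 2).
  elim: N => [|N IH].
    rewrite /series /= big_geq// -(cm_cst 0 (1 / 2)); apply: eq_cm => // z _.
    by rewrite /S big_geq// mulr0.
  rewrite /series /= big_nat_recr//= -[X in X + _]/(series _ N) IH fE -cmZ; last exact: (ccontM cf (cX _)).
  rewrite -cmD; [|exact: (ccontM cf (cS N))|exact: (ccontZ _ (ccontM cf (cX _)))].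
  by apply: eq_cm => // z _; rewrite /S big_nat_recr//=; ring.
have kS N z : cabs z = 1 / 2 -> k z - S N z = k z * (l^-1 * z) ^+ N.*2.
  move=> zh; elim: N => [|N IH]; first by rewrite /S big_geq// subr0 expr0 mulr1.
  rewrite /S big_nat_recr//= opprD addrA -[X in X + _]/(k z - S N z) IH.
  rewrite doubleS !exprS !exprMn invfM exprVn.
  have lN : l ^+ N.*2 != 0 by rewrite expf_neq0.
  by rewrite /k; field; rewrite ?l0 ?lN ?dn.
have cfk : ccont (fun t => f (rc (1 / 2) * expi t) * k (rc (1 / 2) * expi t)) by exact: (ccontM cf ck).
have [M M0 HM] := ccont_bounded (@pi2_ge0 R) cfk.
apply/cvgrPdist_le => e e0.
have [k' ke] : exists k, e = rc k by apply/complex_realP; exact: gtr0_real.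
subst e; rewrite ltcR in e0.
have q1 : `|4^-1 : R| < 1 by rewrite ger0_norm ?invr_ge0// invf_lt1// ltr1n.
(* The ratio is 1/4 because the tail after N terms carries the factor (z/l)^(2N), with |z/l| =
   1/2. *)
have := @cvg_geometric R M 4^-1 q1.
move=> /cvgrPdist_le /(_ _ e0); apply: filterS => N; rewrite sub0r normrN /= => h.
rewrite normE lecR partial; apply: le_trans h.
rewrite -cmB; [|exact: (ccontM cf ck)|exact: (ccontM cf (cS N))].
rewrite (@eq_cm _ _ (fun z => f z * k z * (l^-1 * z) ^+ N.*2)) //; last first.
  by move=> z zh; rewrite -mulrBr kS// mulrA.
have M4 : 0 <= M * 4^-1 ^+ N by rewrite mulr_ge0 ?ltW// exprn_ge0// invr_ge0.
rewrite ger0_norm// /cm cabsM cabs_real gtr0_norm ?invr_gt0 ?pi2_gt0//.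
rewrite mulrC ler_pdivrMr ?pi2_gt0// -[X in _ <= _ * X]subr0.
apply: sint_le; first exact: pi2_ge0.
  apply: ccontM => //; apply: (@circ_contP _ (fun z => (l^-1 * z) ^+ N.*2)) => // z _.
  have [d Hd] := hasD_exp N.*2 (l^-1 * z).
  exact: hasD_zcont (hasD_comp (g := fun z => l^-1 * z) Hd (hasDZ l^-1 (hasD_id z))).
move=> t t02; rewrite cabsM; apply: ler_pM; rewrite ?cabs_ge0 ?HM//.
rewrite cabsX cabsM cabsV l1 invr1 mul1r cabs_ray// -mul2n exprM.
by rewrite lerXn2r// ?nnegrE ?invr_ge0// ?exprn_ge0//; lra.
Qed.

End FourierSeries.

(** * The kernels that extract odd negative and odd positive powers *)

Section CircleContinuity.
Context {R : realType}.
Local Notation C := R[i].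
Implicit Types (f g : C -> C) (s : R).

Lemma circ_cont_cst (k : C) s : circ_cont (fun=> k) s.
Proof. exact: ccont_cst. Qed.

Lemma circ_contD f g s : circ_cont f s -> circ_cont g s -> circ_cont (fun z => f z + g z) s.
Proof. exact: ccontD. Qed.

Lemma circ_contM f g s : circ_cont f s -> circ_cont g s -> circ_cont (fun z => f z * g z) s.
Proof. exact: ccontM. Qed.

(** The sum of the odd powers (u/l)^(2n+1) when |u| < |l|; its mean against f is the part of f in
    negative odd powers, evaluated at l. *)
Definition oker (l u : C) : C := l * u / (l ^+ 2 - u ^+ 2).

Lemma half_neq0 (u : C) : cabs u = (1/2 : R) -> u != 0.
Proof. by move=> us; rewrite -cabs_gt0 us; lra. Qed.

Lemma unit_neq0 (l : C) : cabs l = (1 : R) -> l != 0.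
Proof. by move=> us; rewrite -cabs_gt0 us; lra. Qed.

Lemma sqr_sub_neq0 (l u : C) : cabs u != cabs l -> l ^+ 2 - u ^+ 2 != 0.
Proof.
move=> ul; rewrite subr_sqr; apply/negP => /eqP /(congr1 cabs).
rewrite cabsM cabs0 => /eqP; rewrite mulf_eq0 !cabs_eq0 => /orP[]; rewrite ?subr_eq0 ?addr_eq0.
  by move/eqP => E; rewrite E eqxx in ul.
by move/eqP => E; rewrite E cabsN eqxx in ul.
Qed.

Lemma oker_hasD (l u : C) : l ^+ 2 - u ^+ 2 != 0 -> exists d, hasD (oker l) u d.
Proof.
move=> n0; have [d Hd] := hasD_exp 2 u; eexists.
apply: hasDM; first by apply: hasDZ; exact: hasD_id.
apply: (hasD_comp (f := fun w => w^-1) (g := fun u => l ^+ 2 - u ^+ 2)); first exact: hasD_inv.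
by apply: hasDB; [exact: hasD_cst|exact: Hd].
Qed.

Lemma zcontN f z : zcont f (- z) -> zcont (fun z => f (- z)) z.
Proof. by move=> cf; apply: gcont_comp cf _; exact: hasD_zcont (hasDN (hasD_id z)). Qed.

Lemma cm_opp f s : 0 <= s -> (forall z, cabs z = s -> zcont f z) ->
  cm (fun z => f (- z)) s = cm f s.
Proof.
move=> s0 cf; rewrite -[RHS]cm_rot; last exact: circ_contP.
rewrite -[RHS]cm_rot.
  by apply: eq_cm => // z zs; rewrite mulrA iCiC mulN1r.
apply: circ_contP => // z zs.
apply: gcont_comp; first by apply: cf; rewrite cabsM cabs_i mul1r.
exact: hasD_zcont (hasDZ iC (hasD_id z)).
Qed.

(** For |l| < 2 the kernel is the sum of the odd powers (l/v)^(2n+1): the part of [p] in positive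
    odd powers, as a function on the disc of radius 2. *)
Definition Tker (p : C -> C) (l : C) : C := cm (fun v => p v * (l * v / (v ^+ 2 - l ^+ 2))) (2 : R).

Lemma Tker0 p : Tker p 0 = 0.
Proof.
rewrite /Tker (@eq_cm _ _ (fun=> 0)) ?cm_cst// => z _.
by rewrite mul0r mul0r mulr0.
Qed.

Lemma sqr_ker_hasD (u w : C) : cabs u != cabs w ->
  exists d, hasD (fun w => w * u / (u ^+ 2 - w ^+ 2)) w d.
Proof.
move=> uw; have [d Hd] := hasD_exp 2 w; eexists.
apply: hasDM; first by apply: hasDM; [exact: hasD_id|exact: hasD_cst].
apply: (hasD_comp (f := fun w => w^-1) (g := fun w => u ^+ 2 - w ^+ 2)).
  by apply: hasD_inv; apply: sqr_sub_neq0; rewrite eq_sym.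
by apply: hasDB; [exact: hasD_cst|exact: Hd].
Qed.

(** Near c the modulus stays at most some rho < 2, so that the denominator is at least 4 - rho^2 and
    the holomorphic family of kernels is uniformly bounded. *)
Lemma Tker_hol p : (forall v, cabs v = (2 : R) -> zcont p v) -> hol (disc 0 2) (Tker p).
Proof.
move=> cp; apply: holP => c; rewrite /disc /= subr0 => c2.
have [Mp Mp0 HMp] := circle_bounded cp.
pose r := (2 - cabs c) / 2; have r0 : 0 < r by rewrite /r; lra.
pose rho := 2 - r; have rho0 : 0 <= rho by have := cabs_ge0 c; rewrite /rho /r; lra.
have rho2 : rho < 2 by rewrite /rho; lra.
have wr w : disc c r w -> cabs w <= rho.
  rewrite /disc /= => wc; have := cabs_subr_ge w c; rewrite /rho /r in wc *; lra.
have den (u w : C) : cabs u = (2 : R) -> disc c r w -> 4 - rho ^+ 2 <= cabs (u ^+ 2 - w ^+ 2).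
  move=> u2 /wr ww; have := cabs_subr_ge (u ^+ 2) (w ^+ 2); rewrite !cabsX u2.
  have := lerXn2r 2 (cabs_ge0 w) rho0 ww; lra.
have den0 : 0 < 4 - rho ^+ 2 by nra.
have uw (u w : C) : cabs u = (2 : R) -> disc c r w -> cabs u != cabs w.
  by move=> u2 /wr ww; rewrite u2; apply/eqP; lra.
have cF (u w : C) : cabs u = (2 : R) -> disc c r w ->
    zcont (fun u => p u * (w * u / (u ^+ 2 - w ^+ 2))) u.
  move=> u2 hw; apply: gcontM; first exact: cp.
  have [d Hd] := hasD_exp 2 u; apply: (@hasD_zcont _ (fun u => w * u / (u ^+ 2 - w ^+ 2))).
  apply: hasDM; first by apply: hasDZ; exact: hasD_id.
  apply: (hasD_comp (f := fun w => w^-1) (g := fun u => u ^+ 2 - w ^+ 2)).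
    by apply: hasD_inv; apply: sqr_sub_neq0; rewrite eq_sym uw.
  by apply: hasDB; [exact: Hd|exact: hasD_cst].
eexists; apply: (@cm_hasD _ (fun u w => p u * (w * u / (u ^+ 2 - w ^+ 2))) 2 c r
  (Mp * (rho * 2 / (4 - rho ^+ 2)))) => //.
- move=> u u2; apply: holP => w hw; have [d Hd] := sqr_ker_hasD (uw u w u2 hw).
  by eexists; apply: hasDZ; exact: Hd.
- move=> u w u2 hw; rewrite !cabsM cabsV u2.
  apply: ler_pM; rewrite ?cabs_ge0 ?HMp//.
    by rewrite mulr_ge0 ?invr_ge0 ?mulr_ge0 ?cabs_ge0.
  apply: ler_pM; rewrite ?invr_ge0 ?mulr_ge0 ?cabs_ge0//.
    by rewrite ler_wpM2r// wr.
  by rewrite lef_pV2 ?posrE ?den// (lt_le_trans den0)// den.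
- by move=> w hw; apply: circ_contP => // u u2; exact: cF.
Qed.

End CircleContinuity.

(** * The scalar loops: splitting into negative and positive part, derivatives in z *)

Section ScalarLoops.
Context {R : realType}.
Local Notation C := R[i].
Variables (Om : set C) (z0 : C).
Hypothesis oO : open Om.
Hypothesis sO : simply_connected Om.
Hypothesis Oz0 : Om z0.
Variables (B : C -> C) (g : C -> C).
Hypothesis HB : hol Om B.
Hypothesis Hg : hol Om g.
Variable th : C.

(** What enters the loop is the conjugate of this, exp(-th u^2 conj(B z)). Stored this way it is
    holomorphic in z, as [cm_wdiff] expects, while its conjugate is holomorphic in u. *)
Definition lweight (u z : C) : C := cexp (- ((th * u ^+ 2)^*%C * B z)).
Definition rweight (u z : C) : C :=
  cexp (- (th * u ^- 2 * B z)) * wprim Om z0 B g (th * u ^- 2) z.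
(** For th = i/4 or -i/4, a coordinate of exp(-beta_u Li / 2) applied to the integral in [X_loop],
    that is, of the argument of P. *)
Definition sloop (z u : C) : C := u^-1 * ((lweight u z)^*%C * rweight u z).

Lemma hasD_sqrV (u : C) : u != 0 -> exists d, hasD (fun u => u ^- 2) u d.
Proof.
move=> u0; have [d Hd] := hasD_expz 2 u0; exists d.
by apply: eq_hasD Hd => // w; rewrite -exprVn.
Qed.

Lemma lweight_conj u z : (lweight u z)^*%C = cexp (- (th * u ^+ 2 * (B z)^*%C)).
Proof. by rewrite /lweight -cexp_conj rmorphN rmorphM /= conjcK. Qed.

Lemma hasD_lweight_conj u z : exists d, hasD (fun u => (lweight u z)^*%C) u d.
Proof.
have [d Hd] := hasD_exp 2 u.
eexists; apply: (@eq_hasD _ (fun u => cexp (- (th * (B z)^*%C * u ^+ 2)))); last first.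
- by apply: hasD_comp; [exact: hasD_cexp|apply: hasDN; apply: hasDZ; exact: Hd].
- reflexivity.
- by move=> w; rewrite lweight_conj; congr cexp; ring.
Qed.

Lemma hasD_rweight_param u z : u != 0 -> Om z -> exists d, hasD (fun u => rweight u z) u d.
Proof.
move=> u0 Oz; have [d Hd] := hasD_sqrV u0.
eexists; apply: hasDM.
  apply: (hasD_comp (g := fun u => - (th * u ^- 2 * B z))); first exact: hasD_cexp.
  apply: (@eq_hasD _ (fun u => - (th * B z) * u ^- 2)); last by apply: hasDZ; exact: Hd.
  + by move=> w; ring.
  + reflexivity.
apply: (hasD_comp (f := fun k => wprim Om z0 B g k z) (g := fun u => th * u ^- 2)).
  exact: wprim_hasD.
by apply: hasDZ; exact: Hd.
Qed.

Lemma sloop_hol z : Om z -> hol (fun u => u != 0) (sloop z).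
Proof.
move=> Oz; apply: holP => u u0.
have [d Hd] := hasD_lweight_conj u z; have [e He] := hasD_rweight_param u0 Oz.
by eexists; apply: hasDM (hasD_inv u0) (hasDM Hd He).
Qed.

Lemma hasD_lweight u z : Om z ->
  hasD (lweight u) z (- ((th * u ^+ 2)^*%C) * der B z * lweight u z).
Proof.
move=> Oz; apply: (@eq_hasD _ (fun z => cexp (- ((th * u ^+ 2)^*%C) * B z))); last first.
- by apply: hasD_comp; [exact: hasD_cexp|apply: hasDZ; exact: HB].
- by rewrite /lweight mulNr; ring.
- by move=> w; rewrite /lweight mulNr.
Qed.

Lemma hasD_rweight u z : Om z ->
  hasD (rweight u) z (- (th * u ^- 2) * der B z * rweight u z + g z).
Proof.
move=> Oz; apply: (@eq_hasD _ (fun z => cexp (- (th * u ^- 2) * B z) *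
  wprim Om z0 B g (th * u ^- 2) z)); last first.
- apply: hasDM; last by have [_ H] := wprimP oO sO Oz0 HB Hg (th * u ^- 2); exact: H.
  by apply: hasD_comp; [exact: hasD_cexp|apply: hasDZ; exact: HB].
- rewrite /rweight mulNr; set k := th * _ * B z.
  have H := cexpN k.
  rewrite [cexp (- k) * (cexp k * g z)]mulrA [cexp (- k) * cexp k]mulrC H; ring.
- by move=> w; rewrite /rweight mulNr.
Qed.

Lemma sloop_cm_wdiff (m : C -> C) (s : R) z : 0 < s -> Om z ->
  (forall u, cabs u = s -> zcont m u) ->
  wdiff (fun v => cm (fun u => m u * ((lweight u v)^*%C * rweight u v)) s) z
    (cm (fun u => m u * ((lweight u z)^*%C *
       (- (th * u ^- 2) * der B z * rweight u z + g z))) s)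
    (cm (fun u => m u * (- (th * u ^+ 2) * (der B z)^*%C *
       ((lweight u z)^*%C * rweight u z))) s).
Proof.
move=> s0 Oz cm_; have s0' := ltW s0.
have [Mm Mm0 HMm] := circle_bounded cm_.
have [r1 r10 [rO1 [b0 [b00 Hb]]]] := hol_bounded_near oO HB Oz.
pose L := cabs th * s ^- 2.
have [r2 r20 [rO2 [My My0 HMy]]] := wprim_bounded oO sO Oz0 HB Hg L Oz.
pose r := Num.min r1 r2.
have r0 : 0 < r by rewrite lt_min r10.
have d1 w : disc z r w -> disc z r1 w by rewrite /disc /= lt_min => /andP[].
have d2 w : disc z r w -> disc z r2 w by rewrite /disc /= lt_min => /andP[].
have dO w : disc z r w -> Om w by move=> /d1/rO1.
have un0 (u : C) : cabs u = s -> u != 0 by rewrite -cabs_gt0 => ->.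
pose M := Mm + expR (cabs th * s ^+ 2 * b0) + expR (L * b0) * My.
have e1 := expR_ge0 (cabs th * s ^+ 2 * b0).
have e2 : 0 <= expR (L * b0) * My by rewrite mulr_ge0 ?expR_ge0// ltW.
have expM (x y : C) (c d : R) : cabs x = c -> cabs y <= d ->
    cabs (cexp (- (x * y))) <= expR (c * d).
  move=> xc yd; rewrite cabs_cexp ler_expR; apply: le_trans (ler_norm _) _.
  apply: le_trans (Re_le_cabs _) _; rewrite cabsN cabsM xc.
  by apply: ler_wpM2l => //; rewrite -xc cabs_ge0.
have H := @cm_wdiff _ m lweight rweight s z r M s0' r0.
apply: eq_wdiff (H _ _ _ _ _ _ _ _ _) => //.
- apply: eq_cm => // u us.
  by rewrite (der_hasD (hasD_rweight u Oz)).
- apply: eq_cm => // u us.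
  rewrite (der_hasD (hasD_lweight u Oz)); set t := th * _.
  by rewrite rmorphM rmorphM rmorphN /= conjcK; ring.
- by rewrite /M; lra.
- exact: circ_contP.
- by move=> u us; have := HMm u us; rewrite /M; lra.
- by move=> u us; apply: holP => w /dO Ow; eexists; exact: hasD_lweight.
- by move=> u us; apply: holP => w /dO Ow; eexists; exact: hasD_rweight.
- move=> u w us wz; have Bw := Hb w (d1 _ wz).
  have := expM (th * u ^+ 2)^*%C (B w) (cabs th * s ^+ 2) b0 _ Bw.
  by rewrite cabs_conj cabsM cabsX us => /(_ erefl); rewrite /M /lweight; lra.
- move=> u w us wz; have Bw := Hb w (d1 _ wz).
  have hL : cabs (th * u ^- 2) = L by rewrite cabsM cabsV cabsX us.
  have h1 := expM _ _ _ _ hL Bw; have h2 := HMy (th * u ^- 2) w _ (d2 _ wz).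
  rewrite hL in h2; have {}h2 := h2 (lexx _).
  have : cabs (rweight u w) <= expR (L * b0) * My.
    by rewrite /rweight cabsM; apply: ler_pM; rewrite ?cabs_ge0.
  by rewrite /M; lra.
- move=> w /dO Ow; apply: circ_contP => // u us.
  have [d Hd] := hasD_lweight_conj u w; apply: (@eq_gcont _ _ _ (fun u => ((lweight u w)^*%C)^*%C)).
    by move=> t; rewrite conjcK.
  apply: gcont_comp (hasD_zcont Hd); exact: wdiff_zcont (wdiff_conj _).
- move=> w /dO Ow; apply: circ_contP => // u us.
  by have [d Hd] := hasD_rweight_param (un0 _ us) Ow; exact: hasD_zcont Hd.
Qed.

(** The part of the loop in negative powers, at l. The next two definitions are its Laurent
    coefficients of u and of u^-1. *)
Definition negp (z l : C) : C := cm (fun u => sloop z u * oker l u) (1/2 : R).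
Definition lcoef1 (z : C) : C := cm (fun u => sloop z u * u^-1) (1/2 : R).
Definition lcoefm1 (z : C) : C := cm (fun u => sloop z u * u) (1/2 : R).

(** The z derivative multiplies the loop by -th B' u^-2 and adds g u^-1 times a power series in u^2
    with value 1 at 0, of which g/l is the negative part. The conj z derivative multiplies by -th
    conj(B') u^2. Multiplication by u^-2 moves the coefficient of u into the negative part;
    multiplication by u^2 moves that of u^-1 out of it. *)
Lemma negp_wdiff (z l : C) : Om z -> cabs l = 1 ->
  wdiff (fun z => negp z l) z
    (- th * der B z * (l ^- 2 * negp z l + l^-1 * lcoef1 z) + l^-1 * g z)
    (- th * (der B z)^*%C * (l ^+ 2 * negp z l - l * lcoefm1 z)).
Proof.
move=> Oz l1; have l0 := unit_neq0 l1.
have s0 : 0 < (1/2 : R) by lra.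
have n0 (u : C) : cabs u = (1/2 : R) -> l ^+ 2 - u ^+ 2 != 0.
  by move=> us; apply: sqr_sub_neq0; rewrite us l1; apply/eqP; lra.
have ck (u : C) : cabs u = (1/2 : R) -> zcont (oker l) u.
  by move=> us; have [d Hd] := oker_hasD (n0 _ us); exact: hasD_zcont Hd.
have cV (u : C) : cabs u = (1/2 : R) -> zcont (fun u => u^-1) u.
  by move=> us; exact: hasD_zcont (hasD_inv (half_neq0 us)).
have cw (u : C) : cabs u = (1/2 : R) -> zcont (sloop z) u.
  by move=> us; apply: hol_zcont (sloop_hol Oz) _; exact: half_neq0.
have cE (u : C) : zcont (fun u => (lweight u z)^*%C) u.
  by have [d Hd] := hasD_lweight_conj u z; exact: hasD_zcont Hd.
have s0' := ltW s0.
have cW := circ_contP s0' cw; have cK := circ_contP s0' ck.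
have cI := @circ_contP _ (fun u => u) _ s0' (fun u _ => hasD_zcont (hasD_id u)).
have cJ := circ_contP s0' cV.
(* The term containing g loses its pole at u = 0, because [oker] vanishes there; its mean will be
   the value at the centre. *)
have hL (u : C) : l ^+ 2 - u ^+ 2 != 0 ->
    exists d, hasD (fun u => l * (lweight u z)^*%C / (l ^+ 2 - u ^+ 2)) u d.
  move=> m0; have [d Hd] := hasD_lweight_conj u z; have [e He] := hasD_exp 2 u.
  eexists; apply: hasDM; first by apply: hasDZ; exact: Hd.
  apply: (hasD_comp (f := fun w => w^-1) (g := fun u => l ^+ 2 - u ^+ 2)); first exact: hasD_inv.
  by apply: hasDB; [exact: hasD_cst|exact: He].
have cL : circ_cont (fun u => l * (lweight u z)^*%C / (l ^+ 2 - u ^+ 2)) (1/2 : R).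
  by apply: circ_contP => // u us; have [d Hd] := hL _ (n0 _ us); exact: hasD_zcont Hd.
have H := @sloop_cm_wdiff (fun u => u^-1 * oker l u) (1/2) z s0 Oz.
apply: eq_wdiff (H _) => //; last first.
- by move=> u us; apply: gcontM; [exact: cV|exact: ck].
- rewrite (@eq_cm _ _ (fun u => (- th * (der B z)^*%C * l ^+ 2) * (sloop z u * oker l u) -
    (- th * (der B z)^*%C * l) * (sloop z u * u)) _ s0').
    rewrite cmB; [|exact: circ_contM (circ_cont_cst _ _) (circ_contM cW cK)|
      exact: circ_contM (circ_cont_cst _ _) (circ_contM cW cI)].
    rewrite !cmZ //; try exact: circ_contM.
    by rewrite /negp /lcoefm1; ring.
  move=> u us; rewrite /sloop /oker; field.
  by rewrite n0 ?half_neq0.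
- rewrite (@eq_cm _ _ (fun u => (- th * der B z * l ^- 2) * (sloop z u * oker l u) +
    ((- th * der B z * l^-1) * (sloop z u * u^-1) +
      g z * (l * (lweight u z)^*%C / (l ^+ 2 - u ^+ 2)))) _ s0').
    rewrite cmD; [|exact: circ_contM (circ_cont_cst _ _) (circ_contM cW cK)|
      apply: circ_contD; [exact: circ_contM (circ_cont_cst _ _) (circ_contM cW cJ)|
        exact: circ_contM (circ_cont_cst _ _) cL]].
    rewrite cmD; [|exact: circ_contM (circ_cont_cst _ _) (circ_contM cW cJ)|
        exact: circ_contM (circ_cont_cst _ _) cL].
    rewrite !cmZ //; try exact: circ_contM.
    have -> : cm (fun u => l * (lweight u z)^*%C / (l ^+ 2 - u ^+ 2)) (1/2 : R) = l^-1.
      have H1 : hol (disc 0 1) (fun u => l * (lweight u z)^*%C / (l ^+ 2 - u ^+ 2)).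
        apply: holP => u; rewrite /disc /= subr0 => u1.
        by apply: hL; apply: sqr_sub_neq0; rewrite l1 lt_eqF.
      rewrite (cm_center H1); last by lra.
      rewrite lweight_conj expr0n /= mulr0n !(mulr0, mul0r) oppr0 cexp0 addr0; field.
      exact: l0.
    by rewrite /negp /lcoef1; ring.
  move=> u us; rewrite /sloop /oker; field.
  by rewrite l0 n0 ?half_neq0.
- by move=> w; apply: eq_cm => // u us; rewrite /sloop; ring.
Qed.

Lemma sloopN z u : sloop z (- u) = - sloop z u.
Proof. by rewrite /sloop /lweight /rweight !sqrrN invrN mulNr. Qed.

(** This is [laurent_split], with the Cauchy kernel replaced by its odd version, as the loop is
    odd. *)
Lemma sloop_split z l : Om z -> cabs l = 1 -> sloop z l = negp z l + Tker (sloop z) l.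
Proof.
move=> Oz l1; have Hw := sloop_hol Oz.
(* Averaging over u and -u: half of u/(u - l) - u/(u + l) is l u/(u^2 - l^2). *)
have fold (s : R) : 0 < s -> s != 1 -> cm (fun u => sloop z u * (u / (u - l))) s =
    cm (fun u => sloop z u * (l * u / (u ^+ 2 - l ^+ 2))) s.
  move=> s0 s1; have s0' := ltW s0.
  have us u : cabs u = s -> u != 0 by rewrite -cabs_gt0 => ->.
  have ul u : cabs u = s -> u - l != 0.
    by move=> uE; rewrite subr_eq0; apply/negP => /eqP E; rewrite -uE E l1 eqxx in s1.
  have pl u : cabs u = s -> u + l != 0.
    by move=> uE; rewrite addr_eq0; apply/negP => /eqP E; rewrite -uE E cabsN l1 eqxx in s1.
  have cf u : cabs u = s -> zcont (fun u => sloop z u * (u / (u - l))) u.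
    move=> uE; apply: gcontM; first exact: hol_zcont Hw (us _ uE).
    apply: (@hasD_zcont _ (fun u => u / (u - l))); apply: hasDM (hasD_id u) _.
    by apply: (hasD_comp (f := fun w => w^-1) (g := fun u => u - l));
      [apply: hasD_inv; exact: ul|apply: hasDB; [exact: hasD_id|exact: hasD_cst]].
  have cfN u : cabs u = s -> zcont (fun z0 => sloop z (- z0) * (- z0 / (- z0 - l))) u.
    by move=> uE; apply: (zcontN (f := fun u => sloop z u * (u / (u - l)))); apply: cf; rewrite cabsN.
  have num u : cabs u = s -> - u - l != 0 by move=> uE; rewrite -opprD oppr_eq0 pl.
  rewrite -[LHS]mulr1 -(mulVf (x := 2 : C)) ?pnatr_eq0// mulrCA mulr_natr [cm _ _ *+ 2]mulr2n.
  rewrite -{2}(cm_opp s0' cf) -cmD; [|exact: circ_contP|exact: circ_contP].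
  rewrite -cmZ; last first.
    apply: circ_contD; [exact: circ_contP|exact: circ_contP].
  apply: eq_cm => // u uE; rewrite sloopN; field.
  by apply/and3P; split; [rewrite subr_sqr mulf_neq0 ?ul ?pl|exact: num|exact: ul].
rewrite (laurent_split Hw l1) fold; [|lra|by apply/eqP; lra].
rewrite [cm _ (1/2)]fold; [|lra|by apply/eqP; lra].
rewrite addrC /Tker; congr (_ + _).
rewrite -mulN1r -cmZ.
  apply: eq_cm => [|u us]; first lra.
  have n0 : l ^+ 2 - u ^+ 2 != 0 by apply: sqr_sub_neq0; rewrite us l1; apply/eqP; lra.
  have n1 : u ^+ 2 - l ^+ 2 != 0 by rewrite -opprB oppr_eq0.
  by rewrite /oker; field; rewrite n0 n1.
apply: circ_contP => [|u us]; first lra.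
apply: gcontM; first by apply: hol_zcont Hw _; exact: half_neq0.
have [d Hd] := hasD_exp 2 u; apply: (@hasD_zcont _ (fun u => l * u / (u ^+ 2 - l ^+ 2))).
apply: hasDM; first by apply: hasDZ; exact: hasD_id.
apply: (hasD_comp (f := fun w => w^-1) (g := fun u => u ^+ 2 - l ^+ 2)).
  by apply: hasD_inv; apply: sqr_sub_neq0; rewrite us l1; apply/eqP; lra.
by apply: hasDB; [exact: Hd|exact: hasD_cst].
Qed.

(** On the unit circle conj l = 1/l, so conjugation carries the circle |u| = 1/2 to |v| = 2 with v =
    4u, and [oker] to the kernel of [Tker]. The conjugate of the negative part thereby agrees on the
    circle with a function that is holomorphic on a disc. *)
Lemma negp_conj z l : Om z -> cabs l = 1 ->
  (negp z l)^*%C = Tker (fun v => (sloop z (rc (1/4 : R) * v))^*%C) l.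
Proof.
move=> Oz l1; have Hw := sloop_hol Oz.
have s0 : 0 <= (1/2 : R) by lra.
rewrite /negp -cm_conj; last first.
  apply: circ_contP => // u us.
  apply: gcontM; first by apply: hol_zcont Hw _; exact: half_neq0.
  have [|d Hd] := @oker_hasD _ l u; first by apply: sqr_sub_neq0; rewrite us l1; apply/eqP; lra.
  exact: hasD_zcont Hd.
rewrite /Tker /cm; congr (_ * _); apply: eq_sint => t.
(* The argument 1/4 v on the right-hand side is the point of radius 1/2 when v has radius 2. *)
have E : rc (1/2 : R) * expi t = rc (1/4 : R) * (rc 2 * expi t) :> C.
  by rewrite mulrA -rmorphM; congr (rc _ * _); field.
rewrite {1}E rmorphM /=; congr (_ * _).
have ee : expi t * (expi t)^*%C = 1 :> C by rewrite mul_conj cabs_expi expr1n rc1.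
have ll : l * l^*%C = 1 by rewrite mul_conj l1 expr1n rc1.
have l0 := unit_neq0 l1; have e0 : expi t != 0 :> C by apply: unit_neq0; exact: cabs_expi.
have lV : l^*%C = l^-1 by apply: (mulfI l0); rewrite ll mulfV.
have eV : (expi t)^*%C = (expi t)^-1 :> C by apply: (mulfI e0); rewrite ee mulfV.
have h12 : rc (1/2 : R) = 1 / 2 :> C by rewrite rmorphM /= fmorphV rmorph_nat rc1.
have h2 : rc 2 = 2 :> C by rewrite rmorph_nat.
have hc := @conj_rc R (1/2).
have n1 : (rc 2 * expi t) ^+ 2 - l ^+ 2 != 0.
  apply: sqr_sub_neq0; rewrite l1 cabsM cabs_expi cabs_real.
  by apply/eqP; rewrite mulr1 ger0_norm; lra.
move: h12 h2 hc n1 e0 eV; move: (expi t) (rc (1/2 : R)) (rc 2) => e h k h12 -> hc n1 e0 eV.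
have cM (x y : C) : (x * y)^*%C = x^*%C * y^*%C by exact: rmorphM.
have cB (x y : C) : (x - y)^*%C = x^*%C - y^*%C by exact: rmorphB.
have cV (x : C) : (x^-1)^*%C = (x^*%C)^-1 by exact: fmorphV.
rewrite /oker !expr2 cM cV cB !cM lV.
rewrite !expr2 in n1; rewrite hc eV h12; field; by rewrite l0 e0 n1.
Qed.

Lemma negc_hol z : Om z -> hol (disc 0 2) (Tker (fun v => (sloop z (rc (1/4 : R) * v))^*%C)).
Proof.
move=> Oz; apply: Tker_hol => v v2.
apply: gcont_comp; first exact: wdiff_zcont (wdiff_conj _).
apply: gcont_comp; last exact: hasD_zcont (hasDZ _ (hasD_id v)).
apply: hol_zcont (sloop_hol Oz) _; apply: half_neq0.
by rewrite cabsM cabs_real v2 ger0_norm; lra.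
Qed.

Lemma posp_hol z : Om z -> hol (disc 0 2) (Tker (sloop z)).
Proof.
move=> Oz; apply: Tker_hol => v v2; apply: hol_zcont (sloop_hol Oz) _.
by rewrite -cabs_gt0 v2.
Qed.

Lemma sloop_z0 u : sloop z0 u = 0.
Proof. by rewrite /sloop /rweight (wprimP oO sO Oz0 HB Hg _).1 !mulr0. Qed.

Lemma negp_z0 l : negp z0 l = 0.
Proof.
rewrite /negp (@eq_cm _ _ (fun=> 0)) ?cm_cst//.
by move=> u _; rewrite sloop_z0 mul0r.
Qed.

End ScalarLoops.

(** * The twisting symmetry of the scalar loops *)

Section Twist.
Context {R : realType}.
Local Notation C := R[i].
Variables (Om : set C) (z0 : C).
Hypothesis oO : open Om.
Hypothesis sO : simply_connected Om.
Hypothesis Oz0 : Om z0.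
Variables (B : C -> C) (g : C -> C).
Hypothesis HB : hol Om B.
Hypothesis Hg : hol Om g.
Local Notation w := (sloop Om z0 B g).

Lemma iC_neq0 : (iC : C) != 0.
Proof. by rewrite -cabs_gt0 cabs_i ltr01. Qed.

Lemma iCV : (iC : C)^-1 = - iC.
Proof. by apply: (mulfI iC_neq0); rewrite mulfV ?iC_neq0// mulrN iCiC opprK. Qed.

Lemma sqr_iCM (u : C) : (iC * u) ^+ 2 = - u ^+ 2.
Proof. by rewrite exprMn expr2 iCiC mulN1r. Qed.

(** Under u -> i u the squares u^2 and u^-2 change sign, which amounts to th -> -th, and the
    prefactor u^-1 contributes -i. *)
Lemma sloop_iC th z u : w th z (iC * u) = - iC * w (- th) z u.
Proof.
rewrite /sloop /lweight /rweight sqr_iCM !invrN !mulrN !mulNr invfM iCV mulNr.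
by rewrite mulNr -!mulrA.
Qed.

(** Means are invariant under rotation by i, which transfers the symmetry to Laurent coefficients
    and to the negative part. *)
Lemma sloop_cm_iC th z (f k : C -> C) (s : R) (a : C) : 0 < s -> Om z ->
  (forall u, cabs u = s -> zcont f u) ->
  (forall u, cabs u = s -> f (iC * u) = a * k u) ->
  (forall u, cabs u = s -> zcont k u) ->
  cm (fun u => w th z u * f u) s = - iC * a * cm (fun u => w (- th) z u * k u) s.
Proof.
move=> s0 Oz cf fk ck; have s0' := ltW s0.
have u0 (u : C) : cabs u = s -> u != 0 by rewrite -cabs_gt0 => ->.
rewrite -cm_rot; last first.
  apply: circ_contP => // u us; apply: gcontM (cf _ us).
  by apply: hol_zcont (sloop_hol oO sO Oz0 HB Hg th Oz) _; exact: u0.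
rewrite -cmZ; last first.
  apply: circ_contP => // u us; apply: gcontM (ck _ us).
  by apply: hol_zcont (sloop_hol oO sO Oz0 HB Hg (- th) Oz) _; exact: u0.
by apply: eq_cm => // u us; rewrite sloop_iC fk//; ring.
Qed.

Lemma lcoef1N th z : Om z -> lcoef1 Om z0 B g th z = - lcoef1 Om z0 B g (- th) z.
Proof.
move=> Oz; have s0 : 0 < (1/2 : R) by lra.
have cV (u : C) : cabs u = (1/2 : R) -> zcont (fun u => u^-1) u.
  by move=> us; exact: hasD_zcont (hasD_inv (half_neq0 us)).
rewrite /lcoef1 (sloop_cm_iC th (k := fun u => u^-1) (a := - iC) s0 Oz) //.
  by rewrite mulrNN iCiC mulN1r.
by move=> u us; rewrite invfM iCV.
Qed.

Lemma lcoefm1N th z : Om z -> lcoefm1 Om z0 B g th z = lcoefm1 Om z0 B g (- th) z.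
Proof.
move=> Oz; have s0 : 0 < (1/2 : R) by lra.
have cI (u : C) : cabs u = (1/2 : R) -> zcont (fun u => u) u.
  by move=> us; exact: hasD_zcont (hasD_id u).
rewrite /lcoefm1 (sloop_cm_iC th (k := fun u => u) (a := iC) s0 Oz) //.
by rewrite mulNr iCiC opprK mul1r.
Qed.

Lemma negp_iC th z l : Om z -> cabs l = 1 ->
  negp Om z0 B g th z (iC * l) = - iC * negp Om z0 B g (- th) z l.
Proof.
move=> Oz l1; have s0 : 0 < (1/2 : R) by lra.
have ck (m : C) (u : C) : cabs m = 1 -> cabs u = (1/2 : R) -> zcont (oker m) u.
  move=> l1' us; have [|d Hd] := @oker_hasD _ m u; last exact: hasD_zcont Hd.
  by apply: sqr_sub_neq0; rewrite us l1'; apply/eqP; lra.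
rewrite /negp (sloop_cm_iC th (k := oker l) (a := 1) s0 Oz) ?mulr1//.
- by move=> u us; apply: ck => //; rewrite cabsM cabs_i mul1r.
- move=> u us; rewrite /oker !sqr_iCM mul1r -opprD -mulrACA iCiC.
  by rewrite mulN1r invrN mulrNN.
- by move=> u us; apply: ck.
Qed.

End Twist.

(** * Coordinates of C^4 in which [Li] is diagonal *)

Section EigenCoordinates.
Context {R : realType}.
Local Notation C := R[i].
Implicit Types (p q r t x y k : C).

(** Coordinates in the eigenbasis [Pp] eps, [Pm] eps, [Pp] Li epsb, [Pm] Li epsb of [Li]. The plane
    spanned by eps and Li epsb is p = q, r = t. *)
Definition vec4 p q r t : 'cV[C]_4 := Emx p q *m eps + Emx r t *m (Li *m epsb).

Lemma vec4E p q r t : vec4 p q r t = (4^-1 : C) *: quat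
  (p + q + iC * (r - t)) (- iC * (p - q) + (r + t))
  (- iC * (p + q) - (r - t)) (- (p - q) + iC * (r + t)).
Proof.
rewrite /vec4 /eps /epsb -!scalemxAr !quatE !Emx_quat !quatE.
by congr quat; field: (@iCiC R).
Qed.

Lemma Emx_mul x y (e : 'cV[C]_4) : Emx x y *m e = x *: (Pp *m e) + y *: (Pm *m e).
Proof. by rewrite /Emx; move: Pp Pm => P Q; rewrite mulmxDl -!scalemxAl. Qed.

Lemma vec4_basis : exists e0 e1 e2 e3 : 'cV[C]_4, forall p q r t,
  vec4 p q r t = (p *: e0 + q *: e1) + (r *: e2 + t *: e3).
Proof.
exists (Pp *m eps), (Pm *m eps), (Pp *m (Li *m epsb)), (Pm *m (Li *m epsb)) => p q r t.
by rewrite /vec4 !Emx_mul.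
Qed.

Lemma vec4_coord (i : 'I_4) : exists A0 A1 A2 A3 : C,
  forall p q r t, vec4 p q r t i 0 = A0 * p + A1 * q + A2 * r + A3 * t.
Proof.
have [e0 [e1 [e2 [e3 H]]]] := vec4_basis.
by exists (e0 i 0), (e1 i 0), (e2 i 0), (e3 i 0) => p q r t; rewrite H !mxE; ring.
Qed.

Lemma vec4D p q r t p' q' r' t' :
  vec4 p q r t + vec4 p' q' r' t' = vec4 (p + p') (q + q') (r + r') (t + t').
Proof. by rewrite /vec4 -!EmxD !mulmxDl; rewrite addrACA. Qed.

Lemma vec4Z k p q r t : k *: vec4 p q r t = vec4 (k * p) (k * q) (k * r) (k * t).
Proof. by rewrite /vec4 -!EmxZ scalerDr !scalemxAl. Qed.

Lemma vec4N p q r t : - vec4 p q r t = vec4 (- p) (- q) (- r) (- t).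
Proof. by rewrite -scaleN1r vec4Z !mulN1r. Qed.

Lemma vec4_0 : vec4 0 0 0 0 = 0.
Proof. by rewrite /vec4 Emx0 !mul0mx addr0. Qed.

Lemma Emx_vec4 x y p q r t : Emx x y *m vec4 p q r t = vec4 (x * p) (y * q) (x * r) (y * t).
Proof. by rewrite /vec4 mulmxDr !mulmxA !EmxM. Qed.

(** [Li] is real, so conjugation exchanges [Pp] and [Pm]; it also exchanges eps and epsb, and [Pm]
    epsb = i [Pm] Li epsb. Hence the crossed coordinates and the factors i and -i. *)
Lemma vec4_conj p q r t : map_mx (@conjc R) (vec4 p q r t) =
  vec4 (iC * t^*%C) (- iC * r^*%C) (- iC * q^*%C) (iC * p^*%C).
Proof.
have mq (a b c d : C) : map_mx (@conjc R) (quat a b c d) = quat a^*%C b^*%C c^*%C d^*%C.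
  by apply: quat_ext; rewrite !mxE; rewrite inordK.
have cM (x y : C) : (x * y)^*%C = x^*%C * y^*%C by exact: rmorphM.
have cB (x y : C) : (x - y)^*%C = x^*%C - y^*%C by exact: rmorphB.
have cD (x y : C) : (x + y)^*%C = x^*%C + y^*%C by exact: rmorphD.
have cN (x : C) : (- x)^*%C = - x^*%C by exact: rmorphN.
have ci : (iC : C)^*%C = - iC by rewrite /conjc/= -[RHS]/(Complex (-0) (-1)) oppr0.
have c4 : (4^-1 : C)^*%C = 4^-1 by rewrite -[LHS]/(@conjc R 4^-1) fmorphV rmorph_nat.
rewrite !vec4E !quatE mq; congr quat; rewrite !(cM, cB, cD, cN) ci c4; ring: (@iCiC R).
Qed.

Lemma Lj_vec4 p q r t : - (Lj *m vec4 p q r t) = vec4 (- iC * q) (- iC * p) (- iC * t) (- iC * r).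
Proof. by rewrite !vec4E !quatE; congr quat; field: (@iCiC R). Qed.

Lemma vec4_inj p q r t p' q' r' t' : vec4 p q r t = vec4 p' q' r' t' ->
  [/\ p = p', q = q', r = r' & t = t'].
Proof.
rewrite !vec4E !quatE => /quat_inj[]; have n4 : (4 : C) != 0 by rewrite pnatr_eq0.
have i2 : 4^-1 != 0 :> C by rewrite invr_eq0.
move=> /(mulfI i2) e1 /(mulfI i2) e2 /(mulfI i2) e3 /(mulfI i2) e4.
have n2 : (4 : C) * 1 != 0 by rewrite mulr1.
have h1 : p + q = p' + q'.
  apply: (mulfI (x := 2)); first by rewrite pnatr_eq0.
  have : (p + q + iC * (r - t)) + iC * (- iC * (p + q) - (r - t)) = p' + q' + iC * (r' - t') + iC * (- iC * (p' + q') - (r' - t')) by rewrite e1 e3.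
  by move=> h; apply: etrans (etrans h _); ring: (@iCiC R).
have h2 : r - t = r' - t'.
  have h : iC * (r - t) = iC * (r' - t') by apply: (addrI (p + q)); rewrite {2}h1.
  exact: mulfI (iC_neq0) _ _ h.
have h3 : r + t = r' + t'.
  apply: (mulfI (x := 2)); first by rewrite pnatr_eq0.
  have : (- iC * (p - q) + (r + t)) - iC * (- (p - q) + iC * (r + t)) = (- iC * (p' - q') + (r' + t')) - iC * (- (p' - q') + iC * (r' + t')) by rewrite e2 e4.
  by move=> h; apply: etrans (etrans h _); ring: (@iCiC R).
have h4 : p - q = p' - q'.
  by apply: oppr_inj; apply: (addIr (iC * (r + t))); rewrite {2}h3.
have two (x y x' y' : C) : x + y = x' + y' -> x - y = x' - y' -> x = x' /\ y = y'.
  move=> a b; have n : (2 : C) != 0 by rewrite pnatr_eq0.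
  split; apply: (mulfI n).
    by transitivity ((x + y) + (x - y)); [ring|rewrite a b; ring].
  by transitivity ((x + y) - (x - y)); [ring|rewrite a b; ring].
by have [-> ->] := two _ _ _ _ h1 h4; have [-> ->] := two _ _ _ _ h3 h2.
Qed.

Lemma eps_vec4 : eps = vec4 1 1 0 0 :> 'cV[C]_4.
Proof. by rewrite /vec4 Emx1 Emx0 mul1mx mul0mx addr0. Qed.

Lemma Liepsb_vec4 : Li *m epsb = vec4 0 0 1 1 :> 'cV[C]_4.
Proof. by rewrite /vec4 Emx1 Emx0 mul1mx mul0mx add0r. Qed.

Lemma epsb_vec4 : epsb = vec4 0 0 (- iC) iC :> 'cV[C]_4.
Proof. by rewrite vec4E /epsb !quatE; congr quat; field: (@iCiC R). Qed.

Lemma Lieps_vec4 : Li *m eps = vec4 iC (- iC) 0 0 :> 'cV[C]_4.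
Proof. by rewrite eps_vec4 Li_Emx Emx_vec4 !(mulr0, mulr1). Qed.

End EigenCoordinates.

(** * The projection P in eigencoordinates *)

Section Projection.
Context {R : realType}.
Local Notation C := R[i].

Lemma cvg_conj (u : nat -> C) (x : C) : u @ \oo --> x ->
  (fun n => (u n)^*%C) @ \oo --> x^*%C.
Proof.
move=> ux; apply: (cvg_comp _ (@conjc R) ux).
move=> A /nbhsCP[d d0 H]; apply/nbhsCP; exists d => // w wd; apply: H.
by rewrite -[X in cabs X]/((w^*%C) - (x^*%C)) -rmorphB cabs_conj.
Qed.

Lemma cvg_vec4 (p q r t : nat -> C) (x y v w : C) :
  p @ \oo --> x -> q @ \oo --> y -> r @ \oo --> v -> t @ \oo --> w ->
  (fun n => vec4 (p n) (q n) (r n) (t n)) @ \oo --> vec4 x y v w.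
Proof.
move=> px qy rv tw.
have [e0 [e1 [e2 [e3 H]]]] := @vec4_basis R.
have -> : (fun n => vec4 (p n) (q n) (r n) (t n)) = fun n =>
    (p n *: e0 + q n *: e1) + (r n *: e2 + t n *: e3) by apply/funext => n; rewrite H.
rewrite H.
have Z (f : nat -> C) (l : C) (e : 'cV[C]_4) : f @ \oo --> l -> (fun n => f n *: e) @ \oo --> l *: e.
  by move=> fl; apply: cvgZl.
have D (f g : nat -> 'cV[C]_4) (l m : 'cV[C]_4) : f @ \oo --> l -> g @ \oo --> m ->
    (fun n => f n + g n) @ \oo --> l + m.
  by move=> fl gm; exact: (@cvgD _ ('cV[C]_4 : normedModType C) _ \oo _ f g l m fl gm).
exact: D (D _ _ _ _ (Z _ _ e0 px) (Z _ _ e1 qy)) (D _ _ _ _ (Z _ _ e2 rv) (Z _ _ e3 tw)).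
Qed.

Lemma eq_projP (V V' : C -> 'cV[C]_4) l : (forall m, cabs m = 1 -> V m = V' m) ->
  projP V l = projP V' l.
Proof.
move=> VV'; have E : vfourier V = vfourier V'.
  apply/funext => n; apply/colP => r; rewrite !mxE /fourier; congr (_ * _).
  by apply: eq_cint => t _; rewrite VV' ?cabs_expi.
by rewrite /projP E.
Qed.

Lemma vfourier_vec4 (f0 f1 f2 f3 : C -> C) n : circ_cont f0 1 -> circ_cont f1 1 ->
  circ_cont f2 1 -> circ_cont f3 1 ->
  vfourier (fun m => vec4 (f0 m) (f1 m) (f2 m) (f3 m)) n =
  vec4 (fourier f0 n) (fourier f1 n) (fourier f2 n) (fourier f3 n).
Proof.
move=> c0 c1 c2 c3; apply/colP => i; rewrite mxE.
have [A0 [A1 [A2 [A3 HA]]]] := @vec4_coord R i; rewrite HA.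
have -> : (fun l => vec4 (f0 l) (f1 l) (f2 l) (f3 l) i 0) =
    (fun l => A0 * f0 l + A1 * f1 l + A2 * f2 l + A3 * f3 l) by apply/funext => l.
have cz : circ_cont (fun z : C => z^-1 ^ n) 1.
  apply: circ_contP => // z z1; have [d Hd] := hasD_expz n (unit_neq0 z1).
  exact: hasD_zcont Hd.
have cA (A : C) f : circ_cont f 1 -> circ_cont (fun z => A * f z) 1.
  by move=> cf; exact: circ_contM (circ_cont_cst _ _) cf.
have cAz (A : C) f : circ_cont f 1 -> circ_cont (fun z => A * (f z * z^-1 ^ n)) 1.
  by move=> cf; exact: circ_contM (circ_cont_cst _ _) (circ_contM cf cz).
have c01 := circ_contD (cA A0 _ c0) (cA A1 _ c1).
have c012 := circ_contD c01 (cA A2 _ c2).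
rewrite !fourier_cm //; last by apply: circ_contD => //; exact: cA.
rewrite -!cmZ; try exact: circ_contM.
rewrite -!cmD; try exact: cAz.
- by apply: eq_cm => // z _; ring.
- by apply: circ_contD; try apply: circ_contD; exact: cAz.
- by apply: circ_contD; exact: cAz.
Qed.

Lemma series_vec4 (f0 f1 f2 f3 : nat -> C) :
  series (fun n => vec4 (f0 n) (f1 n) (f2 n) (f3 n)) =
  fun n => vec4 (series f0 n) (series f1 n) (series f2 n) (series f3 n).
Proof.
apply/funext => n; rewrite /series /=; elim: n => [|n IH].
  by rewrite !big_geq// vec4_0.
by rewrite !(big_nat_recr n)//= IH vec4D.
Qed.

(** Both series are summed by [neg_series], since for |l| = 1 the second one is the conjugate of the
    first; [vec4_conj] crosses the coordinates. *)
Lemma projP_vec4 (f0 f1 f2 f3 : C -> C) l (np := fun f : C -> C =>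
    cm (fun z => f z * (l * z / (l ^+ 2 - z ^+ 2))) (1 / 2 : R)) :
  hol (fun z => z != 0) f0 -> hol (fun z => z != 0) f1 ->
  hol (fun z => z != 0) f2 -> hol (fun z => z != 0) f3 -> cabs l = 1 ->
  projP (fun m => vec4 (f0 m) (f1 m) (f2 m) (f3 m)) l =
  vec4 (np f0 + iC * (np f3)^*%C) (np f1 - iC * (np f2)^*%C)
       (np f2 - iC * (np f1)^*%C) (np f3 + iC * (np f0)^*%C).
Proof.
move=> h0 h1 h2 h3 l1.
have cc f : hol (fun z : C => z != 0) f -> circ_cont f 1.
  by move=> hf; apply: circ_contP => // z z1; apply: hol_zcont hf _; exact: unit_neq0.
have l0 := unit_neq0 l1.
have lV : l^*%C = l^-1.
  by apply: (mulfI l0); rewrite mulfV// mul_conj l1 expr1n rc1.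
rewrite /projP.
have E1 : (fun n : nat => l ^- n.*2.+1 *:
    vfourier (fun m => vec4 (f0 m) (f1 m) (f2 m) (f3 m)) (- n.*2.+1%:Z)) =
    fun n => vec4 (l ^- n.*2.+1 * fourier f0 (- n.*2.+1%:Z))
      (l ^- n.*2.+1 * fourier f1 (- n.*2.+1%:Z))
      (l ^- n.*2.+1 * fourier f2 (- n.*2.+1%:Z))
      (l ^- n.*2.+1 * fourier f3 (- n.*2.+1%:Z)).
  by apply/funext => n; rewrite vfourier_vec4 ?vec4Z//; exact: cc.
have E2 : (fun n : nat => l ^+ n.*2.+1 *: map_mx (@conjc R)
    (vfourier (fun m => vec4 (f0 m) (f1 m) (f2 m) (f3 m)) (- n.*2.+1%:Z))) =
    fun n => vec4 (iC * (l ^- n.*2.+1 * fourier f3 (- n.*2.+1%:Z))^*%C)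
      (- iC * (l ^- n.*2.+1 * fourier f2 (- n.*2.+1%:Z))^*%C)
      (- iC * (l ^- n.*2.+1 * fourier f1 (- n.*2.+1%:Z))^*%C)
      (iC * (l ^- n.*2.+1 * fourier f0 (- n.*2.+1%:Z))^*%C).
  apply/funext => n; rewrite vfourier_vec4 ?vec4_conj ?vec4Z//; try exact: cc.
  have E (x : C) : (l ^- n.*2.+1 * x)^*%C = l ^+ n.*2.+1 * x^*%C.
    by rewrite rmorphM fmorphV rmorphXn /= lV exprVn invrK.
  by rewrite !E; congr vec4; ring.
rewrite E1 E2 !series_vec4.
have S f : hol (fun z : C => z != 0) f ->
    series (fun n : nat => l ^- n.*2.+1 * fourier f (- n.*2.+1%:Z)) @ \oo --> np f.
  by move=> hf; exact: neg_series.
have Sc (k : C) f : hol (fun z : C => z != 0) f ->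
    series (fun n : nat => k * (l ^- n.*2.+1 * fourier f (- n.*2.+1%:Z))^*%C) @ \oo -->
    k * (np f)^*%C.
  move=> hf; have -> : series (fun n : nat => k * (l ^- n.*2.+1 * fourier f (- n.*2.+1%:Z))^*%C) =
      fun n => k * (series (fun n : nat => l ^- n.*2.+1 * fourier f (- n.*2.+1%:Z)) n)^*%C.
    by apply/funext => n; rewrite /series /= rmorph_sum mulr_sumr.
  by apply: cvgMr; apply: cvg_conj; exact: S.
have L1 := cvg_vec4 (S _ h0) (S _ h1) (S _ h2) (S _ h3).
have L2 := cvg_vec4 (Sc iC _ h3) (Sc (- iC) _ h2) (Sc (- iC) _ h1) (Sc iC _ h0).
rewrite (cvg_lim _ L1)// (cvg_lim _ L2)// vec4D; congr vec4; ring.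
Qed.

End Projection.

(** * Limits and derivatives of matrices, entry by entry *)

Section MatrixAnalysis.
Context {R : realType}.
Local Notation C := R[i].

Lemma mx_cvgP (T : Type) (F : set_system T) m n (f : T -> 'M[C]_(m, n)) (M : 'M[C]_(m, n)) :
  Filter F -> f @ F --> M <-> forall i j, (fun x => f x i j) @ F --> M i j.
Proof.
move=> FF; split=> [H i j A An|H A [P MP PA]].
  exact: (H _ (@coord_continuous C m n i j M A An)).
have HF : F (fun x => forall ij : 'I_m * 'I_n, P ij.1 ij.2 (f x ij.1 ij.2)).
  by apply: filter_forall => ij; exact: (H ij.1 ij.2 _ (MP ij.1 ij.2)).
by apply: (@filterS _ F _ _ _ _ HF) => x Hx; apply: PA => i j; exact: (Hx (i, j)).
Qed.

Lemma is_derive_mx m n (f : C -> 'M[C]_(m, n)) (z : C) (D : 'M[C]_(m, n)) :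
  is_derive (z : C) (1 : C) f D <-> forall i j, hasD (fun w => f w i j) z (D i j).
Proof.
have E i j : (fun h : C => (h^-1 *: (f (h *: 1 + z) - f z)) i j) =
    (fun h : C => h^-1 *: ((f (h *: 1 + z)) i j - f z i j)).
  by apply/funext => h; rewrite !mxE.
split=> [[df <-] i j|H].
  move: df => /cvg_ex[l Hl]; have -> : 'D_1 f z = l by exact: cvg_lim Hl.
  apply/is_derive_hasD.
  have Hij : h^-1 *: ((f (h *: 1 + z)) i j - f z i j) @[h --> (0 : C)^'] --> l i j.
    by rewrite -E; exact: ((mx_cvgP _ _ _).1 Hl i j).
  split; first by apply/cvg_ex; exists (l i j).
  exact: cvg_lim Hij.
have Hl : h^-1 *: (f (h *: 1 + z) - f z) @[h --> (0 : C)^'] --> D.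
  apply/mx_cvgP => i j; rewrite E.
  have [/cvg_ex[l Hl] <-] := (is_derive_hasD _ _ _).2 (H i j).
  have -> : 'D_1 (fun w => f w i j) z = l by exact: cvg_lim Hl.
  exact: Hl.
split; first by apply/cvg_ex; exists D.
exact: cvg_lim Hl.
Qed.

Lemma zcont_within (A : set C) m n (f : C -> 'M[C]_(m, n)) :
  (forall z, A z -> forall i j, zcont (fun w => f w i j) z) -> {within A, continuous f}.
Proof.
move=> H; apply/subspace_continuousP => x Ax; apply/mx_cvgP => i j.
apply/cvgrPdist_le => e e0.
have [k ke] : exists k, e = rc k by apply/complex_realP; exact: gtr0_real.
subst e; rewrite ltcR in e0; have [d d0 dH] := (zcontP _ _).1 (H x Ax i j) _ e0.
apply/nbhsCP; exists d => // w wd _.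
by rewrite normE lecR cabs_sub; exact: dH.
Qed.

End MatrixAnalysis.

(** * Affine 5x5 matrices in eigencoordinates *)

Section AffineLoops.
Context {R : realType}.
Local Notation C := R[i].

Definition affE (x y p q r t : C) := aff (Emx x y) (vec4 p q r t).

Lemma affE_ext x y p q r t x' y' p' q' r' t' : x = x' -> y = y' -> p = p' -> q = q' ->
  r = r' -> t = t' -> affE x y p q r t = affE x' y' p' q' r' t'.
Proof. by move=> -> -> -> -> -> ->. Qed.

(** The entries are affine functions of the six coordinates, and [lie] is their linear part; so
    holomorphy and derivatives pass from coordinates to entries. *)
Lemma affE_coord (i j : 'I_(4 + 1)) : exists (A0 A1 A2 A3 A4 A5 k : C), forall x y p q r t,
  affE x y p q r t i j = A0 * x + A1 * y + A2 * p + A3 * q + A4 * r + A5 * t + k /\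
  lie (Emx x y) (vec4 p q r t) i j = A0 * x + A1 * y + A2 * p + A3 * q + A4 * r + A5 * t.
Proof.
rewrite -(fintype.splitK i) -(fintype.splitK j).
case: (fintype.split i) => i'; case: (fintype.split j) => j' /=.
- exists ((Pp : 'M[C]_4) i' j'), ((Pm : 'M[C]_4) i' j'), 0, 0, 0, 0, 0 => x y p q r t.
  rewrite /affE /aff /lie !block_mxEul /Emx; move: Pp Pm => P Q; rewrite !mxE.
  by split; ring.
- have [A0 [A1 [A2 [A3 H]]]] := @vec4_coord R i'.
  exists 0, 0, A0, A1, A2, A3, 0 => x y p q r t.
  by rewrite /affE /aff /lie !block_mxEur ord1 H; split; ring.
- exists 0, 0, 0, 0, 0, 0, 0 => x y p q r t.
  by rewrite /affE /aff /lie !block_mxEdl mxE; split; ring.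
- exists 0, 0, 0, 0, 0, 0, 1 => x y p q r t.
  by rewrite /affE /aff /lie !block_mxEdr !ord1 !mxE /= mulr1n; split; ring.
Qed.

Lemma affM (A A' : 'M[C]_4) T T' : aff A T *m aff A' T' = aff (A *m A') (A *m T' + T).
Proof. by rewrite /aff mulmx_block !mul0mx !mulmx0 !mulmx1 !addr0 add0r. Qed.

Lemma affEM x y p q r t x' y' p' q' r' t' :
  affE x y p q r t *m affE x' y' p' q' r' t' =
  affE (x * x') (y * y') (x * p' + p) (y * q' + q) (x * r' + r) (y * t' + t).
Proof. by rewrite /affE affM EmxM Emx_vec4 vec4D. Qed.

Lemma affE1 : affE 1 1 0 0 0 0 = 1%:M.
Proof. by rewrite /affE Emx1 vec4_0 /aff -scalar_mx_block. Qed.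

Lemma tau_affE x y p q r t :
  tau (affE x y p q r t) = affE y x (- iC * q) (- iC * p) (- iC * t) (- iC * r).
Proof. by rewrite /tau /affE block_mxKul block_mxKur Emx_tau Lj_vec4. Qed.

Lemma affE_hasD (x y p q r t : C -> C) z x' y' p' q' r' t' i j :
  hasD x z x' -> hasD y z y' -> hasD p z p' -> hasD q z q' -> hasD r z r' -> hasD t z t' ->
  hasD (fun w => affE (x w) (y w) (p w) (q w) (r w) (t w) i j) z
    (lie (Emx x' y') (vec4 p' q' r' t') i j).
Proof.
have [A0 [A1 [A2 [A3 [A4 [A5 [k H]]]]]]] := affE_coord i j.
move=> hx hy hp hq hr ht.
apply: (@eq_hasD _ (fun w => A0 * x w + A1 * y w + A2 * p w + A3 * q w + A4 * r w + A5 * t w + k)).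
- by move=> w; case: (H (x w) (y w) (p w) (q w) (r w) (t w)).
- reflexivity.
have [_ ->] := H x' y' p' q' r' t'; rewrite -[X in hasD _ _ X]addr0.
apply: hasDD (hasD_cst k z).
by do ?[apply: hasDD]; apply: hasDZ.
Qed.

Lemma affE_hol (U : set C) (x y p q r t : C -> C) i j :
  hol U x -> hol U y -> hol U p -> hol U q -> hol U r -> hol U t ->
  hol U (fun w => affE (x w) (y w) (p w) (q w) (r w) (t w) i j).
Proof.
move=> hx hy hp hq hr ht; apply: holP => z Uz; eexists.
by apply: affE_hasD; [exact: hx|exact: hy|exact: hp|exact: hq|exact: hr|exact: ht].
Qed.

(** The eigenvalues of exp(k Li / 4) are exp([thq e] k), where [e] selects the eigenspace of [Pp] or
    that of [Pm]. *)
Definition thq (e : bool) : C := if e then iC / 4 else - (iC / 4).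

Lemma thqN e : - thq e = thq (~~ e).
Proof. by case: e; rewrite /= ?opprK. Qed.

Lemma conjiC : (iC : C)^*%C = - iC.
Proof. by rewrite /conjc/= -[RHS]/(Complex (-0) (-1)) oppr0. Qed.

Lemma thq_conj e : (thq e)^*%C = - thq e.
Proof.
have c4 : (4^-1 : C)^*%C = 4^-1 by rewrite -[LHS]/(@conjc R 4^-1) fmorphV rmorph_nat.
have cM (x y : C) : (x * y)^*%C = x^*%C * y^*%C by exact: rmorphM.
have cN (x : C) : (- x)^*%C = - x^*%C by exact: rmorphN.
by case: e; rewrite /thq ?cN cM c4 conjiC mulNr.
Qed.

Lemma expmx_thq (k : C) : expmx ((k / 4) *: Li) = Emx (cexp (thq true * k)) (cexp (thq false * k)).
Proof. by rewrite expmx_Li; congr Emx; congr cexp; rewrite /thq; ring. Qed.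

Lemma G0C_1 : G0C (1%:M : 'M[C]_4).
Proof.
exists (quat 1 0 0 0); first by rewrite 4!big_ord_recr big_ord0 !mxE /=; ring.
have [e0 e1 e2 e3] := @qcoord_quat R 1 0 0 0.
by rewrite /G0mx e0 e1 e2 e3 !scale0r !subr0 scale1r.
Qed.

Lemma G0_1 : G0 (1%:M : 'M[C]_4).
Proof.
pose q : 'cV[R]_4 := \col_r (r == 0)%:R.
exists q; first by rewrite 4!big_ord_recr big_ord0 !mxE /=; ring.
have -> : map_mx (fun x : R => rc x) q = quat 1 0 0 0.
  by apply: quat_ext; rewrite !mxE -val_eqE /= inordK ?rc0 ?rc1.
have [e0 e1 e2 e3] := @qcoord_quat R 1 0 0 0.
by rewrite /G0mx e0 e1 e2 e3 !scale0r !subr0 scale1r.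
Qed.

Lemma GC_affE (k p q r t : C) : GC (affE (cexp (thq true * k)) (cexp (thq false * k)) p q r t).
Proof.
exists (Emx (cexp (thq true * k)) (cexp (thq false * k))), (vec4 p q r t); split=> //.
exists 1%:M, (expmx ((k / 4) *: Li)); split; first exact: G0C_1.
  by exists (k / 4).
by rewrite mul1mx expmx_thq.
Qed.

Lemma real_col (v : 'cV[C]_4) : map_mx (@conjc R) v = v ->
  v = map_mx (fun x : R => rc x) (map_mx (fun x : C => complex.Re x) v).
Proof.
move=> H; apply/colP => i; rewrite !mxE; apply: complex_ext => //=.
move/colP : H => /(_ i); rewrite mxE; case: (v i 0) => a b /= [/eqP].
by rewrite eqNr => /eqP ->.
Qed.

Lemma G_affE (k : R) (p q r t : C) (x := cexp (thq true * rc k)) (y := cexp (thq false * rc k)) :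
  map_mx (@conjc R) (vec4 p q r t) = vec4 p q r t -> G (affE x y p q r t).
Proof.
move=> H; exists (Emx x y), (map_mx (fun x : C => complex.Re x) (vec4 p q r t)); split.
  exists 1%:M, (expmx ((rc k / 4) *: Li)); split; first exact: G0_1.
    by exists (k / 4); rewrite rmorphM /= fmorphV rmorph_nat.
  by rewrite mul1mx expmx_thq.
by rewrite -real_col.
Qed.

End AffineLoops.

(** * The explicit loops H, U and V, and the factorisation *)

Section PotentialLoops.
Context {R : realType}.
Local Notation C := R[i].
Variables (s : R) (Om : set C) (z0 : C).
Hypothesis s0 : 0 < s.
Hypothesis oO : open Om.
Hypothesis sO : simply_connected Om.
Hypothesis Oz0 : Om z0.
Variables (beta gamma : C -> R) (a b : C -> C).
Definition cpotential (w : C) : C := Complex (beta w) (gamma w).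
Local Notation B := cpotential.
Hypothesis HB : hol Om B.
Hypothesis Bz0 : B z0 = 0.
Hypothesis Ha : hol Om a.
Hypothesis Hb : hol Om b.

Local Notation w e g := (sloop Om z0 B g (thq e)).
Local Notation n e g := (negp Om z0 B g (thq e)).
Local Notation pk e g z := (Tker (sloop Om z0 B g (thq e) z)).
Local Notation nk e g z :=
  (Tker (fun v => (sloop Om z0 B g (thq e) z (rc (1/4 : R) * v))^*%C)).
(** The eigenvalues of the linear parts of U, H and V are [phaseF], [phaseH] and [phaseV]; [eFV] is
    the factorisation of the linear part. *)
Definition phaseF (e : bool) (l z : C) : C := cexp (thq e * (l ^- 2 * B z + l ^+ 2 * (B z)^*%C)).
Definition phaseH (e : bool) (l z : C) : C := cexp (thq e * (l ^- 2 * B z)).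
Definition phaseV (e : bool) (l z : C) : C := cexp (thq e * - (l ^+ 2 * (B z)^*%C)).
Definition transH (e : bool) (g : C -> C) (l z : C) : C :=
  l^-1 * wprim Om z0 B g (thq e * l ^- 2) z.

Definition Hloop (z l : C) : 'M[C]_(4 + 1) :=
  affE (phaseH true l z) (phaseH false l z)
    (transH true a l z) (transH false a l z) (transH true b l z) (transH false b l z).

(** The value of P in [X_loop], that is, X_l before multiplication by the linear part of U_l. *)
Definition Qloop (z l : C) : 'cV[C]_4 :=
  vec4 (n true a z l + iC * (n false b z l)^*%C) (n false a z l - iC * (n true b z l)^*%C)
       (n true b z l - iC * (n false a z l)^*%C) (n false b z l + iC * (n true a z l)^*%C).

(** The translation is the loop w minus [Qloop]. Negative parts have cancelled, and the conjugates
    of negative parts are given by functions of l that make sense on the whole disc. *)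
Definition Vloop (z l : C) : 'M[C]_(4 + 1) :=
  affE (phaseV true l z) (phaseV false l z)
    (pk true a z l - iC * nk false b z l) (pk false a z l + iC * nk true b z l)
    (pk true b z l + iC * nk false a z l) (pk false b z l - iC * nk true a z l).

Lemma beta_loopE l z : 2^-1 * beta_loop beta gamma l z =
  (l ^- 2 * B z + l ^+ 2 * (B z)^*%C) / 4.
Proof.
have BE : B z = rc (beta z) + iC * rc (gamma z).
  by apply: complex_ext; rewrite /B ?ReD ?ImD ?ReM ?ImM /=; ring.
have BEc : (B z)^*%C = rc (beta z) - iC * rc (gamma z).
  by apply: complex_ext; rewrite /B ?ReB ?ImB ?ReM ?ImM /=; ring.
rewrite BEc BE /beta_loop -[real_complex_def _ (beta z)]/(rc (beta z)).
by rewrite -[real_complex_def _ (gamma z)]/(rc (gamma z)); move: (l ^- 2) => x; field.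
Qed.

Lemma F_loopE l z : F_loop beta gamma l z = Emx (phaseF true l z) (phaseF false l z).
Proof. by rewrite /F_loop beta_loopE expmx_thq. Qed.

Lemma int_loop l z : Om z ->
  int_from Om z0 z (fun v =>
    expmx ((l ^- 2 / 4 * (rc (beta v) + iC * rc (gamma v))) *: Li) *m
    (l^-1 *: (a v *: eps + b v *: (Li *m epsb)))) =
  vec4 (transH true a l z) (transH false a l z) (transH true b l z) (transH false b l z).
Proof.
move=> Oz; have cO := sO.1.
have fE v : expmx ((l ^- 2 / 4 * (rc (beta v) + iC * rc (gamma v))) *: Li) *m
    (l^-1 *: (a v *: eps + b v *: (Li *m epsb))) =
    vec4 (l^-1 * (phaseH true l v * a v)) (l^-1 * (phaseH false l v * a v))
         (l^-1 * (phaseH true l v * b v)) (l^-1 * (phaseH false l v * b v)).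
  have -> : l ^- 2 / 4 * (rc (beta v) + iC * rc (gamma v)) = l ^- 2 * B v / 4.
    have -> : B v = rc (beta v) + iC * rc (gamma v).
      by apply: complex_ext; rewrite /B ?ReD ?ImD ?ReM ?ImM /=; ring.
    by move: (l ^- 2) => x; field.
  rewrite expmx_thq eps_vec4 Liepsb_vec4 !vec4Z vec4D vec4Z Emx_vec4 /phaseH.
  by congr vec4; ring.
have Hy e g v : hol Om g -> Om v -> hasD (transH e g l) v (l^-1 * (phaseH e l v * g v)).
  move=> Hg Ov; have [_ H] := wprimP oO sO Oz0 HB Hg (thq e * l ^- 2).
  apply: eq_hasD (hasDZ l^-1 (H v Ov)) => //.
  by rewrite /phaseH; congr (_ * (cexp _ * _)); ring.
have Hh e : hol Om (phaseH e l).
  apply: holP => v Ov; eexists; apply: hasD_comp; first exact: hasD_cexp.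
  by apply: hasDZ; apply: hasDZ; exact: HB.
have zc e g v : hol Om g -> Om v -> zcont (fun v => l^-1 * (phaseH e l v * g v)) v.
  move=> Hg Ov; apply: hasD_zcont; apply: hasDZ.
  by apply: hasDM; [exact: Hh|exact: Hg].
pose G v := vec4 (transH true a l v) (transH false a l v) (transH true b l v) (transH false b l v).
rewrite (int_from_ftc (G := G) oO cO Oz0 Oz).
  suff -> : G z0 = 0 by rewrite subr0.
  rewrite /G /transH !(wprimP oO sO Oz0 HB Ha _).1 !(wprimP oO sO Oz0 HB Hb _).1 !mulr0.
  exact: vec4_0.
move=> v Ov i; have [A0 [A1 [A2 [A3 H]]]] := @vec4_coord R i; split.
  rewrite fE H; apply: (@eq_hasD _ (fun v => A0 * transH true a l v + A1 * transH false a l v +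
    A2 * transH true b l v + A3 * transH false b l v)); [by move=> x; rewrite /G H|reflexivity|].
  by do ?[apply: hasDD]; apply: hasDZ; exact: Hy.
apply: (@eq_gcont _ _ _ (fun v => A0 * (l^-1 * (phaseH true l v * a v)) + A1 * (l^-1 * (phaseH false l v * a v)) +
    A2 * (l^-1 * (phaseH true l v * b v)) + A3 * (l^-1 * (phaseH false l v * b v)))).
  by move=> x; rewrite fE H.
by do ?[apply: gcontD]; apply: gcontM (gcont_cst _ _ _) _; exact: zc.
Qed.

Lemma sloop_yH e g m z :
  w e g z m = cexp (thq e * - (m ^- 2 * B z + m ^+ 2 * (B z)^*%C)) * transH e g m z.
Proof.
rewrite /sloop lweight_conj /rweight /transH opprD mulrDr cexpD.
have -> : thq e * - (m ^- 2 * B z) = - (thq e * m ^- 2 * B z) by ring.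
have -> : thq e * - (m ^+ 2 * (B z)^*%C) = - (thq e * m ^+ 2 * (B z)^*%C) by ring.
by ring.
Qed.

Lemma loop_integrand m z : Om z ->
  expmx (- (2^-1 * beta_loop beta gamma m z) *: Li) *m
    vec4 (transH true a m z) (transH false a m z) (transH true b m z) (transH false b m z) =
  vec4 (w true a z m) (w false a z m) (w true b z m) (w false b z m).
Proof.
move=> Oz; rewrite beta_loopE -mulNr expmx_thq Emx_vec4.
by rewrite -!sloop_yH.
Qed.

Lemma X_loopE l z : Om z -> cabs l = 1 ->
  X_loop Om z0 beta gamma a b l z = Emx (phaseF true l z) (phaseF false l z) *m Qloop z l.
Proof.
move=> Oz l1; rewrite /X_loop -[expmx _]/(F_loop beta gamma l z) F_loopE; congr (_ *m _).
rewrite (@eq_projP _ _ (fun m => vec4 (w true a z m) (w false a z m) (w true b z m) (w false b z m))).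
  by rewrite projP_vec4//; apply: sloop_hol.
by move=> m m1; rewrite int_loop// loop_integrand.
Qed.

#[local] Opaque negp Tker sloop wprim cm cexp.

Lemma negp_nk e g z l : hol Om g -> Om z -> cabs l = 1 -> (n e g z l)^*%C = nk e g z l.
Proof. by move=> Hg Oz l1; rewrite negp_conj. Qed.

Lemma eFV e l z : phaseF e l z * phaseV e l z = phaseH e l z.
Proof. by rewrite /phaseF /phaseV /phaseH -cexpD; congr cexp; ring. Qed.

Lemma eF_sloop e g l z : phaseF e l z * w e g z l = transH e g l z.
Proof. by rewrite sloop_yH mulrA /phaseF mulrN cexpN mul1r. Qed.

(** In the translation part the negative parts and their conjugates, added by [Qloop] and subtracted
    in [Vloop], cancel; what remains is [phaseF] times w, the translation of H by [eF_sloop]. *)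
Lemma UV_factor z l : Om z -> cabs l = 1 ->
  Hloop z l = aff (F_loop beta gamma l z) (X_loop Om z0 beta gamma a b l z) *m Vloop z l.
Proof.
move=> Oz l1; rewrite F_loopE X_loopE// /Qloop Emx_vec4 affEM !eFV.
have S e g : hol Om g -> pk e g z l = w e g z l - n e g z l.
  by move=> Hg; rewrite (sloop_split oO sO Oz0 HB Hg (thq e) Oz l1) addrC addKr.
rewrite (negp_nk true Ha Oz l1) (negp_nk false Ha Oz l1).
rewrite (negp_nk true Hb Oz l1) (negp_nk false Hb Oz l1).
rewrite (S true _ Ha) (S false _ Ha) (S true _ Hb) (S false _ Hb) /Hloop.
rewrite -(eF_sloop true a) -(eF_sloop false a) -(eF_sloop true b) -(eF_sloop false b).
have H1 (x v n k : C) : x * v = x * (v - n - k) + x * (n + k) by ring.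
have H2 (x v n k : C) : x * v = x * (v - n + k) + x * (n - k) by ring.
exact: (affE_ext erefl erefl (H1 _ _ _ _) (H2 _ _ _ _) (H2 _ _ _ _) (H1 _ _ _ _)).
Qed.

Lemma iCV2 (l : C) : (iC * l) ^- 2 = - l ^- 2.
Proof. by rewrite sqr_iCM invrN. Qed.

Lemma eF_iC e l z : phaseF e (iC * l) z = phaseF (~~ e) l z.
Proof. by rewrite /phaseF iCV2 sqr_iCM -thqN; congr cexp; ring. Qed.

Lemma eH_iC e l z : phaseH e (iC * l) z = phaseH (~~ e) l z.
Proof. by rewrite /phaseH iCV2 -thqN; congr cexp; ring. Qed.

Lemma eV_iC e l z : phaseV e (iC * l) z = phaseV (~~ e) l z.
Proof. by rewrite /phaseV sqr_iCM -thqN; congr cexp; ring. Qed.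

Lemma yH_iC e g l z : transH e g (iC * l) z = - iC * transH (~~ e) g l z.
Proof. by rewrite /transH iCV2 mulrN -mulNr thqN invfM iCV -mulrA. Qed.

Lemma n_iC e g z l : hol Om g -> Om z -> cabs l = 1 ->
  n e g z (iC * l) = - iC * n (~~ e) g z l.
Proof. by move=> Hg Oz l1; rewrite negp_iC// thqN. Qed.

Lemma cabs_iCM (l : C) : cabs l = 1 -> cabs (iC * l) = 1.
Proof. by move=> l1; rewrite cabsM cabs_i mul1r. Qed.

Lemma pk_iC e g z l : hol Om g -> Om z -> cabs l = 1 ->
  pk e g z (iC * l) = - iC * pk (~~ e) g z l.
Proof.
move=> Hg Oz l1.
have S f m : cabs m = 1 -> pk f g z m = w f g z m - n f g z m.
  by move=> m1; rewrite (sloop_split oO sO Oz0 HB Hg (thq f) Oz m1) addrC addKr.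
rewrite (S e _ (cabs_iCM l1)) (S (~~ e) _ l1) (n_iC e Hg Oz l1) sloop_iC thqN.
by move: (w _ _ _ _) (n _ _ _ _) => u v; ring.
Qed.

Lemma nk_iC e g z l : hol Om g -> Om z -> cabs l = 1 ->
  nk e g z (iC * l) = iC * nk (~~ e) g z l.
Proof.
move=> Hg Oz l1; rewrite -(negp_nk e Hg Oz (cabs_iCM l1)) -(negp_nk (~~ e) Hg Oz l1) (n_iC e Hg Oz l1).
have cM (x y : C) : (x * y)^*%C = x^*%C * y^*%C by exact: rmorphM.
have cN (x : C) : (- x)^*%C = - x^*%C by exact: rmorphN.
by rewrite cM cN conjiC opprK.
Qed.

Lemma S1E (l : C) : S1 l <-> cabs l = 1.
Proof. by rewrite /S1 /= normE; split=> [/complexI//|->]. Qed.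

Lemma unit_conj (l : C) : cabs l = 1 -> l^*%C = l^-1.
Proof.
move=> l1; have l0 := unit_neq0 l1.
by apply: (mulfI l0); rewrite mulfV// mul_conj l1 expr1n rc1.
Qed.

Lemma phase_real (l x : C) : cabs l = 1 ->
  exists k : R, l ^- 2 * x + l ^+ 2 * x^*%C = rc k.
Proof.
move=> l1; exists (complex.Re (l ^- 2 * x) + complex.Re (l ^- 2 * x)).
have -> : l ^+ 2 * x^*%C = (l ^- 2 * x)^*%C.
  by rewrite rmorphM fmorphV rmorphXn /= (unit_conj l1) exprVn invrK.
by case: (l ^- 2 * x) => u v; apply: complex_ext; rewrite /= ?ReD ?ImD /= ?subrr.
Qed.

Lemma eF_conj e l z : cabs l = 1 -> (phaseF e l z)^*%C = phaseF (~~ e) l z.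
Proof.
move=> l1; have [k kE] := phase_real (B z) l1.
by rewrite /phaseF kE -cexp_conj -thqN -thq_conj; congr cexp; rewrite -[LHS]/(@conjc R _) mulrC conj_rcM mulrC.
Qed.

Lemma Qloop_conj z l : map_mx (@conjc R) (Qloop z l) = Qloop z l.
Proof.
have cM (x y : C) : (x * y)^*%C = x^*%C * y^*%C by exact: rmorphM.
have cD (x y : C) : (x + y)^*%C = x^*%C + y^*%C by exact: rmorphD.
have cN (x : C) : (- x)^*%C = - x^*%C by exact: rmorphN.
rewrite /Qloop vec4_conj; move: (n true a z l) (n false a z l) (n true b z l) (n false b z l) => n1 n2 n3 n4.
by congr vec4; rewrite !(cD, cN, cM) conjiC conjcK; ring: (@iCiC R).
Qed.

Lemma UloopE z l : Om z -> cabs l = 1 ->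
  aff (F_loop beta gamma l z) (X_loop Om z0 beta gamma a b l z) =
  affE (phaseF true l z) (phaseF false l z)
   (phaseF true l z * (n true a z l + iC * nk false b z l))
   (phaseF false l z * (n false a z l - iC * nk true b z l))
   (phaseF true l z * (n true b z l - iC * nk false a z l))
   (phaseF false l z * (n false b z l + iC * nk true a z l)).
Proof. by move=> Oz l1; rewrite F_loopE X_loopE// /Qloop Emx_vec4
  (negp_nk true Ha Oz l1) (negp_nk false Ha Oz l1) (negp_nk true Hb Oz l1) (negp_nk false Hb Oz l1).
Qed.

(** For |l| = 1 the exponent l^-2 B + l^2 conj B is real, and the output of P is invariant under
    conjugation. *)
Lemma G_Uloop z l : Om z -> cabs l = 1 ->
  G (aff (F_loop beta gamma l z) (X_loop Om z0 beta gamma a b l z)).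
Proof.
move=> Oz l1; have [k kE] := phase_real (B z) l1.
have H := Qloop_conj z l.
rewrite F_loopE X_loopE// /Qloop Emx_vec4.
have eE e : phaseF e l z = cexp (thq e * rc k) by rewrite /phaseF kE.
rewrite !eE; apply: G_affE; rewrite -!eE -Emx_vec4.
have cM (x y : C) : (x * y)^*%C = x^*%C * y^*%C by exact: rmorphM.
have cD (x y : C) : (x + y)^*%C = x^*%C + y^*%C by exact: rmorphD.
have cN (x : C) : (- x)^*%C = - x^*%C by exact: rmorphN.
have e1 := eF_conj true z l1; have e2 := eF_conj false z l1; rewrite /= in e1 e2.
rewrite Emx_vec4; move: e1 e2; move: (phaseF true l z) (phaseF false l z) => x y xy yx.
move: (n true a z l) (n false a z l) (n true b z l) (n false b z l) => n1 n2 n3 n4.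
rewrite vec4_conj !cM xy yx !(cD, cN, cM) conjiC !conjcK.
by congr vec4; ring: (@iCiC R).
Qed.

End PotentialLoops.
#[local] Transparent negp Tker sloop wprim cm cexp.

(** * Derivatives of matrix products *)

Section MatrixDerivatives.
Context {R : realType}.
Local Notation C := R[i].

Lemma hasD_sum (I : Type) (r : seq I) (f : I -> C -> C) (d : I -> C) z :
  (forall i, hasD (f i) z (d i)) ->
  hasD (fun w => \sum_(i <- r) f i w) z (\sum_(i <- r) d i).
Proof.
move=> H; elim: r => [|i r IH].
  by apply: eq_hasD (hasD_cst 0 z) => [w|]; rewrite big_nil.
by apply: eq_hasD (hasDD (H i) IH) => [w|]; rewrite big_cons.
Qed.

Lemma hasD_mulmx m n p (f : C -> 'M[C]_(m, n)) (g : C -> 'M[C]_(n, p)) z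
    (D : 'M[C]_(m, n)) (E : 'M[C]_(n, p)) :
  (forall i j, hasD (fun w => f w i j) z (D i j)) ->
  (forall i j, hasD (fun w => g w i j) z (E i j)) ->
  forall i j, hasD (fun w => (f w *m g w) i j) z ((D *m g z + f z *m E) i j).
Proof.
move=> fD gE i j.
apply: eq_hasD (hasD_sum (index_enum _) (fun k => hasDM (fD i k) (gE k j))).
  by move=> w; rewrite mxE.
by rewrite !mxE -big_split.
Qed.

Lemma hasD0_cst (Om : set C) (z0 z : C) (f : C -> C) : open Om -> connected Om -> Om z0 ->
  (forall w, Om w -> hasD f w 0) -> Om z -> f z = f z0.
Proof.
move=> oO cO Oz0 H; move: z.
apply: (connected_ind oO cO Oz0 (P := fun z => f z = f z0)) => // z Oz.
have [r r0 rO] := nbhsS oO Oz; exists r => //; split; first exact: rO.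
move=> x y hx hy <-; apply/eqP; rewrite -subr_eq0 -cabs_eq0 eq_le cabs_ge0 andbT.
have := @segment_le _ f (fun=> 0) x y 0; rewrite mul0r; apply=> t t01.
  by apply: H; apply: rO; exact: disc_convex hx hy t01.
by rewrite cabs0.
Qed.

Lemma aff_lie (A A' : 'M[C]_4) T T' : aff A T *m lie A' T' = lie (A *m A') (A *m T').
Proof. by rewrite /aff /lie mulmx_block !mulmx0 !mul0mx !addr0. Qed.

Lemma lie_aff (A A' : 'M[C]_4) T T' : lie A' T' *m aff A T = lie (A' *m A) (A' *m T + T').
Proof. by rewrite /aff /lie mulmx_block !mulmx0 !mul0mx !addr0 mulmx1. Qed.

Lemma lieN (A : 'M[C]_4) T : - lie A T = lie (- A) (- T).
Proof. by rewrite /lie opp_block_mx !oppr0. Qed.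

End MatrixDerivatives.

(** * Membership in the loop groups, and uniqueness of the solution of the linear equation *)

Section PotentialLoops.
Context {R : realType}.
Local Notation C := R[i].
Variables (s : R) (Om : set C) (z0 : C).
Hypothesis s0 : 0 < s.
Hypothesis oO : open Om.
Hypothesis sO : simply_connected Om.
Hypothesis Oz0 : Om z0.
Variables (beta gamma : C -> R) (a b : C -> C).
Local Notation B := (cpotential beta gamma).
Hypothesis HB : hol Om B.
Hypothesis Bz0 : B z0 = 0.
Hypothesis Ha : hol Om a.
Hypothesis Hb : hol Om b.

Local Notation w e g := (sloop Om z0 B g (thq e)).
Local Notation n e g := (negp Om z0 B g (thq e)).
Local Notation pk e g z := (Tker (sloop Om z0 B g (thq e) z)).
Local Notation nk e g z :=
  (Tker (fun v => (sloop Om z0 B g (thq e) z (rc (1/4 : R) * v))^*%C)).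
Local Notation eF := (phaseF beta gamma).
Local Notation eH := (phaseH beta gamma).
Local Notation eV := (phaseV beta gamma).
Local Notation yH := (transH Om z0 beta gamma).
Local Notation Hloop := (Hloop Om z0 beta gamma a b).
Local Notation Vloop := (Vloop Om z0 beta gamma a b).

Lemma hasD_phase (e : bool) (k : C) z l : l != 0 ->
  exists d, hasD (fun l => cexp (thq e * (l ^- 2 * B z + l ^+ 2 * k))) l d.
Proof.
move=> l0; have [d Hd] := hasD_sqrV l0; have [c Hc] := hasD_exp 2 l.
eexists; apply: hasD_comp; first exact: hasD_cexp.
apply: hasDZ; apply: hasDD; first by apply: hasDM; [exact: Hd|exact: hasD_cst].
by apply: hasDM; [exact: Hc|exact: hasD_cst].
Qed.

Lemma eF_hol e z : hol (fun l => l != 0) (fun l => eF e l z).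
Proof. by apply: holP => l l0; exact: hasD_phase. Qed.

Lemma eH_hol e z : hol (fun l => l != 0) (fun l => eH e l z).
Proof.
apply: holP => l l0; have [d Hd] := hasD_phase e 0 z l0; exists d.
by apply: eq_hasD Hd => // v; rewrite mulr0 addr0.
Qed.

Lemma eV_hol e z : hol setT (fun l => eV e l z).
Proof.
apply: holP => l _; have [c Hc] := hasD_exp 2 l.
eexists; apply: hasD_comp; first exact: hasD_cexp.
by apply: hasDZ; apply: hasDN; apply: hasDM; [exact: Hc|exact: hasD_cst].
Qed.

Lemma yH_hol e g z : hol Om g -> Om z -> hol (fun l => l != 0) (fun l => yH e g l z).
Proof.
move=> Hg Oz; apply: holP => l l0; have [d Hd] := hasD_sqrV l0.
eexists; apply: hasDM; first exact: hasD_inv.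
apply: (hasD_comp (f := fun k => wprim Om z0 B g k z) (g := fun l => thq e * l ^- 2)).
  exact: wprim_hasD.
by apply: hasDZ; exact: Hd.
Qed.

#[local] Opaque negp Tker sloop wprim cm cexp.

Lemma hol_sub (U V : set C) f : V `<=` U -> hol U f -> hol V f.
Proof. by move=> VU Hf z /VU; exact: Hf. Qed.

Local Notation An := (annulus 2^-1 2 : set C).

Lemma An_neq0 : An `<=` (fun l : C => l != 0).
Proof. by move=> l /andP[l1 _]; rewrite -cabs_gt0 (lt_trans _ l1)// invr_gt0. Qed.

Lemma An_disc : An `<=` disc 0 2.
Proof. by move=> l /andP[_ l2]; rewrite /disc /= subr0. Qed.

Lemma holD (U : set C) f g : hol U f -> hol U g -> hol U (fun z => f z + g z).
Proof. by move=> hf hg; apply: holP => z Uz; eexists; apply: hasDD; [exact: hf|exact: hg]. Qed.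

Lemma holM (U : set C) f g : hol U f -> hol U g -> hol U (fun z => f z * g z).
Proof. by move=> hf hg; apply: holP => z Uz; eexists; apply: hasDM; [exact: hf|exact: hg]. Qed.

Lemma holZ (U : set C) k f : hol U f -> hol U (fun z => k * f z).
Proof. by move=> hf; apply: holP => z Uz; eexists; apply: hasDZ; exact: hf. Qed.

Lemma holN (U : set C) f : hol U f -> hol U (fun z => - f z).
Proof. by move=> hf; apply: holP => z Uz; eexists; apply: hasDN; exact: hf. Qed.

Lemma pk_hol e g z : hol Om g -> Om z -> hol (disc 0 2) (pk e g z).
Proof. by move=> Hg Oz; exact: posp_hol. Qed.

Lemma nk_hol e g z : hol Om g -> Om z -> hol (disc 0 2) (nk e g z).
Proof. by move=> Hg Oz; exact: negc_hol. Qed.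

Lemma Hs_affE (f : C -> 'M[C]_(4 + 1)) (x y p q r t : C -> C) :
  hol An x -> hol An y -> hol An p -> hol An q -> hol An r -> hol An t ->
  (forall l, S1 l -> f l = affE (x l) (y l) (p l) (q l) (r l) (t l)) ->
  forall i j, Hs s (fun l => f l i j).
Proof.
move=> hx hy hp hq hr ht fE i j.
have r1 : 1 < 2 :> R by lra.
apply: (@Hs_hol R s 2 _ (fun l => affE (x l) (y l) (p l) (q l) (r l) (t l) i j)) => //.
  exact: affE_hol.
by move=> l Sl; rewrite fE.
Qed.

Lemma Uloop_LambdaG z : Om z ->
  LambdaG s (fun l => aff (F_loop beta gamma l z) (X_loop Om z0 beta gamma a b l z)).
Proof.
move=> Oz.
have UE l (l1 : cabs l = 1) := UloopE oO sO Oz0 HB Ha Hb Oz l1.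
have eFA e := hol_sub An_neq0 (eF_hol e z).
have wA e g : hol Om g -> hol An (fun l => w e g z l).
  by move=> Hg; apply: hol_sub An_neq0 _; exact: sloop_hol.
have pA e g (Hg : hol Om g) := hol_sub An_disc (pk_hol e Hg Oz).
have nA e g (Hg : hol Om g) := hol_sub An_disc (nk_hol e Hg Oz).
split.
(* For the Sobolev class the negative part is written as w minus the positive part, an expression
   holomorphic on the annulus. *)
- apply: (Hs_affE (x := fun l => eF true l z) (y := fun l => eF false l z)
   (p := fun l => eF true l z * (w true a z l + - pk true a z l + iC * nk false b z l))
   (q := fun l => eF false l z * (w false a z l + - pk false a z l + - (iC * nk true b z l)))
   (r := fun l => eF true l z * (w true b z l + - pk true b z l + - (iC * nk false a z l)))
   (t := fun l => eF false l z * (w false b z l + - pk false b z l + iC * nk true a z l))).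
  + exact: eFA.
  + exact: eFA.
  + apply: holM (eFA _) _; apply: holD (holD (wA _ _ Ha) (holN (pA _ _ Ha))) _.
    exact: holZ (nA _ _ Hb).
  + apply: holM (eFA _) _; apply: holD (holD (wA _ _ Ha) (holN (pA _ _ Ha))) _.
    exact: holN (holZ _ (nA _ _ Hb)).
  + apply: holM (eFA _) _; apply: holD (holD (wA _ _ Hb) (holN (pA _ _ Hb))) _.
    exact: holN (holZ _ (nA _ _ Ha)).
  + apply: holM (eFA _) _; apply: holD (holD (wA _ _ Hb) (holN (pA _ _ Hb))) _.
    exact: holZ (nA _ _ Ha).
  + move=> l /S1E l1; refine (etrans (UE l l1) _).
    have S e g : hol Om g -> n e g z l = w e g z l + - pk e g z l.
      by move=> Hg; rewrite (sloop_split oO sO Oz0 HB Hg (thq e) Oz l1) addrK.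
    by rewrite (S true _ Ha) (S false _ Ha) (S true _ Hb) (S false _ Hb).
- by move=> l /S1E l1; exact: G_Uloop.
- move=> l /S1E l1; have l1' := cabs_iCM l1.
  refine (etrans (UE _ l1') (etrans _ (congr1 tau (esym (UE l l1))))).
  rewrite tau_affE !eF_iC.
  have N e g (Hg : hol Om g) := n_iC oO sO Oz0 HB e Hg Oz l1.
  have K e g (Hg : hol Om g) := nk_iC oO sO Oz0 HB e Hg Oz l1.
  have K1 (x u v u' v' : C) : u' = - iC * u -> v' = iC * v ->
      x * (u' + iC * v') = - iC * (x * (u - iC * v)) by move=> -> ->; ring: (@iCiC R).
  have K2 (x u v u' v' : C) : u' = - iC * u -> v' = iC * v ->
      x * (u' - iC * v') = - iC * (x * (u + iC * v)) by move=> -> ->; ring: (@iCiC R).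
  exact: (affE_ext erefl erefl
    (K1 _ _ _ _ _ (N true _ Ha) (K false _ Hb)) (K2 _ _ _ _ _ (N false _ Ha) (K true _ Hb))
    (K2 _ _ _ _ _ (N true _ Hb) (K false _ Ha)) (K1 _ _ _ _ _ (N false _ Hb) (K true _ Ha))).
Qed.

Lemma Hloop_LambdaGC z : Om z -> LambdaGC s (Hloop z).
Proof.
move=> Oz.
have yA e g (Hg : hol Om g) := hol_sub An_neq0 (yH_hol e Hg Oz).
have eA e := hol_sub An_neq0 (eH_hol e z).
split.
- by apply: (Hs_affE (eA true) (eA false) (yA true _ Ha) (yA false _ Ha) (yA true _ Hb) (yA false _ Hb)).
- by move=> l _; exact: GC_affE.
- move=> l _; rewrite /Hloop tau_affE !eH_iC.
  have Y e g := yH_iC Om z0 beta gamma e g l z.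
  exact: (affE_ext erefl erefl (Y true a) (Y false a) (Y true b) (Y false b)).
Qed.

(** [Vloop] is given by functions holomorphic for |l| < 2, so it is its own extension to the closed
    unit disc. *)
Lemma Vloop_LambdaPlus z : Om z -> LambdaPlus s (Vloop z).
Proof.
move=> Oz.
have pD e g (Hg : hol Om g) := pk_hol e Hg Oz.
have nD e g (Hg : hol Om g) := nk_hol e Hg Oz.
have eD e : hol (disc 0 2) (fun l => eV e l z) by apply: hol_sub (@eV_hol e z).
have vm u v e f : hol Om u -> hol Om v ->
    hol (disc 0 2) (fun l => pk e u z l + - (iC * nk f v z l)).
  by move=> Hu Hv; apply: holD (pD _ _ Hu) (holN (holZ _ (nD _ _ Hv))).
have vp u v e f : hol Om u -> hol Om v ->
    hol (disc 0 2) (fun l => pk e u z l + iC * nk f v z l).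
  by move=> Hu Hv; apply: holD (pD _ _ Hu) (holZ _ (nD _ _ Hv)).
have VD i j : hol (disc 0 2) (fun l => Vloop z l i j).
  exact: (affE_hol i j (eD true) (eD false) (vm _ _ true false Ha Hb)
    (vp _ _ false true Ha Hb) (vp _ _ true false Hb Ha) (vm _ _ false true Hb Ha)).
have GV l : GC (Vloop z l) by exact: GC_affE.
split; first split.
- have A u (U : hol (disc 0 2) u) := hol_sub An_disc U.
  by apply: (Hs_affE (A _ (eD true)) (A _ (eD false)) (A _ (vm _ _ true false Ha Hb))
    (A _ (vp _ _ false true Ha Hb)) (A _ (vp _ _ true false Hb Ha)) (A _ (vm _ _ false true Hb Ha))).
- by move=> l _; exact: GV.
- move=> l /S1E l1; rewrite /Vloop tau_affE !eV_iC.
  have P e g (Hg : hol Om g) := pk_iC oO sO Oz0 HB e Hg Oz l1.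
  have K e g (Hg : hol Om g) := nk_iC oO sO Oz0 HB e Hg Oz l1.
  have K1 (u v u' v' : C) : u' = - iC * u -> v' = iC * v ->
      u' - iC * v' = - iC * (u + iC * v) by move=> -> ->; ring: (@iCiC R).
  have K2 (u v u' v' : C) : u' = - iC * u -> v' = iC * v ->
      u' + iC * v' = - iC * (u - iC * v) by move=> -> ->; ring: (@iCiC R).
  exact: (affE_ext erefl erefl
    (K1 _ _ _ _ (P true _ Ha) (K false _ Hb)) (K2 _ _ _ _ (P false _ Ha) (K true _ Hb))
    (K2 _ _ _ _ (P true _ Hb) (K false _ Ha)) (K1 _ _ _ _ (P false _ Hb) (K true _ Ha))).
have l2 (l : C) (r : R) : r < 2 -> `|l| <= rc r -> disc 0 2 l.
  by move=> r2; rewrite normE lecR /disc /= subr0 => /le_lt_trans; apply.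
have l12 : 1 < 2 :> R by lra.
exists (Vloop z); split.
- apply: zcont_within => l Al i j; apply: hol_zcont (VD i j) _.
  by apply: (l2 l 1 l12); rewrite rc1.
- move=> l l1; pose D := \matrix_(i, j) der (fun l => Vloop z l i j) l.
  have HD i j : hasD (fun l => Vloop z l i j) l (D i j).
    by rewrite mxE; apply: VD; apply: (l2 l 1 l12); rewrite rc1; exact: ltW.
  by have [] := (is_derive_mx (Vloop z) l D).2 HD.
- by move=> l _; exact: GV.
- by [].
(* At l = 0 the phases are 1 and the [Tker] parts vanish, so the value is (1, 0). *)
- exists 1%:M.
    split; first exact: G0C_1.
    by exists 1; rewrite ?ltr01// mul1mx -[real_complex_def _ 1]/(rc 1) rc1 scale1r.
  rewrite /Vloop !Tker0.
  have e1 e : eV e 0 z = 1.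
    by rewrite /phaseV expr0n /= mulr0n mul0r oppr0 mulr0 cexp0.
  by rewrite !e1 !mulr0 !subr0 !addr0 /affE Emx1 vec4_0.
Qed.

Local Notation kz e l z := (thq e * l ^- 2 * der B z).

Lemma dz_beta z : Om z -> dz (fun v => rc (beta v)) z = der B z / 2 /\
  dzb (fun v => rc (beta v)) z = (der B z)^*%C / 2.
Proof.
move=> Oz; have Hz := (hasD_wdiff _ _ _).1 (HB Oz).
have H := wdiffM (wdiff_cst 2^-1 z) (wdiffD Hz (wdiff_conjc Hz)).
have {}H := eq_wdiff (g := fun v => rc (beta v)) _ erefl erefl H.
have E v : 2^-1 * (B v + (B v)^*%C) = rc (beta v).
  have -> : B v + (B v)^*%C = rc (beta v + beta v).
    by apply: complex_ext; rewrite ?ReD ?ImD /= ?subrr.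
  by rewrite rmorphD /=; field.
have {}H := H E; rewrite (wdiff_dz H) (wdiff_dzb H).
have -> : (0 : C)^*%C = 0 by exact: rmorph0.
by split; field.
Qed.

Lemma potentialE l z : Om z -> potential beta a b l z =
  lie (Emx (kz true l z) (kz false l z)) (vec4 (l^-1 * a z) (l^-1 * a z) (l^-1 * b z) (l^-1 * b z)).
Proof.
move=> Oz; rewrite /potential; have [-> _] := dz_beta Oz.
rewrite eps_vec4 Liepsb_vec4 !vec4Z vec4D vec4Z Li_Emx EmxZ !(mulr0, mulr1, addr0, add0r).
by congr (lie (Emx _ _) _); rewrite /thq; move: (l ^- 2) (der B z) => x y; field.
Qed.

Lemma hasD_eH e l z : Om z -> hasD (eH e l) z (kz e l z * eH e l z).
Proof.
move=> Oz; apply: (@eq_hasD _ (fun v => cexp (thq e * l ^- 2 * B v))); last first.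
- by apply: hasD_comp; [exact: hasD_cexp|apply: hasDZ; exact: HB].
- by rewrite /phaseH [thq e * (_ * B z)]mulrA mulrC.
- by move=> v; rewrite /phaseH mulrA.
Qed.

Lemma hasD_yH e g l z : hol Om g -> Om z -> hasD (yH e g l) z (l^-1 * (eH e l z * g z)).
Proof.
move=> Hg Oz; have [_ H] := wprimP oO sO Oz0 HB Hg (thq e * l ^- 2).
by apply: eq_hasD (hasDZ l^-1 (H z Oz)) => //; rewrite /phaseH [thq e * (_ * B z)]mulrA.
Qed.

Definition eHi (e : bool) (l z : C) : C := cexp (- (thq e * l ^- 2) * B z).

Lemma hasD_eHi e l z : Om z -> hasD (eHi e l) z (- kz e l z * eHi e l z).
Proof.
move=> Oz; apply: (@eq_hasD _ (fun v => cexp (- (thq e * l ^- 2) * B v))); last first.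
- by apply: hasD_comp; [exact: hasD_cexp|apply: hasDZ; exact: HB].
- by rewrite /eHi mulrC; congr (_ * _); rewrite mulNr.
- by [].
Qed.

Lemma eH_eHi e l z : eHi e l z * eH e l z = 1.
Proof. by rewrite /eHi /phaseH mulNr [thq e * (_ * B z)]mulrA mulrC cexpN. Qed.

(** The inverse of [Hloop] in closed form, so that its derivative can be computed directly. *)
Definition Hinv (z l : C) : 'M[C]_(4 + 1) :=
  affE (eHi true l z) (eHi false l z)
    (- (eHi true l z * yH true a l z)) (- (eHi false l z * yH false a l z))
    (- (eHi true l z * yH true b l z)) (- (eHi false l z * yH false b l z)).

Lemma HinvK z l : Hinv z l *m Hloop z l = 1%:M.
Proof. by rewrite affEM !eH_eHi !subrr affE1. Qed.

Lemma Hloop_hasD l z : Om z -> forall i j,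
  hasD (fun v => Hloop v l i j) z ((Hloop z l *m potential beta a b l z) i j).
Proof.
move=> Oz i j; rewrite potentialE// /Hloop /affE aff_lie EmxM Emx_vec4.
have K (x y : C) : x * (l^-1 * y) = l^-1 * (x * y) by rewrite mulrCA.
rewrite !K ![eH _ l z * (thq _ * _ * _)]mulrC.
by apply: affE_hasD; first [exact: hasD_eH|exact: hasD_yH].
Qed.

Lemma Hinv_hasD l z : Om z -> forall i j,
  hasD (fun v => Hinv v l i j) z ((- (potential beta a b l z *m Hinv z l)) i j).
Proof.
move=> Oz i j; rewrite potentialE// /Hinv /affE lie_aff EmxM Emx_vec4 vec4D lieN EmxN vec4N.
have HI e g (Hg : hol Om g) : hasD (fun v => - (eHi e l v * yH e g l v)) z
    (- (kz e l z * - (eHi e l z * yH e g l z) + l^-1 * g z)).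
  apply: eq_hasD (hasDN (hasDM (hasD_eHi e l Oz) (hasD_yH e l Hg Oz))) => //.
  have E := eH_eHi e l z; move: (eHi e l z) (eH e l z) (yH e g l z) (thq e) E => x y u t E.
  by move: (t * l ^- 2 * der B z) (l^-1) => k m; ring: E.
have H0 e : hasD (eHi e l) z (- (kz e l z * eHi e l z)) by rewrite -mulNr; exact: hasD_eHi.
exact: (affE_hasD _ _ (H0 true) (H0 false) (HI true _ Ha) (HI false _ Ha) (HI true _ Hb) (HI false _ Hb)).
Qed.

Lemma Hloop_z0 l : Hloop z0 l = 1%:M.
Proof.
rewrite /Hloop /phaseH /transH Bz0 !mulr0 cexp0.
by rewrite !(wprimP oO sO Oz0 HB Ha _).1 !(wprimP oO sO Oz0 HB Hb _).1 !mulr0 affE1.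
Qed.

Lemma Hloop_solves : solves s Om z0 (potential beta a b) Hloop.
Proof.
split; first exact: Hloop_LambdaGC.
  by move=> l _; exact: Hloop_z0.
by move=> l _ z Oz; apply/is_derive_mx; exact: Hloop_hasD.
Qed.

(** The product of [H] with [Hinv] has derivative H mu Hinv - H mu Hinv = 0 and equals 1 at [z0]. *)
Lemma solves_unique H z l : solves s Om z0 (potential beta a b) H -> Om z -> S1 l ->
  H z l = Hloop z l.
Proof.
move=> [_ H1 Hd] Oz Sl; have cO := sO.1.
pose M v := H v l *m Hinv v l.
have M0 v : Om v -> forall i j, hasD (fun v => M v i j) v 0.
  move=> Ov i j; have D1 := (is_derive_mx _ _ _).1 (Hd l Sl v Ov).
  have := hasD_mulmx D1 (Hinv_hasD l Ov) i j.
  by rewrite mulmxN mulmxA subrr [X in hasD _ _ X]mxE.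
have Mz : M z = M z0.
  by apply/matrixP => i j; apply: (hasD0_cst oO cO Oz0 (f := fun v => M v i j)) Oz => v Ov; exact: M0.
have E := HinvK z0 l; rewrite Hloop_z0 mulmx1 in E.
have M1 : M z0 = 1%:M by rewrite /M (H1 l Sl) mul1mx.
by rewrite -[RHS]mul1mx -M1 -Mz /M -mulmxA HinvK mulmx1.
Qed.

Lemma Hloop_iwasawa H z : solves s Om z0 (potential beta a b) H -> Om z ->
  iwasawa_factor s (H z)
    (fun l => aff (F_loop beta gamma l z) (X_loop Om z0 beta gamma a b l z)).
Proof.
move=> HS Oz; split; first exact: Uloop_LambdaG.
exists (Vloop z); first exact: Vloop_LambdaPlus.
move=> l Sl; rewrite (solves_unique HS Oz Sl).
by apply: UV_factor => //; exact/S1E.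
Qed.

End PotentialLoops.
#[local] Transparent negp Tker sloop wprim cm cexp.

(** * Calculus of the classes C^k on an open set *)

Section Smoothness.
Context {R : realType}.
Local Notation C := R[i].
Variable Om : set C.
Hypothesis oO : open Om.

Definition has_pd (w : C) (f : C -> R) (z : C) (d : R) : Prop :=
  is_derive (0 : R) (1 : R) (fun t : R => f (z + rc t * w)) d.

Lemma has_pdP w f z d : has_pd w f z d -> pderivable w f z /\ pd w f z = d.
Proof. by move=> [df <-]; split; [exact: df|rewrite /pd derive1E]. Qed.

Lemma pd_has w f z : pderivable w f z -> has_pd w f z (pd w f z).
Proof. by move=> df; split; [exact: df|rewrite /pd derive1E]. Qed.

Lemma near_has_pd w f g z d : (forall v, Om v -> f v = g v) -> Om z ->
  has_pd w f z d -> has_pd w g z d.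
Proof.
move=> fg Oz /is_derive_cdiff H; apply/is_derive_cdiff.
have [r r0 rO] := nbhsS oO Oz.
have w0 : 0 < 1 + cabs w by rewrite ltr_pwDl// cabs_ge0.
apply: (near_gdiff (f := fun t => rc (f (z + rc t * w))) (d := r / (1 + cabs w))) H.
  by rewrite divr_gt0.
  move=> h hr /=; rewrite add0r fg//; apply: rO.
  rewrite addrAC subrr add0r cabsM cabs_real.
  rewrite ltr_pdivlMr// in hr; apply: le_lt_trans hr.
  by apply: ler_wpM2l => //; rewrite lerDr.
by rewrite /= fg// mul0r addr0.
Qed.

Lemma near_cont f g z : (forall v, Om v -> f v = g v) -> Om z ->
  {for z, continuous (f : C -> R)} -> {for z, continuous (g : C -> R)}.
Proof.
move=> fg Oz /continuousCRP H; apply/continuousCRP => e e0.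
have [d d0 dH] := H e e0; have [r r0 rO] := nbhsS oO Oz.
exists (Num.min d r) => [|w]; first by rewrite lt_min d0.
by rewrite lt_min => /andP[wd wr]; rewrite -!fg//; [exact: dH|exact: rO].
Qed.

Lemma eq_Ck k f g : (forall v, Om v -> f v = g v) -> Ck k Om f -> Ck k Om g.
Proof.
elim: k f g => [|k IH] f g fg [fc fk]; split=> //.
- by move=> z Oz; exact: near_cont fg Oz (fc z Oz).
- by move=> z Oz; exact: near_cont fg Oz (fc z Oz).
have [fd f1 f2] := fk.
have gpd w z : Om z -> pderivable w f z -> pderivable w g z /\ pd w g z = pd w f z.
  by move=> Oz pf; apply: has_pdP; exact: near_has_pd fg Oz (pd_has pf).
split.
- by move=> z Oz; have [p1 p2] := fd z Oz; split; [case: (gpd _ _ Oz p1)|case: (gpd _ _ Oz p2)].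
- by apply: (IH _ _ _ f1) => z Oz; have [p1 p2] := fd z Oz; have [_ ->] := gpd _ _ Oz p1.
- by apply: (IH _ _ _ f2) => z Oz; have [p1 p2] := fd z Oz; have [_ ->] := gpd _ _ Oz p2.
Qed.

(** Partial derivatives may be given by formulas valid on [Om] alone, whereas the definition of [Ck]
    speaks of the total functions [pd]. *)
Lemma Ck_intro k f d1 d2 : (forall z, Om z -> {for z, continuous f}) ->
  (forall z, Om z -> has_pd 1 f z (d1 z)) -> (forall z, Om z -> has_pd iC f z (d2 z)) ->
  Ck k Om d1 -> Ck k Om d2 -> Ck k.+1 Om f.
Proof.
move=> fc h1 h2 c1 c2; split=> //; split.
- by move=> z Oz; split; [case: (has_pdP (h1 z Oz))|case: (has_pdP (h2 z Oz))].
- by apply: eq_Ck c1 => z Oz; case: (has_pdP (h1 z Oz)).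
- by apply: eq_Ck c2 => z Oz; case: (has_pdP (h2 z Oz)).
Qed.

Lemma Ck_elim k f : Ck k.+1 Om f ->
  [/\ forall z, Om z -> {for z, continuous f},
      forall z, Om z -> has_pd 1 f z (pd 1 f z), forall z, Om z -> has_pd iC f z (pd iC f z),
      Ck k Om (pd 1 f) & Ck k Om (pd iC f)].
Proof.
move=> [fc [fd f1 f2]]; split=> // z Oz; have [p1 p2] := fd z Oz; exact: pd_has.
Qed.

Lemma CkW k f : Ck k.+1 Om f -> Ck k Om f.
Proof.
elim: k f => [|k IH] f H; first by split=> //; case: H.
by have [fc h1 h2 c1 c2] := Ck_elim H; apply: Ck_intro fc h1 h2 (IH _ c1) (IH _ c2).
Qed.

Lemma Ck_cst k (c : R) : Ck k Om (fun=> c).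
Proof.
elim: k c => [|k IH] c.
  by split=> // z _; exact: cst_continuous.
have H w z : has_pd w (fun=> c) z 0 by exact: is_derive_cst.
by apply: (Ck_intro (d1 := fun=> 0) (d2 := fun=> 0)) => // z _; exact: cst_continuous.
Qed.

Lemma CkD k f g : Ck k Om f -> Ck k Om g -> Ck k Om (fun z => f z + g z).
Proof.
elim: k f g => [|k IH] f g.
  by move=> [fc _] [gc _]; split=> // z Oz; exact: continuousD (fc z Oz) (gc z Oz).
move=> /Ck_elim[fc f1 f2 Cf1 Cf2] /Ck_elim[gc g1 g2 Cg1 Cg2].
apply: Ck_intro (IH _ _ Cf1 Cg1) (IH _ _ Cf2 Cg2).
- by move=> z Oz; exact: continuousD (fc z Oz) (gc z Oz).
- by move=> z Oz; exact: is_deriveD (f1 z Oz) (g1 z Oz).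
- by move=> z Oz; exact: is_deriveD (f2 z Oz) (g2 z Oz).
Qed.

Lemma CkM k f g : Ck k Om f -> Ck k Om g -> Ck k Om (fun z => f z * g z).
Proof.
elim: k f g => [|k IH] f g.
  by move=> [fc _] [gc _]; split=> // z Oz; exact: continuousM (fc z Oz) (gc z Oz).
move=> Hf Hg; have Wf := CkW Hf; have Wg := CkW Hg; move: Hf Hg.
move=> /Ck_elim[fc f1 f2 Cf1 Cf2] /Ck_elim[gc g1 g2 Cg1 Cg2].
have M w z df dg : has_pd w f z df -> has_pd w g z dg ->
    has_pd w (fun z => f z * g z) z (df * g z + f z * dg).
  move=> hf hg; have := is_deriveM hf hg; rewrite /has_pd mul0r addr0.
  by move=> H; apply: (is_derive_eq H); rewrite addrC ![_ *: _]mulrC ; congr (_ + _); rewrite mulrC.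
apply: (Ck_intro (d1 := fun z => pd 1 f z * g z + f z * pd 1 g z)
  (d2 := fun z => pd iC f z * g z + f z * pd iC g z)).
- by move=> z Oz; exact: continuousM (fc z Oz) (gc z Oz).
- by move=> z Oz; exact: M (f1 z Oz) (g1 z Oz).
- by move=> z Oz; exact: M (f2 z Oz) (g2 z Oz).
- by apply: CkD; apply: IH.
- by apply: CkD; apply: IH.
Qed.

Lemma Ck_exp k f : Ck k Om f -> Ck k Om (fun z => expR (f z)).
Proof.
have cE (h : C -> R) z : {for z, continuous h} -> {for z, continuous (fun z => expR (h z))}.
  by move=> fc; apply: continuous_comp fc _; exact: continuous_expR.
elim: k f => [|k IH] f.
  by move=> [fc _]; split=> // z Oz; exact: cE (fc z Oz).
move=> Hf; have Wf := IH _ (CkW Hf); move: Hf => /Ck_elim[fc f1 f2 Cf1 Cf2].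
have M w z df : has_pd w f z df -> has_pd w (fun z => expR (f z)) z (expR (f z) * df).
  move=> hf.
  have := is_derive1_comp (f := expR) (g := fun t : R => f (z + rc t * w)) (x := 0) _ hf.
  rewrite /has_pd mul0r addr0 => /(_ _ (is_derive_expR _)).
  by move=> H; apply: (is_derive_eq H).
apply: (Ck_intro (d1 := fun z => expR (f z) * pd 1 f z) (d2 := fun z => expR (f z) * pd iC f z)).
- by move=> z Oz; exact: cE (fc z Oz).
- by move=> z Oz; exact: M (f1 z Oz).
- by move=> z Oz; exact: M (f2 z Oz).
- exact: CkM.
- exact: CkM.
Qed.

(** The derivative 1/f of the logarithm is written exp(-ln f), so that the induction closes by means
    of [Ck_exp]. *)
Lemma Ck_ln k f : (forall z, Om z -> 0 < f z) -> Ck k Om f -> Ck k Om (fun z => ln (f z)).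
Proof.
move=> f0.
have cE z : Om z -> {for z, continuous f} -> {for z, continuous (fun z => ln (f z))}.
  by move=> Oz fc; apply: continuous_comp fc _; apply: continuous_ln; exact: f0.
elim: k => [|k IH].
  by move=> [fc _]; split=> // z Oz; exact: cE (fc z Oz).
move=> Hf; have Wf := IH (CkW Hf); move: Hf => /Ck_elim[fc f1 f2 Cf1 Cf2].
have M w z df : Om z -> has_pd w f z df ->
    has_pd w (fun z => ln (f z)) z (expR (-1 * ln (f z)) * df).
  move=> Oz hf.
  have := is_derive1_comp (f := @ln R) (g := fun t : R => f (z + rc t * w)) (x := 0) _ hf.
  have h0 : 0 < f (z + rc 0 * w) by rewrite mul0r addr0; exact: f0.
  move=> /(_ _ (is_derive1_ln h0)); rewrite /has_pd mul0r addr0 in h0 *.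
  by move=> H; apply: (is_derive_eq H); rewrite mulN1r expRN lnK ?posrE.
have E : Ck k Om (fun z => expR (-1 * ln (f z))).
  by apply: Ck_exp; apply: CkM Wf; exact: Ck_cst.
apply: (Ck_intro (d1 := fun z => expR (-1 * ln (f z)) * pd 1 f z)
  (d2 := fun z => expR (-1 * ln (f z)) * pd iC f z)).
- by move=> z Oz; exact: cE (fc z Oz).
- by move=> z Oz; exact: M (f1 z Oz).
- by move=> z Oz; exact: M (f2 z Oz).
- exact: CkM.
- exact: CkM.
Qed.

End Smoothness.

(** * Smooth complex-valued and matrix-valued functions *)

Section ComplexSmoothness.
Context {R : realType}.
Local Notation C := R[i].
Variable Om : set C.
Hypothesis oO : open Om.

Definition csmooth (f : C -> C) : Prop :=
  smooth Om (fun z => complex.Re (f z)) /\ smooth Om (fun z => complex.Im (f z)).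

Lemma eq_smooth (f g : C -> R) : (forall v, Om v -> f v = g v) -> smooth Om f -> smooth Om g.
Proof. by move=> fg Hf k; exact: (eq_Ck oO fg (Hf k)). Qed.

Lemma eq_csmooth f g : (forall v, Om v -> f v = g v) -> csmooth f -> csmooth g.
Proof. by move=> fg [f1 f2]; split; [apply: eq_smooth f1|apply: eq_smooth f2] => v /fg ->. Qed.

Lemma csmooth_cst (c : C) : csmooth (fun=> c).
Proof. by split=> k; exact: Ck_cst. Qed.

Lemma csmoothD f g : csmooth f -> csmooth g -> csmooth (fun z => f z + g z).
Proof.
move=> [f1 f2] [g1 g2]; split=> k.
  by apply: (eq_Ck oO _ (CkD oO (f1 k) (g1 k))) => v _; rewrite ReD.
by apply: (eq_Ck oO _ (CkD oO (f2 k) (g2 k))) => v _; rewrite ImD.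
Qed.

Lemma csmoothM f g : csmooth f -> csmooth g -> csmooth (fun z => f z * g z).
Proof.
move=> [f1 f2] [g1 g2]; split=> k.
  have H := CkM oO (Ck_cst oO k (-1)) (CkM oO (f2 k) (g2 k)).
  by apply: (eq_Ck oO _ (CkD oO (CkM oO (f1 k) (g1 k)) H)) => v _; rewrite ReM mulN1r.
by apply: (eq_Ck oO _ (CkD oO (CkM oO (f1 k) (g2 k)) (CkM oO (f2 k) (g1 k)))) => v _; rewrite ImM.
Qed.

Lemma csmooth_conj f : csmooth f -> csmooth (fun z => (f z)^*%C).
Proof.
move=> [f1 f2]; split=> k.
  by apply: (eq_Ck oO _ (f1 k)) => v _; case: (f v).
apply: (eq_Ck oO _ (CkM oO (Ck_cst oO k (-1)) (f2 k))) => v _.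
by rewrite mulN1r; case: (f v).
Qed.

Lemma csmooth_sum (I : Type) (r : seq I) (f : I -> C -> C) :
  (forall i, csmooth (f i)) -> csmooth (fun z => \sum_(i <- r) f i z).
Proof.
move=> H; elim: r => [|i r IH].
  by apply: eq_csmooth (csmooth_cst 0) => v _; rewrite big_nil.
by apply: eq_csmooth (csmoothD (H i) IH) => v _; rewrite big_cons.
Qed.

(** The partial derivatives of f are f' and i f', which are holomorphic again; induction on the
    order. *)
Lemma hol_csmooth f : hol Om f -> csmooth f.
Proof.
move=> Hf; suff H k : Ck k Om (fun z => complex.Re (f z)) /\ Ck k Om (fun z => complex.Im (f z)).
  by split=> k; case: (H k).
elim: k f Hf => [|k IH] f Hf.
  have zc z : Om z -> zcont f z by move=> Oz; exact: hol_zcont Hf Oz.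
  split; split=> // z Oz; apply/continuousCRP => e e0;
    have [d d0 dH] := (zcontP _ _).1 (zc z Oz) _ (divr_gt0 e0 (ltr0Sn _ 1));
    exists d => // v vd.
    rewrite -ReB; apply: le_lt_trans (Re_le_cabs _) _; apply: le_lt_trans (dH v vd) _; lra.
  rewrite -ImB; apply: le_lt_trans (Im_le_cabs _) _; apply: le_lt_trans (dH v vd) _; lra.
have [C1 C2] := IH f Hf.
have Hd1 : hol Om (der f) by exact: hol_der.
have Hd2 : hol Om (fun z => iC * der f z) by exact: holZ.
have [D1 D2] := IH _ Hd1; have [E1 E2] := IH _ Hd2.
have P (w : C) z : Om z -> [/\ pderivable w (fun v => complex.Re (f v)) z,
    pderivable w (fun v => complex.Im (f v)) z &
    cpd w f z = w * der f z].
  move=> Oz; have [p1 p2 e] := wdiff_pd w ((hasD_wdiff _ _ _).1 (Hf z Oz)); split=> //.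
  by rewrite e mul0r addr0 mulrC.
have PR (w : C) z : Om z -> has_pd w (fun v => complex.Re (f v)) z (complex.Re (w * der f z)).
  move=> /(P w)[p1 _ <-]; exact: pd_has.
have PI (w : C) z : Om z -> has_pd w (fun v => complex.Im (f v)) z (complex.Im (w * der f z)).
  move=> /(P w)[_ p1 <-]; exact: pd_has.
split.
  apply: (Ck_intro oO (d1 := fun z => complex.Re (der f z))
    (d2 := fun z => complex.Re (iC * der f z))) => //.
  - by move=> z Oz; exact: (Ck_cont C1).
  - by move=> z Oz; have := PR 1 z Oz; rewrite mul1r.
  - by move=> z Oz; exact: PR.
apply: (Ck_intro oO (d1 := fun z => complex.Im (der f z))
  (d2 := fun z => complex.Im (iC * der f z))) => //.
- by move=> z Oz; exact: (Ck_cont C2).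
- by move=> z Oz; have := PI 1 z Oz; rewrite mul1r.
- by move=> z Oz; exact: PI.
Qed.

Lemma csmooth_cpd w f : w = 1 \/ w = iC -> csmooth f -> csmooth (cpd w f).
Proof.
move=> ww [f1 f2]; split=> k /=.
  by have [_ _ _ h1 h2] := Ck_elim (f1 k.+1); case: ww => ->.
by have [_ _ _ h1 h2] := Ck_elim (f2 k.+1); case: ww => ->.
Qed.

Lemma csmooth_dz f : csmooth f -> csmooth (dz f).
Proof.
move=> Hf; have H1 := csmooth_cpd (or_introl erefl) Hf.
have H2 := csmooth_cpd (or_intror erefl) Hf.
apply: csmoothM (csmooth_cst 2^-1) _.
apply: (eq_csmooth _ (csmoothD H1 (csmoothM (csmooth_cst (- iC)) H2))) => v _.
by rewrite mulNr.
Qed.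

Lemma mxsmoothP m n (f : C -> 'M[C]_(m, n)) :
  mxsmooth Om f <-> forall i j, csmooth (fun z => f z i j).
Proof. by split=> H i j; have [] := H i j; split. Qed.

Lemma mxsmoothM m n p (f : C -> 'M[C]_(m, n)) (g : C -> 'M[C]_(n, p)) :
  mxsmooth Om f -> mxsmooth Om g -> mxsmooth Om (fun z => f z *m g z).
Proof.
move=> /mxsmoothP Hf /mxsmoothP Hg; apply/mxsmoothP => i j.
apply: (eq_csmooth _ (csmooth_sum (index_enum _) (fun k => csmoothM (Hf i k) (Hg k j)))) => v _.
by rewrite mxE.
Qed.

Lemma mxsmooth_dz m n (f : C -> 'M[C]_(m, n)) : mxsmooth Om f -> mxsmooth Om (mxdz f).
Proof.
move=> /mxsmoothP Hf; apply/mxsmoothP => i j.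
by apply: (eq_csmooth _ (csmooth_dz (Hf i j))) => v _; rewrite mxE.
Qed.

Lemma eq_mxsmooth m n (f g : C -> 'M[C]_(m, n)) : (forall v, Om v -> f v = g v) ->
  mxsmooth Om f -> mxsmooth Om g.
Proof. by move=> fg /mxsmoothP Hf; apply/mxsmoothP => i j; apply: eq_csmooth (Hf i j) => v /fg ->. Qed.

Lemma mxsmooth_cst m n (A : 'M[C]_(m, n)) : mxsmooth Om (fun=> A).
Proof. by apply/mxsmoothP => i j; exact: csmooth_cst. Qed.

Lemma mxsmooth_aff (F : C -> 'M[C]_4) (X : C -> 'cV[C]_4) :
  mxsmooth Om (fun z => aff (F z) (X z)) <-> mxsmooth Om F /\ mxsmooth Om X.
Proof.
split=> [/mxsmoothP H|[/mxsmoothP HF /mxsmoothP HX]].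
  split; apply/mxsmoothP => i j.
    by apply: eq_csmooth (H (lshift 1 i) (lshift 1 j)) => v _; rewrite /aff block_mxEul.
  by apply: eq_csmooth (H (lshift 1 i) (rshift 4 j)) => v _; rewrite /aff block_mxEur.
apply/mxsmoothP => i j; rewrite -(fintype.splitK i) -(fintype.splitK j).
case: (fintype.split i) => i'; case: (fintype.split j) => j' /=.
- by apply: eq_csmooth (HF i' j') => v _; rewrite /aff block_mxEul.
- by apply: eq_csmooth (HX i' j') => v _; rewrite /aff block_mxEur.
- by apply: eq_csmooth (csmooth_cst 0) => v _; rewrite /aff block_mxEdl mxE.
- by apply: eq_csmooth (csmooth_cst ((1%:M : 'M[C]_1) i' j')) => v _; rewrite /aff block_mxEdr.
Qed.

Lemma mxsmooth_Emx x y : csmooth x -> csmooth y -> mxsmooth Om (fun z => Emx (x z) (y z)).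
Proof.
move=> Hx Hy; apply/mxsmoothP => i j; rewrite /Emx; move: Pp Pm => P Q.
apply: (eq_csmooth _ (csmoothD (csmoothM Hx (csmooth_cst (P i j))) (csmoothM Hy (csmooth_cst (Q i j))))).
by move=> v _; rewrite !mxE.
Qed.

End ComplexSmoothness.

(** * The group G_0: invertibility and action on eps and epsb *)

Section UnitQuaternions.
Context {R : realType}.
Local Notation C := R[i].

Lemma G0mx_mul (k : 'cV[C]_4) a b c d : G0mx k *m quat a b c d =
  quat (qcoord k 0 * a + qcoord k 1 * b + qcoord k 2 * c + qcoord k 3 * d)
       (qcoord k 0 * b - qcoord k 1 * a + qcoord k 2 * d - qcoord k 3 * c)
       (qcoord k 0 * c - qcoord k 1 * d - qcoord k 2 * a + qcoord k 3 * b)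
       (qcoord k 0 * d + qcoord k 1 * c - qcoord k 2 * b - qcoord k 3 * a).
Proof.
rewrite /G0mx; move: (qcoord k 0) (qcoord k 1) (qcoord k 2) (qcoord k 3) => k0 k1 k2 k3.
by rewrite !mulmxBl -!scalemxAl mul1mx !quatE; congr quat; ring.
Qed.

Lemma sum_qcoord (k : 'cV[C]_4) : \sum_m k m 0 ^+ 2 =
  qcoord k 0 ^+ 2 + qcoord k 1 ^+ 2 + qcoord k 2 ^+ 2 + qcoord k 3 ^+ 2.
Proof.
have E m (h : (m < 4)%N) : inord m = Ordinal h :> 'I_4 by apply: val_inj; rewrite /= inordK.
rewrite /qcoord !E 4!big_ord_recr big_ord0 /= add0r.
by congr (k _ 0 ^+ 2 + k _ 0 ^+ 2 + k _ 0 ^+ 2 + k _ 0 ^+ 2); exact: val_inj.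
Qed.

(** The conjugate quaternion gives the inverse matrix. *)
Lemma G0mx_unit (k : 'cV[C]_4) : \sum_m k m 0 ^+ 2 = 1 -> G0mx k \in unitmx.
Proof.
rewrite sum_qcoord => H.
pose k' := quat (qcoord k 0) (- qcoord k 1) (- qcoord k 2) (- qcoord k 3).
have [e0 e1 e2 e3] := qcoord_quat (qcoord k 0) (- qcoord k 1) (- qcoord k 2) (- qcoord k 3).
have K : G0mx k' *m G0mx k = 1%:M.
  apply: mx_quat_ext => a b c d; rewrite -mulmxA mul1mx !G0mx_mul /k' e0 e1 e2 e3.
  move: H; move: (qcoord k 0) (qcoord k 1) (qcoord k 2) (qcoord k 3) => k0 k1 k2 k3 H.
  have {}H : k0 ^+ 2 = 1 - k1 ^+ 2 - k2 ^+ 2 - k3 ^+ 2 by rewrite -H; ring.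
  by congr quat; ring: H.
by case: (mulmx1_unit K).
Qed.

Lemma Gvec_unit (A : 'M[C]_4) : Gvec A -> A \in unitmx.
Proof.
move=> [B [D [[q q1 ->] [t ->] ->]]]; rewrite unitmx_mul; apply/andP; split.
  apply: G0mx_unit; rewrite -[RHS](rmorph1 (real_complex R)) -q1 rmorph_sum.
  by apply: eq_bigr => m _; rewrite mxE rmorphXn.
by rewrite expmx_Li; case: (Emx_unit (cexp_neq0 (iC * rc t)) (cexp_neq0 (- iC * rc t))).
Qed.

(** In terms of eps and Li epsb the image has the components k0 - i k2 and -k1 + i k3, so real unit
    quaternions correspond to unit vectors of C^2. *)
Lemma G0mx_eps (k : 'cV[C]_4) (p := qcoord k 0 - iC * qcoord k 2)
  (q := - qcoord k 1 + iC * qcoord k 3) : G0mx k *m eps = vec4 p p q q.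
Proof.
rewrite vec4E /eps -scalemxAr G0mx_mul /p /q !quatE.
move: (qcoord k 0) (qcoord k 1) (qcoord k 2) (qcoord k 3) => k0 k1 k2 k3.
by congr quat; field: (@iCiC R).
Qed.

Lemma G0mx_epsb (k : 'cV[C]_4) (p := qcoord k 0 + iC * qcoord k 2)
  (q := - qcoord k 1 - iC * qcoord k 3) :
  G0mx k *m epsb = vec4 (iC * q) (- iC * q) (- iC * p) (iC * p).
Proof.
rewrite vec4E /epsb -scalemxAr G0mx_mul /p /q !quatE.
move: (qcoord k 0) (qcoord k 1) (qcoord k 2) (qcoord k 3) => k0 k1 k2 k3.
by congr quat; field: (@iCiC R).
Qed.

Lemma aff_inv (A : 'M[C]_4) (T : 'cV[C]_4) : A \in unitmx ->
  aff A T \in unitmx /\ invmx (aff A T) = aff (invmx A) (- (invmx A *m T)).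
Proof.
move=> uA; have K : aff A T *m aff (invmx A) (- (invmx A *m T)) = 1%:M.
  by rewrite affM mulmxV// mulmxN mulmxA mulmxV// mul1mx addNr /aff -scalar_mx_block.
have [u _] := mulmx1_unit K; split=> //.
by rewrite -[LHS]mulmx1 -K mulmxA mulVmx// mul1mx.
Qed.

End UnitQuaternions.

(** * Wirtinger derivatives of affine matrices *)

Section AffineDerivatives.
Context {R : realType}.
Local Notation C := R[i].

Definition lieE (x y p q r t : C) := lie (Emx x y) (vec4 p q r t).

Lemma lieE_ext x y p q r t x' y' p' q' r' t' : x = x' -> y = y' -> p = p' -> q = q' ->
  r = r' -> t = t' -> lieE x y p q r t = lieE x' y' p' q' r' t'.
Proof. by move=> -> -> -> -> -> ->. Qed.

Lemma Emx_lieE (F : 'M[C]_4) X (x y x' y' p q r t : C) : F = Emx x y ->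
  aff F X *m lieE x' y' p q r t = lieE (x * x') (y * y') (x * p) (y * q) (x * r) (y * t).
Proof. by move=> ->; rewrite /lieE aff_lie EmxM Emx_vec4. Qed.

Lemma affE_wdiff (x y p q r t : C -> C) z x1 y1 p1 q1 r1 t1 x2 y2 p2 q2 r2 t2 i j :
  wdiff x z x1 x2 -> wdiff y z y1 y2 -> wdiff p z p1 p2 -> wdiff q z q1 q2 ->
  wdiff r z r1 r2 -> wdiff t z t1 t2 ->
  wdiff (fun w => affE (x w) (y w) (p w) (q w) (r w) (t w) i j) z
    (lieE x1 y1 p1 q1 r1 t1 i j) (lieE x2 y2 p2 q2 r2 t2 i j).
Proof.
have [A0 [A1 [A2 [A3 [A4 [A5 [k H]]]]]]] := @affE_coord R i j.
move=> hx hy hp hq hr ht.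
have [_ L1] := H x1 y1 p1 q1 r1 t1; have [_ L2] := H x2 y2 p2 q2 r2 t2.
have Z (A : C) f d1 d2 : wdiff f z d1 d2 -> wdiff (fun w => A * f w) z (A * d1) (A * d2).
  by move=> hf; apply: eq_wdiff (wdiffM (wdiff_cst A z) hf) => //; rewrite mul0r add0r.
have W := wdiffD (wdiffD (wdiffD (wdiffD (wdiffD (wdiffD (Z A0 _ _ _ hx) (Z A1 _ _ _ hy))
  (Z A2 _ _ _ hp)) (Z A3 _ _ _ hq)) (Z A4 _ _ _ hr)) (Z A5 _ _ _ ht)) (wdiff_cst k z).
refine (eq_wdiff _ (etrans (addr0 _) (esym L1)) (etrans (addr0 _) (esym L2)) W).
by move=> w; case: (H (x w) (y w) (p w) (q w) (r w) (t w)).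
Qed.

Lemma mx_wdiff m n (f : C -> 'M[C]_(m, n)) z (D E : 'M[C]_(m, n)) :
  (forall i j, wdiff (fun v => f v i j) z (D i j) (E i j)) -> mxdz f z = D /\ mxdzb f z = E.
Proof.
move=> H; split; apply/matrixP => i j; rewrite mxE; first exact: wdiff_dz (H i j).
exact: wdiff_dzb (H i j).
Qed.

End AffineDerivatives.

(** * The form U^-1 dU *)

Section PotentialLoops.
Context {R : realType}.
Local Notation C := R[i].
Variables (s : R) (Om : set C) (z0 : C).
Hypothesis s0 : 0 < s.
Hypothesis oO : open Om.
Hypothesis sO : simply_connected Om.
Hypothesis Oz0 : Om z0.
Variables (beta gamma : C -> R) (a b : C -> C).
Local Notation B := (cpotential beta gamma).
Hypothesis HB : hol Om B.
Hypothesis Bz0 : B z0 = 0.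
Hypothesis Ha : hol Om a.
Hypothesis Hb : hol Om b.

Local Notation n e g := (negp Om z0 B g (thq e)).
Local Notation c1 e g := (lcoef1 Om z0 B g (thq e)).
Local Notation cm1 e g := (lcoefm1 Om z0 B g (thq e)).
Local Notation eF := (phaseF beta gamma).
Local Notation U l z := (aff (F_loop beta gamma l z) (X_loop Om z0 beta gamma a b l z)).

Lemma conjM (x y : C) : (x * y)^*%C = x^*%C * y^*%C. Proof. exact: rmorphM. Qed.
Lemma conjD (x y : C) : (x + y)^*%C = x^*%C + y^*%C. Proof. exact: rmorphD. Qed.
Lemma conjN (x : C) : (- x)^*%C = - x^*%C. Proof. exact: rmorphN. Qed.
#[local] Opaque lieE.

Lemma eF_wdiff e l z : Om z -> wdiff (eF e l) z
  (thq e * l ^- 2 * der B z * eF e l z) (thq e * l ^+ 2 * (der B z)^*%C * eF e l z).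
Proof.
move=> Oz; have h (k : C) : hasD (fun z => cexp (k * B z)) z (cexp (k * B z) * (k * der B z)).
  by apply: hasD_comp; [exact: hasD_cexp|apply: hasDZ; exact: HB].
have E v : cexp (thq e * l ^- 2 * B v) * (cexp ((thq e * l ^+ 2)^*%C * B v))^*%C = eF e l v.
  by rewrite -cexp_conj [((thq e * l ^+ 2)^*%C * B v)^*%C]conjM conjcK -cexpD /phaseF; congr cexp; ring.
have H := wdiffM ((hasD_wdiff _ _ _).1 (h (thq e * l ^- 2)))
  (wdiff_conjc ((hasD_wdiff _ _ _).1 (h (thq e * l ^+ 2)^*%C))).
apply: eq_wdiff H => //.
  by rewrite -E [(0 : C)^*%C]rmorph0; ring.
by rewrite -E [(cexp _ * (_ * der B z))^*%C]conjM [(_ * der B z)^*%C]conjM conjcK; ring.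
Qed.

#[local] Opaque negp lcoef1 lcoefm1 sloop wprim cm cexp.

(** The derivative of the phase cancels the terms in which [negp_wdiff] reproduces the negative
    parts. What remains is the phase times l^-1 or l, times a coefficient free of l. *)
Lemma loop_comp_wdiff e (sg : C) g h l z : hol Om g -> hol Om h -> Om z -> cabs l = 1 ->
  wdiff (fun z => eF e l z * (n e g z l + sg * (n (~~ e) h z l)^*%C)) z
    (eF e l z * (l^-1 * (g z - thq e * der B z * c1 e g z +
       sg * thq e * der B z * (cm1 (~~ e) h z)^*%C)))
    (eF e l z * (l * (thq e * (der B z)^*%C * cm1 e g z +
       sg * ((h z)^*%C - thq e * (der B z)^*%C * (c1 (~~ e) h z)^*%C)))).
Proof.
move=> Hg Hh Oz l1.
have W1 := negp_wdiff oO sO Oz0 HB Hg (thq e) Oz l1.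
have W2 := wdiff_conjc (negp_wdiff oO sO Oz0 HB Hh (thq (~~ e)) Oz l1).
have W := wdiffM (eF_wdiff e l Oz) (wdiffD W1 (wdiffM (wdiff_cst sg z) W2)).
have l0 := unit_neq0 l1; have lV := unit_conj l1.
have tc : (thq (~~ e) : C)^*%C = thq e by rewrite thq_conj thqN negbK.
have lV2 : (l ^+ 2)^*%C = l ^- 2 by rewrite expr2 conjM lV -invfM.
have lV3 : (l ^- 2)^*%C = l ^+ 2 by rewrite -lV2 conjcK.
have lV4 : (l^-1)^*%C = l by rewrite -lV conjcK.
apply: eq_wdiff W => //.
  move: (n e g z l) (n (~~ e) h z l) (c1 e g z) (cm1 (~~ e) h z) => N M u v.
  move: (der B z) (eF e l z) (g z) (thq e) (thq (~~ e)) tc => d x y t t' tc.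
  by rewrite !(conjM, conjD, conjN, conjcK) ?lV2 lV tc; field; rewrite ?l0.
move: (n e g z l) (n (~~ e) h z l) (cm1 e g z) (c1 (~~ e) h z) => N M u v.
move: (der B z) (eF e l z) (h z) (thq e) (thq (~~ e)) tc => d x y t t' tc.
by rewrite !(conjM, conjD, conjN, conjcK) ?lV3 ?lV4 tc; field; rewrite ?l0.
Qed.

(** [pz] and [qz] are the components on eps and on Li epsb of the l^-1 term of U^-1 dU. *)
Definition pz (z : C) : C :=
  a z - thq true * der B z * c1 true a z + iC * thq true * der B z * (cm1 true b z)^*%C.
Definition qz (z : C) : C :=
  b z - thq true * der B z * c1 true b z - iC * thq true * der B z * (cm1 true a z)^*%C.

Lemma c1_false g z : hol Om g -> Om z -> c1 false g z = - c1 true g z.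
Proof. by move=> Hg Oz; rewrite (lcoef1N oO sO Oz0 HB Hg (thq false) Oz) thqN. Qed.

Lemma cm1_false g z : hol Om g -> Om z -> cm1 false g z = cm1 true g z.
Proof. by move=> Hg Oz; rewrite (lcoefm1N oO sO Oz0 HB Hg (thq false) Oz) thqN. Qed.

(** The twisting symmetries [c1_false] and [cm1_false] make the coordinates of the dz part equal in
    pairs, which places it in the plane of eps and Li epsb; the d conj z part is the conjugate
    pattern. *)
Lemma Uloop_wdiff l z : Om z -> cabs l = 1 ->
  mxdz (fun z => U l z) z = U l z *m lieE
    (thq true * l ^- 2 * der B z) (thq false * l ^- 2 * der B z)
    (l^-1 * pz z) (l^-1 * pz z) (l^-1 * qz z) (l^-1 * qz z) /\
  mxdzb (fun z => U l z) z = U l z *m lieE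
    (thq true * l ^+ 2 * (der B z)^*%C) (thq false * l ^+ 2 * (der B z)^*%C)
    (l * (iC * (qz z)^*%C)) (l * (- iC * (qz z)^*%C))
    (l * (- iC * (pz z)^*%C)) (l * (iC * (pz z)^*%C)).
Proof.
move=> Oz l1.
have UE v : Om v -> U l v = affE (eF true l v) (eF false l v)
   (eF true l v * (n true a v l + iC * (n false b v l)^*%C))
   (eF false l v * (n false a v l + - iC * (n true b v l)^*%C))
   (eF true l v * (n true b v l + - iC * (n false a v l)^*%C))
   (eF false l v * (n false b v l + iC * (n true a v l)^*%C)).
  move=> Ov; rewrite F_loopE (X_loopE oO sO Oz0 HB Ha Hb Ov l1) /Qloop Emx_vec4.
  by rewrite !mulNr.
have W1 := loop_comp_wdiff true iC Ha Hb Oz l1.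
have W2 := loop_comp_wdiff false (- iC) Ha Hb Oz l1.
have W3 := loop_comp_wdiff true (- iC) Hb Ha Oz l1.
have W4 := loop_comp_wdiff false iC Hb Ha Oz l1.
rewrite /= in W1 W2 W3 W4.
have W i j := affE_wdiff i j (eF_wdiff true l Oz) (eF_wdiff false l Oz) W1 W2 W3 W4.
have [D E] := mx_wdiff (fun i j => near_wdiff oO Oz
  (fun v Ov => congr1 (fun A : 'M[C]_(4 + 1) => A i j) (esym (UE v Ov))) (W i j)).
have tc : (thq true : C)^*%C = - thq true by rewrite thq_conj.
have ca := c1_false Ha Oz; have cb := c1_false Hb Oz.
have ma := cm1_false Ha Oz; have mb := cm1_false Hb Oz.
have M e k x y : x = y -> eF e l z * (k * x) = eF e l z * (k * y) by move=> ->.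
split.
  refine (etrans D (etrans _ (esym (Emx_lieE _ _ _ _ _ _ _ (F_loopE _ _ _ _))))).
  apply: lieE_ext; [exact: mulrC|exact: mulrC|apply: M|apply: M|apply: M|apply: M].
  - by rewrite /pz mb.
  - by rewrite /pz ca /thq; move: (c1 true a z) (cm1 true b z) => u v; ring.
  - by rewrite /qz ma /thq; move: (c1 true b z) (cm1 true a z) => u v; ring.
  - by rewrite /qz cb /thq; move: (c1 true b z) (cm1 true a z) => u v; ring.
have cp : (pz z)^*%C = (a z)^*%C + thq true * (der B z)^*%C * (c1 true a z)^*%C +
    iC * thq true * (der B z)^*%C * cm1 true b z.
  rewrite /pz; move: (c1 true a z) (cm1 true b z) (thq true) tc => u v t tc.
  by rewrite !(conjM, conjD, conjN, conjcK) conjiC tc; ring.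
have cq : (qz z)^*%C = (b z)^*%C + thq true * (der B z)^*%C * (c1 true b z)^*%C -
    iC * thq true * (der B z)^*%C * cm1 true a z.
  rewrite /qz; move: (c1 true b z) (cm1 true a z) (thq true) tc => u v t tc.
  by rewrite !(conjM, conjD, conjN, conjcK) conjiC tc; ring.
refine (etrans E (etrans _ (esym (Emx_lieE _ _ _ _ _ _ _ (F_loopE _ _ _ _))))).
apply: lieE_ext; [exact: mulrC|exact: mulrC|apply: M|apply: M|apply: M|apply: M].
- by rewrite cq cb conjN /thq; move: (c1 true b z) (cm1 true a z) => u v; ring: (@iCiC R).
- by rewrite cq ma /thq; move: (c1 true b z) (cm1 true a z) => u v; ring: (@iCiC R).
- by rewrite cp ca conjN /thq; move: (c1 true a z) (cm1 true b z) => u v; ring: (@iCiC R).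
- by rewrite cp mb /thq; move: (c1 true a z) (cm1 true b z) => u v; ring: (@iCiC R).
Qed.

End PotentialLoops.
#[local] Transparent lieE.
#[local] Transparent negp lcoef1 lcoefm1 sloop wprim cm cexp.

(** * Translation parts of U^-1 dU and injectivity of the differential *)

Section Immersions.
Context {R : realType}.
Local Notation C := R[i].

Lemma ur_lie (A : 'M[C]_4) T : ursubmx (lie A T) = T.
Proof. exact: block_mxKur. Qed.

Lemma urD (A A' : 'M[C]_(4 + 1)) : ursubmx (A + A') = ursubmx A + ursubmx A'.
Proof. by apply/matrixP => i j; rewrite !mxE. Qed.

Lemma urZ k (A : 'M[C]_(4 + 1)) : ursubmx (k *: A) = k *: ursubmx A.
Proof. by apply/matrixP => i j; rewrite !mxE. Qed.

Lemma vec4_ext (p q r t p' q' r' t' : C) : p = p' -> q = q' -> r = r' -> t = t' ->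
  vec4 p q r t = vec4 p' q' r' t'.
Proof. by move=> -> -> -> ->. Qed.

Lemma lieD (A A' : 'M[C]_4) T T' : lie A T + lie A' T' = lie (A + A') (T + T').
Proof. by rewrite /lie add_block_mx !addr0. Qed.

Lemma lieZ k (A : 'M[C]_4) T : k *: lie A T = lie (k *: A) (k *: T).
Proof. by rewrite /lie scale_block_mx !scaler0. Qed.

Lemma mxd_aff (d : (C -> C) -> C -> C) (F : C -> 'M[C]_4) X z :
  (forall c, d (fun=> c) z = 0) ->
  (\matrix_(i, j) d (fun v => aff (F v) (X v) i j) z : 'M[C]_(4 + 1)) =
  lie (\matrix_(i, j) d (fun v => F v i j) z) (\matrix_(i, j) d (fun v => X v i j) z).
Proof.
move=> d0; apply/matrixP => i j; rewrite mxE -(fintype.splitK i) -(fintype.splitK j).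
have E (f g : C -> C) : (forall v, f v = g v) -> d f z = d g z by move=> /funext ->.
case: (fintype.split i) => i'; case: (fintype.split j) => j' /=.
- by rewrite /lie block_mxEul mxE; apply: E => v; rewrite /aff block_mxEul.
- by rewrite /lie block_mxEur mxE; apply: E => v; rewrite /aff block_mxEur.
- by rewrite /lie block_mxEdl mxE -(d0 0); apply: E => v; rewrite /aff block_mxEdl mxE.
- rewrite /lie block_mxEdr mxE -(d0 ((1%:M : 'M[C]_1) i' j')); apply: E => v.
  by rewrite /aff block_mxEdr.
Qed.

Lemma mxdz_aff (F : C -> 'M[C]_4) X z :
  mxdz (fun v => aff (F v) (X v)) z = lie (mxdz F z) (mxdz X z).
Proof. by apply: mxd_aff => c; exact: wdiff_dz (wdiff_cst c z). Qed.

Lemma mxdzb_aff (F : C -> 'M[C]_4) X z :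
  mxdzb (fun v => aff (F v) (X v)) z = lie (mxdzb F z) (mxdzb X z).
Proof. by apply: mxd_aff => c; exact: wdiff_dzb (wdiff_cst c z). Qed.

Lemma ur_inv_lie (F A : 'M[C]_4) X T : F \in unitmx ->
  ursubmx (invmx (aff F X) *m lie A T) = invmx F *m T.
Proof. by move=> /(aff_inv X)[_ ->]; rewrite aff_lie ur_lie. Qed.

Lemma mxpd_dz m n (f : C -> 'M[C]_(m, n)) z :
  mxpd 1 f z = mxdz f z + mxdzb f z /\ mxpd iC f z = iC *: (mxdz f z - mxdzb f z).
Proof.
split; apply/matrixP => i j; rewrite !mxE /dz /dzb.
  by move: (cpd 1 _ z) (cpd iC _ z) => x y; field.
by move: (cpd 1 _ z) (cpd iC _ z) => x y; field: (@iCiC R).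
Qed.

Lemma m1_vec4 (p q : C) : p *: eps + q *: (Li *m epsb) = vec4 p p q q.
Proof. by rewrite eps_vec4 Liepsb_vec4 !vec4Z vec4D !(mulr0, mulr1, addr0, add0r). Qed.

Lemma p1_vec4 (p q : C) :
  p *: epsb + q *: (Li *m eps) = vec4 (iC * q) (- iC * q) (- iC * p) (iC * p).
Proof.
by rewrite epsb_vec4 Lieps_vec4 !vec4Z vec4D; apply: vec4_ext; ring.
Qed.

Lemma eigen_ur (M Mm1 M0 M1 M2 : 'M[C]_(4 + 1)) : eigen_split M Mm1 M0 M1 M2 ->
  exists p q u v : C, [/\ ursubmx Mm1 = vec4 p p q q,
    ursubmx M1 = vec4 (iC * v) (- iC * v) (- iC * u) (iC * u), ursubmx M0 = 0,
    ursubmx M2 = 0 &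
    ursubmx M = vec4 (p + iC * v) (p - iC * v) (q - iC * u) (q + iC * u)].
Proof.
move=> [[p [q E1]] [c1 [c2 [c3 E2]]] [u [v E3]] [c E4] ->].
have h1 : ursubmx Mm1 = vec4 p p q q by rewrite E1 ur_lie m1_vec4.
have h2 : ursubmx M0 = 0 by rewrite E2 ur_lie.
have h3 : ursubmx M1 = vec4 (iC * v) (- iC * v) (- iC * u) (iC * u).
  by rewrite E3 ur_lie p1_vec4.
have h4 : ursubmx M2 = 0 by rewrite E4 ur_lie.
exists p, q, u, v; split=> //.
rewrite !urD h1 h2 h3 h4 !addr0 vec4D.
by apply: vec4_ext => //; rewrite mulNr.
Qed.

(** The left-hand side is (s + i t) X1 + (s - i t) X2. Up to the invertible [F], the coordinates of
    X1 are equal in pairs and those of X2 opposite in pairs; the two planes are complementary, so (s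
    + i t) annihilates p and q. *)
Lemma conformal_injective (F : 'M[C]_4) (X1 X2 : 'cV[C]_4) (p q u v : C) (s t : R) :
  F \in unitmx -> ~ (p = 0 /\ q = 0) ->
  X1 = F *m vec4 p p q q -> X2 = F *m vec4 (iC * v) (- iC * v) (- iC * u) (iC * u) ->
  rc s *: (X1 + X2) + rc t *: (iC *: (X1 - X2)) = 0 -> s = 0 /\ t = 0.
Proof.
move=> uF pq -> ->; rewrite -mulmxDr -mulmxBr !scalemxAr -mulmxDr => /(congr1 (mulmx (invmx F))).
rewrite mulKmx// mulmx0 vec4N !vec4D !vec4Z vec4D -vec4_0 => /vec4_inj[e1 e2 e3 e4].
have n2 : 2 != 0 :> C by rewrite pnatr_eq0.
pose k := rc s + iC * rc t.
have kp : k * p = 0.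
  apply: (mulfI n2); rewrite mulr0 -[RHS]addr0 -{1}e1 -e2 /k; ring.
have kq : k * q = 0.
  apply: (mulfI n2); rewrite mulr0 -[RHS]addr0 -{1}e3 -e4 /k; ring.
have k0 : k = 0.
  apply/eqP; apply/negPn/negP => nk; apply: pq; split; apply: (mulfI nk); rewrite mulr0//.
have ks : k = Complex s t by apply: complex_ext; rewrite /k ?ReD ?ImD ?ReM ?ImM /=; ring.
by move: k0; rewrite ks => /eqP; rewrite eq_complex /= => /andP[/eqP -> /eqP ->].
Qed.

End Immersions.

(** * From an extended lift to immersions *)

Section Equivalence.
Context {R : realType}.
Local Notation C := R[i].
Variables (s : R) (Om : set C) (z0 : C).
Hypothesis s0 : 0 < s.
Hypothesis oO : open Om.
Hypothesis sO : simply_connected Om.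
Hypothesis Oz0 : Om z0.
Variables (beta gamma : C -> R) (a b : C -> C).
Local Notation B := (cpotential beta gamma).
Hypothesis HB : hol Om B.
Hypothesis Bz0 : B z0 = 0.
Hypothesis Ha : hol Om a.
Hypothesis Hb : hol Om b.

Local Notation n e g := (negp Om z0 B g (thq e)).
Local Notation eF := (phaseF beta gamma).
Local Notation F := (F_loop beta gamma).
Local Notation X := (X_loop Om z0 beta gamma a b).
Local Notation U l z := (aff (F_loop beta gamma l z) (X_loop Om z0 beta gamma a b l z)).
Local Notation pz := (pz Om z0 beta gamma a b).
Local Notation qz := (qz Om z0 beta gamma a b).

Lemma F_loop_unit l z : F l z \in unitmx.
Proof.
rewrite F_loopE.
by have [] := @Emx_unit R (eF true l z) (eF false l z) (cexp_neq0 _) (cexp_neq0 _).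
Qed.

(** The component of F0^-1 dX0 along eps and Li epsb cannot vanish, as K eps does not. The lift
    equation transports it, scaled by l^-1, into dX_l for every l, and [conformal_injective]
    concludes. *)
Lemma lift_immersion F0 X0 : LCLI Om z0 F0 X0 ->
  extended_lift s Om z0 F0 X0 (fun z l => U l z) ->
  forall l, S1 l -> immersion Om (X l).
Proof.
move=> [_ _ GU _ [K [f [_ K0 _ dK]]]] [_ _ sm ext] l Sl.
split; first by have [] := (mxsmooth_aff oO _ _).1 (sm l Sl).
move=> z Oz x y; have [-> ->] := mxpd_dz (X l) z.
have [am [a0 [a1 [a2 [bm [b0 [b1 [b2 [eA eB eL]]]]]]]]] := ext z Oz.
have [dU dUb] := eL l Sl.
have [p [q [u [v [mE m1E m0E m2E sE]]]]] := eigen_ur eA.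
have [p' [q' [u' [v' [mE' m1E' m0E' m2E' _]]]]] := eigen_ur eB.
have uF0 : F0 z \in unitmx.
  have [A [T [GA E]]] := GU z Oz; have -> : F0 z = A.
    by have := congr1 (@ulsubmx C 4 1 4 1) E; rewrite /aff !block_mxKul.
  exact: Gvec_unit.
have uF := F_loop_unit l z.
have X1 : mxdz (X l) z = F l z *m vec4 (l^-1 * p) (l^-1 * p) (l^-1 * q) (l^-1 * q).
  rewrite -vec4Z -mE -[LHS](mulKVmx uF) -(ur_inv_lie (mxdz (F l) z) (X l z) (mxdz (X l) z) uF).
  by rewrite -mxdz_aff dU !urD !urZ m2E m0E scaler0 add0r addr0.
have X2 : mxdzb (X l) z = F l z *m vec4 (iC * (l * v')) (- iC * (l * v')) (- iC * (l * u')) (iC * (l * u')).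
  have -> : vec4 (iC * (l * v')) (- iC * (l * v')) (- iC * (l * u')) (iC * (l * u')) =
      l *: vec4 (iC * v') (- iC * v') (- iC * u') (iC * u') by rewrite vec4Z; apply: vec4_ext; ring.
  rewrite -m1E' -[LHS](mulKVmx uF) -(ur_inv_lie (mxdzb (F l) z) (X l z) (mxdzb (X l) z) uF).
  by rewrite -mxdzb_aff dUb !urD !urZ m2E' m0E' scaler0 addr0 add0r.
apply: (conformal_injective uF _ X1 X2) => -[lp lq].
have l0 : l != 0 by apply: unit_neq0; exact/S1E.
have lV0 : l^-1 != 0 by rewrite invr_eq0.
have {lp}p0 : p = 0 by apply: (mulfI lV0); rewrite lp mulr0.
have {lq}q0 : q = 0 by apply: (mulfI lV0); rewrite lq mulr0.
have [k k1 KE] := K0 z Oz; have [dX _] := dK z Oz.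
move: sE; rewrite mxdz_aff (ur_inv_lie _ _ _ uF0) dX KE G0mx_eps vec4Z p0 q0 !add0r => /vec4_inj[e1 e2 e3 e4].
have ef : rc (expR (f z)) != 0 :> C by rewrite -cabs_gt0 cabs_real gtr0_norm expR_gt0.
have n2 : 2 != 0 :> C by rewrite pnatr_eq0.
(* If that component were zero, the coordinates of e^f K eps, which are equal in pairs, would also
   be opposite in pairs, hence zero, against |k| = 1. *)
have half (c d : C) : rc (expR (f z)) * c = d -> rc (expR (f z)) * c = - d -> c = 0.
  move=> h1 h2; apply: (mulfI ef); apply: (mulfI n2); rewrite !mulr0 mulr_natl mulr2n {1}h1 h2.
  by rewrite subrr.
have P0 := half _ _ e1 e2; have Q0 := half _ _ e4 e3.
have cE m : (m < 4)%N -> qcoord (map_mx (fun x : R => rc x) k) m = rc (k (inord m) 0).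
  by move=> m4; rewrite /qcoord mxE.
have s1 : \sum_m (map_mx (fun x : R => rc x) k) m 0 ^+ 2 = 1.
  rewrite -[RHS](rmorph1 (real_complex R)) -k1 rmorph_sum.
  by apply: eq_bigr => m _; rewrite mxE rmorphXn.
move: s1 P0 Q0; rewrite sum_qcoord !cE//.
move: (k (inord 0) 0) (k (inord 1) 0) (k (inord 2) 0) (k (inord 3) 0) => k0 k2 k3 k4 s1 P0 Q0.
have R0 := congr1 (@complex.Re R) P0; have I0 := congr1 (@complex.Im R) P0.
have R1 := congr1 (@complex.Re R) Q0; have I1 := congr1 (@complex.Im R) Q0.
rewrite ReB ReM /= !(mul0r, mul1r, mulr0, subr0, oppr0, addr0) in R0.
rewrite ImB ImM /= !(mul0r, mul1r, mulr0, subr0, sub0r, oppr0, addr0, add0r) in I0.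
rewrite ReD ReM /= !(mul0r, mul1r, mulr0, subr0, oppr0, addr0) in R1.
rewrite ImD ImM /= !(mul0r, mul1r, mulr0, subr0, oppr0, addr0, add0r) in I1.
move/eqP: I0; rewrite oppr_eq0 => /eqP I0; move/eqP: R1; rewrite oppr_eq0 => /eqP R1.
by move/eqP: s1; rewrite R0 I0 R1 I1 rc0 expr0n /= !addr0 eq_sym oner_eq0.
Qed.

End Equivalence.

(** * From immersions to an extended lift *)

Section Converse.
Context {R : realType}.
Local Notation C := R[i].
Variables (s : R) (Om : set C) (z0 : C).
Hypothesis s0 : 0 < s.
Hypothesis oO : open Om.
Hypothesis sO : simply_connected Om.
Hypothesis Oz0 : Om z0.
Variables (beta gamma : C -> R) (a b : C -> C).
Local Notation B := (cpotential beta gamma).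
Hypothesis HB : hol Om B.
Hypothesis Bz0 : B z0 = 0.
Hypothesis Ha : hol Om a.
Hypothesis Hb : hol Om b.
Hypothesis lapl : forall z, Om z -> laplacian beta z = 0.

Local Notation n e g := (negp Om z0 B g (thq e)).
Local Notation eF := (phaseF beta gamma).
Local Notation F := (F_loop beta gamma).
Local Notation X := (X_loop Om z0 beta gamma a b).
Local Notation U l z := (aff (F_loop beta gamma l z) (X_loop Om z0 beta gamma a b l z)).
Local Notation pz := (pz Om z0 beta gamma a b).
Local Notation qz := (qz Om z0 beta gamma a b).

Lemma S1_1 : S1 (1 : C).
Proof. by apply/S1E; exact: cabs1. Qed.

Lemma eF_csmooth e l : csmooth Om (eF e l).
Proof.
have h (k : C) : hol Om (fun z => cexp (k * B z)).
  apply: holP => z Oz; eexists; apply: hasD_comp; first exact: hasD_cexp.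
  by apply: hasDZ; exact: HB.
have H1 := hol_csmooth oO (h (thq e * l ^- 2)).
have H2 := csmooth_conj oO (hol_csmooth oO (h (thq e * l ^+ 2)^*%C)).
apply: (eq_csmooth oO _ (csmoothM oO H1 H2)) => v _.
rewrite -cexp_conj [((thq e * l ^+ 2)^*%C * B v)^*%C]conjM conjcK -cexpD /phaseF.
by congr cexp; ring.
Qed.

Lemma F_smooth l : mxsmooth Om (F l).
Proof.
apply: (eq_mxsmooth oO _ (mxsmooth_Emx oO (eF_csmooth true l) (eF_csmooth false l))) => v _.
by rewrite F_loopE.
Qed.

Lemma eF_false l z : eF true l z * eF false l z = 1.
Proof. by rewrite /phaseF -[thq false]/(- thq true) mulNr cexpN. Qed.

Lemma invF_smooth l : mxsmooth Om (fun z => invmx (F l z)).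
Proof.
apply: (eq_mxsmooth oO _ (mxsmooth_Emx oO (eF_csmooth false l) (eF_csmooth true l))) => v _.
have uF := F_loop_unit beta gamma l v.
have K : F l v *m Emx (eF false l v) (eF true l v) = 1%:M.
  by rewrite F_loopE EmxM [eF false l v * _]mulrC eF_false Emx1.
by rewrite -[RHS]mulmx1 -K mulKmx.
Qed.

Lemma U_inv_d l z : Om z -> cabs l = 1 ->
  invmx (U l z) *m mxdz (fun z => U l z) z = lieE
    (thq true * l ^- 2 * der B z) (thq false * l ^- 2 * der B z)
    (l^-1 * pz z) (l^-1 * pz z) (l^-1 * qz z) (l^-1 * qz z) /\
  invmx (U l z) *m mxdzb (fun z => U l z) z = lieE
    (thq true * l ^+ 2 * (der B z)^*%C) (thq false * l ^+ 2 * (der B z)^*%C)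
    (l * (iC * (qz z)^*%C)) (l * (- iC * (qz z)^*%C))
    (l * (- iC * (pz z)^*%C)) (l * (iC * (pz z)^*%C)).
Proof.
move=> Oz l1; have [D E] := Uloop_wdiff oO sO Oz0 HB Ha Hb Oz l1.
have [u _] := aff_inv (X l z) (F_loop_unit beta gamma l z).
split; first exact: etrans (congr1 (mulmx _) D) (mulKmx u _).
exact: etrans (congr1 (mulmx _) E) (mulKmx u _).
Qed.

Lemma F_inv_dX z : Om z ->
  invmx (F 1 z) *m mxdz (X 1) z = vec4 (pz z) (pz z) (qz z) (qz z) /\
  invmx (F 1 z) *m mxdzb (X 1) z =
    vec4 (iC * (qz z)^*%C) (- iC * (qz z)^*%C) (- iC * (pz z)^*%C) (iC * (pz z)^*%C).
Proof.
move=> Oz; have [D E] := U_inv_d Oz (@cabs1 R).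
have uF := F_loop_unit beta gamma 1 z.
rewrite -(ur_inv_lie (mxdz (F 1) z) (X 1 z) _ uF) -(ur_inv_lie (mxdzb (F 1) z) (X 1 z) _ uF).
rewrite -mxdz_aff -mxdzb_aff; split.
  apply: etrans (congr1 _ D) _; rewrite /lieE ur_lie invr1.
  by apply: vec4_ext; rewrite mul1r.
apply: etrans (congr1 _ E) _; rewrite /lieE ur_lie.
by apply: vec4_ext; rewrite mul1r.
Qed.

Lemma U_z0 l : cabs l = 1 -> F l z0 = 1%:M /\ X l z0 = 0.
Proof.
move=> l1; have e1 e : eF e l z0 = 1.
  by rewrite /phaseF Bz0 [(0 : C)^*%C]rmorph0 !mulr0 addr0 mulr0 cexp0.
rewrite F_loopE (X_loopE oO sO Oz0 HB Ha Hb Oz0 l1) !e1 Emx1 mul1mx; split=> //.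
have na e := negp_z0 oO sO Oz0 HB Ha (thq e) l.
have nb e := negp_z0 oO sO Oz0 HB Hb (thq e) l.
rewrite -vec4_0 /Qloop; have c0 : (0 : C)^*%C = 0 by exact: rmorph0.
by apply: vec4_ext; rewrite ?(na true) ?(na false) ?(nb true) ?(nb false) c0 mulr0 ?subr0 ?addr0.
Qed.

(** Where p and q both vanish, both Wirtinger derivatives of X_1 vanish and so does its
    differential. *)
Lemma coef_neq0 z : immersion Om (X 1) -> Om z -> ~ (pz z = 0 /\ qz z = 0).
Proof.
move=> [_ im] Oz [p0 q0]; have [D E] := F_inv_dX Oz.
have uF := F_loop_unit beta gamma 1 z.
have c0 : (0 : C)^*%C = 0 by exact: rmorph0.
have d0 : mxdz (X 1) z = 0 by rewrite -[LHS](mulKVmx uF) D p0 q0 vec4_0 mulmx0.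
have e0 : mxdzb (X 1) z = 0.
  by rewrite -[LHS](mulKVmx uF) E p0 q0 c0 !mulr0 vec4_0 mulmx0.
have [p1 p2] := mxpd_dz (X 1) z.
have [] := im z Oz 1 0; last by move/eqP; rewrite oner_eq0.
by rewrite p1 p2 d0 e0 subr0 addr0 !scaler0 addr0.
Qed.

(** [pz] and [qz] can be read off from the entries of F^-1 times the z derivative of X, which are
    smooth along with X. *)
Lemma coef_smooth : immersion Om (X 1) -> csmooth Om pz /\ csmooth Om qz.
Proof.
move=> [sX _].
have /mxsmoothP H := mxsmoothM oO (invF_smooth 1) (mxsmooth_dz oO sX).
have E z : Om z -> invmx (F 1 z) *m mxdz (X 1) z =
    quat (pz z / 2) (qz z / 2) (- iC * pz z / 2) (iC * qz z / 2).
  move=> Oz; have [-> _] := F_inv_dX Oz; rewrite vec4E quatZ.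
  by move: (pz z) (qz z) => p q; congr quat; field.
split.
  apply: (eq_csmooth oO _ (csmoothM oO (csmooth_cst oO 2) (H (inord 0) 0))) => z Oz.
  by rewrite (E z Oz) mxE inordK//= mulrC divfK// pnatr_eq0.
apply: (eq_csmooth oO _ (csmoothM oO (csmooth_cst oO 2) (H (inord 1) 0))) => z Oz.
by rewrite (E z Oz) mxE inordK//= mulrC divfK// pnatr_eq0.
Qed.

(** The conformal factor: exp(2 [conf]) = |p|^2 + |q|^2. *)
Definition conf (z : C) : R :=
  2^-1 * ln (complex.Re (pz z) * complex.Re (pz z) + complex.Im (pz z) * complex.Im (pz z) +
    (complex.Re (qz z) * complex.Re (qz z) + complex.Im (qz z) * complex.Im (qz z))).

(** The unit quaternion with k0 - i k2 = e^-f p and -k1 + i k3 = e^-f q, as [G0mx_eps] demands.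
    Signs are written as factors -1 so that products of smooth functions apply. *)
Definition kvec (z : C) : 'cV[R]_4 := \col_r (expR (- 1 * conf z) *
  nth 0 [:: complex.Re (pz z); -1 * complex.Re (qz z);
            -1 * complex.Im (pz z); complex.Im (qz z)] r).

Lemma conf_pos z : immersion Om (X 1) -> Om z ->
  0 < complex.Re (pz z) * complex.Re (pz z) + complex.Im (pz z) * complex.Im (pz z) +
    (complex.Re (qz z) * complex.Re (qz z) + complex.Im (qz z) * complex.Im (qz z)).
Proof.
move=> im Oz; have := coef_neq0 im Oz.
have E (x : C) : complex.Re x * complex.Re x + complex.Im x * complex.Im x = cabs x ^+ 2.
  by rewrite cabs_sqr !expr2.
rewrite !E => pq.
have [p0|p0] := eqVneq (pz z) 0.
  have q0 : qz z != 0 by apply/eqP => q0; exact: pq.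
  by rewrite ltr_wpDl ?sqr_ge0// exprn_gt0// cabs_gt0.
by rewrite ltr_pwDl ?sqr_ge0// exprn_gt0// cabs_gt0.
Qed.

Lemma conf_smooth : immersion Om (X 1) -> smooth Om conf /\
  forall r, smooth Om (fun z => kvec z r 0).
Proof.
move=> im; have [[p1 p2] [q1 q2]] := coef_smooth im.
have sc : smooth Om conf.
  move=> k; apply: CkM (Ck_cst oO k 2^-1) _ => //.
  apply: Ck_ln => //; first by move=> z Oz; exact: conf_pos.
  by do 2 ?[apply: CkD => //]; apply: CkM.
split=> // r k.
have E := Ck_exp oO (CkM oO (Ck_cst oO k (-1)) (sc k)).
have N f : smooth Om f -> Ck k Om (fun z => -1 * f z).
  by move=> sf; exact: (CkM oO (Ck_cst oO k (-1)) (sf k)).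
have V (m : nat) : Ck k Om (fun z => nth 0 [:: complex.Re (pz z); -1 * complex.Re (qz z);
    -1 * complex.Im (pz z); complex.Im (qz z)] m).
  case: m => [|[|[|[|m]]]] /=; [exact: p1|exact: N|exact: N|exact: q2|].
  by apply: (eq_Ck oO _ (Ck_cst oO k 0)) => z _; rewrite nth_nil.
by apply: (eq_Ck oO _ (CkM oO E (V r))) => z _; rewrite mxE.
Qed.

Lemma kvec_sqr z : immersion Om (X 1) -> Om z -> \sum_m kvec z m 0 ^+ 2 = 1.
Proof.
move=> im Oz; rewrite 4!big_ord_recr big_ord0 /= add0r !mxE /=.
have H := conf_pos im Oz.
have E : expR (- 1 * conf z) ^+ 2 * (complex.Re (pz z) * complex.Re (pz z) +
    complex.Im (pz z) * complex.Im (pz z) +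
    (complex.Re (qz z) * complex.Re (qz z) + complex.Im (qz z) * complex.Im (qz z))) = 1.
  rewrite expr2 -expRD /conf; set N := _ + _ in H *.
  have -> : -1 * (2^-1 * ln N) + -1 * (2^-1 * ln N) = - ln N by field.
  by rewrite expRN lnK ?posrE// mulVf// gt_eqF.
by refine (etrans _ E); move: (expR _) => e; ring.
Qed.

Definition Kmx (z : C) : 'M[C]_4 := G0mx (map_mx (fun x : R => rc x) (kvec z)).

Lemma Kmx_eps z : rc (expR (conf z)) *: (Kmx z *m eps) = vec4 (pz z) (pz z) (qz z) (qz z) /\
  rc (expR (conf z)) *: (Kmx z *m epsb) =
    vec4 (iC * (qz z)^*%C) (- iC * (qz z)^*%C) (- iC * (pz z)^*%C) (iC * (pz z)^*%C).
Proof.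
have cE m : (m < 4)%N -> qcoord (map_mx (fun x : R => rc x) (kvec z)) m = rc (kvec z (inord m) 0).
  by move=> m4; rewrite /qcoord mxE.
have ee : rc (expR (conf z)) * rc (expR (- 1 * conf z)) = 1 :> C.
  by rewrite -rmorphM mulN1r expRN mulfV ?rc1// gt_eqF// expR_gt0.
have rM (x y : R) : rc (x * y) = rc x * rc y :> C by exact: rmorphM.
have dec (x : C) : x = rc (complex.Re x) + iC * rc (complex.Im x).
  by apply: complex_ext; rewrite ?ReD ?ImD ?ReM ?ImM /=; ring.
have decc (x : C) : x^*%C = rc (complex.Re x) - iC * rc (complex.Im x).
  by rewrite [in LHS](dec x) conjD conjM conjiC !conj_rc mulNr.
have m1 : rc (-1 : R) = -1 :> C by exact: rmorphN1.
rewrite /Kmx G0mx_eps G0mx_epsb !cE// !mxE !inordK//= !rM !m1.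
move: ee; move: (rc (expR (conf z))) (rc (expR (-1 * conf z))) => x y xy.
have xyz (u : C) : x * (y * u) = u by rewrite mulrA xy mul1r.
rewrite !vec4Z (decc (pz z)) (decc (qz z)) [in X in _ = X /\ _](dec (pz z)) [in X in _ = X /\ _](dec (qz z)).
move: (rc _) (rc _) (rc _) (rc _) => r1 r2 r3 r4.
by split; apply: vec4_ext; ring: xy.
Qed.

Lemma Kmx_smooth : immersion Om (X 1) -> mxsmooth Om Kmx.
Proof.
move=> im; have [_ sk] := conf_smooth im.
have cs r : csmooth Om (fun z => rc (kvec z r 0)) by split; [exact: sk|move=> k; exact: Ck_cst].
apply/mxsmoothP => i j.
pose K (m : nat) z : C := rc (kvec z (inord m) 0).
have H (A0 A1 A2 A3 : C) : csmooth Om (fun z => K 0%N z * A0 + K 1%N z * A1 + (K 2%N z * A2 + K 3%N z * A3)).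
  by do 2 ?[apply: csmoothD => //]; apply: csmoothM => //; try exact: csmooth_cst; exact: cs.
apply: (eq_csmooth oO _ (H ((1%:M : 'M[C]_4) i j) (- (Rq qi : 'M[C]_4) i j)
  (- (Rq qj : 'M[C]_4) i j) (- (Rq qk : 'M[C]_4) i j))) => z _.
have cE m : qcoord (map_mx (fun x : R => rc x) (kvec z)) m = K m z.
  by rewrite /qcoord mxE.
rewrite /Kmx /G0mx !cE; move: (Rq qi) (Rq qj) (Rq qk) (1%:M : 'M[C]_4) => P Q T I.
by rewrite !mxE; move: (K _ z) => *; ring.
Qed.

Lemma immersion_LCLI : immersion Om (X 1) -> LCLI Om z0 (F 1) (X 1).
Proof.
move=> im; have [F0 X0] := U_z0 (@cabs1 R).
split=> //; first exact: F_smooth.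
- by case: im.
- by move=> z Oz; exact: (G_Uloop oO sO Oz0 HB Ha Hb Oz (@cabs1 R)).
exists Kmx, conf; split; first exact: Kmx_smooth.
- by move=> z Oz; exists (kvec z) => //; exact: kvec_sqr.
- by case: (conf_smooth im).
- move=> z Oz; have [D E] := F_inv_dX Oz; have [K1 K2] := Kmx_eps z.
  by split; [exact: etrans D (esym K1)|exact: etrans E (esym K2)].
Qed.

Lemma immersion_hamiltonian : immersion Om (X 1) ->
  hamiltonian_stationary_LCLI Om z0 (F 1) (X 1).
Proof.
move=> im; split; first exact: immersion_LCLI.
exists beta; last exact: lapl.
split; first by have [] := hol_csmooth oO HB.
  by have := congr1 (@complex.Re R) Bz0.
(* At l = 1 the function [beta_loop] is [beta], so F is already exp(beta Li / 2) and the factor in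
   G_0 is trivial. *)
exists (fun=> 1%:M); split; first exact: mxsmooth_cst.
  by move=> z _; exact: G0_1.
move=> z _; rewrite mulmx1 /F_loop; congr expmx; congr (_ *: _).
rewrite /beta_loop expr1n invr1 subrr mulr0 mul0r addr0 -[real_complex_def _ (beta z)]/(rc (beta z)).
rewrite -[real_complex_def _ (beta z / 2)]/(rc (beta z / 2)) rmorphM /= fmorphV rmorph_nat.
by field.
Qed.

Lemma lieE_split (x p q u v k m : C) :
  lieE (thq true * k * x) (thq false * k * x) (m * p) (m * u) (m * q) (m * v) =
  k *: lie ((x / 4) *: Li) 0 + m *: lie 0 (vec4 p u q v).
Proof.
rewrite !lieZ lieD !scaler0 addr0 add0r /lieE Li_Emx !EmxZ vec4Z; congr lie; congr Emx.
  by rewrite /thq; field.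
by rewrite /thq; field.
Qed.

Lemma immersion_lift : (forall l, S1 l -> immersion Om (X l)) ->
  extended_lift s Om z0 (F 1) (X 1) (fun z l => U l z).
Proof.
move=> im; split.
- by move=> z Oz; exact: Uloop_LambdaG.
- move=> l /S1E l1; have [-> ->] := U_z0 l1.
  by rewrite /aff -scalar_mx_block.
- move=> l Sl; apply/mxsmooth_aff => //; split; first exact: F_smooth.
  by case: (im l Sl).
move=> z Oz.
pose am : 'M[C]_(4 + 1) := lie 0 (vec4 (pz z) (pz z) (qz z) (qz z)).
pose b1 : 'M[C]_(4 + 1) := lie 0 (vec4 (iC * (qz z)^*%C) (- iC * (qz z)^*%C)
  (- iC * (pz z)^*%C) (iC * (pz z)^*%C)).
pose a2 : 'M[C]_(4 + 1) := lie ((der B z / 4) *: Li) 0.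
pose b2 : 'M[C]_(4 + 1) := lie (((der B z)^*%C / 4) *: Li) 0.
have D l : cabs l = 1 -> invmx (U l z) *m mxdz (fun z => U l z) z = l ^- 2 *: a2 + l^-1 *: am.
  by move=> l1; have [D _] := U_inv_d Oz l1; apply: etrans D _; exact: lieE_split.
have E l : cabs l = 1 -> invmx (U l z) *m mxdzb (fun z => U l z) z = l ^+ 2 *: b2 + l *: b1.
  by move=> l1; have [_ E] := U_inv_d Oz l1; apply: etrans E _; exact: lieE_split.
have z00 : lie 0 0 = 0 :> 'M[C]_(4 + 1) by exact: block_mx0.
have hm1 : lie_m1 am by exists (pz z), (qz z); rewrite m1_vec4.
have h1 : lie_1 b1 by exists (pz z)^*%C, (qz z)^*%C; rewrite p1_vec4.
have h2 : lie_2 a2 by exists (der B z / 4).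
have h2' : lie_2 b2 by exists ((der B z)^*%C / 4).
have hm10 : lie_m1 (0 : 'M[C]_(4 + 1)) by exists 0, 0; rewrite !scale0r addr0 z00.
have h10 : lie_1 (0 : 'M[C]_(4 + 1)) by exists 0, 0; rewrite !scale0r addr0 z00.
have h00 : lie_0 (0 : 'M[C]_(4 + 1)) by exists 0, 0, 0; rewrite !scale0r !addr0 z00.
(* The form has no component in the Lie algebra of G_0; its dz part lies in the eigenspaces for -1
   and 2, its d conj z part in those for 1 and 2. *)
exists am, 0, 0, a2, 0, 0, b1, b2; split.
- by split=> //; rewrite (D 1 (@cabs1 R)) expr1n invr1 !scale1r !addr0 addrC.
- by split=> //; rewrite (E 1 (@cabs1 R)) expr1n !scale1r !add0r addrC.
move=> l /S1E l1; split; first by rewrite (D l l1) addr0.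
by rewrite (E l l1) add0r addrC.
Qed.

End Converse.

Theorem theorem9 (R : realType) (s : R) (hs : 2^-1 < s)
  (Om : set R[i]) (z0 : R[i])
  (hOm_open : open Om) (hOm_sc : simply_connected Om) (hz0 : Om z0)
  (beta : R[i] -> R) (hbeta : harmonic_on Om beta) (hbeta0 : beta z0 = 0)
  (a b : R[i] -> R[i]) (ha : holomorphic_on Om a) (hb : holomorphic_on Om b)
  (gamma : R[i] -> R) (hgamma : harmonic_on Om gamma) (hgamma0 : gamma z0 = 0)
  (hconj : forall z, Om z -> dzb (fun w => Complex (beta w) (gamma w)) z = 0) :
  let mu := potential beta a b in
  let F := F_loop beta gamma in
  let X := X_loop Om z0 beta gamma a b in
  let U := fun z l => aff (F l z) (X l z) in
  [/\ exists H, solves s Om z0 mu H,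
      forall H H', solves s Om z0 mu H -> solves s Om z0 mu H' ->
        forall z l, Om z -> S1 l -> H z l = H' z l,
      forall H, solves s Om z0 mu H ->
        forall z, Om z -> iwasawa_factor s (H z) (U z) &
      (exists F0 X0, hamiltonian_stationary_LCLI Om z0 F0 X0 /\
                     extended_lift s Om z0 F0 X0 U)
      <-> (forall l, S1 l -> immersion Om (X l))].
Proof.
move=> mu F X U.
have s0 : 0 < s by apply: lt_trans hs; rewrite invr_gt0.
have HB : hol Om (cpotential beta gamma).
  exact: hol_of_conjugates hOm_open hbeta.1 hgamma.1 hconj.
have Bz0 : cpotential beta gamma z0 = 0 by rewrite /cpotential hbeta0 hgamma0.
have hol_on (g : R[i] -> R[i]) : holomorphic_on Om g -> hol Om g.
  move=> Hg; apply: holP => z Oz; exists ('D_1 g z); apply/is_derive_hasD.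
  by split; first exact: Hg.
have Ha := hol_on a ha; have Hb := hol_on b hb.
split.
- exists (Hloop Om z0 beta gamma a b); exact: Hloop_solves.
- move=> H H' HS HS' z l Oz Sl.
  by rewrite (solves_unique hOm_open hOm_sc hz0 HB Bz0 Ha Hb HS Oz Sl)
    (solves_unique hOm_open hOm_sc hz0 HB Bz0 Ha Hb HS' Oz Sl).
- by move=> H HS z Oz; exact: Hloop_iwasawa.
- split=> [[F0 [X0 [[HL _] HE]]]|im].
    exact: lift_immersion HL HE.
  exists (F 1), (X 1); split; first exact: (immersion_hamiltonian hOm_open hOm_sc hz0 HB Bz0 Ha Hb hbeta.2 (im 1 (@S1_1 R))).
  exact: immersion_lift.
Qed.
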